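(* Let $L$ be a connected prime-like link diagram with no nugatory crossings, $G_L$ its face-crossing incidence graph, and $\Sigma_0=(\mathbf x,Q^{\mathrm{ext}}_{G_L})$. For a segment $i$, let $\hat0_{L,i}$ be the minimal perfect matching of $G_{L,i}$ and $f_i$ the face of $G_L$ containing $i$. Then for every segment $i$ there is a cluster variable $z_i$ of $\mathcal{A}(\Sigma_0)$ with $F^{\Sigma_0}_{z_i}(\mathbf y)=D_{G_{L,i}}(\mathbf y)$. Moreover: (1) the $g$-vector of $z_i$ equals $\mathbf{h}^{G_L}_{\hat0_{L,i}}-\mathbf e_{f_i}$, with entries $g_f=0$ if $f=f_i$ and $g_f=1-|f\cap\hat0_{L,i}|$ otherwise; (2) $z_i=\sum_{M}\mathbf x^{\mathbf h^{G_L}_M-\mathbf e_{f_i}}$, summed over perfect matchings $M$ of $G_{L,i}$; (3) the denominator vector of $z_i$ has entry $d_f=0$ if $f$ shares a white vertex with $f_i$, and $d_f=1$ otherwise.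
   Context: A segment of a link diagram is a curve between two crossings. $L$ is connected if the diagram is connected; prime-like if no simple closed curve meets $L$ in exactly two points with crossings on both sides; a crossing is nugatory if some simple closed curve meets $L$ only at it. $G_L$ (drawn on the sphere): black vertex $b_c$ at each crossing, white vertex $w_r$ in each region, edge $(b_c,w_r)$ iff crossing $c$ touches region $r$; its faces correspond to segments and each has four edges. $G_{L,i}$: draw $G_L$ in the plane with $f_i$ the infinite face, delete the two white vertices of $f_i$; it is a finite connected bipartite plane graph in which every edge is in a perfect matching. Its bounded faces are faces of $G_L$. Dimer face polynomial of such a graph $G$: for a bounded face $f$, an edge is black-white if going clockwise around $f$ one meets its black endpoint first, white-black otherwise; the down-flip at $f$ replaces the black-white edges of $f$ in a matching containing them all by the white-black edges; perfect matchings ordered by down-flips form a distributive lattice with minimum $\hat0$; for a saturated chain $\hat0=M_0\lessdot\cdots\lessdot M_\ell=M$ with $M_{k-1},M_k$ related by a flip at $g_k$, $\mathrm{mrk}(M)=y_{g_1}\cdots y_{g_\ell}$ (chain-independent), and $D_G=\sum_M\mathrm{mrk}(M)$. $Q^{\mathrm{ext}}_{G_L}$: one mutable vertex per face of $G_L$ (including $f_i$); for each edge separating two distinct faces an arrow crossing it with the white endpoint on the right; then delete oriented 2-cycles. Cluster variables $x_f$ indexed by faces. For a set $M$ of edges, $\mathbf h^{G_L}_M=(h_f)$ with $h_f=|f|/2-|M\cap f|-1$ ($|f|$ = number of edges of $f$, $|M\cap f|$ = number of them in $M$). $\mathbf e_{f_i}$ is the standard basis vector. $F$-polynomials: computed from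 the principal-coefficient framing (add frozen $f^\bullet\to f$ with variables $y_f$; $F(\mathbf y)$ is the numerator polynomial of the corresponding framed cluster variable evaluated at all $x_f=1$); the $g$-vector $\mathbf g$ satisfies $z=\mathbf x^{\mathbf g}F(\hat y)$ with $\hat y_f=\prod_{a\to f}x_a/\prod_{f\to a}x_a$. The denominator vector $(d_f)$: $z=P(\mathbf x)/\prod x_f^{d_f}$ with $P$ not divisible by any $x_f$. *)

(* Defs.v *)
From HB Require Import structures.
From mathcomp Require Import all_boot all_order all_algebra all_fingroup.
From mathcomp Require Import mpoly.
From Stdlib Require Import ClassicalEpsilon.

Set Implicit Arguments.
Unset Strict Implicit.
Unset Printing Implicit Defensive.

Import Order.TTheory GRing.Theory Num.Theory.
Local Open Scope ring_scope.

(* A link diagram on the oriented sphere, as a combinatorial map.  A dart is an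
   end of a segment at a crossing; [rot] is the counterclockwise rotation of
   the four darts at each crossing, [opp] exchanges the two darts of a segment,
   and [over d] tells whether [d] lies on the overstrand of its crossing.  The
   corner of [d] is the angle at its crossing between [d] and [rot d], so that
   corners are also indexed by darts.  Going along [d] to the other end of its
   segment and keeping the corner of [d] on the left leads to the corner
   [rot^-1 (opp d)], hence the regions are the cycles of [opp * rot^-1]
   (permutations compose from left to right).  Planarity is Euler's formula,
   summed over the connected components. *)
Definition dart_adj (D : finType) (rot opp : {perm D}) : rel D :=
  fun d e => (e == rot d) || (e == opp d).

Record link_diagram := LinkDiagram {
  dart : finType;
  rot : {perm dart};
  opp : {perm dart};
  over : dart -> bool;
  rot_four : forall d, #|porbit rot d| = 4%N;
  opp_neq : forall d, opp d != d;
  oppK : involutive opp;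
  over_rot : forall d, over (rot d) = ~~ over d;
  planar : (#|porbits rot| + #|porbits opp| + #|porbits (opp * rot^-1)%g|
            = #|dart| + 2 * n_comp (dart_adj rot opp) dart)%N
}.

Section LinkDiagrams.
Variable L : link_diagram.

Definition region_perm : {perm dart L} := (opp L * (rot L)^-1)%g.
Definition crossing_of (d : dart L) : {set dart L} := porbit (rot L) d.
Definition region_of (d : dart L) : {set dart L} := porbit region_perm d.

Definition crossing : finType := {c : {set dart L} | c \in porbits (rot L)}.
Definition segment : finType := {s : {set dart L} | s \in porbits (opp L)}.

Definition connected : Prop :=
  forall d e : dart L, connect (dart_adj (rot L) (opp L)) d e.

(* A closed curve transverse to [L] with exactly two intersection points leaves
   [region_of d] across the segment of [d], and comes back to it across the
   segment of [e].  By the Jordan curve theorem it has two sides: the ends of a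
   segment are on different sides iff the curve crosses that segment an odd
   number of times. *)
Definition curve_sides (d e : dart L) (side : dart L -> bool) : Prop :=
  (forall x, side (rot L x) = side x) /\
  (forall x, side (opp L x) =
     side x (+) (x \in porbit (opp L) d) (+) (x \in porbit (opp L) e)).

Definition prime_like : Prop :=
  ~ exists d e : dart L,
      [/\ region_of (opp L d) = region_of e,
          region_of (opp L e) = region_of d
        & exists side, [/\ curve_sides d e side,
            exists x, side x = true & exists y, side y = false]].

(* A closed curve meeting [L] only at [c] runs inside one region from one
   corner of [c] to another one. *)
Definition nugatory (c : crossing) : Prop :=
  exists d e : dart L,
    [/\ d \in val c, e \in val c, d <> e & region_of d = region_of e].

End LinkDiagrams.

(* A bipartite graph embedded in the oriented sphere: [brot] and [wrot] rotate
   counterclockwise the edges around their black and white endpoints.  Going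
   clockwise around a face along a black-white edge [e], the next edge (which is
   white-black) is [wrot e], and the next black-white edge is [brot (wrot e)].
   A face is represented by the set of its black-white edges, a cycle of
   [wrot * brot]. *)
Record bipartite_map := BipartiteMap {
  edge : finType;
  brot : {perm edge};
  wrot : {perm edge}
}.

Section BipartiteMaps.
Variable G : bipartite_map.

Definition black_end (e : edge G) : {set edge G} := porbit (brot G) e.
Definition white_end (e : edge G) : {set edge G} := porbit (wrot G) e.

Definition face_perm : {perm edge G} := (wrot G * brot G)%g.
Definition face : finType := {f : {set edge G} | f \in porbits face_perm}.

Fact face_of_subproof (e : edge G) : porbit face_perm e \in porbits face_perm.
Proof. exact: imset_f. Qed.

Definition face_of (e : edge G) : face :=
  exist _ (porbit face_perm e) (face_of_subproof e).

Definition bw_edges (f : face) : {set edge G} := val f.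
Definition wb_edges (f : face) : {set edge G} := wrot G @: val f.
Definition face_edges (f : face) : {set edge G} := bw_edges f :|: wb_edges f.

Definition white_vertices (f : face) : {set {set edge G}} :=
  white_end @: face_edges f.
Definition share_white (f g : face) : bool :=
  white_vertices f :&: white_vertices g != set0.

(* The edge [e] separates [face_of e], in which it is black-white, from
   [face_of (brot e)], in which it is white-black; [face_of e] is on the right
   of [e] directed from black to white, so the arrow crossing [e] with the white
   endpoint on its right goes from [face_of e] to [face_of (brot e)].
   [quiver f g] is the number of arrows from [f] to [g] minus the number of
   arrows from [g] to [f]. *)
Definition arrows (f g : face) : nat :=
  #|[set e : edge G | (face_of e == f) && (face_of (brot G e) == g)]|.
Definition quiver (f g : face) : int := (arrows f g)%:Z - (arrows g f)%:Z.

Definition hvec (M : {set edge G}) (f : face) : int :=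
  (#|face_edges f|./2)%:Z - #|M :&: face_edges f|%:Z - 1.

Section Dimers.
(* The plane graph obtained by taking [f0] as infinite face and deleting the
   white vertices of [f0].  All the faces around a deleted vertex merge with
   [f0], so the bounded faces are the faces sharing no white vertex with it. *)
Variable f0 : face.

Definition kept_edge (e : edge G) : bool :=
  white_end e \notin white_vertices f0.

Definition perfect_matching (M : {set edge G}) : bool :=
  [&& [forall e in M, kept_edge e],
      [forall e, #|M :&: black_end e| == 1%N]
    & [forall e, kept_edge e ==> (#|M :&: white_end e| == 1%N)]].

Definition bounded_face (f : face) : bool := ~~ share_white f f0.

(* [M] is obtained from [N] by the down-flip at [g]. *)
Definition down_flip (g : face) (N M : {set edge G}) : bool :=
  [&& bounded_face g, perfect_matching N, bw_edges g \subset N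
    & M == (N :\: bw_edges g) :|: wb_edges g].

(* [gs] labels the flips of an ascending saturated chain from [M] to [N]. *)
Fixpoint flip_chain (M : {set edge G}) (gs : seq face) (N : {set edge G}) :
    Prop :=
  if gs is g :: gs' then
    exists2 M', down_flip g M' M & flip_chain M' gs' N
  else M = N.

Definition flip_le (M N : {set edge G}) : Prop := exists gs, flip_chain M gs N.

Definition min_matching : {set edge G} :=
  epsilon (inhabits set0) (fun M =>
    perfect_matching M /\ forall N, perfect_matching N -> flip_le M N).

Definition mrk (M : {set edge G}) : {mpoly int[#|face|]} :=
  epsilon (inhabits 0) (fun m =>
    exists2 gs, flip_chain min_matching gs M
              & m = \prod_(g <- gs) 'X_(enum_rank g)).

Definition dimer_face_poly : {mpoly int[#|face|]} :=
  \sum_(M : {set edge G} | perfect_matching M) mrk M.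

End Dimers.
End BipartiteMaps.

(* Face-crossing incidence graph.  Its edges are the corners; when there is no
   nugatory crossing, distinct corners have distinct pairs of endpoints. *)
Definition incidence_graph (L : link_diagram) : bipartite_map :=
  @BipartiteMap (dart L) (rot L) (region_perm L).

Fact segment_face_subproof (L : link_diagram) (i : segment L) :
  val i \in porbits (face_perm (incidence_graph L)).
Proof. by rewrite /face_perm /= /region_perm mulgKV; apply: (valP i). Qed.

Definition segment_face (L : link_diagram) (i : segment L) :
    face (incidence_graph L) :=
  exist _ (val i) (segment_face_subproof i).

Definition ratfun (I : finType) : fieldType := {fraction {mpoly int[#|I|]}}.

Definition ivar (I : finType) (a : I) : ratfun I :=
  tofrac ('X_(enum_rank a) : {mpoly int[#|I|]}).

(* A labelled seed; [exmat a b] is the number of arrows [a -> b] minus the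
   number of arrows [b -> a]. *)
Record seed (I : finType) (K : fieldType) := Seed {
  cvar : I -> K;
  exmat : I -> I -> int
}.

Definition posz_part (m : int) : int := Num.max m 0.

Definition mutate_mat (I : finType) (k : I) (B : I -> I -> int) : I -> I -> int :=
  fun a b =>
    if (a == k) || (b == k) then - B a b
    else B a b + posz_part (B a k) * posz_part (B k b)
               - posz_part (- B a k) * posz_part (- B k b).

Definition mutate (I : finType) (K : fieldType) (k : I) (s : seed I K) :
    seed I K :=
  Seed
    (fun a => if a == k then
        (\prod_b cvar s b ^ posz_part (exmat s b k) +
         \prod_b cvar s b ^ posz_part (exmat s k b)) / cvar s k
      else cvar s a)
    (mutate_mat k (exmat s)).

Definition initial_seed (I : finType) (B : I -> I -> int) : seed I (ratfun I) :=
  Seed (@ivar I) B.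

Definition mutations (I : finType) (K : fieldType) (s : seed I K) (ks : seq I) :
    seed I K :=
  foldl (fun s k => mutate k s) s ks.

Section Cluster.
Variables (V : finType) (B : V -> V -> int).

(* The cluster variable labelled by [k] after mutating successively at [ks]. *)
Definition cluster_variable (ks : seq V) (k : V) : ratfun V :=
  cvar (mutations (initial_seed B) ks) k.

(* Principal framing: [inl f] is the mutable vertex [f], [inr f] is the frozen
   vertex of the arrow [inr f -> inl f]. *)
Definition framed_mat (a b : V + V) : int :=
  match a, b with
  | inl f, inl g => B f g
  | inr f, inl g => (f == g)%:Z
  | inl f, inr g => - (f == g)%:Z
  | inr _, inr _ => 0
  end.

Definition framed_cluster_variable (ks : seq V) (k : V) :
    ratfun (V + V)%type :=
  cvar (mutations (initial_seed framed_mat) (map inl ks)) (inl k).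

Definition specialize_x1 (P : {mpoly int[#|{: V + V}|]}) : {mpoly int[#|V|]} :=
  mmap (@mpolyC #|V| int)
       (fun j => match enum_val j with
                 | inl _ => 1
                 | inr f => 'X_(enum_rank f)
                 end) P.

(* Any numerator [P] over a monomial denominator in the x's has the same
   specialization, so [F] is unique. *)
Definition is_F_polynomial (ks : seq V) (k : V) (F : {mpoly int[#|V|]}) : Prop :=
  exists (P : {mpoly int[#|{: V + V}|]}) (a : V -> nat),
    framed_cluster_variable ks k
      = tofrac P / \prod_f ivar (inl f : (V + V)%type) ^+ a f
    /\ F = specialize_x1 P.

Definition xmon (v : V -> int) : ratfun V := \prod_f ivar f ^ v f.

Definition yhat (f : V) : ratfun V := \prod_a ivar a ^ B a f.

Definition subst_yhat (F : {mpoly int[#|V|]}) : ratfun V :=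
  mmap (intmul 1) (fun j => yhat (enum_val j)) F.

Definition is_g_vector (ks : seq V) (k : V) (g : V -> int) : Prop :=
  exists2 F, is_F_polynomial ks k F
           & cluster_variable ks k = xmon g * subst_yhat F.

Definition is_denominator_vector (z : ratfun V) (d : V -> int) : Prop :=
  exists P : {mpoly int[#|V|]},
    z = tofrac P / xmon d /\
    forall f, ~ exists Q : {mpoly int[#|V|]}, P = 'X_(enum_rank f) * Q.

End Cluster.

(* Main.v *)
From HB Require Import structures.
From mathcomp Require Import all_boot all_order all_algebra all_fingroup.
From mathcomp Require Import mpoly ring zify.
From Stdlib Require Import FunctionalExtensionality ClassicalEpsilon.
Require Import Defs.

Set Implicit Arguments.
Unset Strict Implicit.
Unset Printing Implicit Defensive.

Import Order.TTheory GRing.Theory Num.Theory.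
Local Open Scope ring_scope.

(* Call a state a choice of one corner at each crossing that occupies every
   region not adjacent to the segment [i] exactly once; the states are the
   perfect matchings of G_{L,i}.  Give each corner the weight
   1 / (x_a x_b), where a and b are its two sides, times a monomial in frozen
   variables chosen so that hat y_f is the ratio of the weights met across f.
   The state sum, times the product of the x_f for f <> f_i, is a cluster
   variable: it is invariant under sliding a strand across a triangle, which is
   realized by four mutations, and under the removal of a bigon, which is
   realized by two mutations, and every diagram reduces in this way to the one
   with two crossings.  To make the induction terminate, regions carry levels
   which differ by one across each segment and vanish at the root; Euler's
   formula gives a bigon, or a triangle whose move lowers the total level.

   Euler's formula also makes the sphere acyclic.  Over the field with two
   elements this turns primeness into the statement that a segment is determined
   by its two regions, and gives the chessboard colouring behind the levels; over
   the rationals it shows that the frozen exponents, summed over a state, form a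
   height function which drops by one at a face when a down-flip is made there.
   Heights give the minimal matching and the monomials mrk, and the powers of
   the frozen variables are pinned by the fact that a cluster variable is not
   divisible by a frozen variable.  The denominators come from the fact that each
   corner away from [i] belongs to a state, which is an exchange argument based
   on a linear-algebra bound of a set of regions by the crossings it meets. *)

(** * Monomials, mutations and positivity *)

(** Two features of the reduction dictate the form of the statements. The sides of a removed bigon
    remain in the quiver as vertices that are not mutated any more, hence as frozen variables of the
    smaller diagram. The induction therefore allows arbitrary frozen vertices, carries their
    exponents [nu] along, and asks for one sequence of mutations that serves all framings; applied
    to the plain quiver and to its principal framing, it gives the cluster variable and its
    F-polynomial. Secondly, identities are asserted for the values of a seed at points of a positive
    cone in any field, rather than for rational functions. Then no denominator vanishes, the
    induction hypothesis applies directly to mutated values, and sending one frozen variable to a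
    uniformizer measures its power. *)

Section Monomials.
Variables (I : finType) (K : fieldType).
Implicit Types (X : I -> K) (v : I -> int) (B : I -> I -> int).

Definition mon X v : K := \prod_a X a ^ v a.

Definition nonzero X := forall a, X a != 0.

Lemma mon_neq0 X v : nonzero X -> mon X v != 0.
Proof. by move=> X0; apply/prodf_neq0 => a _; rewrite expfz_eq0 negb_and X0 orbT. Qed.

Lemma monD X u v : nonzero X -> mon X (fun a => u a + v a) = mon X u * mon X v.
Proof.
by move=> X0; rewrite -big_split /=; apply: eq_bigr => a _; rewrite expfzDr.
Qed.

Lemma monN X v : mon X (fun a => - v a) = (mon X v)^-1.
Proof. by rewrite -prodfV; apply: eq_bigr => a _; rewrite -invr_expz. Qed.

Lemma monX X v n : mon X (fun a => v a * n) = mon X v ^ n.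
Proof.
case: n => n.
  rewrite -exprnP -prodrXl; apply: eq_bigr => a _.
  by rewrite exprnP exprz_exp.
rewrite NegzE -exprnN -exprVn -prodfV -prodrXl; apply: eq_bigr => a _.
by rewrite exprnP exprz_inv exprz_exp.
Qed.

Lemma eq_mon X u v : u =1 v -> mon X u = mon X v.
Proof. by move=> e; apply: eq_bigr => a _; rewrite e. Qed.

Lemma mon_delta X b : mon X (fun a => (a == b)%:Z) = X b.
Proof.
rewrite /mon (bigD1 b) //= eqxx expr1z big1 ?mulr1 // => a /negbTE ->.
by rewrite expr0z.
Qed.

Definition yh X B j : K := mon X (B^~ j).
Definition outp X B k : K := mon X (fun b => posz_part (B k b)).

Lemma posz_partB (m : int) : posz_part m - posz_part (- m) = m.
Proof. by rewrite /posz_part; case: (leP m 0) => h; case: (leP (- m) 0) => h1; lia. Qed.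

Definition antisym B := forall a b, B a b = - B b a.

Lemma antisym0 B a : antisym B -> B a a = 0.
Proof. by move=> asym; have := asym a a; lia. Qed.

Lemma mutate_antisym B k : antisym B -> antisym (mutate_mat k B).
Proof.
move=> asym a b; rewrite /mutate_mat orbC; case: ifP => _; first by rewrite (asym a b).
rewrite (asym a b) (asym a k) (asym k b) !opprK; ring.
Qed.

Lemma inp_yh X B k : nonzero X -> antisym B ->
  mon X (fun b => posz_part (B b k)) = yh X B k * outp X B k.
Proof.
move=> X0 asym; rewrite /yh /outp -monD //; apply: eq_mon => a.
by rewrite -[in RHS](posz_partB (B a k)) (asym k a) subrK.
Qed.

Lemma mutate_cvar (s : seed I K) k : nonzero (cvar s) -> antisym (exmat s) ->
  cvar (mutate k s) k =
    outp (cvar s) (exmat s) k * (1 + yh (cvar s) (exmat s) k) / cvar s k.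
Proof.
move=> X0 asym; rewrite /mutate /= eqxx -/(mon _ _) inp_yh // -/(outp _ _ _).
by rewrite mulrDr mulr1 addrC [_ * yh _ _ _]mulrC.
Qed.

Lemma mutate_cvarE (s : seed I K) k a : a != k -> cvar (mutate k s) a = cvar s a.
Proof. by rewrite /mutate /= => /negbTE ->. Qed.

(** Values of hat y mutate among themselves, as in a Y-pattern, so they can be followed through
    several mutations without expanding the cluster variables. *)
Lemma yh_mutate (s : seed I K) k j :
    nonzero (cvar s) -> antisym (exmat s) -> 1 + yh (cvar s) (exmat s) k != 0 ->
  yh (cvar (mutate k s)) (exmat (mutate k s)) j =
    if j == k then (yh (cvar s) (exmat s) k)^-1 else
    yh (cvar s) (exmat s) j * yh (cvar s) (exmat s) k ^ posz_part (exmat s k j)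
      * (1 + yh (cvar s) (exmat s) k) ^ (- exmat s k j).
Proof.
move=> X0 asym y0; have Bkk := antisym0 k asym.
set X := cvar s in X0 y0 *; set B := exmat s in asym Bkk y0 *.
set y := yh X B k in y0 *.
have yE : y != 0 by apply: mon_neq0.
have oE : outp X B k != 0 by apply: mon_neq0.
case: eqP => [-> | /eqP jk].
  rewrite -monN /yh /mon; apply: eq_bigr => a _.
  have -> : exmat (mutate k s) a k = - B a k by rewrite /= /mutate_mat eqxx orbT.
  case: (eqVneq a k) => [-> | ak]; first by rewrite Bkk oppr0 !expr0z.
  by rewrite mutate_cvarE.
rewrite {1}/yh {1}/mon (bigD1 k) // mutate_cvar // -/X -/B -/y.
have -> : exmat (mutate k s) k j = - B k j by rewrite /= /mutate_mat eqxx.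
rewrite (eq_bigr (fun a => X a ^
   (B a j + (posz_part (B a k) * posz_part (B k j)
    - posz_part (- B a k) * posz_part (- B k j))))); last first.
  move=> a ak; rewrite /= (negbTE ak) /mutate_mat (negbTE ak) (negbTE jk) /= -/B.
  by rewrite addrA.
set n := B k j; rewrite -/(posz_part n).
(* The product over [a != k] is completed by the factor at [k], whose exponent is [n]. By [inp_yh]
   the incoming monomial at [k] is [y * outp X B k]. *)
have -> : \prod_(a | a != k) X a ^ (B a j + (posz_part (B a k) * posz_part n
    - posz_part (- B a k) * posz_part (- n))) =
  X k ^ (- n) * (yh X B j * (y * outp X B k) ^ posz_part n
    * outp X B k ^ (- posz_part (- n))).
  have -> : outp X B k ^ (- posz_part (- n)) =
     mon X (fun a => - (posz_part (- B a k) * posz_part (- n))).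
    rewrite -monX; apply: eq_mon => a; rewrite (asym k a) mulrN //.
  rewrite -inp_yh // -monX -monD // -monD // /mon [in RHS](bigD1 k) //=.
  rewrite Bkk oppr0 -/n /posz_part maxxx !mul0r oppr0 !addr0 mulrA -expfzDr //.
  rewrite addrC subrr expr0z mul1r; apply: eq_bigr => a _; congr (_ ^ _).
  by rewrite addrA.
rewrite /= !expfzMl.
have -> : (X k)^-1 ^ (- n) = (X k ^ (- n))^-1 by rewrite exprz_inv -invr_expz.
have Xk0 : X k ^ (- n) != 0 by rewrite expfz_eq0 negb_and X0 orbT.
have -> : outp X B k ^ (- n) * (1 + y) ^ (- n) / X k ^ (- n) *
  (X k ^ (- n) * (yh X B j * (y ^ posz_part n * outp X B k ^ posz_part n) *
     outp X B k ^ (- posz_part (- n)))) =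
  (outp X B k ^ (- n) * outp X B k ^ posz_part n * outp X B k ^ (- posz_part (- n)))
   * (yh X B j * y ^ posz_part n * (1 + y) ^ (- n)) by field.
by rewrite -!expfzDr // -addrA posz_partB addNr expr0z mul1r.
Qed.

End Monomials.

(** Exchange relations are subtraction-free, so mutation stays inside such a set, where neither a
    variable nor a factor [1 + y] can vanish. *)
Record positive_cone (K : fieldType) (pos : K -> Prop) : Prop := PositiveCone {
  pos1 : pos 1;
  posM : forall x y, pos x -> pos y -> pos (x * y);
  posV : forall x, pos x -> pos x^-1;
  posD : forall x y, pos x -> pos y -> pos (x + y);
  pos_neq0 : forall x, pos x -> x != 0 }.

Section Positivity.
Variables (I : finType) (K : fieldType) (pos : K -> Prop).
Hypothesis cone : positive_cone pos.

Definition all_pos (X : I -> K) := forall a, pos (X a).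

Lemma all_pos_nonzero X : all_pos X -> nonzero X.
Proof. by move=> Xp a; apply: (pos_neq0 cone); apply: Xp. Qed.

Lemma pos_expz x (n : int) : pos x -> pos (x ^ n).
Proof.
move=> px; have pn m : pos (x ^+ m).
  by elim: m => [|m IH]; rewrite ?expr0 ?exprS; [apply: (pos1 cone) | apply: (posM cone)].
by case: n => n; [rewrite -exprnP | rewrite NegzE -exprnN; apply: (posV cone)].
Qed.

Lemma pos_prod (J : finType) (P : pred J) (F : J -> K) :
  (forall j, P j -> pos (F j)) -> pos (\prod_(j | P j) F j).
Proof.
by move=> Fp; apply: big_ind => //; [apply: (pos1 cone) | apply: (posM cone)].
Qed.

Lemma pos_mon X v : all_pos X -> pos (mon X v).
Proof. by move=> Xp; apply: pos_prod => a _; apply: pos_expz. Qed.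

Lemma mutate_pos (s : seed I K) k : all_pos (cvar s) -> all_pos (cvar (mutate k s)).
Proof.
move=> Xp a; rewrite /mutate /=; case: eqP => // _.
by apply: (posM cone); [apply: (posD cone); apply: pos_mon | apply: (posV cone)].
Qed.

Lemma mutations_pos (s : seed I K) ks :
  all_pos (cvar s) -> all_pos (cvar (mutations s ks)).
Proof. by elim: ks s => //= k ks IH s Xp; apply/IH/mutate_pos. Qed.

End Positivity.

(** * Cones of fractions that are positive at a point *)

Section EvaluationCone.
Variables (R : idomainType) (ev : {rmorphism R -> int}).

Definition evpos (z : {fraction R}) := exists P Q : R,
  [/\ 0 < ev P, 0 < ev Q & z = tofrac P / tofrac Q].

Lemma ev_neq0 P : 0 < ev P -> tofrac P != 0.
Proof. by rewrite tofrac_eq0; apply: contraTneq => ->; rewrite rmorph0. Qed.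

Lemma evpos_tofrac P : 0 < ev P -> evpos (tofrac P).
Proof. by move=> h; exists P, 1; split; rewrite ?rmorph1 ?divr1. Qed.

Lemma evpos_cone : positive_cone evpos.
Proof.
split.
- by apply: (@evpos_tofrac 1); rewrite rmorph1.
- move=> _ _ [P [Q [p q ->]]] [P' [Q' [p' q' ->]]]; exists (P * P'), (Q * Q').
  by split; rewrite ?rmorphM ?mulr_gt0 //= mulf_div.
- move=> _ [P [Q [p q ->]]]; exists Q, P; split=> //.
  by rewrite invf_div.
- move=> _ _ [P [Q [p q ->]]] [P' [Q' [p' q' ->]]].
  exists (P * Q' + P' * Q), (Q * Q'); split.
  + by rewrite rmorphD !rmorphM addr_gt0 // mulr_gt0.
  + by rewrite rmorphM mulr_gt0.
  + by rewrite addf_div ?ev_neq0 // rmorphD !rmorphM.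
- by move=> _ [P [Q [p q ->]]]; rewrite mulf_neq0 ?invr_eq0 ?ev_neq0.
Qed.

Lemma evposD_tofrac z w (P : R) :
  0 <= ev P -> evpos z -> evpos w -> evpos (z + tofrac P * w).
Proof.
move=> P0 [A [C [a c ->]]] [A' [C' [a' c' ->]]].
exists (A * C' + P * A' * C), (C * C'); split.
- by rewrite rmorphD !rmorphM ltr_wpDr ?mulr_gt0 // !mulr_ge0 // ltW.
- by rewrite rmorphM mulr_gt0.
- by rewrite mulrA addf_div ?ev_neq0 // rmorphD !rmorphM.
Qed.

End EvaluationCone.

(* The field in which orders of vanishing are measured: a cone element of
   [val0] is a unit at [0], so no power of [tvar] but the trivial one lies in
   [val0]. *)
Definition tfield : fieldType := {fraction {poly int}}.
Definition tvar : tfield := tofrac ('X : {poly int}).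
Definition val0 : tfield -> Prop := evpos (horner_eval (0 : int)).
(** Unlike [val0] this cone contains [tvar]: identities valid on positive cones may be specialized
    at [tvar], and the result is then tested for membership in [val0]. *)
Definition tpos : tfield -> Prop := evpos (horner_eval (1 : int)).

Lemma val0_cone : positive_cone val0. Proof. exact: evpos_cone. Qed.
Lemma tpos_cone : positive_cone tpos. Proof. exact: evpos_cone. Qed.

Lemma tpos_tvar : tpos tvar.
Proof. by apply: evpos_tofrac; rewrite /= /horner_eval hornerX. Qed.

Lemma tvar_val0 (n : int) : val0 (tvar ^ n) -> n = 0.
Proof.
wlog : n / 0 <= n => [wl h | n0].
  have [n0|n0] := leP 0 n; first exact: wl.
  apply: oppr_inj; rewrite oppr0; apply: wl; first by rewrite oppr_ge0 ltW.
  by rewrite -invr_expz; apply: (posV val0_cone).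
case: n n0 => // n _ [P [Q [p q]]]; rewrite -exprnP => e.
have /eqP : tofrac ('X^n * Q : {poly int}) == tofrac P.
  by rewrite rmorphM rmorphXn [tofrac 'X ^+ n]e divfK // (@ev_neq0 _ (horner_eval 0)).
move=> /eqP; rewrite tofrac_eq => /eqP/(congr1 (fun R => R.[0])).
rewrite hornerM hornerXn expr0n; case: n {e} => //= n; rewrite mul0r => e.
by move: p; rewrite /= /horner_eval -e ltxx.
Qed.

Lemma val0D z w (n : int) : 0 <= n -> val0 z -> val0 w -> val0 (z + tvar ^ n * w).
Proof.
case: n => // n _ z0 w0; rewrite -exprnP -rmorphXn; apply: evposD_tofrac => //.
by rewrite /= /horner_eval hornerXn expr0n; case: n.
Qed.

Section UnitMutations.
Variables (I : finType) (p : I).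

Definition unit_off (X : I -> tfield) := X p = tvar /\ forall a, a != p -> val0 (X a).

Lemma mon_unit_off X v : unit_off X -> exists2 w, val0 w & mon X v = tvar ^ v p * w.
Proof.
case=> Xp Xu; exists (\prod_(a | a != p) X a ^ v a).
  by apply: (pos_prod val0_cone) => a ap; apply: (pos_expz val0_cone); apply: Xu.
by rewrite /mon (bigD1 p) //= Xp.
Qed.

(** With [n] the entry of the matrix at [p] and [k], the two monomials of the exchange relation
    carry [tvar] to the powers max(n, 0) and max(-n, 0). One of these is zero, so the sum does not
    vanish at [tvar = 0]. *)
Lemma mutate_unit_off (s : seed I tfield) k : k != p -> antisym (exmat s) ->
  unit_off (cvar s) -> unit_off (cvar (mutate k s)).
Proof.
move=> kp asym Xu; split; first by rewrite mutate_cvarE 1?eq_sym //; case: Xu.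
move=> a ap; rewrite /mutate /=; case: eqP => [_ | _]; last by case: Xu => _; apply.
apply: (posM val0_cone); last by apply: (posV val0_cone); case: Xu => _; apply.
have [w w0 e] := mon_unit_off (fun b => posz_part (exmat s b k)) Xu.
have [w' w0' e'] := mon_unit_off (fun b => posz_part (exmat s k b)) Xu.
rewrite -!/(mon _ _) e e' (asym k p); set n := exmat s p k.
have [n0|n0] := leP n 0; rewrite /posz_part.
  by rewrite (max_r n0) expr0z mul1r; apply: val0D => //; rewrite le_max lexx orbT.
rewrite addrC (_ : Num.max (- n) 0 = 0) ?expr0z ?mul1r; last by apply: max_r; lia.
by apply: val0D => //; rewrite le_max lexx orbT.
Qed.

Lemma mutations_unit_off (s : seed I tfield) ks : p \notin ks -> antisym (exmat s) ->
  unit_off (cvar s) -> unit_off (cvar (mutations s ks)).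
Proof.
elim: ks s => //= k ks IH s; rewrite inE negb_or eq_sym => /andP[kp pks] asym Xu.
by apply: IH => //; [apply: mutate_antisym | apply: mutate_unit_off].
Qed.

End UnitMutations.

(** * Link diagrams with levels *)

(* A prime diagram together with the data driving its reduction.  The regions
   are named by [reg], which identifies two corners iff they are in the same
   cycle of [opp \o rot]; the dart [i0] lies on the distinguished segment.  The
   level of a region is a distance to the region of [i0]: adjacent regions have
   levels differing by one, and only the region of [i0] has no lower
   neighbour. *)
Record diagram (D J : finType) (rot opp : D -> D) (reg : D -> J)
    (lev : J -> nat) (i0 : D) : Prop := Diagram {
  rot4 : forall d, rot (rot (rot (rot d))) = d;
  rot2_neq : forall d, rot (rot d) != d;
  dopK : involutive opp;
  reg_back : forall d, reg (opp (rot d)) = reg d;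
  reg_conn : forall d e, reg d = reg e -> fconnect (opp \o rot) d e;
  reg_prime : forall d e, reg d = reg e -> reg (opp d) = reg (opp e) -> d = e;
  lev_opp : forall d, lev (reg (opp d)) = (lev (reg d)).+1 \/
                      lev (reg d) = (lev (reg (opp d))).+1;
  lev_root : lev (reg i0) = 0%N;
  lev_down : forall d, reg d <> reg i0 ->
    exists2 e, reg e = reg d & (lev (reg (opp e)) < lev (reg e))%N;
  reg_card : (#|D| + 8 <= 4 * #|[set reg d | d : D]|)%N
}.

Section DiagramTheory.
Variables (D J : finType) (rot opp : D -> D) (reg : D -> J) (lev : J -> nat) (i0 : D).
Hypothesis Dg : diagram rot opp reg lev i0.

Let rotK := rot4 Dg.
Let oppK := dopK Dg.
Local Notation l d := (lev (reg d)).
Local Notation r2 d := (rot (rot d)).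
Local Notation r3 d := (rot (rot (rot d))).

Definition fnext d := r3 (opp d).
Definition fprev d := opp (rot d).

Lemma drot_inj : injective rot.
Proof. exact: (can_inj (g := fun d => r3 d)). Qed.

Lemma fnextK : cancel fnext fprev.
Proof. by move=> d; rewrite /fnext /fprev rotK oppK. Qed.

Lemma fprevK : cancel fprev fnext.
Proof. by move=> d; rewrite /fnext /fprev oppK rotK. Qed.

Lemma reg_fprev d : reg (fprev d) = reg d. Proof. exact: (reg_back Dg). Qed.

Lemma reg_fnext d : reg (fnext d) = reg d.
Proof. by rewrite -(reg_fprev (fnext d)) fnextK. Qed.

Lemma reg_r3 d : reg (r3 d) = reg (opp d).
Proof. by rewrite -(reg_back Dg (r3 d)) rotK. Qed.

Lemma rot_neq d : rot d != d.
Proof. by apply: contraNneq (rot2_neq Dg d) => e; rewrite !e. Qed.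

Lemma reg_rot_neq d : reg (rot d) != reg d.
Proof.
apply/eqP => e; have := lev_opp Dg (rot d); rewrite (reg_back Dg) e; lia.
Qed.

(** Connectedness is not a field of [diagram]: [lev_down] descends from any region to the root, and
    [reg_conn] carries [P] along each region. *)
Lemma diagram_conn (P : pred D) : (forall d, P (rot d) = P d) ->
  (forall d, P (opp d) = P d) -> forall d e, P d = P e.
Proof.
move=> Pr Po; suff H n d : (l d <= n)%N -> P d = P i0.
  by move=> d e; rewrite (H _ _ (leqnn (l d))) (H _ _ (leqnn (l e))).
have Pc e f : reg e = reg f -> P e = P f.
  move/(reg_conn Dg)/connectP => [p ep ->].
  elim: p e ep => //= x p IH e /andP[/eqP ex xp]; rewrite -IH // -ex /=.
  by rewrite Po Pr.
elim: n d => [|n IH] d ld.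
  have [/eqP/Pc //|/eqP /(lev_down Dg)[e ee]] := boolP (reg d == reg i0).
  by rewrite ee; lia.
have [/eqP/Pc //|/eqP /(lev_down Dg)[e ee el]] := boolP (reg d == reg i0).
by rewrite -(Pc e d) // -Po IH //; rewrite ee in el *; lia.
Qed.

(** A monogon joins [d] to [rot d]. The other two darts of the crossing then separate the same two
    regions, so [reg_prime] joins them too, and the four darts form a whole component. *)
Lemma no_monogon d : (4 < #|D|)%N -> fnext d != d.
Proof.
move=> D4; apply/eqP => e; have e1 : opp d = rot d by rewrite -[d in RHS]e /fnext rotK.
have e2 : r2 d = opp (r3 d).
  apply: (reg_prime Dg); first by rewrite -(reg_r3 (r3 d)) rotK.
  rewrite oppK. rewrite reg_r3. rewrite e1 -reg_r3 rotK. by [].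
pose P := [pred x | x \in [:: d; rot d; r2 d; r3 d]].
have Pr x : P (rot x) = P x.
  have g : (rot x == d) = (x == r3 d) by rewrite -{1}[d]rotK (inj_eq drot_inj).
  by rewrite /= !inE g !(inj_eq drot_inj); case: (x == d) (x == rot d) (x == r2 d) (x == r3 d) => [] [] [] [].
have Po x : P (opp x) = P x.
  have oi : injective opp by apply: inv_inj.
  have f a b : (opp a == b) = (a == opp b) by rewrite -{1}[b]oppK (inj_eq oi).
  have e3 : opp (rot d) = d by rewrite -e1 oppK.
  have e4 : opp (r2 d) = r3 d by rewrite -[RHS]oppK -e2.
  rewrite /= !inE !f e1 e3 e4 -e2.
  by case: (x == d) (x == rot d) (x == r2 d) (x == r3 d) => [] [] [] [].
have PT x : P x by rewrite (diagram_conn Pr Po x d) /= inE eqxx.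
have : (#|D| <= size [:: d; rot d; r2 d; r3 d])%N.
  by apply: leq_trans (card_size _); apply/subset_leq_card/subsetP => x _; apply: PT.
by rewrite leqNgt D4.
Qed.

(** Levels differ by one across a segment, so around a crossing they read k, k-1, k-2, k-1 or k,
    k-1, k, k-1. The first pattern has one [top] and two [side] corners, the second has two [sad]
    corners. A [cap] is a segment whose two corners in the region of [d] are both [top]. *)
Definition dn d := (l (opp d) < l d)%N.
Definition dcorner d := dn d && dn (fprev d).
Definition side d := dn d (+) dn (fprev d).
Definition top d := dcorner d && (l (r2 d) < l d)%N.
Definition sad d := dcorner d && ~~ (l (r2 d) < l d)%N.
Definition cap d := top d && top (fnext d).

Lemma lev_rot d : l (rot d) = (l d).+1 \/ l d = (l (rot d)).+1.
Proof. by have := lev_opp Dg (rot d); rewrite (reg_back Dg); lia. Qed.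

Lemma dn_r3 d : dn d = (l (r3 d) < l d)%N. Proof. by rewrite /dn reg_r3. Qed.

Lemma dn_fprev d : dn (fprev d) = (l (rot d) < l d)%N.
Proof. by rewrite /dn /fprev oppK (reg_back Dg). Qed.

Lemma fprev_inj : injective fprev. Proof. exact: can_inj fprevK. Qed.

Lemma lev_pattern (a b c e : nat) : b = a.+1 \/ a = b.+1 -> c = b.+1 \/ b = c.+1 ->
    e = c.+1 \/ c = e.+1 -> a = e.+1 \/ e = a.+1 ->
  let x := (b < a)%N in let y := (c < b)%N in let z := (e < c)%N in let w := (a < e)%N in
  [/\ [/\ (a < b)%N = ~~ x, (b < c)%N = ~~ y, (c < e)%N = ~~ z & (e < a)%N = ~~ w],
      [/\ (c < a)%N = x && y, (e < b)%N = y && z, (a < c)%N = z && w & (b < e)%N = w && x]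
    & (x + y + z + w = 2)%N].
Proof.
move=> h1 h2 h3 h4 x y z w; rewrite /x /y /z /w.
by split; [split; lia | split; apply/idP/andP => [?|[? ?]]; try split; lia |
  case: (ltnP b a) => ?; case: (ltnP c b) => ?; case: (ltnP e c) => ?;
  case: (ltnP a e) => ? //=; lia].
Qed.

Lemma crossing_count d : let f d := (sad d + side d)%N in
  (f d + f (rot d) + f (r2 d) + f (r3 d))%N = 2%N.
Proof.
move=> f; rewrite /f /sad /side /dcorner !dn_fprev !dn_r3 !rotK.
have h4 := lev_rot (r3 d); rewrite rotK in h4.
have [[-> -> -> ->] [-> -> -> ->]] := lev_pattern (lev_rot d) (lev_rot (rot d)) (lev_rot (r2 d)) h4.
by case: (_ < _)%N; case: (_ < _)%N; case: (_ < _)%N; case: (_ < _)%N.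
Qed.

Lemma sum_rot (F : D -> nat) : (\sum_d F (rot d) = \sum_d F d)%N.
Proof. by rewrite [RHS](reindex_inj drot_inj). Qed.

Lemma sum_sad_side : (2 * \sum_d (sad d + side d) = #|D|)%N.
Proof.
have [f fE] : exists f : D -> nat, forall d, f d = (sad d + side d)%N by exists (fun d => (sad d + side d)%N).
rewrite -(eq_bigr _ (fun d _ => fE d)).
have : (\sum_d (f d + f (rot d) + f (r2 d) + f (r3 d)) = \sum_(d : D) 2)%N.
  by apply: eq_bigr => d _; rewrite !fE; apply: crossing_count.
rewrite !big_split /= sum_nat_const.
have -> : (\sum_d f (r3 d) = \sum_d f (r2 d))%N by apply: (sum_rot (fun d => f (r2 d))).
have -> : (\sum_d f (r2 d) = \sum_d f (rot d))%N by apply: (sum_rot (fun d => f (rot d))).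
rewrite (sum_rot f).
by move: (\sum_i f i)%N #|D| => a b; lia.
Qed.

Definition capu d := cap (opp d).

(** Seen from below, the ends of a cap are [side] corners, and such a corner has only one higher
    neighbour, so at most one of its two segments is a cap. *)
Lemma capu_side d : (capu d + capu (fprev d) <= side d)%N.
Proof.
apply: (@leq_trans (top (r3 d) + top (rot d))).
  apply: leq_add; first by rewrite /capu /cap /fnext oppK; case: top; case: top.
  by rewrite /capu /cap {1}/fprev oppK; case: (top (rot d)) => //=; case: top.
rewrite /side /top /dcorner !dn_fprev !dn_r3 !rotK.
have h4 := lev_rot (r3 d); rewrite rotK in h4.
have [[E1 E2 E3 E4] [F1 F2 F3 F4]] := lev_pattern (lev_rot d) (lev_rot (rot d)) (lev_rot (r2 d)) h4.
rewrite ?E1 ?E2 ?E3 ?E4 ?F1 ?F2 ?F3 ?F4.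
by case: (_ < _)%N; case: (_ < _)%N; case: (_ < _)%N; case: (_ < _)%N.
Qed.


(** * Discharging over the regions *)

Definition fsum (F : D -> nat) r := (\sum_(d | reg d == r) F d)%N.

Lemma fsum_fprev F r : fsum (fun d => F (fprev d)) r = fsum F r.
Proof.
rewrite /fsum [RHS](reindex_inj fprev_inj) /=.
by apply: eq_bigl => d; rewrite reg_fprev.
Qed.

Lemma fsum_fnext F r : fsum (fun d => F (fnext d)) r = fsum F r.
Proof. by rewrite -fsum_fprev; apply: eq_bigr => d _; rewrite fprevK. Qed.

Lemma fsum_ge F r d : reg d = r -> (F d <= fsum F r)%N.
Proof. by move=> rd; rewrite /fsum (bigD1 d) ?rd //= leq_addr. Qed.

Lemma fsum_ge3 F r d e f : reg d = r -> reg e = r -> reg f = r ->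
  d != e -> d != f -> e != f -> (F d + F e + F f <= fsum F r)%N.
Proof.
move=> rd re rf de df ef; rewrite /fsum (bigD1 d) ?rd //= (bigD1 e) /=; last first.
  by rewrite re eqxx eq_sym.
rewrite (bigD1 f) /= ?addnA ?leq_addr //.
by rewrite rf eqxx eq_sym df eq_sym ef.
Qed.

Lemma fsum_ge4 F r d e f g : reg d = r -> reg e = r -> reg f = r -> reg g = r ->
  uniq [:: d; e; f; g] -> (F d + F e + F f + F g <= fsum F r)%N.
Proof.
move=> rd re rf rg; rewrite /= !inE !negb_or => /and4P[/and3P[de df dg] /andP[ef eg] fg _].
rewrite /fsum (bigD1 d) ?rd //= (bigD1 e) /=; last first.
  by rewrite re eqxx eq_sym.
rewrite (bigD1 f) /=; last by rewrite rf eqxx eq_sym df eq_sym ef.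
rewrite (bigD1 g) /= ?addnA ?leq_addr //.
by rewrite rg eqxx eq_sym dg eq_sym eg eq_sym fg.
Qed.

(** [side] marks the changes of [dn] along the boundary of a region, which is a closed walk. *)
Lemma side_even r : ~~ odd (fsum (fun d => side d) r).
Proof.
have e : (fsum (fun d => side d) r + fsum (fun d => 2 * (dn d && dn (fprev d))) r
   = 2 * fsum (fun d => dn d) r)%N.
  rewrite mul2n -addnn -{2}(fsum_fprev (fun d => dn d) r).
  rewrite /fsum -!big_split /=; apply: eq_bigr => d _; rewrite /side.
  by case: (dn d); case: (dn _).
have e2 : fsum (fun d => 2 * (dn d && dn (fprev d)))%N r
    = (2 * fsum (fun d => dn d && dn (fprev d)) r)%N by rewrite /fsum big_distrr.
by move: e; rewrite e2; do 3!move: (fsum _ _); lia.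
Qed.

Lemma capu_le r : (2 * fsum (fun d => capu d) r <= fsum (fun d => side d) r)%N.
Proof.
rewrite mul2n -addnn -{2}(fsum_fprev (fun d => capu d) r) /fsum -big_split /=.
by apply: leq_sum => d _; apply: capu_side.
Qed.

(* Every region but the root and the reducible ones has excess at least 4,
   whereas the excesses add up to the number of darts. *)
Definition excess r : int := (fsum (fun d => cap d) r)%:Z - (fsum (fun d => capu d) r)%:Z
  + 2 * (fsum (fun d => sad d) r)%:Z + 2 * (fsum (fun d => side d) r)%:Z.

Lemma excess_ge0 r : 0 <= excess r.
Proof. by have := capu_le r; rewrite /excess; lia. Qed.

(** By parity there are s >= 2 sides, and at most s/2 caps seen from below: 2s - s/2 is at least
    3. *)
Lemma excess_side r : (0 < fsum (fun d => side d) r)%N -> 3 <= excess r.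
Proof. by have := capu_le r; have := side_even r; rewrite /excess; lia. Qed.

Lemma no_side_dn r d : fsum (fun d => side d) r = 0%N -> reg d = r ->
  r <> reg i0 -> dn d.
Proof.
move=> s0 rd ri; have [e re de] : exists2 e, reg e = reg d & dn e.
  by apply: (lev_down Dg); rewrite rd.
have ns x : reg x = r -> dn x = dn (fprev x).
  move=> rx; have := fsum_ge (fun d => side d) rx; rewrite s0 /side.
  by case: (dn x); case: (dn _).
have /connectP[p ep ->] := reg_conn Dg re.
have {re} re : reg e = r by rewrite re.
elim: p e ep de re => //= x p IH e /andP[/eqP ex xp] de re.
by apply: (IH x); rewrite // -ex /= -?/(fprev e) ?reg_fprev // -ns.
Qed.

(** Such a region is a local maximum, so its corners are [top] or [sad]. Each of its segments is a
    cap or ends at a saddle, and each saddle ends two segments. *)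
Lemma no_side_excess r : fsum (fun d => side d) r = 0%N -> r <> reg i0 ->
  (#|[set d | reg d == r]|%:Z <= excess r) /\ (2 * (fsum (fun d => sad d) r)%:Z <= excess r).
Proof.
move=> s0 ri; have := capu_le r; rewrite /excess s0 => h.
have {h} -> : fsum (fun d => capu d) r = 0%N by lia.
suff : (#|[set d | reg d == r]| <= fsum (fun d => cap d) r + 2 * fsum (fun d => sad d) r)%N.
  by lia.
rewrite mul2n -addnn -{2}(fsum_fnext (fun d => sad d) r) addnA.
rewrite /fsum -!big_split /= -sum1dep_card; apply: leq_sum => d /eqP rd.
have dc x : reg x = r -> dcorner x.
  by move=> rx; rewrite /dcorner !(no_side_dn s0) ?reg_fprev.
have D1 := dc d rd; have D2 := dc (fnext d) (etrans (reg_fnext d) rd).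
rewrite /cap /sad /top D1 D2 /=.
by case: (l (r2 d) < _)%N; case: (l (r2 (fnext d)) < _)%N.
Qed.

Definition bigon_at d := fnext (fnext d) == d.
Definition triangle_at d := fnext (fnext (fnext d)) == d.

Lemma excess_ge4 d : ~~ bigon_at d -> reg d <> reg i0 ->
  [\/ 4 <= excess (reg d),
     exists2 e, reg e = reg d & bigon_at e
   | exists e, [/\ reg e = reg d, triangle_at e & top e]].
Proof.
move=> nb ri; set r := reg d in ri *.
have [s0|s0] := posnP (fsum (fun d => side d) r).
  have [h1 h2] := no_side_excess s0 ri.
  have n1 : fnext d != d by apply: contraNneq nb => e; rewrite /bigon_at !e.
  have rn := reg_fnext.
  have [t|nt] := boolP (triangle_at d).
    have [td|ntd] := boolP (top d); first by constructor 3; exists d.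
    have [te|nte] := boolP (top (fnext d)).
      by constructor 3; exists (fnext d); rewrite /triangle_at (eqP t) rn; split.
    have [tf|ntf] := boolP (top (fnext (fnext d))).
      by constructor 3; exists (fnext (fnext d)); rewrite /triangle_at (eqP t) !rn; split.
    have sd x : reg x = r -> ~~ top x -> sad x.
      by move=> rx; rewrite /top /sad /dcorner !(no_side_dn s0) ?reg_fprev //=.
    constructor 1; have := @fsum_ge3 (fun d => sad d) r d (fnext d) (fnext (fnext d)).
    rewrite !rn !sd ?rn // !(inj_eq (can_inj fnextK)) !(eq_sym d) -/(bigon_at d) nb n1.
    by move=> /(_ erefl erefl erefl erefl erefl erefl); lia.
  constructor 1; suff : (4 <= #|[set d | reg d == r]|)%N by lia.
  rewrite -sum1dep_card; have := @fsum_ge4 (fun=> 1%N) r d (fnext d) (fnext (fnext d))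
    (fnext (fnext (fnext d))); rewrite !rn; apply=> //.
  rewrite /= !inE !(inj_eq (can_inj fnextK)) !(eq_sym d) -/(bigon_at d).
  by rewrite -/(triangle_at d) (negbTE nb) (negbTE nt) (negbTE n1).
have sE := side_even r; have cE := capu_le r.
have [s4|s4] := leqP 4 (fsum (fun d => side d) r).
  by constructor 1; rewrite /excess; lia.
have {s4 sE s0} s2 : fsum (fun d => side d) r = 2%N by lia.
have [c0|] := posnP (fsum (fun d => capu d) r).
  by constructor 1; rewrite /excess c0 s2; lia.
rewrite lt0n /fsum sum_nat_eq0 negb_forall => /existsP[e].
rewrite negb_imply eqb0 negbK => /andP[/eqP re ce].
have [c0|nc] := posnP (fsum (fun d => cap d) r); last first.
  by constructor 1; rewrite /excess s2; lia.
have [sd0|ns] := posnP (fsum (fun d => sad d) r); last first.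
  by constructor 1; rewrite /excess s2; lia.
have rn := reg_fnext.
(* What remains is two sides and one cap seen from below, on the segment of [e], which ends at these
   two sides. All further corners are [top]; two in a row would form a cap, so the region is a bigon
   or a triangle. *)
have se : side e by have := capu_side e; rewrite ce; case: side; lia.
have sfe : side (fnext e).
  by have := capu_side (fnext e); rewrite fnextK ce; case: side; lia.
have ne1 : fnext e != e.
  apply/eqP => ee; have := capu_side e; rewrite -{2}ee fnextK ce; case: side => //; lia.
have [be|nbe] := boolP (bigon_at e); first by constructor 2; exists e.
have ns x : reg x = r -> x != e -> x != fnext e -> side x = false.
  move=> rx xe xf; have := @fsum_ge3 (fun d => side d) r x e (fnext e).
  rewrite s2 se sfe rn => /(_ rx re re xe xf); rewrite eq_sym ne1 => /(_ erefl).
  by case: side.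
have upe : dn e = false.
  by move: ce; rewrite /capu /cap /top /dcorner /dn oppK; case: ltnP => //; case: ltnP => //; lia.
have d1 : dn (fnext e) by move: sfe; rewrite /side fnextK upe addbF.
have tp x : reg x = r -> x != e -> x != fnext e -> dn (fprev x) -> top x.
  move=> rx xe xf dx; have := ns _ rx xe xf; have := fsum_ge (fun d => sad d) rx.
  rewrite sd0 /side /sad /top /dcorner dx.
  by case: (dn x) => //=; case: ltnP.
have nf : fnext (fnext e) != fnext e by rewrite (inj_eq (can_inj fnextK)).
have tf : top (fnext (fnext e)) by apply: tp; rewrite ?rn ?fnextK.
have [tr|ntr] := boolP (triangle_at e).
  by constructor 3; exists (fnext (fnext e)); rewrite /triangle_at (eqP tr) !rn; split.
have tg : top (fnext (fnext (fnext e))).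
  apply: tp; rewrite ?rn ?fnextK ?(inj_eq (can_inj fnextK)) //.
  by move: tf; rewrite /top /dcorner => /andP[/andP[]].
have := @fsum_ge (fun d => cap d) r (fnext (fnext e)).
by rewrite c0 /cap tf tg !rn re => /(_ erefl).
Qed.

Lemma fiber_closed (P : pred D) d : (forall x, P x -> P (fprev x)) -> P d ->
  forall e, reg e = reg d -> P e.
Proof.
move=> Pf Pd e; move/esym/(reg_conn Dg)/connectP => [p ep ->].
by elim: p d ep Pd => //= x p IH d /andP[/eqP <- xp] /Pf Pd; apply: IH.
Qed.

Lemma bigon_fiber d e : bigon_at d -> reg e = reg d -> e = d \/ e = fnext d.
Proof.
move=> /eqP b re.
suff : (e == d) || (e == fnext d) by case/orP => /eqP ->; [left | right].
move: re.
suff H x : (x == d) || (x == fnext d) -> (fprev x == d) || (fprev x == fnext d).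
  by apply: (fiber_closed (P := fun x => (x == d) || (x == fnext d))); rewrite ?eqxx.
case/orP => /eqP ->; rewrite ?fnextK ?eqxx //.
  by rewrite (_ : fprev d = fnext d) ?eqxx ?orbT // -[in LHS]b fnextK.
Qed.

Lemma triangle_fiber d e : triangle_at d -> reg e = reg d ->
  [\/ e = d, e = fnext d | e = fnext (fnext d)].
Proof.
move=> /eqP b re.
suff : [|| e == d, e == fnext d | e == fnext (fnext d)].
  by case/or3P => /eqP ->; [constructor 1 | constructor 2 | constructor 3].
move: re.
suff H x : [|| x == d, x == fnext d | x == fnext (fnext d)] ->
    [|| fprev x == d, fprev x == fnext d | fprev x == fnext (fnext d)].
  apply: (fiber_closed (P := fun x => [|| x == d, x == fnext d | x == fnext (fnext d)])) => //.
  by rewrite eqxx.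
case/or3P => /eqP ->; rewrite ?fnextK ?eqxx ?orbT //.
by rewrite (_ : fprev d = fnext (fnext d)) ?eqxx ?orbT // -[in LHS]b fnextK.
Qed.

Lemma lev0_root d : l d = 0%N -> reg d = reg i0.
Proof.
move=> l0; apply/eqP; apply: contraT => /eqP/(lev_down Dg)[e re].
by rewrite re l0 ltn0.
Qed.

Lemma top_lev d : top d -> [/\ l (rot d) = (l d).-1, l (r3 d) = (l d).-1,
  l (r2 d) = (l d).-2 & (1 < l d)%N].
Proof.
rewrite /top /dcorner dn_fprev dn_r3 => /andP[/andP[h1 h2] h3].
have := lev_rot d; have := lev_rot (rot d); have := lev_rot (r2 d).
by have := lev_rot (r3 d); rewrite rotK; split; lia.
Qed.

Lemma sum_fsum F : (\sum_(r in [set reg d | d : D]) fsum F r = \sum_d F d)%N.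
Proof.
rewrite (partition_big reg (mem [set reg d | d : D])) //= => d _.
exact: imset_f.
Qed.

(** [opp] exchanges [cap] and [capu], whose sums cancel, and by [crossing_count] each crossing
    contributes 2 * 2, the number of its darts. *)
Lemma sum_excess : \sum_(r in [set reg d | d : D]) excess r = #|D|%:Z.
Proof.
have cs : (\sum_d capu d = \sum_d cap d)%N.
  by rewrite [RHS](reindex_inj (inv_inj oppK)).
have := sum_sad_side; rewrite big_split /= => <-.
rewrite /excess !big_split /= sumrN -!mulr_sumr.
have e F : \sum_(r in [set reg d | d : D]) (fsum F r)%:Z = (\sum_d F d)%:Z.
  by rewrite -(sum_fsum F); rewrite (big_morph Posz (id1 := 0) (op1 := +%R)).
by rewrite !e cs; lia.
Qed.

(** Euler's formula, in the form of [reg_card], says that the regions fall short of an average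
    excess of 4 by at least 8 in total. If nothing were reducible, the deficits would add up to 6 at
    most: 4 at the root, 1 at the other region of [i0], and 1 at the region [x], the only one that
    can be a [top] triangle spoilt by an adjacent bigon. *)
Lemma exists_reducible : (4 < #|D|)%N ->
  (exists d, [/\ bigon_at d, reg d <> reg i0 & reg d <> reg (opp i0)]) \/
  (exists d, [/\ triangle_at d, top d, reg d <> reg i0, reg d <> reg (opp i0)
    & forall e f, reg e = reg d -> reg f = reg (opp e) -> ~~ bigon_at f]).
Proof.
move=> D4.
case: (pickP [pred d | [&& bigon_at d, reg d != reg i0 & reg d != reg (opp i0)]]).
  by move=> d /and3P[b /eqP h1 /eqP h2]; left; exists d.
move=> nb.
case: (pickP [pred d | [&& triangle_at d, top d, reg d != reg i0, reg d != reg (opp i0)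
  & [forall e, forall f, (reg e == reg d) ==> (reg f == reg (opp e)) ==> ~~ bigon_at f]]]).
  move=> d /and5P[t p /eqP h1 /eqP h2 /forallP h3]; right; exists d; split=> // e f re rf.
  by have /forallP/(_ f) := h3 e; rewrite re rf !eqxx.
move=> nt; exfalso.
have br f : bigon_at f -> reg f = reg i0 \/ reg f = reg (opp i0).
  move=> bf; have := nb f; rewrite /= bf /=.
  by case: eqP => [|_]; [left | case: eqP => // e _; right].
pose x := reg (opp (fnext (opp i0))).
have l1 : l (opp i0) = 1%N by have := lev_opp Dg i0; rewrite (lev_root Dg); lia.
suff H d : 4 <= excess (reg d) + (4 * (reg d == reg i0)%:Z
    + ((reg d == reg (opp i0))%:Z + (reg d == x)%:Z)).
  have S : \sum_(r in [set reg d | d : D]) (4 : int) <=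
     \sum_(r in [set reg d | d : D]) (excess r + (4 * (r == reg i0)%:Z
    + ((r == reg (opp i0))%:Z + (r == x)%:Z))).
    by apply: ler_sum => _ /imsetP[d _ ->]; apply: H.
  have T y : \sum_(r in [set reg d | d : D]) (r == reg y)%:Z = 1 :> int.
    rewrite (bigD1 (reg y)) ?imset_f //= eqxx big1 ?addr0 // => r /andP[_ /negbTE ->] //.
  have [ex exE] : exists ex, forall r, ex r = excess r by exists excess.
  rewrite sumr_const in S; move: S; under eq_bigr do rewrite -exE.
  rewrite big_split /= (eq_bigr _ (fun r _ => exE r)) sum_excess big_split /= -mulr_sumr.
  rewrite big_split /= !T -mulr_natr natz; have := reg_card Dg.
  by move: #|[set reg d | d : D]| #|D| => a b; lia.
have e0 := excess_ge0 (reg d).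
have [ri|/eqP ri] := eqVneq (reg d) (reg i0); first by lia.
have [r0|/eqP r0] := eqVneq (reg d) (reg (opp i0)).
  suff : 3 <= excess (reg d) by lia.
  apply: excess_side; rewrite lt0n; apply/eqP => s0.
  have := no_monogon (opp i0) D4; case/eqP; apply: (reg_prime Dg); first exact: reg_fnext.
  rewrite oppK; apply: lev0_root.
  have : dn (fnext (opp i0)) by apply: (no_side_dn s0); rewrite ?reg_fnext.
  by rewrite /dn reg_fnext l1; lia.
have nbd e : reg e = reg d -> ~~ bigon_at e.
  by move=> re; apply/negP => /br; rewrite re => -[].
have [|[e re]|[e [re te pe]]] := excess_ge4 (nbd d erefl) ri; first by lia.
  by rewrite (negbTE (nbd e re)).
have := nt e; rewrite /= te pe re; case: eqP => //= _; case: eqP => //= _.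
move/negbT; rewrite negb_forall => /existsP[e']; rewrite negb_forall => /existsP[f].
rewrite !negb_imply => /and3P[/eqP re' /eqP rf]; rewrite andbT => bf.
have [_ _ _ le] := top_lev pe.
(* The adjacent bigon is not the root, since a triangle with a [top] corner has level at least 2.
   Hence it is the region of [opp i0], and the triangle lies across its other side. *)
have rx : reg d == x.
  case: (br f bf) => rf'.
    have := lev_opp Dg e'; rewrite -rf rf' (lev_root Dg) re'; rewrite re in le; lia.
  have [o1|o1] := bigon_fiber bf (esym rf'); have [o2|o2] := bigon_fiber bf (esym rf).
  - by case: ri; rewrite -re' -(oppK e') o2 -o1 oppK.
  - by rewrite /x o1 -o2 oppK re'.
  - by rewrite /x o1 (eqP bf) -o2 oppK re'.
  - by case: ri; rewrite -re' -(oppK e') o2 -o1 oppK.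
rewrite rx; suff : 3 <= excess (reg d) by lia.
have [s0|/excess_side //] := posnP (fsum (fun d => side d) (reg d)).
have [h _] := no_side_excess s0 ri; apply: le_trans h; rewrite lez_nat -sum1dep_card.
have ne := no_monogon e D4; have := nbd e re; rewrite /bigon_at => ne2.
apply: (@fsum_ge3 (fun=> 1%N) (reg d) e (fnext e) (fnext (fnext e))); rewrite ?reg_fnext //.
- by rewrite eq_sym.
- by rewrite eq_sym.
- by rewrite (inj_eq (can_inj fnextK)) eq_sym.
Qed.

End DiagramTheory.

(** * The triangle and bigon moves *)

Section TriangleMove.
Variables (D J : finType) (rot opp : D -> D) (reg : D -> J) (lev : J -> nat) (i0 : D).
Hypothesis Dg : diagram rot opp reg lev i0.
Hypothesis D4 : (4 < #|D|)%N.

Let rotK := rot4 Dg.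
Let oppK := dopK Dg.
Local Notation l d := (lev (reg d)).
Local Notation r2 d := (rot (rot d)).
Local Notation r3 d := (rot (rot (rot d))).
Local Notation nx := (fnext rot opp).
Local Notation pv := (fprev rot opp).
Let nxK := fnextK Dg.
Let pvK := fprevK Dg.

Lemma reg_r2_neq d : reg (r2 d) != reg d.
Proof.
apply/eqP => e; have := no_monogon Dg (rot d) D4; rewrite /fnext.
suff -> : opp (rot d) = r2 d by rewrite rotK eqxx.
apply: (reg_prime Dg); first by rewrite (reg_back Dg) e.
by rewrite oppK -(reg_r3 Dg (r2 d)) rotK.
Qed.

Lemma reg_opp_neq d : reg (opp d) != reg d.
Proof. by rewrite -(reg_r3 Dg) -{2}[d]rotK eq_sym (reg_rot_neq Dg). Qed.

Variable d0 : D.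
Hypothesis tri : triangle_at rot opp d0.
Hypothesis tip : top rot opp reg lev d0.
Hypothesis t_i0 : reg d0 <> reg i0.
Hypothesis t_i1 : reg d0 <> reg (opp i0).
Hypothesis nb : forall e f, reg e = reg d0 -> reg f = reg (opp e) -> ~~ bigon_at rot opp f.

Local Notation t := (reg d0).
Local Notation inn x := (reg (opp x) == t).
Local Notation pre x := (reg (rot x) == t).

(* The three strands around the triangle [t] are slid across one another: the
   crossings keep their darts, but the ends of the segments are permuted by the
   6-cycle [tmove]. *)
Definition tmove x := if inn x then nx x else if pre x then opp (nx (rot x)) else x.
Definition tmoveV x := if inn x then r3 (pv (opp x)) else if pre x then pv x else x.
Definition topp x := tmoveV (opp (tmove x)).
(** The name [t] is reused for the new triangle, whose corner at each vertex precedes the old one.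
    The old corner passes to a region that was opposite to [t] at another vertex. *)
Definition treg x :=
  if reg x == t then reg (r2 (pv x)) else if pre x then t else reg x.
Definition tlev r := if r == t then (lev t).-1 else lev r.

Lemma pre_inn x : pre x -> inn x = false.
Proof.
move=> /eqP p; apply/negP => /eqP e; have := reg_r2_neq (r3 x).
by rewrite rotK p (reg_r3 Dg) e eqxx.
Qed.

Lemma tmoveK : cancel tmove tmoveV.
Proof.
move=> x; rewrite /tmove; case: ifPn => [ix|nix].
  rewrite /tmoveV /fnext rotK ix; case: ifP => [h|_]; last by rewrite -/(nx x) nxK.
  by have := @pre_inn (r3 (opp x)); rewrite rotK ix h => /(_ erefl).
case: ifPn => [px|npx]; last by rewrite /tmoveV (negbTE nix) (negbTE npx).
by rewrite /tmoveV oppK (reg_fnext Dg) px nxK rotK.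
Qed.

Lemma tmoveVK : cancel tmoveV tmove.
Proof.
move=> x; rewrite /tmoveV; case: ifPn => [ix|nix].
  rewrite /tmove rotK (reg_fprev Dg) ix; case: ifP => [h|_]; last by rewrite pvK oppK.
  by have := @pre_inn (r3 (pv (opp x))); rewrite rotK (reg_fprev Dg) ix h => /(_ erefl).
case: ifPn => [px|npx]; last by rewrite /tmove (negbTE nix) (negbTE npx).
by rewrite /tmove {1}/fprev oppK px pvK.
Qed.

Lemma toppK : involutive topp.
Proof. by move=> x; rewrite /topp tmoveVK oppK tmoveK. Qed.

Definition outer x := (reg x != t) && (reg (opp x) != t).

Lemma outer_opp x : outer x -> outer (opp x).
Proof. by rewrite /outer oppK andbC. Qed.

Lemma tri_cases x y : reg x = t -> reg y = t -> [\/ y = x, y = nx x | x = nx y].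
Proof.
have fx z : reg z = t -> nx (nx (nx z)) = z.
  by case/(triangle_fiber Dg tri) => ->; rewrite !(eqP tri).
move=> rx ry; have tx : triangle_at rot opp x by rewrite /triangle_at fx.
have [->|->|->] : [\/ y = x, y = nx x | y = nx (nx x)].
- by apply: (triangle_fiber Dg tx); rewrite ry.
- by constructor 1.
- by constructor 2.
- by constructor 3; rewrite fx.
Qed.

Lemma in_t_inn x : reg x = t -> inn x = false.
Proof. by move=> <-; apply: negbTE; apply: reg_opp_neq. Qed.

Lemma in_t_pre x : reg x = t -> pre x = false.
Proof. by move=> <-; apply: negbTE; apply: (reg_rot_neq Dg). Qed.

Lemma in_t_r2 x : reg x = t -> (reg (r2 x) == t) = false.
Proof. by move=> <-; apply: negbTE; apply: reg_r2_neq. Qed.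

Lemma rot_nx x : rot (nx x) = opp x. Proof. by rewrite /fnext rotK. Qed.

Lemma pre_pv e : pre e -> pre (pv e) = false.
Proof.
move=> pe; have -> : rot (pv e) = r2 (nx (rot e)) by rewrite rot_nx.
by apply: in_t_r2; rewrite (reg_fnext Dg); apply/eqP.
Qed.

Lemma tmoveV_t x : reg x = t -> tmoveV x = x.
Proof. by move=> rx; rewrite /tmoveV in_t_inn ?in_t_pre. Qed.

Lemma tmoveV_outer e : outer e -> tmoveV e = if pre e then pv e else e.
Proof. by case/andP=> _ /negbTE nie; rewrite /tmoveV nie. Qed.

Lemma treg_t x : reg x = t -> treg (tmoveV x) = reg (r2 (pv x)).
Proof. by move=> rx; rewrite tmoveV_t // /treg rx eqxx. Qed.

Lemma treg_inn x : reg (opp x) = t -> treg (tmoveV x) = t.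
Proof.
move=> ix; rewrite /tmoveV ix eqxx /treg rotK (reg_r3 Dg) (reg_fprev Dg) ix eqxx.
by rewrite in_t_inn // (reg_fprev Dg).
Qed.

Lemma treg_outer e : outer e -> treg (tmoveV e) = reg e.
Proof.
move=> oe; rewrite tmoveV_outer //; case/andP: oe => ne nie.
case: ifPn => [pe|npe]; last by rewrite /treg (negbTE ne) (negbTE npe).
by rewrite /treg (reg_fprev Dg) (negbTE ne) pre_pv.
Qed.

Lemma outer_r3 x : reg x = t -> outer (r3 x).
Proof.
move=> rx; rewrite /outer -!(reg_r3 Dg) rotK (reg_r3 Dg) in_t_inn //=.
by rewrite in_t_r2.
Qed.

Lemma dart_cases u : [\/ reg u = t, reg (opp u) = t | outer u].
Proof.
rewrite /outer; case: eqP => [|_]; first by constructor 1.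
by case: eqP => [|_]; [constructor 2 | constructor 3].
Qed.

Lemma tnext_t x : reg x = t -> topp (rot x) = tmoveV (opp (r3 (pv x))).
Proof. by move=> rx; rewrite /topp /tmove (reg_back Dg) rx eqxx. Qed.

Lemma tnext_r2 x : reg (r2 x) = t -> topp (rot x) = nx (r2 x).
Proof.
move=> rx; rewrite /topp /tmove (reg_back Dg) rx eqxx.
have := in_t_r2 rx; rewrite rotK => ->.
by rewrite oppK tmoveV_t // (reg_fnext Dg).
Qed.

Lemma tnext_pre x : reg (rot x) = t -> topp (rot x) = r3 (pv (rot x)).
Proof.
move=> rx; rewrite /topp /tmove in_t_inn // in_t_pre // /tmoveV oppK rx eqxx.
by [].
Qed.

Lemma tnext_else x : reg x <> t -> reg (rot x) <> t -> reg (r2 x) <> t ->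
  outer (pv x) /\ topp (rot x) = tmoveV (pv x).
Proof.
move=> /eqP h1 /eqP h2 /eqP h3; rewrite /outer (reg_fprev Dg) h1 /fprev oppK h2.
by rewrite /topp /tmove (reg_back Dg) (negbTE h1) (negbTE h3).
Qed.

Lemma treg_back x : treg (topp (rot x)) = treg x.
Proof.
have [rx|nx0] := eqVneq (reg x) t.
  have op : outer (opp (r3 (pv x))).
    by apply/outer_opp/outer_r3; rewrite (reg_fprev Dg).
  by rewrite tnext_t // treg_outer // /treg rx eqxx -(reg_r3 Dg) rotK.
have [px|np] := eqVneq (reg (rot x)) t.
  rewrite tnext_pre // /treg rotK (reg_r3 Dg) (reg_fprev Dg) px eqxx (negbTE nx0).
  by rewrite in_t_inn // (reg_fprev Dg).
have [rx|n2] := eqVneq (reg (r2 x)) t.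
  rewrite tnext_r2 // /treg (reg_fnext Dg) rx eqxx nxK rotK.
  by rewrite (negbTE nx0) (negbTE np).
have [o ->] := tnext_else (elimN eqP nx0) (elimN eqP np) (elimN eqP n2).
by rewrite treg_outer // (reg_fprev Dg) /treg (negbTE nx0) (negbTE np).
Qed.

Let tn x := topp (rot x).

Lemma tn_inj : injective tn.
Proof. by move=> x y /(inv_inj toppK) /(drot_inj Dg). Qed.

(** Representative in the new diagram of an old corner [x] outside [t]: if [x] has become a corner
    of the new triangle, the previous corner of its old region is taken instead. *)
Let st x := if pre x then pv x else x.

Lemma st_step x : reg x <> t -> fconnect tn (st x) (st (pv x)).
Proof.
move=> nx0; rewrite /st; have [px|np] := eqVneq (reg (rot x)) t.
  by rewrite pre_pv // px.
have [rx|n2] := eqVneq (reg (r2 x)) t.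
  apply: (@connect_trans _ _ (tn x)); first exact: fconnect1.
  have -> : tn x = nx (r2 x) by apply: tnext_r2.
  apply: (@connect_trans _ _ (tn (nx (r2 x)))); first exact: fconnect1.
  have -> : tn (nx (r2 x)) = tmoveV (pv x).
    by rewrite /tn tnext_t ?(reg_fnext Dg) // nxK rotK.
  rewrite tmoveV_outer ?connect0 // /outer (reg_fprev Dg) /fprev oppK np andbT.
  exact/eqP.
have [o e] := tnext_else nx0 (elimN eqP np) (elimN eqP n2).
by rewrite -tmoveV_outer // -e; apply: fconnect1.
Qed.

Lemma st_conn x y : reg x = reg y -> reg x <> t -> fconnect tn (st x) (st y).
Proof.
move=> /(reg_conn Dg)/connectP[p xp ->] nx0.
elim: p x xp nx0 => [|z p IH] x /=; first by rewrite connect0.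
case/andP=> /eqP xz zp nx0; apply: (connect_trans (st_step nx0)).
by rewrite -xz in zp *; apply: IH => //; rewrite (reg_back Dg).
Qed.

Lemma treg_conn x y : treg x = treg y -> fconnect tn x y.
Proof.
have sym := fconnect_sym tn_inj.
have tP z : treg z = t -> reg (rot z) = t.
  rewrite /treg; case: eqP => [rz|nz]; last by case: eqP => // _ /nz.
  by move/eqP; rewrite in_t_r2 // (reg_fprev Dg).
have base z : treg z <> t ->
    exists b, [/\ reg b = treg z, fconnect tn z (st b) & reg b <> t].
  move=> tz; have [rz|nz] := eqVneq (reg z) t.
    have rpz : reg (pv z) = t by rewrite (reg_fprev Dg).
    exists (r2 (pv z)); split; first by rewrite /treg rz eqxx.
      rewrite /st (reg_r3 Dg) in_t_inn // sym.
      have e : tn (r2 (pv z)) = z by rewrite /tn tnext_r2 rotK // pvK.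
      by rewrite -{2}e; apply: fconnect1.
    by apply/eqP; rewrite in_t_r2.
  exists z; move: tz; rewrite /treg /st (negbTE nz).
  by case: eqP => // _ _; split=> //; apply/eqP.
move=> e; have [tx|/eqP tx] := eqVneq (treg x) t; last first.
  have [b [rb xb nb0]] := base x tx; have [c [rc yc _]] := base y (fun h => tx (etrans e h)).
  apply: (connect_trans xb); rewrite sym; apply: (connect_trans yc).
  by apply: st_conn; rewrite rc -?e -?rb.
have rx := tP x tx; have ry := tP y (etrans (esym e) tx).
have st1 z : reg (rot z) = t -> tn z = r3 (pv (rot z)) by apply: tnext_pre.
have [h|h|h] := tri_cases rx ry.
- by rewrite (drot_inj Dg h) connect0.
- rewrite sym; have -> : x = tn y by rewrite st1 // h nxK rotK.
  exact: fconnect1.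
- have -> : y = tn x by rewrite st1 // h nxK rotK.
  exact: fconnect1.
Qed.

(** Otherwise the two segments that continue the boundary of the region across [a] beyond the ends
    of [a] would separate the same two regions. By [reg_prime] they would coincide, and that region
    would be a bigon, which [nb] excludes. *)
Lemma opposite_neq a : reg a = t -> reg (r2 a) <> reg (r2 (nx a)).
Proof.
move=> ra e; have rna : rot (nx a) = opp a := rot_nx a.
suff e1 : opp (r3 a) = r2 (nx a).
  have := nb ra (congr1 reg rna).
  by rewrite /bigon_at {2}/fnext rna oppK /fnext e1 -rna rotK eqxx.
apply: (reg_prime Dg); first by rewrite -(reg_r3 Dg) rotK.
by rewrite oppK (reg_r3 Dg) -(reg_r3 Dg (r2 (nx a))) rotK rna.
Qed.

Lemma opposite_inj a b : reg a = t -> reg b = t -> reg (r2 a) = reg (r2 b) -> a = b.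
Proof.
move=> ra rb e; have [->//|h|h] := tri_cases ra rb; subst.
  by have := opposite_neq ra.
by have := opposite_neq rb; rewrite e.
Qed.

Lemma treg_prime x y : treg x = treg y -> treg (topp x) = treg (topp y) -> x = y.
Proof.
rewrite -(tmoveK x) -(tmoveK y) /topp !tmoveVK.
move: (tmove x) (tmove y) => u v e1 e2; congr tmoveV; move: e1 e2.
have io z : outer z -> reg z <> t /\ reg (opp z) <> t by case/andP => /eqP ? /eqP ?.
have r2t z : reg z = t -> reg (r2 (pv z)) <> t.
  by move=> rz; apply/eqP; rewrite in_t_r2 // (reg_fprev Dg).
have oo z : reg z = t -> reg (opp (opp z)) = t by rewrite oppK.
case: (dart_cases u) => hu; case: (dart_cases v) => hv.
- rewrite (treg_t hu) (treg_t hv) => e _.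
  by apply: (fprev_inj Dg); apply: opposite_inj; rewrite ?(reg_fprev Dg).
- by rewrite (treg_t hu) (treg_inn hv) => /(r2t _ hu).
- have [h1 h2] := io v hv.
  by rewrite (treg_inn (oo _ hu)) (treg_outer (outer_opp hv)) => _ /esym /h2.
- by rewrite (treg_t hv) (treg_inn hu) => /esym/(r2t _ hv).
- rewrite (treg_t hu) (treg_t hv) => _ e; apply: (inv_inj oppK).
  by apply: (fprev_inj Dg); apply: opposite_inj; rewrite ?(reg_fprev Dg).
- have [h1 h2] := io v hv.
  by rewrite (treg_inn hu) (treg_outer hv) => /esym /h1.
- have [h1 h2] := io u hu.
  by rewrite (treg_inn (oo _ hv)) (treg_outer (outer_opp hu)) => _ /h2.
- have [h1 h2] := io u hu.
  by rewrite (treg_inn hv) (treg_outer hu) => /h1.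
- by rewrite !treg_outer ?outer_opp //; apply: (reg_prime Dg).
Qed.

(** The regions opposite to [t] become its neighbours. Each vertex of [t] touches one of the two
    regions below the tip, so none of them lies two levels above [t]; hence the new triangle fits
    one level lower. *)
Lemma lev_opposite x : reg x = t -> l (r2 x) = l d0 \/ (l (r2 x)).+2 = l d0.
Proof.
move=> rx; have [h1 h2 _ h3] := top_lev Dg tip.
have : l (rot x) = (l d0).-1 \/ l (r3 x) = (l d0).-1.
  have [->|->|e] := tri_cases erefl rx; first by left.
    by left; rewrite rot_nx -(reg_r3 Dg).
  by right; rewrite (reg_r3 Dg) -rot_nx -e.
have := lev_rot Dg (rot x); have := lev_rot Dg (r2 x); lia.
Qed.

Lemma tlev_neq r : r <> t -> tlev r = lev r.
Proof. by rewrite /tlev; case: eqP. Qed.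

Lemma tlev_t : tlev t = (l d0).-1. Proof. by rewrite /tlev eqxx. Qed.

Lemma outer_i0 : outer i0.
Proof. by rewrite /outer; apply/andP; split; apply/eqP => /esym. Qed.

Lemma treg_root : treg (tmoveV i0) = reg i0.
Proof. exact: treg_outer outer_i0. Qed.

Lemma treg_root_opp : treg (topp (tmoveV i0)) = reg (opp i0).
Proof. by rewrite /topp tmoveVK treg_outer // outer_opp // outer_i0. Qed.

Lemma treg_image : [set treg x | x : D] = [set reg x | x : D].
Proof.
apply/setP => r; apply/imsetP/imsetP => -[x _ ->].
  rewrite /treg; case: ifP => _; first by exists (r2 (pv x)).
  by case: ifP => _; [exists d0 | exists x].
case: (dart_cases x) => hx.
- by exists (tmoveV (opp x)); rewrite // treg_inn // oppK.
- exists x => //; rewrite /treg; have -> : (reg x == t) = false.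
    by rewrite -(oppK x) in_t_inn.
  have e : reg (r3 x) = t by rewrite (reg_r3 Dg).
  by have := in_t_r2 e; rewrite rotK => ->.
- by exists (tmoveV x); rewrite // treg_outer.
Qed.

Lemma triangle_move : diagram rot topp treg tlev (tmoveV i0).
Proof.
have io z : outer z -> reg z <> t /\ reg (opp z) <> t by case/andP => /eqP ? /eqP ?.
have r2t z : reg z = t -> reg (r2 z) <> t by move=> rz; apply/eqP; rewrite in_t_r2.
have oo z : reg z = t -> reg (opp (opp z)) = t by rewrite oppK.
have [_ _ tl2 tl] := top_lev Dg tip.
split.
- exact: (rot4 Dg).
- exact: (rot2_neq Dg).
- exact: toppK.
- exact: treg_back.
- exact: treg_conn.
- exact: treg_prime.
- move=> x; rewrite -(tmoveK x) /topp !tmoveVK; move: (tmove x) => u.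
  case: (dart_cases u) => hu.
  + have rp : reg (pv u) = t by rewrite (reg_fprev Dg).
    rewrite (treg_t hu) (treg_inn (oo _ hu)) tlev_t tlev_neq; last exact: r2t.
    by have := lev_opposite rp; lia.
  + have rp : reg (pv (opp u)) = t by rewrite (reg_fprev Dg).
    rewrite (treg_t hu) (treg_inn hu) tlev_t tlev_neq; last exact: r2t.
    by have := lev_opposite rp; lia.
  + have [h1 h2] := io u hu.
    by rewrite !treg_outer ?outer_opp // !tlev_neq //; apply: (lev_opp Dg).
- by rewrite treg_root tlev_neq ?(lev_root Dg) // => /esym.
- move=> x; rewrite treg_root => xi.
  have [tx|/eqP tx] := eqVneq (treg x) t.
    exists (tmoveV (opp (nx d0))); first by rewrite treg_inn // oppK (reg_fnext Dg).
    have rn : reg (nx d0) = t by rewrite (reg_fnext Dg).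
    rewrite /topp tmoveVK oppK (treg_t rn) nxK (treg_inn (oo _ rn)) tlev_t tlev_neq.
      by rewrite tl2; lia.
    exact: r2t.
  have [b rb] : exists b, reg b = treg x.
    have : treg x \in [set reg x | x : D] by rewrite -treg_image imset_f.
    by case/imsetP => b _ ->; exists b.
  have [f rf lf] : exists2 e, reg e = reg b & (lev (reg (opp e)) < lev (reg e))%N.
    by apply: (lev_down Dg); rewrite rb.
  rewrite rb in rf; have [ro|/eqP ro] := eqVneq (reg (opp f)) t; last first.
    have o : outer f by rewrite /outer rf; apply/andP; split; apply/eqP.
    exists (tmoveV f); first by rewrite treg_outer.
    by rewrite /topp tmoveVK !treg_outer ?outer_opp // !tlev_neq // rf.
  have o := outer_r3 ro; have [h1 h2] := io _ o.
  have rr : reg (r3 (opp f)) = treg x by rewrite (reg_r3 Dg) oppK.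
  exists (tmoveV (r3 (opp f))); first by rewrite treg_outer.
  rewrite /topp tmoveVK !treg_outer ?outer_opp // !tlev_neq // rr.
  rewrite -(reg_r3 Dg (r3 _)) rotK; rewrite ro rf in lf.
  by have := lev_opposite ro; lia.
- by rewrite treg_image; apply: (reg_card Dg).
Qed.

Definition level_sum (g : D -> J) (h : J -> nat) := (\sum_(r in [set g x | x : D]) h r)%N.

Lemma triangle_level_sum : (level_sum treg tlev < level_sum reg lev)%N.
Proof.
have [_ _ _ tl] := top_lev Dg tip.
rewrite /level_sum treg_image (bigD1 t) ?imset_f //= [X in (_ < X)%N](bigD1 t) ?imset_f //=.
rewrite tlev_t (eq_bigr lev); first by rewrite -addSn leq_add2r; lia.
by move=> r /andP[_ /eqP]; apply: tlev_neq.
Qed.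

End TriangleMove.

(** * Merging the two crossings of a bigon *)

Section BigonMove.
Variables (D J : finType) (rot opp : D -> D) (reg : D -> J) (lev : J -> nat) (i0 : D).
Hypothesis Dg : diagram rot opp reg lev i0.
Hypothesis D4 : (4 < #|D|)%N.

Let rotK := rot4 Dg.
Let oppK := dopK Dg.
Local Notation l d := (lev (reg d)).
Local Notation r2 d := (rot (rot d)).
Local Notation r3 d := (rot (rot (rot d))).
Local Notation nx := (fnext rot opp).
Local Notation pv := (fprev rot opp).
Let nxK := fnextK Dg.
Let pvK := fprevK Dg.

Variable d0 : D.
Hypothesis bg : bigon_at rot opp d0.
Hypothesis t_i0 : reg d0 <> reg i0.
Hypothesis t_i1 : reg d0 <> reg (opp i0).

Local Notation t := (reg d0).
Local Notation inn x := (reg (opp x) == t).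
Local Notation pre x := (reg (rot x) == t).
Local Notation out := (outer opp reg d0).

(* The two crossings of the bigon [t] are merged into one, and the four ends of
   its two sides disappear. *)
Definition merge_rot x := if pre x then rot (opp (rot x)) else rot x.

Lemma bigon_nx x : reg x = t -> nx (nx x) = x.
Proof. by case/(bigon_fiber Dg bg) => ->; rewrite !(eqP bg). Qed.

Lemma brot_r3 d : reg d = t -> merge_rot (r3 d) = r2 (nx d).
Proof. by move=> rd; rewrite /merge_rot rotK rd eqxx (rot_nx Dg). Qed.

Lemma bin_opp x : reg x = t -> inn x = false.
Proof. by move=> <-; apply/negbTE/(reg_opp_neq Dg). Qed.

Lemma bin_rot x : reg x = t -> pre x = false.
Proof. by move=> <-; apply/negbTE/(reg_rot_neq Dg). Qed.

Lemma bin_r2 x : reg x = t -> (reg (r2 x) == t) = false.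
Proof. by move=> <-; apply/negbTE/(reg_r2_neq Dg D4). Qed.

Lemma brot_r2 d : reg d = t -> merge_rot (r2 d) = r3 d.
Proof. by move=> rd; rewrite /merge_rot (reg_r3 Dg) bin_opp. Qed.

Lemma bouter_cases x : out x -> [\/ reg (rot x) = t, reg (r2 x) = t |
  [/\ merge_rot x = rot x, reg (rot x) <> t & reg (r2 x) <> t]].
Proof.
move=> ox; have [h|/eqP h] := eqVneq (reg (rot x)) t; first by constructor 1.
have [h'|/eqP h'] := eqVneq (reg (r2 x)) t; first by constructor 2.
by constructor 3; split=> //; rewrite /merge_rot; case: eqP.
Qed.

Lemma outer_r2 d : reg d = t -> out (r2 d).
Proof.
by move=> rd; rewrite /outer bin_r2 //= -(reg_r3 Dg) rotK bin_rot.
Qed.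

Lemma brot_outer x : out x -> out (merge_rot x).
Proof.
move=> ox; case/andP: (ox) => h1 h2; case: (bouter_cases ox) => [h|h|[-> h h']].
- rewrite -[x]rotK brot_r3 // outer_r2 // (reg_fnext Dg) //.
- rewrite -[x]rotK brot_r2 //; exact: (outer_r3 Dg D4).
- by rewrite /outer (reg_back Dg) h1 andbT; apply/eqP.
Qed.

Lemma brot4 x : out x -> merge_rot (merge_rot (merge_rot (merge_rot x))) = x.
Proof.
move=> ox; case: (bouter_cases ox) => [h|h|[e h h']].
- rewrite -[x]rotK; move: (rot x) h => d rd.
  by rewrite brot_r3 // brot_r2 ?(reg_fnext Dg) // brot_r3 ?(reg_fnext Dg) // bigon_nx
    // brot_r2.
- rewrite -[x]rotK; move: (r2 x) h => d rd.
  by rewrite brot_r2 // brot_r3 // brot_r2 ?(reg_fnext Dg) // brot_r3 ?(reg_fnext Dg)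
    // bigon_nx.
- case/andP: ox => h1 h2; rewrite e {3}/merge_rot; case: eqP => // _.
  rewrite {2}/merge_rot; have -> : (reg (r3 x) == t) = false by rewrite (reg_r3 Dg) (negbTE h2).
  by rewrite /merge_rot rotK (negbTE h1).
Qed.

Lemma brot2_neq x : out x -> merge_rot (merge_rot x) != x.
Proof.
move=> ox; have ne d : nx d != d by apply: (no_monogon Dg).
case: (bouter_cases ox) => [h|h|[e h h']].
- rewrite -[x]rotK; move: (rot x) h => d rd.
  by rewrite brot_r3 // brot_r2 ?(reg_fnext Dg) // !(inj_eq (drot_inj Dg)).
- rewrite -[x]rotK; move: (r2 x) h => d rd.
  by rewrite brot_r2 // brot_r3 // !(inj_eq (drot_inj Dg)).
- rewrite e /merge_rot; move/eqP/negbTE: h' => ->; exact: (rot2_neq Dg).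
Qed.

Lemma breg_back x : reg (opp (merge_rot x)) = reg x.
Proof. by rewrite /merge_rot; case: ifP => _; rewrite !(reg_back Dg). Qed.

Let bn x := opp (merge_rot x).
Let st x := if out x then x else pv x.

Lemma pv_outer e : reg e <> t -> inn e -> out (pv e).
Proof.
move=> /eqP ne ie; rewrite /outer (reg_fprev Dg) ne /fprev oppK /=.
have -> : rot e = r2 (r3 e) by rewrite rotK.
by rewrite bin_r2 // (reg_r3 Dg); apply/eqP.
Qed.

Lemma bst_step e : reg e <> t -> fconnect bn (st e) (st (pv e)).
Proof.
move=> ne; rewrite /st; case: ifPn => oe.
  case: (boolP (pre e)) => pe.
    have -> : out (pv e) = false by rewrite /outer /fprev oppK pe andbF.
    have -> : pv (pv e) = bn e by rewrite /bn /merge_rot pe.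
    exact: fconnect1.
  have -> : out (pv e) by rewrite /outer (reg_fprev Dg) /fprev oppK pe andbT; apply/eqP.
  have -> : pv e = bn e by rewrite /bn /merge_rot (negbTE pe).
  exact: fconnect1.
have ie : inn e by move: oe; rewrite /outer negb_and !negbK => /orP[/eqP|].
by rewrite pv_outer.
Qed.

Lemma bconn x y : out x -> out y -> reg x = reg y -> fconnect bn x y.
Proof.
move=> ox oy /(reg_conn Dg)/connectP[p xp ey].
have -> : x = st x by rewrite /st ox.
have {oy} -> : y = st y by rewrite /st oy.
rewrite {}ey; case/andP: ox => /eqP nx0 _.
elim: p x xp nx0 => [|z p IH] x /=; first by rewrite connect0.
case/andP=> /eqP xz zp nx0; apply: (connect_trans (bst_step nx0)).
by rewrite -xz in zp *; apply: IH => //; rewrite (reg_back Dg).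
Qed.

Definition bdart : finType := {x : D | out x}.
Definition bdrot (x : bdart) : bdart := insubd x (merge_rot (val x)).
Definition bdopp (x : bdart) : bdart := insubd x (opp (val x)).
Definition bdreg (x : bdart) : J := reg (val x).

Lemma val_bdrot x : val (bdrot x) = merge_rot (val x).
Proof. by rewrite val_insubd brot_outer // (valP x). Qed.

Lemma val_bdopp x : val (bdopp x) = opp (val x).
Proof. by rewrite val_insubd (outer_opp Dg) // (valP x). Qed.

Lemma outer_i0b : out i0.
Proof. exact: outer_i0. Qed.

Definition bdroot : bdart := Sub i0 outer_i0b.

Lemma outer_fiber e : reg e <> t -> exists2 x : bdart, bdreg x = reg e & True.
Proof.
move=> ne; case: (boolP (out e)) => oe; first by exists (Sub e oe); rewrite /bdreg ?SubK.
have ie : inn e by move: oe; rewrite /outer negb_and !negbK => /orP[/eqP|].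
by exists (Sub (pv e) (pv_outer ne ie)); rewrite /bdreg ?SubK ?(reg_fprev Dg).
Qed.

Lemma bdreg_image : [set bdreg x | x : bdart] = [set reg x | x : D] :\ t.
Proof.
apply/setP => r; rewrite !inE; apply/imsetP/andP => [[x _ ->]|[nr /imsetP[e _ re]]].
  by case/andP: (valP x) => h _; split=> //; apply: imset_f.
have [|x xe _] := @outer_fiber e; first by apply/eqP; rewrite -re.
by exists x; rewrite // re xe.
Qed.

Lemma card_bdart : (#|bdart| + 4 = #|D|)%N.
Proof.
have ne : nx d0 != d0 by apply: (no_monogon Dg).
have rn : reg (nx d0) = t by rewrite (reg_fnext Dg).
have e x : (~~ out x) = (x \in [:: d0; nx d0; rot d0; rot (nx d0)]).
  rewrite /outer negb_and !negbK !inE; apply/orP/or4P.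
    case=> /eqP h; first by case: (bigon_fiber Dg bg h) => ->; [constructor 1|constructor 2].
    have -> : x = rot (nx (opp x)) by rewrite (rot_nx Dg) oppK.
    case: (bigon_fiber Dg bg h) => ->; first by constructor 4.
    by constructor 3; rewrite (eqP bg).
  case=> /eqP ->; [by left | by left; rewrite rn | right | right].
    by rewrite (reg_back Dg).
  by rewrite (reg_back Dg) rn.
have u : uniq [:: d0; nx d0; rot d0; rot (nx d0)].
  rewrite /= !inE !negb_or (inj_eq (drot_inj Dg)) eq_sym ne.
  have h a b : reg a = t -> reg b = t -> a != rot b.
    by move=> ra rb; apply/eqP => e1; have := bin_rot rb; rewrite -e1 ra eqxx.
  by rewrite !h.
rewrite card_sig -(cardC out); congr (_ + _)%N.
transitivity #|[:: d0; nx d0; rot d0; rot (nx d0)]|; first by rewrite (card_uniqP u).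
by apply: eq_card => x; rewrite -e.
Qed.

Lemma bigon_move : diagram bdrot bdopp bdreg lev bdroot.
Proof.
split.
- by move=> x; apply: val_inj; rewrite !val_bdrot brot4 // (valP x).
- by move=> x; rewrite -val_eqE !val_bdrot brot2_neq // (valP x).
- by move=> x; apply: val_inj; rewrite !val_bdopp oppK.
- by move=> x; rewrite /bdreg val_bdopp val_bdrot breg_back.
- move=> x y exy; have h := bconn (valP x) (valP y) exy.
  have := iter_findex h; set n := findex _ _ _ => h2.
  have -> : y = iter n (bdopp \o bdrot) x; last exact: fconnect_iter.
  apply: val_inj; rewrite -h2; elim: (n) => //= m ->.
  by rewrite val_bdopp val_bdrot.
- by move=> x y e1; rewrite /bdreg !val_bdopp => e2; apply: val_inj; apply: (reg_prime Dg).
- by move=> x; rewrite /bdreg val_bdopp; apply: (lev_opp Dg).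
- exact: (lev_root Dg).
- move=> x /(lev_down Dg)[f rf lf].
  have nf : reg f <> t by rewrite rf; case/andP: (valP x) => /eqP.
  have [ro|ro] := eqVneq (reg (opp f)) t; last first.
    have o : out f by rewrite /outer ro andbT; apply/eqP.
    by exists (Sub f o); rewrite /bdreg ?val_bdopp ?SubK.
  set d := opp f in ro; have o := outer_r3 Dg D4 ro.
  have rr : reg (r3 d) = reg f by rewrite (reg_r3 Dg) /d oppK.
  exists (Sub (r3 d) o); rewrite /bdreg ?val_bdopp ?SubK ?rr //.
  rewrite -(reg_r3 Dg) rotK; rewrite -/d ro in lf.
  (* The lower neighbour found across [f] is the bigon, which disappears. The bigon has a lower
     neighbour in turn, across its other side; the region at [r2 d], between that one and the region
     of [f], has the level of the bigon and replaces it. *)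
  have [g rg lg] := lev_down Dg t_i0.
  have lrot : l (rot d) = (l d0).-1.
    have -> : reg (rot d) = reg (opp g).
      have rgd : reg g = reg d by rewrite ro.
      have bd : bigon_at rot opp d by rewrite /bigon_at bigon_nx.
      case: (bigon_fiber Dg bd rgd) => e; first by move: lg; rewrite e ro /d oppK; lia.
      by rewrite e -(rot_nx Dg) bigon_nx.
    by have := lev_opp Dg g; rewrite rg in lg *; lia.
  have := lev_rot Dg (rot d); have := lev_rot Dg (r2 d); have := lev_opp Dg f.
  by rewrite -/d ro rr; lia.
- have := reg_card Dg; rewrite bdreg_image (cardsD1 t) imset_f // -card_bdart /=; lia.
Qed.

End BigonMove.

(** * State sums *)

Section StateSum.
Variables (D J : finType) (K : fieldType).
Variables (rot : D -> D) (reg : D -> J) (ks : seq J).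

Definition orb c := [:: c; rot c; rot (rot c); rot (rot (rot c))].

(* Sum over the states assigning to each crossing of [cs] one of its corners in
   such a way that, together with the regions [u] already used, every region of
   [ks] is used exactly once. *)
Fixpoint ssum (om : D -> K) (cs : seq D) (u : seq J) : K :=
  if cs is c :: cs' then \sum_(a <- orb c) om a * ssum om cs' (reg a :: u)
  else (perm_eq u ks)%:R.

Lemma ssum_cons om c cs u : ssum om (c :: cs) u =
  om c * ssum om cs (reg c :: u) + (om (rot c) * ssum om cs (reg (rot c) :: u)
  + (om (rot (rot c)) * ssum om cs (reg (rot (rot c)) :: u)
  + om (rot (rot (rot c))) * ssum om cs (reg (rot (rot (rot c))) :: u))).
Proof. by rewrite /= !big_cons big_nil addr0. Qed.

Lemma ssum_perm_used om cs u v : perm_eq u v -> ssum om cs u = ssum om cs v.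
Proof.
elim: cs u v => [|c cs IH] u v uv /=; first by rewrite (permPl uv).
by apply: eq_bigr => a _; congr (_ * _); apply: IH; rewrite perm_cons.
Qed.

Lemma ssum_pull om c s1 s2 u : ssum om (s1 ++ c :: s2) u = ssum om (c :: s1 ++ s2) u.
Proof.
elim: s1 u => //= d s1 IH u; under eq_bigr => a _ do rewrite IH /= big_distrr /=.
rewrite exchange_big /=; apply: eq_bigr => b _; rewrite big_distrr /=.
apply: eq_bigr => a _; rewrite mulrCA; congr (_ * (_ * _)); apply: ssum_perm_used.
by rewrite -[_ :: _ :: u]/([:: _] ++ [:: _] ++ u) perm_catCA.
Qed.

Hypothesis rotK : forall d, rot (rot (rot (rot d))) = d.

Lemma orb_rot c : perm_eq (orb (rot c)) (orb c).
Proof. by rewrite /orb rotK -[X in perm_eq X _]/(rcons [:: _; _; _] c) perm_rcons. Qed.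

Lemma orb_mem c d : d \in orb c -> perm_eq (orb d) (orb c).
Proof.
rewrite !inE => /or4P[] /eqP ->; rewrite ?perm_refl ?orb_rot //.
  exact: perm_trans (orb_rot _) (orb_rot _).
exact: perm_trans (orb_rot _) (perm_trans (orb_rot _) (orb_rot _)).
Qed.

Lemma ssum_orb om c d cs u : d \in orb c -> ssum om (d :: cs) u = ssum om (c :: cs) u.
Proof. by move=> dc /=; apply: perm_big; apply: orb_mem. Qed.

Lemma ssum_dup om cs u : uniq ks -> ~~ uniq u -> ssum om cs u = 0.
Proof.
move=> uks; elim: cs u => [|c cs IH] u nu /=.
  by case: (boolP (perm_eq u ks)) => // /perm_uniq e; rewrite e uks in nu.
by apply: big1 => a _; rewrite IH ?mulr0 // /= negb_and nu orbT.
Qed.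

Lemma ssum_miss om cs u t : t \in ks -> t \notin u ->
  (forall c a, c \in cs -> a \in orb c -> reg a != t) -> ssum om cs u = 0.
Proof.
move=> tks; elim: cs u => [|c cs IH] u tu h /=.
  by case: (boolP (perm_eq u ks)) => // /perm_mem/(_ t); rewrite tks (negbTE tu).
apply: big1_seq => a /andP[_ ac]; rewrite IH ?mulr0 //.
  by rewrite inE negb_or tu andbT eq_sym (h c) // mem_head.
by move=> c' a' c's; apply: h; rewrite inE c's orbT.
Qed.

Definition crossings cs := perm_eq (flatten [seq orb c | c <- cs]) (enum D).

Lemma crossings_mem cs d : crossings cs -> exists2 c, c \in cs & d \in orb c.
Proof.
move=> /perm_mem/(_ d); rewrite mem_enum => /flattenP[s /mapP[c cc ->] ds].
by exists c.
Qed.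

Lemma flatten_orb c cs :
  flatten [seq orb c | c <- c :: cs] = orb c ++ flatten [seq orb c | c <- cs].
Proof. by []. Qed.

Lemma flatten_orb_cat cs cs' : flatten [seq orb c | c <- cs ++ cs'] =
  flatten [seq orb c | c <- cs] ++ flatten [seq orb c | c <- cs'].
Proof. by rewrite map_cat flatten_cat. Qed.

Lemma crossings_front cs s d : perm_eq (flatten [seq orb c | c <- cs]) s -> d \in s ->
  exists2 cs', perm_eq (flatten [seq orb c | c <- d :: cs']) s &
    forall om u, ssum om cs u = ssum om (d :: cs') u.
Proof.
move=> p; rewrite -(perm_mem p) => /flattenP[_ /mapP[c cc ->] dc].
case/splitPr: cc p => s1 s2 p; exists (s1 ++ s2) => [|om u].
  apply: perm_trans p; rewrite !flatten_orb flatten_orb_cat flatten_orb_cat flatten_orb.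
  by rewrite perm_sym perm_catCA perm_cat2r perm_sym; apply: orb_mem.
by rewrite ssum_pull (ssum_orb _ _ _ dc).
Qed.

(** Allows the crossings of a triangle or of a bigon to be listed first, each from a chosen
    corner. *)
Lemma ssum_indep om cs cs' u :
  perm_eq (flatten [seq orb c | c <- cs]) (flatten [seq orb c | c <- cs']) ->
  ssum om cs u = ssum om cs' u.
Proof.
elim: cs cs' u => [|c cs IH] cs' u p.
  by case: cs' p => // c' cs' /perm_size.
have cin : c \in flatten [seq orb c | c <- cs'].
  by rewrite -(perm_mem p) flatten_orb mem_cat mem_head.
have [cs2 p2 ->] := crossings_front (perm_refl _) cin.
rewrite /=; apply: eq_bigr => a _; congr (_ * _); apply: IH.
by rewrite perm_sym in p2; have := perm_trans p p2; rewrite !flatten_orb perm_cat2l.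
Qed.

End StateSum.

Lemma eq_ssum (D J : finType) (K : fieldType) (rot : D -> D) (reg reg' : D -> J) ks
    (om om' : D -> K) cs u :
  (forall c a, c \in cs -> a \in orb rot c -> om a = om' a /\ reg a = reg' a) ->
  ssum rot reg ks om cs u = ssum rot reg' ks om' cs u.
Proof.
elim: cs u => // c cs IH u h.
have lE (g : D -> J) (k : D -> K) : ssum rot g ks k (c :: cs) u =
  \sum_(a <- orb rot c) k a * ssum rot g ks k cs (g a :: u) by [].
rewrite !lE; apply: eq_big_seq => a ac; have [-> ->] := h c a (mem_head _ _) ac.
by congr (_ * _); apply: IH => c' a' c's; apply: h; rewrite inE c's orbT.
Qed.

(** Weights and regions are paired so that the sum takes the shape of [tsum], in which no darts
    occur. *)
Lemma ssum3 (D J : finType) (K : fieldType) (rot : D -> D) (reg : D -> J) ks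
    (om : D -> K) c1 c2 c3 cs u : ssum rot reg ks om [:: c1, c2, c3 & cs] u =
  \sum_(x <- [seq (om a, reg a) | a <- orb rot c1])
  \sum_(y <- [seq (om a, reg a) | a <- orb rot c2])
  \sum_(z <- [seq (om a, reg a) | a <- orb rot c3])
    x.1 * y.1 * z.1 * ssum rot reg ks om cs [:: z.2, y.2, x.2 & u].
Proof.
have lE c cs' w : ssum rot reg ks om (c :: cs') w =
  \sum_(a <- orb rot c) om a * ssum rot reg ks om cs' (reg a :: w) by [].
rewrite lE big_map; apply: eq_bigr => a _; rewrite lE big_distrr big_map.
apply: eq_bigr => b _; rewrite lE !big_distrr big_map; apply: eq_bigr => d _ /=.
by rewrite !mulrA.
Qed.

Lemma ssum_map (D D' J : finType) (K : fieldType) (rot : D -> D) (rot' : D' -> D')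
    (reg : D -> J) (reg' : D' -> J) ks (om : D -> K) (om' : D' -> K) (f : D' -> D) cs u :
  (forall c, c \in cs -> [/\ [seq f a | a <- orb rot' c] = orb rot (f c),
     {in orb rot' c, forall a, reg' a = reg (f a)}
   & {in orb rot' c, forall a, om' a = om (f a)}]) ->
  ssum rot' reg' ks om' cs u = ssum rot reg ks om [seq f c | c <- cs] u.
Proof.
elim: cs u => // c cs IH u h; have [e1 e2 e3] := h c (mem_head _ _).
have lE w (g : D -> J) (k : D -> K) (q : D -> D) x xs : ssum q g ks k (x :: xs) w =
  \sum_(a <- orb q x) k a * ssum q g ks k xs (g a :: w) by [].
rewrite lE -e1 big_map; apply: eq_big_seq => a ac.
rewrite e2 ?e3 //; congr (_ * _); apply: IH => c' c'c.
by apply: h; rewrite inE c'c orbT.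
Qed.

Section ExistsCrossings.
Variables (D : finType) (rot : D -> D).
Hypothesis rotK : forall d, rot (rot (rot (rot d))) = d.
Hypothesis rot2N : forall d, rot (rot d) != d.

Lemma orb_uniq c : uniq (orb rot c).
Proof.
have ri : injective rot by apply: (can_inj (g := fun d => rot (rot (rot d)))).
have r1 d : rot d != d by apply: contraNneq (rot2N d) => e; rewrite !e.
have r3 d : rot (rot (rot d)) != d.
  by apply: contraNneq (r1 d) => e; rewrite -{2}[d]rotK e.
by rewrite /= !inE !negb_or !(inj_eq ri) !(eq_sym _ (rot _)) ?r1 ?rot2N ?r3.
Qed.

Lemma exists_crossings : exists cs, crossings rot cs.
Proof.
suff H n (s : seq D) : (size s <= n)%N -> uniq s -> {in s, forall d, rot d \in s} ->
    exists cs, perm_eq (flatten [seq orb rot c | c <- cs]) s.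
  by have := H _ _ (leqnn _) (enum_uniq D); apply=> d _; rewrite mem_enum.
elim: n s => [|n IH] [|d s] //= sn us cl; try by exists [::].
pose s' := [seq x <- d :: s | x \notin orb rot d].
have sub : {subset orb rot d <= d :: s}.
  have h1 := cl _ (mem_head d s); have h2 := cl _ h1; have h3 := cl _ h2.
  by move=> x; rewrite [x \in orb _ _]inE => /predU1P[->|]; rewrite ?mem_head //;
    rewrite !inE => /or3P[] /eqP ->; rewrite -in_cons.
have p : perm_eq (orb rot d ++ s') (d :: s).
  apply: uniq_perm => //.
    rewrite cat_uniq orb_uniq filter_uniq // andbT /=.
    by apply/hasPn => x; rewrite mem_filter => /andP[].
  move=> x; rewrite mem_cat mem_filter; case: (boolP (x \in orb rot d)) => //= /sub //.
have [||| cs pcs] := IH s'.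
- have := perm_size p; rewrite size_cat /=; lia.
- exact: filter_uniq.
- move=> x; rewrite !mem_filter => /andP[xo xs]; rewrite cl // andbT.
  apply: contra xo => xo; rewrite -(perm_mem (orb_mem rotK xo)).
  by rewrite !inE rotK eqxx !orbT.
by exists (d :: cs); apply: perm_trans p; rewrite flatten_orb perm_cat2l.
Qed.

End ExistsCrossings.


Section StateSet.
Variables (D J : finType) (K : fieldType) (rot : D -> D) (reg : D -> J) (ks : seq J).

Fixpoint choices (cs : seq D) : seq (seq D) :=
  if cs is c :: cs' then [seq a :: s | a <- orb rot c, s <- choices cs'] else [:: [::]].

Lemma choices_cons c cs :
  choices (c :: cs) = [seq a :: s | a <- orb rot c, s <- choices cs].
Proof. by []. Qed.

Lemma ssum_choices (om : D -> K) cs u : ssum rot reg ks om cs u =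
  \sum_(s <- choices cs | perm_eq (map reg s ++ u) ks) \prod_(a <- s) om a.
Proof.
elim: cs u => [|c cs IH] u.
  by rewrite /= big_mkcond big_seq1 big_nil; case: ifP.
rewrite choices_cons big_mkcond big_allpairs_dep /=; apply: eq_bigr => a _.
rewrite IH [in LHS]big_mkcond big_distrr; apply: eq_bigr => s _.
rewrite (_ : perm_eq (map reg s ++ reg a :: u) ks = perm_eq (reg a :: map reg s ++ u) ks).
  by rewrite big_cons; case: ifP; rewrite /= ?mulr0.
by rewrite -cat1s perm_catCA.
Qed.

Lemma choicesP cs s : reflect (size s = size cs /\
    forall x y i, (i < size cs)%N -> nth x s i \in orb rot (nth y cs i)) (s \in choices cs).
Proof.
elim: cs s => [|c cs IH] s.
  rewrite inE; apply: (iffP eqP) => [-> //|[]]; by case: s.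
rewrite choices_cons; apply: (iffP idP) => [/allpairsPdep[a [s' [ac /IH[ss h] ->]]]|].
  split=> [|x y [|i]] //=; first by rewrite ss.
  by rewrite ltnS => /h; apply.
case: s => [[]|a s'] // [[ss] h]; apply/allpairsPdep; exists a, s'; split=> //; first exact: (h a a 0%N).
by apply/IH; split=> // x y i i_lt; apply: (h x y i.+1).
Qed.

End StateSet.

(* The local identity behind the triangle move: each side is linear in the
   values [W u v], where [u] and [v] are the outer regions used at the three
   crossings of the triangle. *)
Section TriangleIdentity.
Variable (K : fieldType) (J : eqType).
Variables (t xa xb xc pA pB pC : J) (v : J -> J -> J -> K) (W : J -> J -> K).
Hypothesis Wsym : forall r s, W r s = W s r.
Hypothesis Wdiag : forall r, W r r = 0.
Hypothesis vt1 : forall r s, v t r s = W r s.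
Hypothesis vt2 : forall r s, v r t s = W r s.
Hypothesis vt3 : forall r s, v r s t = W r s.
Hypothesis Wt : forall r, W t r = 0.
Hypothesis v0 : forall r s q, r != t -> s != t -> q != t -> v r s q = 0.
Hypothesis tN : [/\ xa != t, xb != t, xc != t & [/\ pA != t, pB != t & pC != t]].

Definition tsum (r0 r1 r2 r3 s0 s1 s2 s3 q0 q1 q2 q3 : J) :=
  fun a0 a1 a2 a3 b0 b1 b2 b3 c0 c1 c2 c3 : K =>
  \sum_(x <- [:: (a0, r0); (a1, r1); (a2, r2); (a3, r3)])
  \sum_(y <- [:: (b0, s0); (b1, s1); (b2, s2); (b3, s3)])
  \sum_(z <- [:: (c0, q0); (c1, q1); (c2, q2); (c3, q3)])
    x.1 * y.1 * z.1 * v x.2 y.2 z.2.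

Lemma tsum_old (a0 a1 a2 a3 b0 b1 b2 b3 c0 c1 c2 c3 : K) :
   tsum t xb pA xc t xc pB xa t xa pC xb
    a0 a1 a2 a3 b0 b1 b2 b3 c0 c1 c2 c3 =
  (a1 * b3 * c0 + a1 * b0 * c1 + a0 * b3 * c3) * W xa xb
  + (a3 * b3 * c0 + a3 * b0 * c1 + a0 * b1 * c1) * W xa xc
  + (a1 * b1 * c0 + a3 * b0 * c3 + a0 * b1 * c3) * W xb xc
  + (a2 * b3 * c0 + a2 * b0 * c1) * W pA xa + a2 * b0 * c3 * W pA xb
  + a2 * b1 * c0 * W pA xc + a2 * b2 * c0 * W pA pB + a2 * b0 * c2 * W pA pC
  + a0 * b2 * c1 * W pB xa + (a1 * b2 * c0 + a0 * b2 * c3) * W pB xb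
  + a3 * b2 * c0 * W pB xc + a0 * b2 * c2 * W pB pC
  + a0 * b3 * c2 * W pC xa + a1 * b0 * c2 * W pC xb
  + (a3 * b0 * c2 + a0 * b1 * c2) * W pC xc.
Proof.
case: tN => n1 n2 n3 [n4 n5 n6]; rewrite /tsum !big_cons !big_nil /=.
rewrite !vt1 !vt2 !vt3 ?v0 // !Wt !Wdiag ?(Wsym xb xa) ?(Wsym xc xa) ?(Wsym xc xb).
rewrite ?(Wsym xa pA) ?(Wsym xb pA) ?(Wsym xc pA) ?(Wsym xa pB) ?(Wsym xb pB) ?(Wsym xc pB).
rewrite ?(Wsym xa pC) ?(Wsym xb pC) ?(Wsym xc pC) ?(Wsym pB pA) ?(Wsym pC pA) ?(Wsym pC pB).
rewrite ?Wt ?(Wsym _ t) ?Wt; ring.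
Qed.

Lemma tsum_new (a0 a1 a2 a3 b0 b1 b2 b3 c0 c1 c2 c3 : K) :
   tsum pC xb pA t pA xc pB t pB xa pC t
    a0 a1 a2 a3 b0 b1 b2 b3 c0 c1 c2 c3 =
  a1 * b3 * c1 * W xa xb + a3 * b1 * c1 * W xa xc + a1 * b1 * c3 * W xb xc
  + (a2 * b3 * c1 + a3 * b0 * c1) * W pA xa + a1 * b0 * c3 * W pA xb
  + a2 * b1 * c3 * W pA xc + (a2 * b2 * c3 + a2 * b3 * c0 + a3 * b0 * c0) * W pA pB
  + (a2 * b3 * c2 + a0 * b0 * c3 + a3 * b0 * c2) * W pA pC
  + a3 * b2 * c1 * W pB xa + (a1 * b2 * c3 + a1 * b3 * c0) * W pB xb
  + a3 * b1 * c0 * W pB xc + (a0 * b2 * c3 + a0 * b3 * c0 + a3 * b2 * c2) * W pB pC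
  + a0 * b3 * c1 * W pC xa + a1 * b3 * c2 * W pC xb
  + (a0 * b1 * c3 + a3 * b1 * c2) * W pC xc.
Proof.
case: tN => n1 n2 n3 [n4 n5 n6]; rewrite /tsum !big_cons !big_nil /=.
rewrite !vt1 !vt2 !vt3 ?v0 // !Wt !Wdiag ?(Wsym xb xa) ?(Wsym xc xa) ?(Wsym xc xb).
rewrite ?(Wsym xa pA) ?(Wsym xb pA) ?(Wsym xc pA) ?(Wsym xa pB) ?(Wsym xb pB) ?(Wsym xc pB).
rewrite ?(Wsym xa pC) ?(Wsym xb pC) ?(Wsym xc pC) ?(Wsym pB pA) ?(Wsym pC pA) ?(Wsym pC pB).
rewrite ?Wt ?(Wsym _ t) ?Wt; ring.
Qed.

Ltac nz := match goal with
  | h : is_true (?Q != 0) |- is_true (?P != 0) => by rewrite (_ : P = Q) //; ring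
  end.
Ltac side := field; rewrite ?mulf_neq0 //; do ?[apply/andP; split]; try done; nz.

Section Weights.
Variables (a0 a1 a2 a3 b0 b1 b2 b3 c0 c1 c2 c3 : K).
Hypotheses (a00 : a0 != 0) (b00 : b0 != 0) (c00 : c0 != 0).
Hypotheses (a30 : a3 != 0) (b30 : b3 != 0) (c30 : c3 != 0).
Let y0 := a0 * b1 / (a3 * b0).
Let y1 := b0 * c1 / (b3 * c0).
Let y2 := c0 * a1 / (c3 * a0).
Variables G0 G1 G2 Th u0 u1 u2 : K.
Hypotheses (u0E : u0 = 1 + y2 + y2 * y1) (u1E : u1 = 1 + y0 + y0 * y2)
  (u2E : u2 = 1 + y1 + y1 * y0).
Hypotheses (u00 : u0 != 0) (u10 : u1 != 0) (u20 : u2 != 0).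

(** Both sides are linear in the fifteen values of [W] at pairs of outer regions, and the
    coefficients are compared one by one. [G0], [G1], [G2] rescale the weights at one crossing; [Th]
    multiplies the corners of the new triangle, of which every surviving term uses exactly one. All
    four therefore come out as common factors. *)
Lemma triangle_identity : tsum pC xb pA t pA xc pB t pB xa pC t
    (G0 * (c2 * a3 * b0 / u0)) (G0 * (c3 * a3 * b0))
    (G0 * (a2 * c0 * b1 / u1)) (G0 * (Th * (a3 * b0 * c0 * u2)))
    (G1 * (a2 * b3 * c0 / u1)) (G1 * (a3 * b3 * c0))
    (G1 * (b2 * a0 * c1 / u2)) (G1 * (Th * (b3 * c0 * a0 * u0)))
    (G2 * (b2 * c3 * a0 / u2)) (G2 * (b3 * c3 * a0))
    (G2 * (c2 * b0 * a1 / u0)) (G2 * (Th * (c3 * a0 * b0 * u1)))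
  = G0 * G1 * G2 * Th * (a0 * a3 * b0 * b3 * c0 * c3) *
    tsum t xb pA xc t xc pB xa t xa pC xb a0 a1 a2 a3 b0 b1 b2 b3 c0 c1 c2 c3.
Proof.
have v0E : u0 * (c3 * a0 * b3) = c3 * a0 * b3 + c0 * a1 * b3 + a1 * b0 * c1.
  by rewrite u0E /y2 /y1; field; rewrite ?a00 ?b00 ?c00 ?a30 ?b30 ?c30.
have v1E : u1 * (a3 * b0 * c3) = a3 * b0 * c3 + a0 * b1 * c3 + b1 * c0 * a1.
  by rewrite u1E /y0 /y2; field; rewrite ?a00 ?b00 ?c00 ?a30 ?b30 ?c30.
have v2E : u2 * (b3 * c0 * a3) = b3 * c0 * a3 + b0 * c1 * a3 + c1 * a0 * b1.
  by rewrite u2E /y1 /y0; field; rewrite ?a00 ?b00 ?c00 ?a30 ?b30 ?c30.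
have w0 : c3 * a0 * b3 + c0 * a1 * b3 + a1 * b0 * c1 != 0.
  by rewrite -v0E !mulf_neq0.
have w1 : a3 * b0 * c3 + a0 * b1 * c3 + b1 * c0 * a1 != 0.
  by rewrite -v1E !mulf_neq0.
have w2 : b3 * c0 * a3 + b0 * c1 * a3 + c1 * a0 * b1 != 0.
  by rewrite -v2E !mulf_neq0.
have x0E : u0 = (c3 * a0 * b3 + c0 * a1 * b3 + a1 * b0 * c1) / (c3 * a0 * b3).
  by rewrite -v0E mulfK // !mulf_neq0.
have x1E : u1 = (a3 * b0 * c3 + a0 * b1 * c3 + b1 * c0 * a1) / (a3 * b0 * c3).
  by rewrite -v1E mulfK // !mulf_neq0.
have x2E : u2 = (b3 * c0 * a3 + b0 * c1 * a3 + c1 * a0 * b1) / (b3 * c0 * a3).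
  by rewrite -v2E mulfK // !mulf_neq0.
rewrite tsum_new tsum_old; clear v0E v1E v2E.
have -> : (G0 * (c3 * a3 * b0)) * (G1 * (Th * (b3 * c0 * a0 * u0))) * (G2 * (b3 * c3 * a0)) =
  G0 * G1 * G2 * Th * (a0 * a3 * b0 * b3 * c0 * c3) * ((a1 * b3 * c0 + a1 * b0 * c1 + a0 * b3 * c3)).
  by rewrite ?x0E ?x1E ?x2E; side.
have -> : (G0 * (Th * (a3 * b0 * c0 * u2))) * (G1 * (a3 * b3 * c0)) * (G2 * (b3 * c3 * a0)) =
  G0 * G1 * G2 * Th * (a0 * a3 * b0 * b3 * c0 * c3) * ((a3 * b3 * c0 + a3 * b0 * c1 + a0 * b1 * c1)).
  by rewrite ?x0E ?x1E ?x2E; side.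
have -> : (G0 * (c3 * a3 * b0)) * (G1 * (a3 * b3 * c0)) * (G2 * (Th * (c3 * a0 * b0 * u1))) =
  G0 * G1 * G2 * Th * (a0 * a3 * b0 * b3 * c0 * c3) * ((a1 * b1 * c0 + a3 * b0 * c3 + a0 * b1 * c3)).
  by rewrite ?x0E ?x1E ?x2E; side.
have -> : ((G0 * (a2 * c0 * b1 / u1)) * (G1 * (Th * (b3 * c0 * a0 * u0))) * (G2 * (b3 * c3 * a0)) + (G0 * (Th * (a3 * b0 * c0 * u2))) * (G1 * (a2 * b3 * c0 / u1)) * (G2 * (b3 * c3 * a0))) =
  G0 * G1 * G2 * Th * (a0 * a3 * b0 * b3 * c0 * c3) * ((a2 * b3 * c0 + a2 * b0 * c1)).
  by rewrite ?x0E ?x1E ?x2E; side.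
have -> : (G0 * (c3 * a3 * b0)) * (G1 * (a2 * b3 * c0 / u1)) * (G2 * (Th * (c3 * a0 * b0 * u1))) =
  G0 * G1 * G2 * Th * (a0 * a3 * b0 * b3 * c0 * c3) * (a2 * b0 * c3).
  by rewrite ?x0E ?x1E ?x2E; side.
have -> : (G0 * (a2 * c0 * b1 / u1)) * (G1 * (a3 * b3 * c0)) * (G2 * (Th * (c3 * a0 * b0 * u1))) =
  G0 * G1 * G2 * Th * (a0 * a3 * b0 * b3 * c0 * c3) * (a2 * b1 * c0).
  by rewrite ?x0E ?x1E ?x2E; side.
have -> : ((G0 * (a2 * c0 * b1 / u1)) * (G1 * (b2 * a0 * c1 / u2)) * (G2 * (Th * (c3 * a0 * b0 * u1))) + (G0 * (a2 * c0 * b1 / u1)) * (G1 * (Th * (b3 * c0 * a0 * u0))) * (G2 * (b2 * c3 * a0 / u2)) + (G0 * (Th * (a3 * b0 * c0 * u2))) * (G1 * (a2 * b3 * c0 / u1)) * (G2 * (b2 * c3 * a0 / u2))) =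
  G0 * G1 * G2 * Th * (a0 * a3 * b0 * b3 * c0 * c3) * (a2 * b2 * c0).
  by rewrite ?x0E ?x1E ?x2E; side.
have -> : ((G0 * (a2 * c0 * b1 / u1)) * (G1 * (Th * (b3 * c0 * a0 * u0))) * (G2 * (c2 * b0 * a1 / u0)) + (G0 * (c2 * a3 * b0 / u0)) * (G1 * (a2 * b3 * c0 / u1)) * (G2 * (Th * (c3 * a0 * b0 * u1))) + (G0 * (Th * (a3 * b0 * c0 * u2))) * (G1 * (a2 * b3 * c0 / u1)) * (G2 * (c2 * b0 * a1 / u0))) =
  G0 * G1 * G2 * Th * (a0 * a3 * b0 * b3 * c0 * c3) * (a2 * b0 * c2).
  by rewrite ?x0E ?x1E ?x2E; side.
have -> : (G0 * (Th * (a3 * b0 * c0 * u2))) * (G1 * (b2 * a0 * c1 / u2)) * (G2 * (b3 * c3 * a0)) =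
  G0 * G1 * G2 * Th * (a0 * a3 * b0 * b3 * c0 * c3) * (a0 * b2 * c1).
  by rewrite ?x0E ?x1E ?x2E; side.
have -> : ((G0 * (c3 * a3 * b0)) * (G1 * (b2 * a0 * c1 / u2)) * (G2 * (Th * (c3 * a0 * b0 * u1))) + (G0 * (c3 * a3 * b0)) * (G1 * (Th * (b3 * c0 * a0 * u0))) * (G2 * (b2 * c3 * a0 / u2))) =
  G0 * G1 * G2 * Th * (a0 * a3 * b0 * b3 * c0 * c3) * ((a1 * b2 * c0 + a0 * b2 * c3)).
  by rewrite ?x0E ?x1E ?x2E; side.
have -> : (G0 * (Th * (a3 * b0 * c0 * u2))) * (G1 * (a3 * b3 * c0)) * (G2 * (b2 * c3 * a0 / u2)) =
  G0 * G1 * G2 * Th * (a0 * a3 * b0 * b3 * c0 * c3) * (a3 * b2 * c0).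
  by rewrite ?x0E ?x1E ?x2E; side.
have -> : ((G0 * (c2 * a3 * b0 / u0)) * (G1 * (b2 * a0 * c1 / u2)) * (G2 * (Th * (c3 * a0 * b0 * u1))) + (G0 * (c2 * a3 * b0 / u0)) * (G1 * (Th * (b3 * c0 * a0 * u0))) * (G2 * (b2 * c3 * a0 / u2)) + (G0 * (Th * (a3 * b0 * c0 * u2))) * (G1 * (b2 * a0 * c1 / u2)) * (G2 * (c2 * b0 * a1 / u0))) =
  G0 * G1 * G2 * Th * (a0 * a3 * b0 * b3 * c0 * c3) * (a0 * b2 * c2).
  by rewrite ?x0E ?x1E ?x2E; side.
have -> : (G0 * (c2 * a3 * b0 / u0)) * (G1 * (Th * (b3 * c0 * a0 * u0))) * (G2 * (b3 * c3 * a0)) =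
  G0 * G1 * G2 * Th * (a0 * a3 * b0 * b3 * c0 * c3) * (a0 * b3 * c2).
  by rewrite ?x0E ?x1E ?x2E; side.
have -> : (G0 * (c3 * a3 * b0)) * (G1 * (Th * (b3 * c0 * a0 * u0))) * (G2 * (c2 * b0 * a1 / u0)) =
  G0 * G1 * G2 * Th * (a0 * a3 * b0 * b3 * c0 * c3) * (a1 * b0 * c2).
  by rewrite ?x0E ?x1E ?x2E; side.
have -> : ((G0 * (c2 * a3 * b0 / u0)) * (G1 * (a3 * b3 * c0)) * (G2 * (Th * (c3 * a0 * b0 * u1))) + (G0 * (Th * (a3 * b0 * c0 * u2))) * (G1 * (a3 * b3 * c0)) * (G2 * (c2 * b0 * a1 / u0))) =
  G0 * G1 * G2 * Th * (a0 * a3 * b0 * b3 * c0 * c3) * ((a3 * b0 * c2 + a0 * b1 * c2)).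
  by rewrite ?x0E ?x1E ?x2E; side.
by set C := _ * (a0 * a3 * b0 * b3 * c0 * c3); ring.
Qed.

End Weights.
End TriangleIdentity.

(** * Framed quivers *)

Section InOut.
Variables (I : finType) (lb : pred I).
Implicit Types (B : I -> I -> int) (In Out : I -> int).

(* The row [k] of [B], restricted to the vertices [lb], split into its positive
   and its negative part. *)
Definition inout B k In Out := forall j, lb j ->
  [/\ B k j = Out j - In j, 0 <= In j, 0 <= Out j & In j = 0 \/ Out j = 0].

Lemma inout_posz B k In Out j : inout B k In Out -> lb j ->
  posz_part (B k j) = Out j /\ posz_part (- B k j) = In j.
Proof.
by move=> io /io[-> h1 h2 [h|h]]; rewrite /posz_part h; split; lia.
Qed.

Lemma inout_mat B k In Out u v : antisym B -> inout B k In Out -> lb u -> lb v ->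
  u != k -> v != k -> mutate_mat k B u v = B u v + In u * Out v - Out u * In v.
Proof.
move=> asym io lu lv /negbTE uk /negbTE vk; rewrite /mutate_mat uk vk /= (asym u k) opprK.
by have [-> ->] := inout_posz io lu; have [-> ->] := inout_posz io lv.
Qed.

Lemma mutate_matk B k v : mutate_mat k B k v = - B k v.
Proof. by rewrite /mutate_mat eqxx. Qed.

Lemma mutate_mat_col B k u : mutate_mat k B u k = - B u k.
Proof. by rewrite /mutate_mat eqxx orbT. Qed.

Definition frozen_out B k (a : I) : int := if lb a then 0 else posz_part (B k a).

Lemma inout_outp (K : fieldType) (X : I -> K) B k In Out : nonzero X ->
  inout B k In Out ->
  outp X B k = mon X (frozen_out B k) * \prod_(j | lb j) X j ^ Out j.
Proof.
move=> X0 io; rewrite /outp /mon [X in _ = _ * X]big_mkcond -big_split /=; apply: eq_bigr => a _.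
rewrite /frozen_out; case: ifP => la; rewrite ?mulr1 // expr0z mul1r.
by have [-> _] := inout_posz io la.
Qed.

Lemma inout_yh (K : fieldType) (s : seed I K) k In Out j : nonzero (cvar s) ->
    antisym (exmat s) -> 1 + yh (cvar s) (exmat s) k != 0 ->
    inout (exmat s) k In Out -> lb j -> j != k ->
  yh (cvar (mutate k s)) (exmat (mutate k s)) j =
  yh (cvar s) (exmat s) j * yh (cvar s) (exmat s) k ^ Out j
   * (1 + yh (cvar s) (exmat s) k) ^ (In j - Out j).
Proof.
move=> X0 asym y0 io lj jk; rewrite yh_mutate // (negbTE jk).
by have [-> _] := inout_posz io lj; have [-> _ _ _] := io _ lj; rewrite opprB.
Qed.

Lemma prod_one (K : fieldType) (X : I -> K) a : lb a ->
  \prod_(j | lb j) X j ^ (j == a)%:Z = X a.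
Proof.
move=> la; rewrite (bigD1 a) //= eqxx expr1z big1 ?mulr1 // => j /andP[_ /negbTE ->].
by rewrite expr0z.
Qed.

Lemma prod_two (K : fieldType) (X : I -> K) a b : nonzero X -> lb a -> lb b ->
  \prod_(j | lb j) X j ^ ((j == a)%:Z + (j == b)%:Z) = X a * X b.
Proof.
move=> X0 la lb'; under eq_bigr => j _ do rewrite expfzDr //.
by rewrite big_split /= !prod_one.
Qed.

End InOut.

Section Involution.
Variables (I : finType) (K : fieldType).

Lemma mutate_matK (B : I -> I -> int) k : mutate_mat k (mutate_mat k B) = B.
Proof.
apply: functional_extensionality => a; apply: functional_extensionality => b.
rewrite {1}/mutate_mat mutate_mat_col mutate_matk /mutate_mat.
case: (a == k) (b == k) => [] [] /=; rewrite ?opprK //; ring.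
Qed.

Lemma mutateK (s : seed I K) k : nonzero (cvar s) -> antisym (exmat s) ->
  nonzero (cvar (mutate k s)) -> mutate k (mutate k s) = s.
Proof.
move=> X0 asym X0'; case: s X0 asym X0' => X B /= X0 asym X0'.
congr Seed; last exact: mutate_matK.
apply: functional_extensionality => a /=; case: eqP => // ->; rewrite eqxx.
have Xk := X0 k; have := X0' k; rewrite /= eqxx; set P := \prod_b _; set Q := \prod_b _.
move=> nz; have PQ : P + Q != 0 by apply: contraNneq nz => ->; rewrite mul0r.
have E (F G : I -> int) : F k = 0 -> F =1 G ->
  \prod_b (if b == k then (P + Q) / X k else X b) ^ F b = \prod_b X b ^ G b.
  move=> Fk FG; apply: eq_bigr => b _; rewrite -FG.
  by case: eqP => // ->; rewrite Fk !expr0z.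
rewrite (E _ (fun b => posz_part (B k b))); first last.
- by move=> b; rewrite mutate_mat_col (asym b k) opprK.
- by rewrite mutate_mat_col (antisym0 k asym) oppr0.
rewrite (E _ (fun b => posz_part (B b k))); first last.
- by move=> b; rewrite mutate_matk (asym k b) opprK.
- by rewrite mutate_matk (antisym0 k asym) oppr0.
rewrite -/P -/Q addrC; field; by rewrite Xk PQ.
Qed.

(** Mutation is an involution that preserves the cone, so every point of the cone is the cluster of
    a mutated seed. Facts about mutated values are thereby facts about all values. *)
Lemma unmutate (pos : K -> Prop) ks (B : I -> I -> int) X' : positive_cone pos ->
  antisym B -> all_pos pos X' -> exists2 X, all_pos pos X &
    mutations (Seed X B) ks = Seed X' (foldl (fun B k => mutate_mat k B) B ks).
Proof.
move=> cone; elim: ks B => [|k ks IH] B asym Xp; first by exists X'.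
have asym' := mutate_antisym k asym; have [X1 X1p e1] := IH _ asym' Xp.
pose s := mutate k (Seed X1 (mutate_mat k B)).
have sp : all_pos pos (cvar s) by apply: (mutate_pos cone).
exists (cvar s) => //=.
have -> : Seed (cvar s) B = s by rewrite /s /mutate /= mutate_matK.
by rewrite mutateK //; apply: (all_pos_nonzero cone).
Qed.

End Involution.

Section Framing.
Variables (D J : finType) (rot opp : D -> D) (reg : D -> J) (i0 : D).

Definition kept : seq J :=
  enum ([set reg d | d : D] :\ reg i0 :\ reg (opp i0)).

Section Labels.
Variables (I : finType) (lab : D -> I).

Section Weights.
Variables (K : fieldType) (X : I -> K).

Definition omega (nu : D -> I -> int) d : K :=
  mon X (nu d) / (X (lab d) * X (lab (rot d))).

(** [d] and [rot (rot (rot d))] are the corners on the two sides of the dart [d]: the factor is the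
    change of weight at one end of a segment under a flip across it. *)
Definition mfac (om : D -> K) d : K := om d / om (rot (rot (rot d))).

Definition segprod : K := \prod_(a | (a \in codom lab) && (a != lab i0)) X a.

End Weights.

(* The quiver [B] has a vertex [lab d] for each segment of the diagram, with the
   arrows of the crossing-incidence quiver; the other vertices are frozen and
   enter through the exponents [nu] of the corner weights. *)
Record framed (B : I -> I -> int) (nu : D -> I -> int) : Prop := Framed {
  lab_eq : forall d e, (lab d == lab e) = (e == d) || (e == opp d);
  framed_asym : antisym B;
  framed_seg : forall d e, B (lab e) (lab d) =
    (lab e == lab (rot (rot (rot d))))%:Z + (lab e == lab (rot (rot (rot (opp d)))))%:Z
    - (lab e == lab (rot d))%:Z - (lab e == lab (rot (opp d)))%:Z;
  framed_nu : forall d e, nu d (lab e) = 0;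
  framed_y : forall (K : fieldType) (pos : K -> Prop) (X : I -> K), positive_cone pos ->
    all_pos pos X -> forall d, d != i0 -> d != opp i0 ->
    yh X B (lab d) = mfac (omega X nu) d * mfac (omega X nu) (opp d)
}.

End Labels.

(* The mutation sequence does not depend on the framing, so that it serves both
   the quiver and its principal framing. *)
Definition computed : Prop := exists (mus : seq D) (k : D),
  forall (I : finType) (lab : D -> I) B nu, framed lab B nu ->
  exists2 gam : I -> int, forall d, gam (lab d) = 0 &
  forall cs, crossings rot cs ->
  forall (K : fieldType) (pos : K -> Prop) (X : I -> K), positive_cone pos ->
    all_pos pos X ->
    cvar (mutations (Seed X B) (map lab mus)) (lab k) =
      mon X gam * segprod lab X * ssum rot reg kept (omega lab X nu) cs [::].

End Framing.

(** * The triangle move as four mutations *)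

(* The sequence of mutations [a], [b], [c], [a] at the three sides of a
   triangle; [Ab], ..., [Cb] are the six other segments at its vertices. *)
Record triangle_quiver (I : finType) (lb : pred I) (B : I -> I -> int)
    (a b c Ab Ac Bc Ba Ca Cb : I) : Prop := TriangleQuiver {
  tq_asym : antisym B;
  tq_lb : [/\ lb a, lb b & lb c] /\
    [/\ [/\ lb Ab, lb Ac & lb Bc], lb Ba, lb Ca & lb Cb];
  tq_inner : [/\ a != b, b != c & c != a];
  tq_a : [/\ [/\ a != Ab, a != Ac & a != Bc], a != Ba, a != Ca & a != Cb];
  tq_b : [/\ [/\ b != Ab, b != Ac & b != Bc], b != Ba, b != Ca & b != Cb];
  tq_c : [/\ [/\ c != Ab, c != Ac & c != Bc], c != Ba, c != Ca & c != Cb];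
  tq_nobigon : [/\ Ba != Ca, Cb != Ab & Ac != Bc];
  tq_nomonogon : [/\ Ab != Ac, Bc != Ba & Ca != Cb];
  tq_rowa : forall j, lb j ->
    B a j = (j == c)%:Z + (j == Ca)%:Z - ((j == b)%:Z + (j == Ba)%:Z);
  tq_rowb : forall j, lb j ->
    B b j = (j == a)%:Z + (j == Ab)%:Z - ((j == c)%:Z + (j == Cb)%:Z);
  tq_rowc : forall j, lb j ->
    B c j = (j == b)%:Z + (j == Bc)%:Z - ((j == a)%:Z + (j == Ac)%:Z)
}.

Section FourMutations.
Variables (I : finType) (lb : pred I) (B : I -> I -> int).
Variables a b c Ab Ac Bc Ba Ca Cb : I.
Hypothesis Q : triangle_quiver lb B a b c Ab Ac Bc Ba Ca Cb.
Local Notation e x j := ((j == x)%:Z).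
Let asym := tq_asym Q.
Let lbT := tq_lb Q.
Let inner := tq_inner Q.
Let aN := tq_a Q.
Let bN := tq_b Q.
Let cN := tq_c Q.
Let nobigon := tq_nobigon Q.
Let nomonogon := tq_nomonogon Q.
Let rowa := tq_rowa Q.
Let rowb := tq_rowb Q.
Let rowc := tq_rowc Q.

Let N (x y : I) : x != y -> ((x == y) = false) * ((y == x) = false).
Proof. by move=> /negbTE h; rewrite (eq_sym y) h. Qed.

Let ine : ((a == b) = false) * ((b == a) = false) * ((b == c) = false) *
  ((c == b) = false) * ((c == a) = false) * ((a == c) = false).
Proof. by case: inner => h1 h2 h3; rewrite !(N h1) !(N h2) !(N h3). Qed.

Let ina : ((a == Ab) = false) * ((a == Ac) = false) * ((a == Bc) = false) *
  ((a == Ba) = false) * ((a == Ca) = false) * ((a == Cb) = false).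
Proof. by case: aN => -[h1 h2 h3] h4 h5 h6; do !split; apply: negbTE. Qed.
Let inb : ((b == Ab) = false) * ((b == Ac) = false) * ((b == Bc) = false) *
  ((b == Ba) = false) * ((b == Ca) = false) * ((b == Cb) = false).
Proof. by case: bN => -[h1 h2 h3] h4 h5 h6; do !split; apply: negbTE. Qed.
Let inc : ((c == Ab) = false) * ((c == Ac) = false) * ((c == Bc) = false) *
  ((c == Ba) = false) * ((c == Ca) = false) * ((c == Cb) = false).
Proof. by case: cN => -[h1 h2 h3] h4 h5 h6; do !split; apply: negbTE. Qed.
Let la : lb a. Proof. by case: lbT => -[]. Qed.
Let lbb : lb b. Proof. by case: lbT => -[]. Qed.
Let lc : lb c. Proof. by case: lbT => -[]. Qed.
Let lo : [/\ lb Ab, lb Ca, lb Bc & lb Ac]. Proof. by case: lbT => _ [[]]. Qed.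

Lemma inout_two B' k i1 i2 o1 o2 :
  (forall j, lb j -> B' k j = e o1 j + e o2 j - (e i1 j + e i2 j)) ->
  [&& i1 != o1, i1 != o2, i2 != o1 & i2 != o2] ->
  inout lb B' k (fun j => e i1 j + e i2 j) (fun j => e o1 j + e o2 j).
Proof.
move=> h /and4P[h1 h2 h3 h4] j lj; rewrite h //; split=> //; try by case: (_ == _); case: (_ == _).
have [->|_] := eqVneq j i1; first by right; rewrite (negbTE h1) (negbTE h2).
have [->|_] := eqVneq j i2; first by right; rewrite (negbTE h3) (negbTE h4).
by left.
Qed.

Definition mB1 := mutate_mat a B.
Definition mB2 := mutate_mat b mB1.
Definition mB3 := mutate_mat c mB2.
Definition mB4 := mutate_mat a mB3.

Let as1 : antisym mB1. Proof. exact: mutate_antisym. Qed.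
Let as2 : antisym mB2. Proof. exact: mutate_antisym. Qed.
Let as3 : antisym mB3. Proof. exact: mutate_antisym. Qed.

Let io1 : inout lb B a (fun j => e b j + e Ba j) (fun j => e c j + e Ca j).
Proof.
apply: inout_two rowa _; case: nobigon => h _ _.
by rewrite !ine !inb h eq_sym inc.
Qed.

Ltac lin := rewrite ?eqxx ?ine ?ina ?inb ?inc /=; ring.

Lemma row1b j : lb j -> mB1 b j = e Ab j + e Ca j - (e Cb j + e a j).
Proof.
move=> lj; have [->|ja] := eqVneq j a.
  by rewrite /mB1 mutate_mat_col rowb //; lin.
by rewrite /mB1 (inout_mat asym io1) ?ine // rowb // ?(negbTE ja); lin.
Qed.

Lemma row1c j : lb j -> mB1 c j = e Bc j + e a j - (e Ac j + e Ba j).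
Proof.
move=> lj; have [->|ja] := eqVneq j a.
  by rewrite /mB1 mutate_mat_col rowc //; lin.
by rewrite /mB1 (inout_mat asym io1) ?ine // rowc // ?(negbTE ja); lin.
Qed.

Lemma row1a j : lb j -> mB1 a j = e b j + e Ba j - (e c j + e Ca j).
Proof. by move=> lj; rewrite /mB1 mutate_matk rowa //; ring. Qed.

Let io2 : inout lb mB1 b (fun j => e Cb j + e a j) (fun j => e Ab j + e Ca j).
Proof.
apply: inout_two row1b _; case: nobigon nomonogon => _ h _ [_ _ h'].
by rewrite h eq_sym h' !ina.
Qed.

Lemma row2a j : lb j -> mB2 a j = e Ba j + e Ab j - (e c j + e b j).
Proof.
move=> lj; have [->|jb] := eqVneq j b.
  by rewrite /mB2 mutate_mat_col row1a //; lin.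
by rewrite /mB2 (inout_mat as1 io2) ?ine // row1a // ?(negbTE jb); lin.
Qed.

Lemma row2b j : lb j -> mB2 b j = e Cb j + e a j - (e Ab j + e Ca j).
Proof. by move=> lj; rewrite /mB2 mutate_matk row1b //; ring. Qed.

Lemma row2c j : lb j -> mB2 c j = e Bc j + e a j - (e Ac j + e Ba j).
Proof.
move=> lj; have [->|jb] := eqVneq j b.
  by rewrite /mB2 mutate_mat_col row1c //; lin.
by rewrite /mB2 (inout_mat as1 io2) ?ine // row1c //; lin.
Qed.

Let io3 : inout lb mB2 c (fun j => e Ac j + e Ba j) (fun j => e Bc j + e a j).
Proof.
apply: inout_two row2c _; case: nobigon nomonogon => _ _ h [_ h' _].
by rewrite h (eq_sym Ba) h' !(eq_sym _ a) !ina.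
Qed.

Lemma row3a j : lb j -> mB3 a j = e Ab j + e c j - (e b j + e Ac j).
Proof.
move=> lj; have [->|jc] := eqVneq j c.
  by rewrite /mB3 mutate_mat_col row2a //; lin.
by rewrite /mB3 (inout_mat as2 io3) ?ine // row2a // ?(negbTE jc); lin.
Qed.

Lemma row3b j : lb j -> mB3 b j = e Cb j + e a j - (e Ab j + e Ca j).
Proof.
move=> lj; have [->|jc] := eqVneq j c.
  by rewrite /mB3 mutate_mat_col row2b //; lin.
by rewrite /mB3 (inout_mat as2 io3) ?ine // row2b //; lin.
Qed.

Lemma row3c j : lb j -> mB3 c j = e Ac j + e Ba j - (e Bc j + e a j).
Proof. by move=> lj; rewrite /mB3 mutate_matk row2c //; ring. Qed.

Let io4 : inout lb mB3 a (fun j => e b j + e Ac j) (fun j => e Ab j + e c j).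
Proof.
apply: inout_two row3a _; case: nomonogon => h _ _.
by rewrite !ine !inb (eq_sym Ac) h eq_sym inc.
Qed.

Lemma row4a j : lb j -> mB4 a j = e b j + e Ac j - (e Ab j + e c j).
Proof. by move=> lj; rewrite /mB4 mutate_matk row3a //; ring. Qed.

Lemma row4b j : lb j -> mB4 b j = e Cb j + e c j - (e Ca j + e a j).
Proof.
move=> lj; have [->|ja] := eqVneq j a.
  by rewrite /mB4 mutate_mat_col row3b //; lin.
by rewrite /mB4 (inout_mat as3 io4) ?ine // row3b // ?(negbTE ja); lin.
Qed.

Lemma row4c j : lb j -> mB4 c j = e Ba j + e a j - (e Bc j + e b j).
Proof.
move=> lj; have [->|ja] := eqVneq j a.
  by rewrite /mB4 mutate_mat_col row3c //; lin.
by rewrite /mB4 (inout_mat as3 io4) ?ine // row3c // ?(negbTE ja); lin.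
Qed.

Lemma mB4_outer u v : lb u -> lb v -> u != a -> u != b -> u != c ->
  v != a -> v != b -> v != c ->
  mB4 u v = B u v + (e Ba u * e Ca v - e Ca u * e Ba v)
   + (e Cb u * (e Ab v + e Ca v) - (e Ab u + e Ca u) * e Cb v)
   + ((e Ac u + e Ba u) * e Bc v - e Bc u * (e Ac v + e Ba v))
   + (e Ac u * e Ab v - e Ab u * e Ac v).
Proof.
move=> lu lv ua ub uc va vb vc.
rewrite /mB4 (inout_mat as3 io4) // /mB3 (inout_mat as2 io3) // /mB2 (inout_mat as1 io2) //.
rewrite /mB1 (inout_mat asym io1) // (negbTE ua) (negbTE ub) (negbTE uc).
by rewrite (negbTE va) (negbTE vb) (negbTE vc) /=; ring.
Qed.

Definition f1 := frozen_out lb B a.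
Definition f2 := frozen_out lb mB1 b.
Definition f3 := frozen_out lb mB2 c.
Definition f4 := frozen_out lb mB3 a.

Section Values.
Variables (K : fieldType) (pos : K -> Prop) (X : I -> K).
Hypothesis cone : positive_cone pos.
Hypothesis Xp : all_pos pos X.

Definition ms1 := mutate a (Seed X B).
Definition ms2 := mutate b ms1.
Definition ms3 := mutate c ms2.
Definition ms4 := mutate a ms3.

Let p1 : all_pos pos (cvar ms1). Proof. exact: (mutate_pos cone). Qed.
Let p2 : all_pos pos (cvar ms2). Proof. exact: (mutate_pos cone). Qed.
Let p3 : all_pos pos (cvar ms3). Proof. exact: (mutate_pos cone). Qed.
Let X0 : nonzero X. Proof. exact: all_pos_nonzero cone _ Xp. Qed.
Let z1 : nonzero (cvar ms1). Proof. exact: all_pos_nonzero cone _ p1. Qed.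
Let z2 : nonzero (cvar ms2). Proof. exact: all_pos_nonzero cone _ p2. Qed.
Let z3 : nonzero (cvar ms3). Proof. exact: all_pos_nonzero cone _ p3. Qed.

Local Notation ya := (yh X B a).
Local Notation yb := (yh X B b).
Local Notation yc := (yh X B c).
Local Notation T := (1 + ya + ya * yc).
Local Notation U := (1 + yb + yb * ya).
Local Notation V := (1 + yc + yc * yb).

Let pya : pos ya. Proof. exact: (@pos_mon _ _ _ cone X (B^~ a) Xp). Qed.
Let pyb : pos yb. Proof. exact: (@pos_mon _ _ _ cone X (B^~ b) Xp). Qed.
Let pyc : pos yc. Proof. exact: (@pos_mon _ _ _ cone X (B^~ c) Xp). Qed.
Let pos_T x y : pos x -> pos y -> 1 + x + x * y != 0.
Proof.
move=> px py; apply: (pos_neq0 cone); do 2?apply: (posD cone) => //; first exact: (pos1 cone).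
exact: (posM cone).
Qed.
Lemma T_neq0 : T != 0. Proof. exact: pos_T. Qed.
Lemma U_neq0 : U != 0. Proof. exact: pos_T. Qed.
Lemma V_neq0 : V != 0. Proof. exact: pos_T. Qed.
Lemma ya_neq0 : ya != 0. Proof. exact: pos_neq0 cone _ pya. Qed.
Lemma yb_neq0 : yb != 0. Proof. exact: pos_neq0 cone _ pyb. Qed.
Lemma yc_neq0 : yc != 0. Proof. exact: pos_neq0 cone _ pyc. Qed.
Let a1_neq0 : 1 + ya != 0.
Proof. by apply: (pos_neq0 cone); apply: (posD cone) => //; apply: (pos1 cone). Qed.

Lemma mon_frozen (X' : I -> K) v : (forall j, lb j -> v j = 0) ->
  (forall j, ~~ lb j -> X' j = X j) -> mon X' v = mon X v.
Proof.
move=> v0 XX; apply: eq_bigr => j _; case: (boolP (lb j)) => [lj|nl]; last by rewrite XX.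
by rewrite v0 // !expr0z.
Qed.

Let f_lb B' k j : lb j -> frozen_out lb B' k j = 0.
Proof. by rewrite /frozen_out => ->. Qed.

Let nlb j x : lb x -> ~~ lb j -> j != x. Proof. by move=> lx; apply: contraNneq => ->. Qed.

Let yh1 j : lb j -> j != a -> yh (cvar ms1) mB1 j =
  yh X B j * ya ^ (e c j + e Ca j) * (1 + ya) ^ (e b j + e Ba j - (e c j + e Ca j)).
Proof. by move=> lj ja; apply: (@inout_yh _ _ _ (Seed X B) _ _ _ _ X0 asym a1_neq0 io1 lj ja). Qed.

Let yh1a : yh (cvar ms1) mB1 a = ya^-1.
Proof. by have := @yh_mutate _ _ (Seed X B) a a X0 asym a1_neq0; rewrite eqxx. Qed.

Let yh1b : yh (cvar ms1) mB1 b = yb * (1 + ya).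
Proof. by rewrite yh1 ?ine // ?inb ?eqxx /= !expr0z !expr1z mulr1. Qed.

Let yh1c : yh (cvar ms1) mB1 c = yc * ya / (1 + ya).
Proof. by rewrite yh1 ?ine // ?inc ?eqxx /= !expr1z. Qed.

Let u2 : 1 + yh (cvar ms1) mB1 b = U. Proof. by rewrite yh1b; ring. Qed.
Let u2_neq0 : 1 + yh (cvar ms1) mB1 b != 0. Proof. by rewrite u2 U_neq0. Qed.

Let yh2 j : lb j -> j != b -> yh (cvar ms2) mB2 j =
  yh (cvar ms1) mB1 j * (yb * (1 + ya)) ^ (e Ab j + e Ca j)
   * U ^ (e Cb j + e a j - (e Ab j + e Ca j)).
Proof.
move=> lj jb; rewrite -yh1b -u2.
exact: (@inout_yh _ _ _ ms1 _ _ _ _ z1 as1 u2_neq0 io2 lj jb).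
Qed.

Let yh2a : yh (cvar ms2) mB2 a = U / ya.
Proof.
by rewrite yh2 ?ine // yh1a ?ina ?eqxx /= !expr0z !expr1z mulr1 mulrC.
Qed.

Let yh2b : yh (cvar ms2) mB2 b = (yb * (1 + ya))^-1.
Proof. by have := @yh_mutate _ _ ms1 b b z1 as1 u2_neq0; rewrite eqxx yh1b. Qed.

Let yh2c : yh (cvar ms2) mB2 c = yc * ya / (1 + ya).
Proof. by rewrite yh2 ?ine // ?inc /= !expr0z !mulr1 yh1c. Qed.

Let u3 : 1 + yh (cvar ms2) mB2 c = T / (1 + ya).
Proof. by rewrite yh2c; field. Qed.
Let u3_neq0 : 1 + yh (cvar ms2) mB2 c != 0.
Proof. by rewrite u3 mulf_neq0 ?invr_eq0 ?T_neq0. Qed.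

Let yh3 j : lb j -> j != c -> yh (cvar ms3) mB3 j =
  yh (cvar ms2) mB2 j * (yc * ya / (1 + ya)) ^ (e Bc j + e a j)
   * (T / (1 + ya)) ^ (e Ac j + e Ba j - (e Bc j + e a j)).
Proof.
move=> lj jc; rewrite -yh2c -u3.
exact: (@inout_yh _ _ _ ms2 _ _ _ _ z2 as2 u3_neq0 io3 lj jc).
Qed.

Let yh3a : yh (cvar ms3) mB3 a = U * yc / T.
Proof.
rewrite yh3 ?ine // yh2a ?ina ?eqxx /= !expr1z.
rewrite -[X in _ ^ X]/(-1 : int) exprN1; field.
by rewrite T_neq0 ya_neq0 a1_neq0.
Qed.

Let yh3b : yh (cvar ms3) mB3 b = (yb * (1 + ya))^-1.
Proof. by rewrite yh3 ?ine // ?inb /= !expr0z !mulr1 yh2b. Qed.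

Let yh3c : yh (cvar ms3) mB3 c = (yc * ya / (1 + ya))^-1.
Proof. by have := @yh_mutate _ _ ms2 c c z2 as2 u3_neq0; rewrite eqxx yh2c. Qed.

Let u4 : 1 + yh (cvar ms3) mB3 a = (1 + ya) * V / T.
Proof. by rewrite yh3a; field; rewrite T_neq0. Qed.
Let u4_neq0 : 1 + yh (cvar ms3) mB3 a != 0.
Proof. by rewrite u4 !mulf_neq0 ?invr_eq0 ?T_neq0 ?V_neq0. Qed.

Let yh4 j : lb j -> j != a -> yh (cvar ms4) mB4 j =
  yh (cvar ms3) mB3 j * (U * yc / T) ^ (e Ab j + e c j)
   * ((1 + ya) * V / T) ^ (e b j + e Ac j - (e Ab j + e c j)).
Proof.
move=> lj ja; rewrite -yh3a -u4.
exact: (@inout_yh _ _ _ ms3 _ _ _ _ z3 as3 u4_neq0 io4 lj ja).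
Qed.

Lemma yh4a : yh (cvar ms4) mB4 a = T / (U * yc).
Proof.
have := @yh_mutate _ _ ms3 a a z3 as3 u4_neq0; rewrite eqxx => ->.
by rewrite yh3a invf_div.
Qed.

Lemma yh4b : yh (cvar ms4) mB4 b = V / (T * yb).
Proof.
rewrite yh4 ?ine // yh3b ?inb ?eqxx /= !expr0z !expr1z; field.
by rewrite T_neq0 yb_neq0 a1_neq0.
Qed.

Lemma yh4c : yh (cvar ms4) mB4 c = U / (ya * V).
Proof.
rewrite yh4 ?ine // yh3c ?inc ?eqxx /= !expr1z.
rewrite -[X in _ ^ X]/(-1 : int) exprN1; field.
by rewrite T_neq0 yc_neq0 ya_neq0 V_neq0 a1_neq0.
Qed.

(** The result is invariant under the cyclic permutation of [a], [b], [c], a symmetry that the order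
    of the mutations hides: the intermediate factor [1 + ya] cancels. *)
Lemma yh4_outer j : lb j -> j != a -> j != b -> j != c ->
  yh (cvar ms4) mB4 j = yh X B j * (ya * yb / U) ^ e Ca j * T ^ e Ba j * U ^ e Cb j
    * (yb * yc / V) ^ e Ab j * V ^ e Ac j * (yc * ya / T) ^ e Bc j.
Proof.
move=> lj ja jb jc; rewrite yh4 // yh3 // yh2 // yh1 //.
rewrite (negbTE ja) (negbTE jb) (negbTE jc) ?add0r ?addr0.
have nz := (T_neq0, U_neq0, V_neq0, ya_neq0, yb_neq0, yc_neq0, a1_neq0).
(* Exponents are kept as sums of indicators, more than one of which may be 1, because the six outer
   segments may coincide. *)
have S1 (y u : K) (m n : bool) : u != 0 ->
    y ^ m%:Z * u ^ (n%:Z - m%:Z) = (y / u) ^ m%:Z * u ^ n%:Z.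
  by case: m; case: n => /=; rewrite ?expr0z ?expr1z // => u0; rewrite ?exprN1; field.
have S2 (y u : K) (m m' n : bool) : u != 0 ->
    y ^ (m%:Z + m'%:Z) * u ^ (n%:Z - (m%:Z + m'%:Z)) =
    (y / u) ^ m%:Z * (y / u) ^ m'%:Z * u ^ n%:Z.
  move=> u0; case: m; case: m'; case: n => /=; rewrite ?expr0z ?expr1z //;
    rewrite -?[(1 + 1 : int)]/(2 : int) -?[(1 - 2 : int)]/(-1 : int)
      -?[(0 - 2 : int)]/(-2 : int) ?exprN1 -?exprnN -?exprnP; by field.
have S3 (y u : K) (m n n' : bool) : u != 0 ->
    y ^ m%:Z * u ^ (n%:Z + n'%:Z - m%:Z) = (y / u) ^ m%:Z * u ^ n%:Z * u ^ n'%:Z.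
  move=> u0; case: m; case: n; case: n' => /=; rewrite ?expr0z ?expr1z //;
    rewrite -?[(1 + 1 : int)]/(2 : int) -?[(2 - 0 : int)]/(2 : int)
     ?exprN1 -?exprnN -?exprnP; by field.
have Unz : (1 + ya) * V / T != 0 by rewrite !mulf_neq0 ?invr_eq0 ?nz.
have Tnz : T / (1 + ya) != 0 by rewrite !mulf_neq0 ?invr_eq0 ?nz.
rewrite -[LHS]mulrA S1 // -[X in X * _ = _]mulrA S3 // -[X in X * _ * _ = _]mulrA S2 ?nz //.
rewrite -[X in X * _ * _ * _ = _]mulrA S1 ?nz //.
have -> : ya * yb / U = (ya / (1 + ya)) * (yb * (1 + ya) / U).
  by field; rewrite !nz.
have -> : yb * yc / V = (yb * (1 + ya) / U) * (U * yc / T / ((1 + ya) * V / T)).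
  by field; rewrite !nz.
have -> : yc * ya / T = yc * ya / (1 + ya) / (T / (1 + ya)) by field; rewrite !nz.
have -> : T ^ e Ba j = (1 + ya) ^ e Ba j * (T / (1 + ya)) ^ e Ba j.
  by rewrite -expfzMl; congr (_ ^ _); field.
have -> : V ^ e Ac j = (T / (1 + ya)) ^ e Ac j * ((1 + ya) * V / T) ^ e Ac j.
  by rewrite -expfzMl; congr (_ ^ _); field; rewrite !nz.
rewrite ![(_ * _) ^ e Ca j]expfzMl ![((_ / U) * _) ^ e Ab j]expfzMl.
by do ![move: (_ ^ _) => ?]; ring.
Qed.

Lemma ms4_b : cvar ms4 b = mon X f2 * (X Ab * X Ca) * U / X b.
Proof.
rewrite (@mutate_cvarE _ _ ms3 a b) ?ine // (@mutate_cvarE _ _ ms2 c b) ?ine //.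
rewrite (@mutate_cvar _ _ ms1) // u2; case: lo => l1 l2 l3 l4.
rewrite (inout_outp z1 io2) (prod_two z1) // !mutate_cvarE 1?eq_sym ?ina ?ine //= ?ina //.
rewrite (@mon_frozen (cvar ms1)) // => j; first exact: f_lb.
by move=> nl; rewrite mutate_cvarE // nlb.
Qed.

Lemma ms1_a : cvar ms1 a = mon X f1 * (X c * X Ca) * (1 + ya) / X a.
Proof.
rewrite (@mutate_cvar _ _ (Seed X B)) // (inout_outp X0 io1) (prod_two X0) //.
by case: lo.
Qed.

Lemma ms3_c : cvar ms3 c = mon X f1 * mon X f3 * (X Bc * X Ca) * T / X a.
Proof.
have X20 := z1 a; rewrite (@mutate_cvar _ _ ms2) // u3; case: lo => l1 l2 l3 l4.
rewrite (inout_outp z2 io3) (prod_two z2) //.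
rewrite (@mutate_cvarE _ _ ms1 b a) ?ine // ms1_a.
rewrite !mutate_cvarE 1?eq_sym ?ina ?inb ?ine //.
rewrite (@mon_frozen (cvar ms2)); first last.
- by move=> j nl; rewrite !mutate_cvarE // nlb.
- by move=> j; apply: f_lb.
rewrite /= -/f3; field; by rewrite !X0 a1_neq0.
Qed.

Lemma ms4_c : cvar ms4 c = mon X f1 * mon X f3 * (X Bc * X Ca) * T / X a.
Proof. by rewrite mutate_cvarE ?ine // ms3_c. Qed.

Lemma ms4_a : cvar ms4 a = mon X f3 * mon X f4 * (X Ab * X Bc) * V / X c.
Proof.
rewrite (@mutate_cvar _ _ ms3) // u4; case: lo => l1 l2 l3 l4.
rewrite (inout_outp z3 io4) (prod_two z3) // ms3_c.
rewrite (@mutate_cvarE _ _ ms2 c a) ?ine // (@mutate_cvarE _ _ ms1 b a) ?ine // ms1_a.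
rewrite !mutate_cvarE 1?eq_sym ?ina ?inb ?inc //.
rewrite (@mon_frozen (cvar ms3)); first last.
- by move=> j nl; rewrite !mutate_cvarE // nlb.
- by move=> j; apply: f_lb.
rewrite /= -/f4; field.
by rewrite !X0 T_neq0 a1_neq0 !mon_neq0.
Qed.

Lemma ms4_outer j : j != a -> j != b -> j != c -> cvar ms4 j = X j.
Proof. by move=> ja jb jc; rewrite !mutate_cvarE. Qed.

End Values.
End FourMutations.

Section TriangleStep.
Variables (D J : finType) (rot opp : D -> D) (reg : D -> J) (lev : J -> nat) (i0 : D).
Hypothesis Dg : diagram rot opp reg lev i0.
Hypothesis D4 : (4 < #|D|)%N.
Variable d0 : D.
Hypothesis tri : triangle_at rot opp d0.
Hypothesis tip : top rot opp reg lev d0.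
Hypothesis t_i0 : reg d0 <> reg i0.
Hypothesis t_i1 : reg d0 <> reg (opp i0).
Hypothesis nb : forall e f, reg e = reg d0 -> reg f = reg (opp e) -> ~~ bigon_at rot opp f.

Local Notation r2 d := (rot (rot d)).
Local Notation r3 d := (rot (rot (rot d))).
Local Notation nx := (fnext rot opp).
Local Notation pv := (fprev rot opp).
Local Notation t := (reg d0).
(* Abstract names, lest rewriting look through the definition of [fnext]. *)
Variables d1 d2 : D.
Hypotheses (nx0 : nx d0 = d1) (nx1 : nx d1 = d2).
Let rotK := rot4 Dg.
Let oppK := dopK Dg.
Let nxK := fnextK Dg.
Let pvK := fprevK Dg.
Local Notation tm := (tmove rot opp reg d0).
Local Notation tmV := (tmoveV rot opp reg d0).
Local Notation out := (outer opp reg d0).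

Let rt1 : reg d1 = t. Proof. by rewrite -nx0 (reg_fnext Dg). Qed.
Let rt2 : reg d2 = t. Proof. by rewrite -nx1 (reg_fnext Dg). Qed.
Let nx2 : nx d2 = d0. Proof. by rewrite -nx1 -nx0; apply: (eqP tri). Qed.
Let pv0 : pv d0 = d2. Proof. by rewrite -nx2 nxK. Qed.
Let pv1 : pv d1 = d0. Proof. by rewrite -nx0 nxK. Qed.
Let pv2 : pv d2 = d1. Proof. by rewrite -nx1 nxK. Qed.
Let od0 : opp d0 = rot d1. Proof. by rewrite -nx0 (rot_nx Dg). Qed.
Let od1 : opp d1 = rot d2. Proof. by rewrite -nx1 (rot_nx Dg). Qed.
Let od2 : opp d2 = rot d0. Proof. by rewrite -nx2 (rot_nx Dg). Qed.

Let t_cases x : reg x = t -> [\/ x = d0, x = d1 | x = d2].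
Proof. by rewrite -nx1 -nx0; apply: (triangle_fiber Dg tri). Qed.

Let oppE x y : (opp x == y) = (x == opp y).
Proof. by apply/eqP/eqP => [<-|->]; rewrite oppK. Qed.

Let out_r2 x : reg x = t -> out (r2 x).
Proof.
move=> rx; rewrite /outer (in_t_r2 Dg D4 rx) /= -(reg_r3 Dg) rotK.
by rewrite (in_t_pre Dg rx).
Qed.

Let out_r3 x : reg x = t -> out (r3 x). Proof. by move=> rx; apply: (outer_r3 Dg D4). Qed.

Let tm_t x : reg x = t -> tm x = x.
Proof. by move=> rx; rewrite -{1}(tmoveV_t Dg rx) (tmoveVK Dg D4 d0). Qed.

Let tmV_r2 x : reg x = t -> tmV (r2 x) = r2 x.
Proof.
move=> rx; rewrite (tmoveV_outer rot (out_r2 rx)) (reg_r3 Dg).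
by rewrite (in_t_inn Dg rx).
Qed.

Let tmV_r3 x : reg x = t -> tmV (r3 x) = rot (nx x).
Proof.
move=> rx; rewrite (tmoveV_outer rot (out_r3 rx)) rotK rx eqxx /fprev rotK.
by rewrite (rot_nx Dg).
Qed.

Let tmV_opp x : reg x = t -> tmV (opp x) = r3 (pv x).
Proof. by move=> rx; rewrite /tmoveV oppK rx eqxx. Qed.

Let tm_rot x : reg x = t -> tm (rot x) = r3 (pv x).
Proof.
move=> rx; rewrite -[rot x](_ : tmV (r3 (pv x)) = _) ?(tmoveVK Dg D4 d0) //.
by rewrite tmV_r3 ?(reg_fprev Dg) // pvK.
Qed.

Let tm_r2 x : reg x = t -> tm (r2 x) = r2 x.
Proof. by move=> rx; rewrite -{1}(tmV_r2 rx) (tmoveVK Dg D4 d0). Qed.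

Let tm_r3 x : reg x = t -> tm (r3 x) = opp (nx x).
Proof.
move=> rx; have rn : reg (nx x) = t by rewrite (reg_fnext Dg).
by rewrite -[r3 x](_ : tmV (opp (nx x)) = _) ?(tmoveVK Dg D4 d0) // tmV_opp // nxK.
Qed.

Definition far x := [&& reg x != t, reg (rot x) != t, reg (r2 x) != t & reg (r3 x) != t].

Let far_rot x : far (rot x) = far x.
Proof. by rewrite /far rotK; do 4?case: (_ != t). Qed.

Let tm_far x : far x -> tm x = x.
Proof.
move=> /and4P[h1 h2 h3 h4]; rewrite /tmove -(reg_r3 Dg) (negbTE h4).
by rewrite (negbTE h2).
Qed.

Let tmV_far x : far x -> tmV x = x.
Proof. by move=> fx; rewrite -{1}(tm_far fx) (tmoveK Dg D4 d0). Qed.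

Let outer_cases z : out z ->
  [\/ exists2 x, reg x = t & z = r2 x, exists2 x, reg x = t & z = r3 x | far z].
Proof.
case/andP=> h1; rewrite -(reg_r3 Dg) => h4.
have [/eqP h2|h2] := boolP (reg (rot z) == t).
  by constructor 2; exists (rot z); rewrite ?rotK.
have [/eqP h3|h3] := boolP (reg (r2 z) == t).
  by constructor 1; exists (r2 z); rewrite ?rotK.
by constructor 3; rewrite /far h1 h2 h3 h4.
Qed.

(** The mutations at [a], [b], [c], [a] produce the quiver of the moved diagram with the labels of
    the sides [d0] and [d2] interchanged. *)
Definition swd x := if (d2 == x) || (d2 == opp x) then d0
  else if (d0 == x) || (d0 == opp x) then d2 else x.

Section Labelled.
Variables (I : finType) (lab : D -> I) (B : I -> I -> int) (nu : D -> I -> int).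
Hypothesis Fr : framed rot opp i0 lab B nu.
Let lE := lab_eq Fr.
Local Notation a := (lab d1).
Local Notation b := (lab d2).
Local Notation c := (lab d0).
Local Notation Ab := (lab (r2 d0)).
Local Notation Ac := (lab (r3 d0)).
Local Notation Bc := (lab (r2 d1)).
Local Notation Ba := (lab (r3 d1)).
Local Notation Ca := (lab (r2 d2)).
Local Notation Cb := (lab (r3 d2)).
Local Notation lb := (fun u => u \in codom lab).

Let lab_opp x : lab (opp x) = lab x.
Proof. by apply/eqP; rewrite lE oppK eqxx orbT. Qed.

Let lr0 : lab (rot d0) = b. Proof. by rewrite -od2 lab_opp. Qed.
Let lr1 : lab (rot d1) = c. Proof. by rewrite -od0 lab_opp. Qed.
Let lr2 : lab (rot d2) = a. Proof. by rewrite -od1 lab_opp. Qed.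

Let inner_outer x z : reg x = t -> out z -> lab x != lab z.
Proof.
move=> rx /andP[h1 h2]; rewrite lE; apply/norP; split.
  by apply: contraNneq h1 => ->; apply/eqP.
by apply: contraNneq h2 => ->; rewrite oppK; apply/eqP.
Qed.

Let inner_neq x : reg x = t -> lab x != lab (nx x).
Proof.
move=> rx; rewrite lE; apply/norP; split; first exact: (no_monogon Dg).
by apply/eqP => e; have := in_t_inn Dg rx; rewrite -e (reg_fnext Dg) rx eqxx.
Qed.

Let nomono x : lab (r2 x) != lab (r3 x).
Proof.
rewrite lE; apply/norP; split; first exact: (rot_neq Dg).
apply: contraNneq (no_monogon Dg (r2 x) D4) => e.
by rewrite /fnext -e rotK.
Qed.

Let nobig x : reg x = t -> lab (r3 x) != lab (r2 (nx x)).
Proof.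
move=> rx; have rn : reg (nx x) = t by rewrite (reg_fnext Dg).
rewrite lE; apply/norP; split.
  apply/eqP => e; have := reg_rot_neq Dg (rot (nx x)).
  by rewrite e (reg_r3 Dg) (rot_nx Dg) eqxx.
apply/eqP => e; have := nb rx (f := rot (nx x)); rewrite (rot_nx Dg) => /(_ erefl).
apply/negP; rewrite negbK /bigon_at; apply/eqP.
by rewrite {2}/fnext oppK /fnext -e (rot_nx Dg) rotK.
Qed.

Let lbT d : lb (lab d). Proof. exact: codom_f. Qed.

Let row d j : lb j -> B (lab d) j =
  (j == lab (rot d))%:Z + (j == lab (rot (opp d)))%:Z
  - ((j == lab (r3 d))%:Z + (j == lab (r3 (opp d)))%:Z).
Proof.
by move=> /codomP[f ->]; rewrite (framed_asym Fr) (framed_seg Fr); ring.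
Qed.

Let tN x : reg x = t -> [/\ [/\ lab x != Ab, lab x != Ac & lab x != Bc],
  lab x != Ba, lab x != Ca & lab x != Cb].
Proof.
have o2 := out_r2; have o3 := out_r3.
by move=> rx; split; first split; apply: inner_outer => //; auto.
Qed.

Let conds : [/\ a != b, b != c & c != a] /\
  [/\ Ba != Ca, Cb != Ab & Ac != Bc] /\ [/\ Ab != Ac, Bc != Ba & Ca != Cb].
Proof.
have e0 := inner_neq (erefl t); have e1 := inner_neq rt1; have e2 := inner_neq rt2.
have g0 := nobig (erefl t); have g1 := nobig rt1; have g2 := nobig rt2.
by move: e0 e1 e2 g0 g1 g2; rewrite nx0 nx1 nx2 => *; do !split; rewrite ?nomono.
Qed.

Let rowa j : lb j -> B a j = (j == c)%:Z + (j == Ca)%:Z - ((j == b)%:Z + (j == Ba)%:Z).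
Proof. by move=> lj; rewrite row // od1 lr1 rotK; ring. Qed.
Let rowb j : lb j -> B b j = (j == a)%:Z + (j == Ab)%:Z - ((j == c)%:Z + (j == Cb)%:Z).
Proof. by move=> lj; rewrite row // od2 lr2 rotK; ring. Qed.
Let rowc j : lb j -> B c j = (j == b)%:Z + (j == Bc)%:Z - ((j == a)%:Z + (j == Ac)%:Z).
Proof. by move=> lj; rewrite row // od0 lr0 rotK; ring. Qed.

Let lbs : [/\ lb a, lb b & lb c] /\
  [/\ [/\ lb Ab, lb Ac & lb Bc], lb Ba, lb Ca & lb Cb].
Proof. by do !split; apply: lbT. Qed.

Let Q : triangle_quiver lb B a b c Ab Ac Bc Ba Ca Cb.
Proof.
case: conds => h1 [h2 h3]; split=> //; try exact: tN; exact: (framed_asym Fr).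
Qed.

Definition swl u := if u == b then c else if u == c then b else u.

Let lab_swd x : lab (swd x) = swl (lab x).
Proof. by rewrite /swd /swl -!lE; do 2?case: ifP => //. Qed.

Let swlK : involutive swl.
Proof.
move=> u; rewrite /swl; case: conds => -[_ bc _] _.
case: (eqVneq u b) => [->|ub]; first by rewrite eq_sym (negbTE bc) eqxx.
case: (eqVneq u c) => [->|uc]; first by rewrite eqxx.
by rewrite (negbTE ub) (negbTE uc).
Qed.

Definition tlab x := lab (swd (tm x)).

Let tlabE x : tlab x = swl (lab (tm x)). Proof. exact: lab_swd. Qed.

Let swl_out z : out z -> swl (lab z) = lab z.
Proof.
move=> oz; rewrite /swl ![lab z == _]eq_sym.
by rewrite (negbTE (inner_outer rt2 oz)) (negbTE (inner_outer erefl oz)).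
Qed.

Let swlb : swl b = c. Proof. by rewrite /swl eqxx. Qed.
Let swlc : swl c = b.
Proof. by case: conds => -[_ bc _] _; rewrite /swl eq_sym (negbTE bc) eqxx. Qed.
Let swla : swl a = a.
Proof. by case: conds => -[ab _ ca] _; rewrite /swl (negbTE ab) eq_sym (negbTE ca). Qed.

Let tlab_t : [/\ tlab d0 = b, tlab d1 = a & tlab d2 = c].
Proof. by rewrite !tlabE !tm_t // swlb swlc swla. Qed.

Let tlab_rot x : reg x = t -> tlab (rot x) = lab (r3 (pv x)).
Proof. by move=> rx; rewrite tlabE tm_rot // swl_out // out_r3 // (reg_fprev Dg). Qed.

Let tlab_r2 x : reg x = t -> tlab (r2 x) = lab (r2 x).
Proof. by move=> rx; rewrite tlabE tm_r2 // swl_out // out_r2. Qed.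

Let tlab_r3 : [/\ tlab (r3 d0) = a, tlab (r3 d1) = c & tlab (r3 d2) = b].
Proof. by rewrite !tlabE !tm_r3 // !lab_opp nx0 nx1 nx2 swla swlb swlc. Qed.

Let far_out x : far x -> out x.
Proof. by move=> /and4P[h1 _ _ h4]; rewrite /outer h1 -(reg_r3 Dg). Qed.

Let tlab_far x : far x -> tlab x = lab x.
Proof. by move=> fx; rewrite tlabE tm_far // swl_out // far_out. Qed.

Let tlab_eq d e : (tlab d == tlab e) = (e == d) || (e == topp rot opp reg d0 d).
Proof.
rewrite !tlabE (inj_eq (inv_inj swlK)) lE (inj_eq (can_inj (tmoveK Dg D4 d0))).
by rewrite /topp -(inj_eq (can_inj (tmoveK Dg D4 d0)) e (tmV _)) (tmoveVK Dg D4 d0).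
Qed.

Let codom_tlab u : (u \in codom tlab) = lb u.
Proof.
apply/idP/idP => [/codomP[x ->]|/codomP[x ->]]; first exact: lbT.
apply/codomP; exists (tmV (swd x)); rewrite tlabE (tmoveVK Dg D4 d0) lab_swd swlK.
by [].
Qed.

Let tlab_root : tlab (tmV i0) = lab i0.
Proof. by rewrite tlabE (tmoveVK Dg D4 d0) swl_out //; apply: outer_i0. Qed.

Local Notation B4 := (mB4 B a b c).

Local Notation io d z := ((z == d)%:Z).
Let io2 z d : (lab z == lab d)%:Z = io d z + io d (opp z) :> int.
Proof.
have ox : opp z != z.
  by apply: contraNneq (reg_opp_neq Dg z) => ->.
rewrite eq_sym lE oppE; have [<-|_] := eqVneq z d; last by case: (z == opp d).
by rewrite eq_sym (negbTE ox).
Qed.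

Local Notation kap u z := ((u == tlab (r3 (tmV z)))%:Z - (u == tlab (rot (tmV z)))%:Z : int).

Let iota_r2 x y : reg x = t -> reg y = t -> (r2 x == r3 y) = false.
Proof.
move=> rx ry; apply/eqP => /(drot_inj Dg)/(drot_inj Dg) e.
by have := in_t_pre Dg ry; rewrite -e rx eqxx.
Qed.

Let iota_r2' x y : (r2 x == r2 y) = (x == y).
Proof. by rewrite !(inj_eq (drot_inj Dg)). Qed.
Let iota_r3' x y : (r3 x == r3 y) = (x == y).
Proof. by rewrite !(inj_eq (drot_inj Dg)). Qed.

Let dne : ((d0 == d1) = false) * ((d1 == d0) = false) * ((d1 == d2) = false) *
  ((d2 == d1) = false) * ((d2 == d0) = false) * ((d0 == d2) = false).
Proof.
have h x : (x == nx x) = false by rewrite eq_sym; apply: negbTE; apply: (no_monogon Dg).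
have := h d2; have := h d1; have := h d0; rewrite nx0 nx1 nx2 => h0 h1 h2.
by do !split; rewrite ?h0 ?h1 ?h2 // eq_sym ?h0 ?h1 ?h2.
Qed.

Let far_iota z x : far z -> reg x = t -> ((z == r2 x) = false) * ((z == r3 x) = false).
Proof.
move=> /and4P[h1 h2 h3 h4] rx; split; apply/eqP => e; move: h2 h3.
  by rewrite e rotK rx eqxx.
by rewrite e rotK rx eqxx.
Qed.

Let outer_ind (P : D -> Prop) : P (r2 d0) -> P (r3 d0) -> P (r2 d1) -> P (r3 d1) ->
  P (r2 d2) -> P (r3 d2) -> (forall z, far z -> P z) -> forall z, out z -> P z.
Proof.
move=> p1 p2 p3 p4 p5 p6 pf z /outer_cases[[x rx ->]|[x rx ->]|/pf //].
  by case: (t_cases rx) => ->.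
by case: (t_cases rx) => ->.
Qed.

Let tlabs : ((tlab d0 = b) * (tlab d1 = a) * (tlab d2 = c)) *
  ((tlab (rot d0) = Cb) * (tlab (rot d1) = Ac) * (tlab (rot d2) = Ba)) *
  ((tlab (r2 d0) = Ab) * (tlab (r2 d1) = Bc) * (tlab (r2 d2) = Ca)) *
  ((tlab (r3 d0) = a) * (tlab (r3 d1) = c) * (tlab (r3 d2) = b)).
Proof.
case: tlab_t => -> -> ->; case: tlab_r3 => -> -> ->.
rewrite (tlab_rot (x := d0) erefl) (tlab_rot rt1) (tlab_rot rt2) (tlab_r2 (x := d0) erefl).
by rewrite (tlab_r2 rt1) (tlab_r2 rt2) pv0 pv1 pv2.
Qed.

Let kap_r2 u x : reg x = t ->
  kap u (r2 x) = (u == tlab (rot x))%:Z - (u == tlab (r3 x))%:Z.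
Proof. by move=> rx; rewrite tmV_r2 // rotK. Qed.

Let kap_r3 u x : reg x = t ->
  kap u (r3 x) = (u == tlab (nx x))%:Z - (u == tlab (r2 (nx x)))%:Z.
Proof. by move=> rx; rewrite tmV_r3 // rotK. Qed.

Let kap_far u z : far z -> kap u z = (u == lab (r3 z))%:Z - (u == lab (rot z))%:Z.
Proof. by move=> fz; rewrite tmV_far // !tlab_far ?far_rot. Qed.

Let far_lab z x : far z -> reg x = t -> ((lab x == lab (r3 z)) = false)
  * ((lab x == lab (rot z)) = false).
Proof.
by move=> fz rx; split; apply: negbTE; apply: inner_outer => //; apply: far_out; rewrite ?far_rot.
Qed.

Let iE : (((a == b) = false) * ((b == a) = false) * ((b == c) = false) *
  ((c == b) = false) * ((c == a) = false) * ((a == c) = false)).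
Proof.
case: conds => -[h1 h2 h3] _; rewrite (negbTE h1) (negbTE h2) (negbTE h3).
by rewrite eq_sym (negbTE h1) eq_sym (negbTE h2) eq_sym (negbTE h3).
Qed.

Let oE x : reg x = t -> ((lab x == Ab) = false) * ((lab x == Ac) = false) *
  ((lab x == Bc) = false) * ((lab x == Ba) = false) * ((lab x == Ca) = false) *
  ((lab x == Cb) = false).
Proof. by move=> /tN[[h1 h2 h3] h4 h5 h6]; do !split; apply: negbTE. Qed.

Let io_r2r3 : (((r2 d0 == r3 d0) = false) * ((r2 d0 == r3 d1) = false) *
 ((r2 d0 == r3 d2) = false) * ((r2 d1 == r3 d0) = false) * ((r2 d1 == r3 d1) = false) *
 ((r2 d1 == r3 d2) = false) * ((r2 d2 == r3 d0) = false) * ((r2 d2 == r3 d1) = false) *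
 ((r2 d2 == r3 d2) = false)) * (((r3 d0 == r2 d0) = false) * ((r3 d0 == r2 d1) = false) *
 ((r3 d0 == r2 d2) = false) * ((r3 d1 == r2 d0) = false) * ((r3 d1 == r2 d1) = false) *
 ((r3 d1 == r2 d2) = false) * ((r3 d2 == r2 d0) = false) * ((r3 d2 == r2 d1) = false) *
 ((r3 d2 == r2 d2) = false)).
Proof.
have h2 := iota_r2; have h3 x y (rx : reg x = t) (ry : reg y = t) : (r3 y == r2 x) = false.
  by rewrite eq_sym h2.
by do !split; first [by apply: h2 | by apply: h3].
Qed.

Let io_same : (((r2 d0 == r2 d1) = false) * ((r2 d1 == r2 d0) = false) *
  ((r2 d1 == r2 d2) = false) * ((r2 d2 == r2 d1) = false) * ((r2 d2 == r2 d0) = false) *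
  ((r2 d0 == r2 d2) = false)) * (((r3 d0 == r3 d1) = false) * ((r3 d1 == r3 d0) = false) *
  ((r3 d1 == r3 d2) = false) * ((r3 d2 == r3 d1) = false) * ((r3 d2 == r3 d0) = false) *
  ((r3 d0 == r3 d2) = false)).
Proof.
do !split; first [by rewrite iota_r2' dne | by rewrite iota_r3' dne].
Qed.

Let kap_inner z : out z -> [/\ kap a z = io (r3 d0) z - io (r2 d0) z,
  kap b z = io (r3 d2) z - io (r2 d2) z & kap c z = io (r3 d1) z - io (r2 d1) z].
Proof.
move: z; apply: outer_ind => [||||||z fz].
7: have fi := (far_iota fz rt1, far_iota fz rt2, far_iota fz (erefl t)).
7: have fl := (far_lab fz rt1, far_lab fz rt2, far_lab fz (erefl t)).
7: by rewrite !kap_far // !fl !fi.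
1: rewrite !(kap_r2 _ (erefl t)).
2: rewrite !(kap_r3 _ (erefl t)).
3: rewrite !(kap_r2 _ rt1).
4: rewrite !(kap_r3 _ rt1).
5: rewrite !(kap_r2 _ rt2).
6: rewrite !(kap_r3 _ rt2).
all: rewrite ?nx0 ?nx1 ?nx2 !tlabs ?io_r2r3 ?io_same ?eqxx.
all: by rewrite !iE !(oE rt1) !(oE rt2) !(oE erefl).
Qed.

(* One dart at a time, so that coincidences among the six outer segments need
   not be distinguished. *)
Let kap_outer u z : u != a -> u != b -> u != c -> out z -> kap u z =
  (u == lab (r3 z))%:Z - (u == lab (rot z))%:Z
  + io (r2 d2) z * ((u == Ba)%:Z + (u == Cb)%:Z)
  - io (r3 d1) z * ((u == Ca)%:Z + (u == Bc)%:Z)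
  + io (r2 d0) z * ((u == Cb)%:Z + (u == Ac)%:Z)
  - io (r3 d2) z * ((u == Ab)%:Z + (u == Ca)%:Z)
  + io (r2 d1) z * ((u == Ac)%:Z + (u == Ba)%:Z)
  - io (r3 d0) z * ((u == Bc)%:Z + (u == Ab)%:Z).
Proof.
move=> /negbTE ua /negbTE ub /negbTE uc; move: z; apply: outer_ind => [||||||z fz].
7: have fi := (far_iota fz rt1, far_iota fz rt2, far_iota fz (erefl t)).
7: have fl := (far_lab fz rt1, far_lab fz rt2, far_lab fz (erefl t)).
7: by rewrite !kap_far // !fi /=; ring.
1: rewrite !(kap_r2 _ (erefl t)).
2: rewrite !(kap_r3 _ (erefl t)).
3: rewrite !(kap_r2 _ rt1).
4: rewrite !(kap_r3 _ rt1).
5: rewrite !(kap_r2 _ rt2).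
6: rewrite !(kap_r3 _ rt2).
all: rewrite ?nx0 ?nx1 ?nx2 !tlabs ?io_r2r3 ?io_same ?eqxx.
all: rewrite !rotK ?lr0 ?lr1 ?lr2 ?ua ?ub ?uc /=; ring.
Qed.

Let B4_asym : antisym B4. Proof. by do 4!apply: mutate_antisym; apply: (framed_asym Fr). Qed.

(** The arrows at a segment of the moved diagram are collected end by end, [kap u x] being the share
    of the end that the move brings to [tmV x]. *)
Let B4_kap u x : lb u -> B4 u (swl (lab x)) = kap u x + kap u (opp x).
Proof.
move=> lu; have inn y : reg y = t -> B4 u (swl (lab y)) = kap u y + kap u (opp y).
  move=> ry; rewrite !tmV_opp // !(tmoveV_t Dg ry) !rotK B4_asym.
  case: (t_cases ry) => ->; rewrite ?pv0 ?pv1 ?pv2 ?tlabs ?swla ?swlb ?swlc.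
  - by rewrite (row4b Q) //; ring.
  - by rewrite (row4a Q) //; ring.
  - by rewrite (row4c Q) //; ring.
case: (dart_cases opp reg d0 x) => [rx|rx|ox]; first exact: inn.
  by have := inn _ rx; rewrite oppK lab_opp => ->; rewrite addrC.
rewrite swl_out //; have oox : out (opp x) by apply: (outer_opp Dg).
have [a1 b1 c1] := kap_inner ox; have [a2 b2 c2] := kap_inner oox.
have ioE := io2 x.
have xN y : reg y = t -> lab x != lab y by move=> ry; rewrite eq_sym inner_outer.
have [->|ua] := eqVneq u a; first by rewrite (row4a Q) // a1 a2 ?(negbTE (xN _ rt1)) ?(negbTE (xN _ rt2)) ?(negbTE (xN d0 erefl)) !ioE /=; ring.
have [->|ub] := eqVneq u b; first by rewrite (row4b Q) // b1 b2 ?(negbTE (xN _ rt1)) ?(negbTE (xN _ rt2)) ?(negbTE (xN d0 erefl)) !ioE /=; ring.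
have [->|uc] := eqVneq u c; first by rewrite (row4c Q) // c1 c2 ?(negbTE (xN _ rt1)) ?(negbTE (xN _ rt2)) ?(negbTE (xN d0 erefl)) !ioE /=; ring.
rewrite !kap_outer // (mB4_outer Q) ?xN //.
case/codomP: lu ua ub uc => f -> ua ub uc; rewrite (framed_seg Fr) !ioE; ring.
Qed.

Let seg4 d f : B4 (tlab f) (tlab d) =
  (tlab f == tlab (r3 d))%:Z + (tlab f == tlab (r3 (topp rot opp reg d0 d)))%:Z
  - (tlab f == tlab (rot d))%:Z - (tlab f == tlab (rot (topp rot opp reg d0 d)))%:Z.
Proof.
rewrite [tlab d in LHS]tlabE B4_kap ?lbT // (tmoveK Dg D4 d0) /topp; ring.
Qed.

(** Frozen exponents of the new variable at the side [x] of the triangle, as accumulated by the four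
    mutations; see [X4a], [X4b] and [X4c] below. *)
Definition th x u : int :=
  if x == d0 then f2 lb B a b u
  else if x == d1 then f3 lb B a b c u + f4 lb B a b c u
  else f1 lb B a u + f3 lb B a b c u.

Definition tnu x u : int :=
  if reg x == t then th x u + (nu (r2 (pv x)) u + nu (r3 x) u + nu (nx x) u)
  else if reg (r3 x) == t then
    nu (r3 (pv (r3 x))) u + nu (r3 (r3 x)) u + nu (nx (r3 x)) u
  else if reg (r2 x) == t then
    th (nx (r2 x)) u + (nu (r2 (r2 x)) u + nu (pv (r2 x)) u + nu (rot (nx (r2 x))) u)
  else if reg (rot x) == t then
    th (rot x) u + th (nx (rot x)) u
     + (nu (r3 (rot x)) u + nu (nx (rot x)) u + nu (pv (rot x)) u)
  else nu x u.

Let f_lb B' k j : lb j -> frozen_out lb B' k j = 0.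
Proof. by rewrite /frozen_out => ->. Qed.

Let th_lb x u : lb u -> th x u = 0.
Proof. by move=> lu; rewrite /th /f1 /f2 /f3 /f4 !f_lb // !if_same. Qed.

Let nu_lb x u : lb u -> nu x u = 0.
Proof. by case/codomP=> y ->; apply: (framed_nu Fr). Qed.

Let tnu_lb x u : lb u -> tnu x u = 0.
Proof. by move=> lu; rewrite /tnu !th_lb // !nu_lb // !if_same. Qed.

Section Values.
Variables (K : fieldType) (pos : K -> Prop) (X : I -> K).
Hypothesis cone : positive_cone pos.
Hypothesis Xp : all_pos pos X.
Let X0 : nonzero X. Proof. exact: all_pos_nonzero cone _ Xp. Qed.

Local Notation X4 := (cvar (ms4 B a b c X)).
Local Notation om := (omega rot lab X nu).
Local Notation om' := (omega rot tlab X4 tnu).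
Local Notation ya := (yh X B a).
Local Notation yb := (yh X B b).
Local Notation yc := (yh X B c).
Local Notation T := (1 + ya + ya * yc).
Local Notation U := (1 + yb + yb * ya).
Local Notation V := (1 + yc + yc * yb).
Local Notation W x := (mon X (nu x)).
Local Notation H x := (mon X (th x)).

Let mon4 v : (forall j, lb j -> v j = 0) -> mon X4 v = mon X v.
Proof.
move=> v0; apply: (mon_frozen v0) => j nl.
by rewrite ms4_outer //; apply: contraNneq nl => ->; apply: lbT.
Qed.

Let om'E x : om' x = mon X (tnu x) / (X4 (tlab x) * X4 (tlab (rot x))).
Proof. by rewrite /omega mon4 // => j; apply: tnu_lb. Qed.

Let tnu_0 x : reg x = t ->
  mon X (tnu x) = H x * (W (r2 (pv x)) * W (r3 x) * W (nx x)).
Proof.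
by move=> rx; rewrite -!monD //; apply: eq_mon => u; rewrite /tnu rx eqxx.
Qed.

Let tnu_1 x : reg x = t ->
  mon X (tnu (rot x)) = W (r3 (pv x)) * W (r3 x) * W (nx x).
Proof.
move=> rx; rewrite -!monD //; apply: eq_mon => u.
by rewrite /tnu (in_t_pre Dg rx) !rotK rx eqxx.
Qed.

Let tnu_2 x : reg x = t ->
  mon X (tnu (r2 x)) = H (nx x) * (W (r2 x) * W (pv x) * W (rot (nx x))).
Proof.
move=> rx; rewrite -!monD //; apply: eq_mon => u.
by rewrite /tnu (in_t_r2 Dg D4 rx) !rotK (in_t_pre Dg rx) rx eqxx.
Qed.

Let tnu_3 x : reg x = t ->
  mon X (tnu (r3 x)) = H x * H (nx x) * (W (r3 x) * W (nx x) * W (pv x)).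
Proof.
move=> rx; rewrite -!monD //; apply: eq_mon => u.
rewrite /tnu (reg_r3 Dg) (in_t_inn Dg rx) !rotK (in_t_r2 Dg D4 rx) (in_t_pre Dg rx).
by rewrite rx eqxx.
Qed.

Let tnu_far x : far x -> mon X (tnu x) = W x.
Proof.
case/and4P=> /negbTE h1 /negbTE h2 /negbTE h3 /negbTE h4.
by apply: eq_mon => u; rewrite /tnu h1 h2 h3 h4.
Qed.

Let H0 : H d0 = mon X (f2 lb B a b).
Proof. by apply: eq_mon => u; rewrite /th eqxx. Qed.
Let H1 : H d1 = mon X (f3 lb B a b c) * mon X (f4 lb B a b c).
Proof. by rewrite -monD //; apply: eq_mon => u; rewrite /th dne eqxx. Qed.
Let H2 : H d2 = mon X (f1 lb B a) * mon X (f3 lb B a b c).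
Proof. by rewrite -monD //; apply: eq_mon => u; rewrite /th !dne. Qed.

Let X4a : X4 a = H d1 * (X Ab * X Bc) * V / X c.
Proof. by rewrite (ms4_a Q cone Xp) H1. Qed.
Let X4b : X4 b = H d0 * (X Ab * X Ca) * U / X b.
Proof. by rewrite (ms4_b Q cone Xp) H0. Qed.
Let X4c : X4 c = H d2 * (X Bc * X Ca) * T / X a.
Proof. by rewrite (ms4_c Q cone Xp) H2. Qed.
Let X4o z : out z -> X4 (lab z) = X (lab z).
Proof.
move=> oz; have N y : reg y = t -> lab z != lab y by move=> ry; rewrite eq_sym inner_outer.
by rewrite ms4_outer ?N.
Qed.

Let oo := (X4o (out_r2 (erefl t)), X4o (out_r2 rt1), X4o (out_r2 rt2),
  X4o (out_r3 (erefl t)), X4o (out_r3 rt1), X4o (out_r3 rt2)).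

Let G0 := X a * X b * X c * X c * X Ac / X Ab.
Let G1 := X a * X b * X c * X a * X Ba / X Bc.
Let G2 := X a * X b * X c * X b * X Cb / X Ca.
Let Th := X a * X b * X c / (X Ab * X Bc * X Ca * T * U * V).

Let T0 := T_neq0 B a c cone Xp.
Let U0 := U_neq0 B a b cone Xp.
Let V0 := V_neq0 B b c cone Xp.
Let m0 v := mon_neq0 v X0.
Let labels := (lr0, lr1, lr2, rotK).

Ltac fld := rewrite /G0 /G1 /G2 /Th; field; rewrite ?X0 ?T0 ?U0 ?V0 ?m0.

Let om'0 : [/\ om' d0 = G0 * (om (r2 d2) * om (r3 d0) * om d1 / U),
  om' (rot d0) = G0 * (om (r3 d2) * om (r3 d0) * om d1),
  om' (r2 d0) = G0 * (om (r2 d0) * om d2 * om (rot d1) / V)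
 & om' (r3 d0) = G0 * (Th * (om (r3 d0) * om d1 * om d2 * T))].
Proof.
split; rewrite om'E ?tlabs ?rotK ?tlabs ?X4a ?X4b ?X4c ?oo /omega ?labels.
- by rewrite tnu_0 // pv0 ?nx0; fld.
- by rewrite tnu_1 // pv0 ?nx0; fld.
- by rewrite tnu_2 // pv0 ?nx0; fld.
- by rewrite tnu_3 // pv0 ?nx0; fld.
Qed.

Let om'1 : [/\ om' d1 = G1 * (om (r2 d0) * om (r3 d1) * om d2 / V),
  om' (rot d1) = G1 * (om (r3 d0) * om (r3 d1) * om d2),
  om' (r2 d1) = G1 * (om (r2 d1) * om d0 * om (rot d2) / T)
 & om' (r3 d1) = G1 * (Th * (om (r3 d1) * om d2 * om d0 * U))].
Proof.
split; rewrite om'E ?tlabs ?rotK ?tlabs ?X4a ?X4b ?X4c ?oo /omega ?labels.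
- by rewrite tnu_0 // pv1 ?nx1; fld.
- by rewrite tnu_1 // pv1 ?nx1; fld.
- by rewrite tnu_2 // pv1 ?nx1; fld.
- by rewrite tnu_3 // pv1 ?nx1; fld.
Qed.

Let om'2 : [/\ om' d2 = G2 * (om (r2 d1) * om (r3 d2) * om d0 / T),
  om' (rot d2) = G2 * (om (r3 d1) * om (r3 d2) * om d0),
  om' (r2 d2) = G2 * (om (r2 d2) * om d1 * om (rot d0) / U)
 & om' (r3 d2) = G2 * (Th * (om (r3 d2) * om d0 * om d1 * V))].
Proof.
split; rewrite om'E ?tlabs ?rotK ?tlabs ?X4a ?X4b ?X4c ?oo /omega ?labels.
- by rewrite tnu_0 // pv2 ?nx2; fld.
- by rewrite tnu_1 // pv2 ?nx2; fld.
- by rewrite tnu_2 // pv2 ?nx2; fld.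
- by rewrite tnu_3 // pv2 ?nx2; fld.
Qed.

Let om'_far z : far z -> om' z = om z.
Proof.
move=> fz; have fr : far (rot z) by rewrite far_rot.
by rewrite om'E /omega tnu_far // !tlab_far // !X4o // far_out.
Qed.

Let notroot x : reg x = t -> (x != i0) /\ (x != opp i0).
Proof. by move=> rx; split; apply/eqP => e; [apply: t_i0|apply: t_i1]; rewrite -rx e. Qed.

Let yE x : reg x = t -> yh X B (lab x) = mfac rot om x * mfac rot om (opp x).
Proof. by move=> /notroot[h1 h2]; apply: (framed_y Fr cone Xp). Qed.

Let om0 x : om x != 0.
Proof. by rewrite mulf_neq0 ?invr_eq0 ?m0 // mulf_neq0 ?X0. Qed.

Let ycE : yc = om d0 * om (rot d1) / (om (r3 d0) * om d1).
Proof. by rewrite yE // od0 /mfac rotK; field; rewrite !om0. Qed.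
Let yaE : ya = om d1 * om (rot d2) / (om (r3 d1) * om d2).
Proof. by rewrite yE // od1 /mfac rotK; field; rewrite !om0. Qed.
Let ybE : yb = om d2 * om (rot d0) / (om (r3 d2) * om d0).
Proof. by rewrite yE // od2 /mfac rotK; field; rewrite !om0. Qed.

Let G00 : [/\ G0 != 0, G1 != 0, G2 != 0 & Th != 0].
Proof. by split; rewrite /G0 /G1 /G2 /Th !mulf_neq0 ?invr_eq0 ?mulf_neq0 ?X0 ?T0 ?U0 ?V0. Qed.

(** Share of the dart [z] in the product of [yh4_outer], whose indicators are sums over the two
    darts of a segment by [io2]. *)
Definition tfac z := (ya * yb / U) ^ io (r2 d2) z * T ^ io (r3 d1) z * U ^ io (r3 d2) z
  * (yb * yc / V) ^ io (r2 d0) z * V ^ io (r3 d0) z * (yc * ya / T) ^ io (r2 d1) z.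

Let mfac_outer z : out z -> mfac rot om' (tmV z) = mfac rot om z * tfac z.
Proof.
move: om'0 om'1 om'2 T0 U0 V0; rewrite /tfac; set t' := T; set u' := U; set v' := V.
move=> [a0 a1 a2 a3] [b0 b1 b2 b3] [c0 c1 c2 c3] t0 u0 v0.
case: G00 => g0 g1 g2 g3; move: z; apply: outer_ind => [||||||z fz].
7: have fi := (far_iota fz rt1, far_iota fz rt2, far_iota fz (erefl t)).
7: by rewrite !fi !expr0z !mulr1 tmV_far // /mfac !om'_far ?far_rot.
1: rewrite (tmV_r2 (erefl t)).
2: rewrite (tmV_r3 (erefl t)).
3: rewrite (tmV_r2 rt1).
4: rewrite (tmV_r3 rt1).
5: rewrite (tmV_r2 rt2).
6: rewrite (tmV_r3 rt2).
all: rewrite ?nx0 ?nx1 ?nx2 ?io_r2r3 ?io_same ?eqxx !expr0z !expr1z ?mul1r ?mulr1.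
all: rewrite /mfac !rotK ?a0 ?a1 ?a2 ?a3 ?b0 ?b1 ?b2 ?b3 ?c0 ?c1 ?c2 ?c3.
all: rewrite ?yaE ?ybE ?ycE; field; by rewrite ?om0 ?t0 ?u0 ?v0 ?g0 ?g1 ?g2 ?g3.
Qed.

Lemma y4 x : x != i0 -> x != opp i0 ->
  yh X4 B4 (swl (lab x)) = mfac rot om' (tmV x) * mfac rot om' (tmV (opp x)).
Proof.
have inn y : reg y = t ->
    yh X4 B4 (swl (lab y)) = mfac rot om' (tmV y) * mfac rot om' (tmV (opp y)).
  move=> ry; rewrite tmV_opp // (tmoveV_t Dg ry).
  move: om'0 om'1 om'2 T0 U0 V0 (yh4a Q cone Xp) (yh4b Q cone Xp) (yh4c Q cone Xp).
  set t' := T; set u' := U; set v' := V.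
  move=> [a0 a1 a2 a3] [b0 b1 b2 b3] [c0 c1 c2 c3] t0 u0 v0 ya4 yb4 yc4.
  case: G00 => g0 g1 g2 g3.
  case: (t_cases ry) => ->; rewrite ?pv0 ?pv1 ?pv2 ?swla ?swlb ?swlc /mfac !rotK.
  - rewrite yb4 a0 a3 c3 c2 ybE.
    by field; rewrite ?om0 ?t0 ?u0 ?v0 ?g0 ?g1 ?g2 ?g3.
  - rewrite ya4 b0 b3 a3 a2 ycE.
    by field; rewrite ?om0 ?t0 ?u0 ?v0 ?g0 ?g1 ?g2 ?g3.
  - rewrite yc4 c0 c3 b3 b2 yaE.
    by field; rewrite ?om0 ?t0 ?u0 ?v0 ?g0 ?g1 ?g2 ?g3.
move=> x0 x1; case: (dart_cases opp reg d0 x) => [rx|rx|ox]; first exact: inn.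
  by have := inn _ rx; rewrite oppK lab_opp => ->; rewrite mulrC.
have oox : out (opp x) by apply: (outer_opp Dg).
have N y : reg y = t -> lab x != lab y by move=> ry; rewrite eq_sym inner_outer.
rewrite swl_out // !mfac_outer // (yh4_outer Q cone Xp) ?N //.
rewrite (framed_y Fr cone Xp) // /tfac !io2.
have nz := (T0, U0, V0, yc_neq0 B c cone Xp, ya_neq0 B a cone Xp, yb_neq0 B b cone Xp).
have e1 : ya * yb / U != 0 by rewrite !mulf_neq0 ?invr_eq0 ?nz.
have e2 : yb * yc / V != 0 by rewrite !mulf_neq0 ?invr_eq0 ?nz.
have e3 : yc * ya / T != 0 by rewrite !mulf_neq0 ?invr_eq0 ?nz.
by rewrite !expfzDr ?nz //; do ![move: (_ ^ _) => ?]; ring.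
Qed.

Let segprod4 : segprod (tmV i0) tlab X4 = segprod i0 lab X
   * (X4 a * X4 b * X4 c) / (X a * X b * X c).
Proof.
have lN y : reg y = t -> lab y != lab i0.
  by move=> ry; apply: inner_outer => //; apply: outer_i0.
rewrite /segprod tlab_root (eq_bigl (fun u => lb u && (u != lab i0))); last first.
  by move=> u; rewrite codom_tlab.
have sp (F : I -> K) : \prod_(u | lb u && (u != lab i0)) F u = F a * F b * F c *
   \prod_(u | [&& lb u, u != lab i0, u != a, u != b & u != c]) F u.
  rewrite (bigD1 a) ?lbT ?lN //= (bigD1 b) ?lbT ?lN //=; last by rewrite !iE.
  rewrite (bigD1 c) ?lbT ?lN //=; last by rewrite !iE.
  by rewrite !mulrA; congr (_ * _); apply: eq_bigl => u; rewrite -!andbA.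
rewrite !sp [X in _ * X = _](eq_bigr X); last first.
  by move=> u /and5P[_ _ ua ub uc]; rewrite ms4_outer.
move: (\prod_(_ | _) _) => P; field; by rewrite !X0.
Qed.

Let ks := kept opp reg i0.

Let ksE : kept (topp rot opp reg d0) (treg rot opp reg d0) (tmV i0) = ks.
Proof.
have e1 : [set treg rot opp reg d0 x | x : D] = [set reg x | x : D] by apply: (treg_image Dg D4).
have e2 : treg rot opp reg d0 (tmV i0) = reg i0 by apply: (treg_root Dg D4).
have e3 : treg rot opp reg d0 (topp rot opp reg d0 (tmV i0)) = reg (opp i0).
  by apply: (treg_root_opp Dg D4).
by rewrite /kept e1 e2 e3.
Qed.

Let t_ks : t \in ks.
Proof.
rewrite mem_enum !inE imset_f // andbT; apply/andP; split; exact/eqP.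
Qed.

Let orb_t x y : reg x = t -> reg y = t -> x \in orb rot y -> x = y.
Proof.
move=> rx ry; rewrite !inE => /or4P[] /eqP e //; move: rx; rewrite e => /eqP.
- by rewrite (in_t_pre Dg ry).
- by rewrite (in_t_r2 Dg D4 ry).
- by rewrite (reg_r3 Dg) (in_t_inn Dg ry).
Qed.

Let frontcs : exists cs', crossings rot [:: d0, d1, d2 & cs'].
Proof.
have [cs pcs] := exists_crossings rotK (rot2_neq Dg).
have tl x y : reg x = t -> reg y = t -> x != y -> (x \in orb rot y) = false.
  by move=> rx ry; apply: contraNF => /orb_t ->.
have [|cs1 p1 _] := crossings_front K reg ks rotK (d := d0) pcs; first by rewrite mem_enum.
have m1 : d1 \in flatten [seq orb rot c | c <- cs1].
  have := mem_enum D d1; rewrite -(perm_mem p1) flatten_orb mem_cat.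
  by rewrite tl ?dne.
have [cs2 p2 _] := crossings_front K reg ks rotK (perm_refl _) m1.
have m2 : d2 \in flatten [seq orb rot c | c <- cs2].
  have := mem_enum D d2; rewrite -(perm_mem p1) flatten_orb mem_cat.
  by rewrite tl ?dne //= -(perm_mem p2) flatten_orb mem_cat tl ?dne.
have [cs3 p3 _] := crossings_front K reg ks rotK (perm_refl _) m2.
exists cs3; apply: perm_trans p1; rewrite !(flatten_orb _ d0) perm_cat2l.
apply: perm_trans p2; rewrite !(flatten_orb _ d1) perm_cat2l.
exact: p3.
Qed.

Let ssum_far cs' : crossings rot [:: d0, d1, d2 & cs'] ->
  forall x a, x \in cs' -> a \in orb rot x -> far a.
Proof.
move=> cc x y xc yx; have cl z : z \in orb rot x -> reg z != t.
  move=> zx; apply/eqP => rz.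
  have zf : z \in flatten [seq orb rot c | c <- cs'] by apply/flattenP; exists (orb rot x) => //; apply: map_f.
  have := enum_uniq D; rewrite -(perm_uniq cc) !flatten_orb !cat_uniq.
  case/and3P=> _ h0 /and3P[_ h1 /and3P[_ h2 _]].
  have hh w : w \in [:: w] by rewrite inE.
  case: (t_cases rz) => e; [move: h0|move: h1|move: h2]; apply/negP; rewrite negbK;
    apply/hasP; exists z; rewrite ?mem_cat ?zf ?orbT // e mem_head //.
have cr z : z \in orb rot x -> rot z \in orb rot x.
  by rewrite !inE => /or4P[] /eqP ->; rewrite ?eqxx ?orbT // rotK eqxx.
by rewrite /far !cl ?cr.
Qed.

Let rE : (reg (rot d0) = reg (r3 d2)) * (reg (rot d1) = reg (r3 d0)) *
  (reg (rot d2) = reg (r3 d1)).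
Proof. by rewrite !(reg_r3 Dg) od0 od1 od2. Qed.

Let trE : (treg rot opp reg d0 d0 = reg (r2 d2)) * (treg rot opp reg d0 d1 = reg (r2 d0))
  * (treg rot opp reg d0 d2 = reg (r2 d1)).
Proof. by rewrite /treg !rt1 !rt2 !eqxx pv0 pv1 pv2. Qed.

Let tr1 x : reg x = t -> treg rot opp reg d0 (rot x) = reg (rot x).
Proof. by move=> rx; rewrite /treg (in_t_pre Dg rx) (in_t_r2 Dg D4 rx). Qed.
Let tr2 x : reg x = t -> treg rot opp reg d0 (r2 x) = reg (r2 x).
Proof.
by move=> rx; rewrite /treg (in_t_r2 Dg D4 rx) (reg_r3 Dg) (in_t_inn Dg rx).
Qed.
Let tr3 x : reg x = t -> treg rot opp reg d0 (r3 x) = t.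
Proof. by move=> rx; rewrite /treg (reg_r3 Dg) (in_t_inn Dg rx) rotK rx eqxx. Qed.

Let ssum4 cs : crossings rot cs ->
  ssum rot (treg rot opp reg d0) ks om' cs [::] =
  G0 * G1 * G2 * Th *
   (om d0 * om (r3 d0) * om d1 * om (r3 d1) * om d2 * om (r3 d2))
   * ssum rot reg ks om cs [::].
Proof.
move=> cc; have [cs' cc'] := frontcs; have cp : perm_eq (flatten [seq orb rot c | c <- cs])
    (flatten [seq orb rot c | c <- [:: d0, d1, d2 & cs']]).
  by apply: perm_trans cc _; rewrite perm_sym.
rewrite !(ssum_indep _ _ rotK _ _ cp) !ssum3 /orb !map_cons.
case: om'0 => -> -> -> ->; case: om'1 => -> -> -> ->; case: om'2 => -> -> -> ->.
rewrite !trE (tr1 (erefl t)) (tr1 rt1) (tr1 rt2) (tr2 (erefl t)) (tr2 rt1) (tr2 rt2).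
rewrite (tr3 (erefl t)) (tr3 rt1) (tr3 rt2) !rE rt1 rt2.
have fs u : ssum rot (treg rot opp reg d0) ks om' cs' u = ssum rot reg ks om cs' u.
  apply: eq_ssum => x y xc yx; have fy := ssum_far cc' xc yx; rewrite om'_far //.
  by case/and4P: fy => h1 h2 _ _; rewrite /treg (negbTE h1) (negbTE h2).
under eq_bigr => x _ do (under eq_bigr => y _ do under eq_bigr => z _ do rewrite fs).
have sw u v : perm_eq u v -> ssum rot reg ks om cs' u = ssum rot reg ks om cs' v.
  exact: ssum_perm_used.
have uks : uniq ks by apply: enum_uniq.
have dup u : ~~ uniq u -> ssum rot reg ks om cs' u = 0 by apply: ssum_dup.
have uE := (ycE, yaE, ybE); have [G g] : exists G, G = (T, U, V) by eexists.
have regN x : reg x = t -> [/\ reg (rot x) != t, reg (r2 x) != t & reg (r3 x) != t].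
  by move=> rx; rewrite (in_t_pre Dg rx) (in_t_r2 Dg D4 rx) (reg_r3 Dg) (in_t_inn Dg rx).
(* [W r s] is the state sum over the other crossings once the triangle has used [t], [r] and [s].
   Choices that miss [t] or use a region twice contribute nothing, by [ssum_miss] and [ssum_dup]. *)
apply: (@triangle_identity K J t (reg (r3 d1)) (reg (r3 d2)) (reg (r3 d0))
  (reg (r2 d0)) (reg (r2 d1)) (reg (r2 d2))
  (fun r s q => ssum rot reg ks om cs' [:: q; s; r])
  (fun r s => ssum rot reg ks om cs' [:: s; r; t])).
- by move=> r s; apply: sw; rewrite -![[:: _; _; t]]/([:: _] ++ [:: _] ++ [:: t]) perm_catCA.
- by move=> r; apply: dup; rewrite /= inE eqxx.
- by [].
- by move=> r s; apply: sw; rewrite perm_cons -![[:: _; _]]/([:: _] ++ [:: _]) perm_catC.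
- move=> r s; apply: sw; rewrite -[[:: t; s; r]]/([:: t] ++ [:: s; r]) perm_catC.
  by [].
- by move=> r; apply: dup; rewrite /= !inE eqxx /= andbF.
- move=> r s q rt st qt; apply: (@ssum_miss _ _ _ _ _ _ _ _ _ t) => //.
    by rewrite !inE ![t == _]eq_sym !negb_or qt st rt.
  by move=> x y xc yx; case/and4P: (ssum_far cc' xc yx).
- by case: (regN d0) (regN d1 rt1) (regN d2 rt2) => // h1 h2 h3 [h4 h5 h6] [h7 h8 h9].
- exact: om0.
- exact: om0.
- exact: om0.
- exact: om0.
- exact: om0.
- exact: om0.
- by rewrite -ybE -yaE.
- by rewrite -ycE -ybE.
- by rewrite -yaE -ycE.
- exact: U0.
- exact: V0.
- exact: T0.
Qed.

Lemma step_value cs gam' : crossings rot cs -> (forall u, lb u -> gam' u = 0) ->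
  mon X4 gam' * segprod (tmV i0) tlab X4 *
    ssum rot (treg rot opp reg d0) (kept (topp rot opp reg d0) (treg rot opp reg d0) (tmV i0))
      om' cs [::] =
  mon X (fun u => gam' u + (th d0 u + th d1 u + th d2 u
     + (nu d0 u + nu (r3 d0) u + nu d1 u + nu (r3 d1) u + nu d2 u + nu (r3 d2) u)))
   * segprod i0 lab X * ssum rot reg ks om cs [::].
Proof.
move=> cc g0; rewrite ksE ssum4 // segprod4 mon4 // !monD //.
by rewrite X4a X4b X4c /omega !labels; fld.
Qed.


End Values.

Lemma framed_triangle : framed rot (topp rot opp reg d0) (tmV i0) tlab B4 tnu.
Proof.
split; [exact: tlab_eq | exact: B4_asym | exact: seg4 | by move=> d e; apply: tnu_lb; apply: lbT |].
move=> K pos X' cone X'p d dn dn'.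
(* [y4] evaluates hat y only at clusters obtained by the four mutations; every point of the cone is
   such a cluster. *)
have [X Xp e] := unmutate (K := K) (pos := pos) [:: a; b; c; a] cone (framed_asym Fr) X'p.
have -> : X' = cvar (ms4 B a b c X) by
  transitivity (cvar (mutations (Seed X B) [:: a; b; c; a])); first by rewrite e.
rewrite tlabE (y4 cone Xp) ?(tmoveK Dg D4 d0) //.
  by apply: contraNneq dn => <-; rewrite (tmoveK Dg D4 d0).
by apply: contraNneq dn' => e'; rewrite /topp (tmoveVK Dg D4 d0) -e' (tmoveK Dg D4 d0).
Qed.

Lemma triangle_value (gam' : I -> int) (mus' : seq D) (k' : D) :
  (forall d, gam' (tlab d) = 0) ->
  (forall cs, crossings rot cs -> forall (K : fieldType) (pos : K -> Prop) (X : I -> K),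
    positive_cone pos -> all_pos pos X ->
    cvar (mutations (Seed X B4) (map tlab mus')) (tlab k') =
      mon X gam' * segprod (tmV i0) tlab X * ssum rot (treg rot opp reg d0)
      (kept (topp rot opp reg d0) (treg rot opp reg d0) (tmV i0)) (omega rot tlab X tnu) cs [::]) ->
  exists2 gam : I -> int, forall d, gam (lab d) = 0 &
  forall cs, crossings rot cs -> forall (K : fieldType) (pos : K -> Prop) (X : I -> K),
    positive_cone pos -> all_pos pos X ->
    cvar (mutations (Seed X B)
      (map lab ([:: d1; d2; d0; d1] ++ [seq swd (tm x) | x <- mus']))) (lab (swd (tm k'))) =
      mon X gam * segprod i0 lab X * ssum rot reg (kept opp reg i0) (omega rot lab X nu) cs [::].
Proof.
move=> g0' val; have g0 u : lb u -> gam' u = 0.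
  by rewrite -codom_tlab => /codomP[x ->].
exists (fun u => gam' u + (th d0 u + th d1 u + th d2 u
     + (nu d0 u + nu (r3 d0) u + nu d1 u + nu (r3 d1) u + nu d2 u + nu (r3 d2) u))).
  by move=> d; rewrite g0 ?lbT // !th_lb ?lbT // !nu_lb ?lbT.
move=> cs cc K pos X cone Xp.
have X4p : all_pos pos (cvar (ms4 B a b c X)) by do 4!apply: (mutate_pos cone).
rewrite -(step_value cone Xp cc g0) -(val cs cc K pos _ cone X4p).
by rewrite /mutations map_cat foldl_cat -map_comp.
Qed.

End Labelled.

End TriangleStep.

Lemma triangle_computed (D J : finType) (rot opp : D -> D) (reg : D -> J)
    (lev : J -> nat) (i0 : D) (Dg : diagram rot opp reg lev i0) (D4 : (4 < #|D|)%N) d0 :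
  triangle_at rot opp d0 -> reg d0 <> reg i0 -> reg d0 <> reg (opp i0) ->
  (forall e f, reg e = reg d0 -> reg f = reg (opp e) -> ~~ bigon_at rot opp f) ->
  computed rot (topp rot opp reg d0) (treg rot opp reg d0) (tmoveV rot opp reg d0 i0) ->
  computed rot opp reg i0.
Proof.
move=> tri t0 t1 nb [mus' [k' H]]; set d1 := fnext rot opp d0; set d2 := fnext rot opp d1.
exists ([:: d1; d2; d0; d1] ++ [seq swd opp d0 d2 (tmove rot opp reg d0 x) | x <- mus']).
exists (swd opp d0 d2 (tmove rot opp reg d0 k')) => I lab B nu Fr.
have [gam' g0 val] := H _ _ _ _
  (framed_triangle Dg D4 tri t0 t1 nb (erefl d1) (erefl d2) Fr).
exact: (triangle_value Dg D4 tri t0 t1 nb (erefl d1) (erefl d2) Fr g0 val).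
Qed.

(** * Every kept corner lies in a state *)

Lemma linear_inj_card (F : fieldType) (P Q : finType) (M : P -> Q -> F) :
  (forall v : P -> F, (forall q, \sum_p v p * M p q = 0) -> forall p, v p = 0) ->
  (#|P| <= #|Q|)%N.
Proof.
move=> inj; pose A : 'M[F]_(#|P|, #|Q|) := \matrix_(i, j) M (enum_val i) (enum_val j).
suff /eqP <- : row_free A by apply: rank_leq_col.
rewrite -kermx_eq0; apply/eqP/row_matrixP => i; rewrite row0.
have : row i (kermx A) *m A = 0 by rewrite -row_mul mulmx_ker row0.
move: (row i _) => w wA; apply/rowP => j; rewrite mxE.
have := inj (fun p => w 0 (enum_rank p)) _ (enum_val j); rewrite enum_valK; apply=> q.
have /rowP/(_ (enum_rank q)) := wA; rewrite !mxE => e; apply: etrans e.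
rewrite (reindex _ (onW_bij _ (@enum_val_bij P))) /=; apply: eq_bigr => k _.
by rewrite enum_valK !mxE enum_rankK.
Qed.

(** * Cuts of a prime diagram and a bound for sets of regions *)

Section Cuts.
Variables (D J : finType) (rot opp : D -> D) (reg : D -> J) (lev : J -> nat) (i0 : D).
Hypothesis Dg : diagram rot opp reg lev i0.
Let rotK := rot4 Dg.
Let oppK := dopK Dg.
Local Notation r2 d := (rot (rot d)).
Local Notation r3 d := (rot (rot (rot d))).
Local Notation nx := (fnext rot opp).
Local Notation pv := (fprev rot opp).

Definition rot_closed (C : {set D}) := forall x, (rot x \in C) = (x \in C).
Definition cut (C : {set D}) := [set x in C | opp x \notin C].
Definition inside (C : {set D}) := [set x in C | opp x \in C].
Definition half (C : {set D}) :=
  [set x in inside C | (enum_rank x < enum_rank (opp x))%N].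

Lemma opp_neq_self x : opp x != x.
Proof. by apply: contraNneq (reg_opp_neq Dg x) => ->. Qed.

Lemma card_half C : #|inside C| = (2 * #|half C|)%N.
Proof.
have oi : injective opp by apply: inv_inj.
rewrite mul2n -addnn -[X in (_ + X)%N](card_imset _ oi).
have -> : opp @: half C = inside C :\: half C.
  apply/setP => x; rewrite !inE; apply/imsetP/idP => [[y]|].
    rewrite !inE => /andP[/andP[yC oyC] lt] ->; rewrite oppK oyC yC /= andbT.
    by rewrite -leqNgt ltnW.
  case/andP=> nh /andP[xC oxC]; exists (opp x); rewrite ?oppK // !inE oppK oxC xC /=.
  move: nh; rewrite xC oxC /= -leqNgt leq_eqVlt => /orP[/eqP/val_inj/enum_rank_inj e|//].
  by have := opp_neq_self x; rewrite e eqxx.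
rewrite cardsD (setIidPr _) ?subnKC //; last by apply/subsetP => x; rewrite !inE => /andP[].
by apply/subset_leq_card/subsetP => x; rewrite !inE => /andP[].
Qed.

Lemma card_cut C : (#|cut C| + 2 * #|half C|)%N = #|C|.
Proof.
rewrite -card_half -cardsUI (_ : _ :&: _ = set0) ?cards0 ?addn0.
  by apply: eq_card => x; rewrite !inE; case: (x \in C); case: (opp x \in C).
by apply/setP => x; rewrite !inE; case: (x \in C); case: (opp x \in C).
Qed.

Definition rep x := froot rot x.

Let rsym : connect_sym (frel rot). Proof. exact: fconnect_sym (drot_inj Dg). Qed.

Lemma rep_rot x : rep (rot x) = rep x.
Proof. by apply/esym/eqP; rewrite (root_connect rsym) fconnect1. Qed.

Lemma rep_orb x y : (rep x == rep y) = (y \in orb rot x).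
Proof.
rewrite (root_connect rsym); apply/idP/idP => [|yx].
  have cl : closed (frel rot) (mem (orb rot x)).
    move=> z _ /eqP <-; rewrite !inE; have ri := inj_eq (drot_inj Dg).
    have -> : (rot z == x) = (z == r3 x) by rewrite -{1}(rotK x) ri.
    by rewrite !ri [RHS]orbC -!orbA.
  by move=> c; rewrite -(closed_connect cl c) mem_head.
have h z : fconnect rot x z -> fconnect rot x (rot z).
  by move=> c; apply: connect_trans c (fconnect1 _ _).
have h0 := connect0 (frel rot) x; have h1 := h _ h0; have h2 := h _ h1.
have h3 := h _ h2; by move: yx; rewrite !inE => /or4P[] /eqP ->.
Qed.

Lemma rep_idem x : rep (rep x) = rep x. Proof. exact: root_root rsym x. Qed.

Definition reps (C : {set D}) := [set x in C | rep x == x].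

Lemma rep_closed C x : rot_closed C -> (rep x \in C) = (x \in C).
Proof.
move=> Cr; have : rep x \in orb rot x by rewrite -rep_orb rep_idem.
by rewrite !inE => /or4P[] /eqP ->; rewrite ?Cr.
Qed.

Lemma card_reps C : rot_closed C -> #|C| = (4 * #|reps C|)%N.
Proof.
move=> Cr; rewrite -sum1_card (partition_big rep (mem (reps C))) /=; last first.
  by move=> x xC; rewrite !inE rep_closed // xC rep_idem eqxx.
rewrite (eq_bigr (fun=> 4%N)) => [|z]; first by rewrite sum_nat_const mulnC.
rewrite !inE => /andP[zC /eqP rz].
have /card_uniqP e4 := orb_uniq rotK (rot2_neq Dg) z.
rewrite sum1_card -[RHS]/(size (orb rot z)) -e4.
apply: eq_card => x; rewrite -rep_orb rz [in RHS]eq_sym.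
rewrite unfold_in; case: eqP => [e|]; rewrite ?andbF //.
by rewrite andbT -rep_closed // e zC.
Qed.

(* Along the boundary of a region, the set is left as often as it is entered. *)
Lemma cut_next C x : rot_closed C -> x \in cut C ->
  exists2 y, y \in cut C & reg (opp y) = reg x.
Proof.
move=> Cr; rewrite inE => /andP[xC oxC].
case: (boolP [exists y, (y \in cut C) && (reg (opp y) == reg x)]) => [/existsP[y /andP[h /eqP]]|].
  by exists y.
rewrite negb_exists => /forallP no.
have bw y : reg y = reg x -> (y \in C) -> pv y \in C.
  move=> ry yC; have := no (rot y); rewrite !inE Cr yC /= -/(pv y) (reg_fprev Dg) ry eqxx andbT.
  by rewrite negbK.
have : nx x \in C.
  have /connectP[p] : fconnect (opp \o rot) x (nx x) by apply: (reg_conn Dg); rewrite (reg_fnext Dg).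
  have aux y : y \in C -> reg y = reg x -> fpath (opp \o rot) y p -> last y p \in C.
    elim: p y => //= z p IH y yC ry /andP[/eqP <- pp]; apply: IH => //; first exact: bw.
    by rewrite (reg_back Dg).
  by move=> pp ->; apply: aux.
by rewrite /fnext !Cr (negbTE oxC).
Qed.

(** Walking along the regions that meet the cut gives three darts of it, which are distinct because
    [reg_prime] forbids a closed curve with two crossings. The size of the cut is even, since [C]
    consists of whole crossings, of four darts each. *)
Lemma cut_ge4 C : rot_closed C -> C != set0 -> C != setT -> (4 <= #|cut C|)%N.
Proof.
move=> Cr /set0Pn[x0 x0C] /eqP CT.
have [x xc] : exists x, x \in cut C.
  apply/existsP; apply: contraT; rewrite negb_exists => /forallP no; case: CT.
  apply/setP => y; rewrite inE -x0C.
  apply: (diagram_conn Dg (P := [pred y | y \in C])) => z /=; first exact: Cr.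
  have := no z; have := no (opp z); rewrite !inE oppK.
  by case: (z \in C); case: (opp z \in C).
have [x1 x1c e1] := cut_next Cr xc; have [x2 x2c e2] := cut_next Cr x1c.
have d1 u v : u \in cut C -> reg (opp v) = reg u -> u != v.
  by move=> _ e; apply/eqP => uv; have := reg_opp_neq Dg v; rewrite e uv eqxx.
have n01 : x != x1 by apply: d1.
have n12 : x1 != x2 by apply: d1.
have n02 : x != x2.
  apply/eqP => e; rewrite -e in e2 *; have := reg_prime Dg (esym e1).
  rewrite oppK => /(_ e2) e3; move: xc x1c; rewrite e3 !inE oppK.
  by case: (x1 \in C); case: (opp x1 \in C).
have c3 : (3 <= #|cut C|)%N.
  have /card_uniqP /= <- : uniq [:: x; x1; x2] by rewrite /= !inE negb_or n01 n12 n02.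
  by apply/subset_leq_card/subsetP => y; rewrite !inE => /or3P[] /eqP ->; move: xc x1c x2c; rewrite !inE.
have := card_cut C; have := card_reps Cr; lia.
Qed.

Section Bound.
Variables (N : {set D}) (R : {set J}).
Hypothesis Nr : rot_closed N.
Hypothesis N0 : N != set0.
Hypothesis NT : N != setT.
Hypothesis RN : forall x, reg x \in R -> x \in N.
Hypothesis Rreg : forall r, r \in R -> exists x, reg x = r.
Hypothesis Rroot : reg i0 \notin R.

Let e x y := (y \in orb rot x) || [&& y == opp x, x \in N & y \in N].

Let e_sym x y : e x y = e y x.
Proof.
rewrite /e -!rep_orb eq_sym; congr (_ || _).
have <- : (y == opp x) = (x == opp y) by apply/eqP/eqP => ->; rewrite oppK.
by rewrite [(y \in N) && _]andbC.
Qed.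

Let cs : connect_sym e. Proof. exact: sym_connect_sym e_sym. Qed.

Let N_e x y : e x y -> (x \in N) = (y \in N).
Proof.
case/orP => [|/and3P[_ -> -> //]].
by rewrite !inE => /or4P[] /eqP ->; rewrite ?Nr.
Qed.

Let clN : closed e (mem N). Proof. by move=> x y /N_e. Qed.

Let croots := [set x in N | fingraph.root e x == x].
Let comp r := [set x in N | fingraph.root e x == r].

Let comp_rot r : rot_closed (comp r).
Proof.
move=> x; rewrite !inE Nr; congr (_ && (_ == _)); apply/esym/eqP.
by rewrite (root_connect cs); apply: connect1; rewrite /e !inE eqxx orbT.
Qed.

Let comp_cut r : cut (comp r) \subset cut N.
Proof.
apply/subsetP => x; rewrite !inE => /andP[/andP[xN rx]]; rewrite xN /=; apply: contra => oN.
rewrite oN -(eqP rx) (root_connect cs) cs connect1 //.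
by rewrite /e eqxx xN oN orbT.
Qed.

Let card_croots : (4 * #|croots| <= #|cut N|)%N.
Proof.
have -> : #|cut N| = (\sum_(r in croots) #|[set x in cut N | fingraph.root e x == r]|)%N.
  rewrite -sum1_card (partition_big (fingraph.root e) (mem croots)) /=.
    by apply: eq_bigr => r _; rewrite -sum1_card; apply: eq_bigl => x; rewrite !inE.
  move=> x; rewrite !inE => /andP[xN _]; rewrite (root_root cs) eqxx andbT.
  by rewrite -(closed_connect clN (connect_root _ x)).
rewrite mulnC -sum_nat_const; apply: leq_sum => r; rewrite inE => /andP[rN rr].
apply: (@leq_trans #|cut (comp r)|).
  apply: cut_ge4; first exact: comp_rot.
    by apply/set0Pn; exists r; rewrite inE rN rr.
  apply: contraNneq NT => e'; apply/eqP/setP => x; have := in_setT x.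
  by rewrite -e' !inE => /andP[->].
apply/subset_leq_card/subsetP => x xc; rewrite !inE.
have := subsetP (comp_cut r) _ xc; rewrite !inE => /andP[-> ->].
by move: xc; rewrite !inE => /andP[/andP[]].
Qed.

Let Pt := ({r : J | r \in R} + {x : D | x \in reps N})%type.
Let Qt := ({x : D | x \in half N} + {x : D | x \in croots})%type.

Let M (p : Pt) (q : Qt) : rat := match p, q with
  | inl r, inl x => (reg (val x) == val r)%:R - (reg (opp (val x)) == val r)%:R
  | inr z, inl x => (rep (val x) == val z)%:R - (rep (opp (val x)) == val z)%:R
  | inl _, inr _ => 0
  | inr z, inr x => (rep (val x) == val z)%:R
  end.

(** Consider the linear map [M] that sends functions [f] on [R] and [g] on the crossings of [N] to
    the sums of their differences across the segments inside [N], together with one value of [g] on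
    each component of [N]. On its kernel [f] and [g] are conjugate, as in the Cauchy-Riemann
    equations, so the gradient of [f] has norm zero and the map is injective. As every component has
    at least four darts in the cut, comparing dimensions gives [4 * #|R| + #|cut N| <= #|N|]. *)
Lemma region_bound : (4 * #|R| < #|N|)%N.
Proof.
suff : (#|{: Pt}| <= #|{: Qt}|)%N.
  rewrite !card_sum !card_sig; have := card_croots; have := card_cut N.
  have := card_reps Nr; have := cut_ge4 Nr N0 NT.
  have cE (T : finType) (A : {set T}) : #|[pred x in A]| = #|A| by apply: eq_card.
  rewrite !cE; lia.
apply: (@linear_inj_card rat Pt Qt M) => v ve.
pose f r : rat := if insub r is Some r' then v (inl r') else 0.
pose g x : rat := if insub (rep x) is Some z then v (inr z) else 0.
have fE r : \sum_(r' : {r : J | r \in R}) v (inl r') * (r == val r')%:R = f r.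
  rewrite /f; case: insubP => [r' rR e'|nR].
    rewrite (bigD1 r') //= e' eqxx mulr1 big1 ?addr0 // => s; rewrite -val_eqE /= e' eq_sym.
    by move/negbTE=> ->; rewrite mulr0.
  apply: big1 => s _; case: eqP => [e'|]; rewrite ?mulr0 //.
  by rewrite e' (valP s) in nR.
have gE x : \sum_(z : {x : D | x \in reps N}) v (inr z) * (rep x == val z)%:R = g x.
  rewrite /g; case: insubP => [r' rR e'|nR].
    rewrite (bigD1 r') //= e' eqxx mulr1 big1 ?addr0 // => s; rewrite -val_eqE /= e' eq_sym.
    by move/negbTE=> ->; rewrite mulr0.
  apply: big1 => s _; case: eqP => [e'|]; rewrite ?mulr0 //.
  by rewrite e' (valP s) in nR.
have g_rot x : g (rot x) = g x by rewrite /g rep_rot.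
have g_off x : x \notin N -> g x = 0.
  move=> xN; rewrite /g insubF //; apply: contraNF xN; rewrite inE => /andP[].
  by rewrite rep_closed.
have f_off r : r \notin R -> f r = 0 by move=> rR; rewrite /f insubF //; apply: negbTE.
pose h x := f (reg x) - f (reg (opp x)).
have eqh x : x \in inside N -> h x = g (opp x) - g x.
  have eq1 y : y \in half N -> h y = g (opp y) - g y.
    move=> yh; have := ve (inl (exist _ y yh)); rewrite big_sumType /=.
    under eq_bigr => r _ do rewrite mulrBr.
    under [X in _ + X]eq_bigr => r _ do rewrite mulrBr.
    rewrite !sumrB !fE !gE /h => /eqP; rewrite addr_eq0 opprB => /eqP.
    by [].
  move=> xi; case: (ltngtP (enum_rank x) (enum_rank (opp x))) => lt.
  - by apply: eq1; rewrite inE xi.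
  - have /eq1 : opp x \in half N by rewrite !inE oppK lt andbT; move: xi; rewrite !inE andbC.
    by rewrite /h oppK => e1; rewrite -opprB e1 opprB.
  - by have := opp_neq_self x; rewrite (enum_rank_inj (val_inj (esym lt))) eqxx.
have far x : x \notin N -> f (reg x) = 0 /\ f (reg (opp x)) = 0.
  move=> xN; split; apply: f_off; apply: contra xN; first exact: RN.
  by rewrite -(reg_r3 Dg) => /RN; rewrite !Nr.
have h_out x : x \notin inside N -> h x = 0.
  rewrite /h inE negb_and => /orP[/far[-> ->]|/far[]]; first by rewrite subrr.
  by rewrite oppK => -> ->; rewrite subrr.
(* Around a crossing [g] is constant and the differences [h] telescope. *)
have sum0 : \sum_x h x * g x = 0.
  under eq_bigr => x _ do rewrite /h -(reg_r3 Dg) mulrBl.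
  rewrite sumrB; apply/eqP; rewrite subr_eq0; apply/eqP.
  have r3i : injective (fun x => r3 x) by move=> x y /(drot_inj Dg)/(drot_inj Dg)/(drot_inj Dg).
  by rewrite (reindex_inj r3i) /=; apply: eq_bigr => x _; rewrite !g_rot.
(* One factor [h] is replaced by the difference of [g]; since [h] is odd under [opp], both parts
   reduce to [sum0]. Rational coefficients turn the vanishing sum of squares into [h = 0]. *)
have sumh2 : \sum_x h x ^+ 2 = 0.
  have oi : injective opp by apply: inv_inj.
  have -> : \sum_x h x ^+ 2 = \sum_x h x * (g (opp x) - g x).
    apply: eq_bigr => x _; case: (boolP (x \in inside N)) => [/eqh <-|/h_out ->] //.
    by rewrite expr2 !mul0r.
  under eq_bigr => x _ do rewrite mulrBr.
  rewrite sumrB sum0 subr0 (reindex_inj oi) /=.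
  have -> : \sum_x h (opp x) * g (opp (opp x)) = - \sum_x h x * g x.
    by rewrite -sumrN; apply: eq_bigr => x _; rewrite oppK /h oppK -mulNr opprB.
  by rewrite sum0 oppr0.
have h0 x : h x = 0.
  have := sumh2 => /eqP; rewrite psumr_eq0; last by move=> *; apply: sqr_ge0.
  by move/allP/(_ x (mem_index_enum _)); rewrite implyTb sqrf_eq0 => /eqP.
have F0 x : f (reg x) = 0.
  pose P := [pred y | f (reg y) == 0].
  have Po y : P (opp y) = P y.
    by rewrite /P /=; have /eqP := h0 y; rewrite subr_eq0 => /eqP ->.
  have Pr y : P (rot y) = P y by rewrite -Po /P /= (reg_back Dg).
  by apply/eqP; rewrite -[_ == 0]/(P x) (diagram_conn Dg Pr Po x i0) /P /= f_off.
have g_e x y : e x y -> g x = g y.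
  case/orP => [|/and3P[/eqP -> xN oN]].
    by rewrite !inE => /or4P[] /eqP ->; rewrite ?g_rot.
  have /eqh : x \in inside N by rewrite inE xN.
  by rewrite h0 => /esym/eqP; rewrite subr_eq0 => /eqP.
have g_c x y : connect e x y -> g x = g y.
  case/connectP=> p; elim: p x => [|z p IH] x /=; first by move=> _ ->.
  by case/andP=> /g_e -> pp /IH; apply.
have G0 x : x \in N -> g x = 0.
  move=> xN; rewrite (g_c _ _ (connect_root e x)).
  have rin : fingraph.root e x \in croots.
    by rewrite inE (root_root cs) eqxx andbT -(closed_connect clN (connect_root _ x)).
  have := ve (inr (exist (fun x => x \in croots) _ rin)); rewrite big_sumType /= gE.
  by rewrite big1 ?add0r // => r _; rewrite mulr0.
case=> [r|z].
  have [x xr] := Rreg (valP r); have := F0 x; rewrite xr /f.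
  by case: insubP => [r' _ /val_inj -> //|]; rewrite (valP r).
have zN : val z \in N by have := valP z; rewrite inE => /andP[].
have := G0 _ zN; rewrite /g; have /andP[_ /eqP ->] : (val z \in N) && (rep (val z) == val z).
  by have := valP z; rewrite inE.
by case: insubP => [r' _ /val_inj -> //|]; rewrite (valP z).
Qed.

End Bound.
End Cuts.

(** * States as sets of corners *)

Section StateSets.
Variables (D J : finType) (rot : D -> D) (reg : D -> J) (ks : seq J).
Hypothesis rotK : forall d, rot (rot (rot (rot d))) = d.
Hypothesis uks : uniq ks.
Hypothesis ksreg : forall r, r \in ks -> exists d, reg d = r.

Record is_state (S : {set D}) : Prop := IsState {
  state_kept : forall x, x \in S -> reg x \in ks;
  state_ex : forall d, exists2 x, x \in S & x \in orb rot d;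
  state_inj : forall x y, x \in S -> y \in S -> y \in orb rot x -> x = y;
  state_reg_inj : forall x y, x \in S -> y \in S -> reg x = reg y -> x = y;
  state_reg_ex : forall r, r \in ks -> exists2 x, x \in S & reg x = r }.

(** Shaped like [perfect_matching], with which it is compared conjunct by conjunct. *)
Definition stateb (S : {set D}) := [&& [forall d in S, reg d \in ks],
  [forall d, #|S :&: [set x in orb rot d]| == 1%N] &
  [forall d, (reg d \in ks) ==> (#|S :&: [set x | reg x == reg d]| == 1%N)]].

Lemma orb_in x y z : y \in orb rot x -> (z \in orb rot y) = (z \in orb rot x).
Proof. by move=> /(orb_mem rotK)/perm_mem ->. Qed.

Lemma orb_sym x y : (x \in orb rot y) = (y \in orb rot x).
Proof.
by apply/idP/idP => h; [rewrite (orb_in _ h) | rewrite (orb_in _ h)]; rewrite mem_head.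
Qed.

Lemma stateP S : reflect (is_state S) (stateb S).
Proof.
apply: (iffP and3P) => [[/forallP h1 /forallP h2 /forallP h3]|[h1 h2 h3 h4 h5]].
  have g1 x : x \in S -> reg x \in ks by move=> xS; apply: (implyP (h1 x)).
  have g3 x : reg x \in ks -> #|S :&: [set y | reg y == reg x]| = 1%N.
    by move=> xk; apply/eqP/(implyP (h3 x)).
  split=> // [d|x y xS yS yx|x y xS yS e|r rk].
  - have /eqP/eqP/cards1P[x e] := h2 d; exists x;
      by have := set11 x; rewrite -e !inE => /andP[].
  - have /eqP/eqP/cards1P[z e] := h2 x.
    have : x \in S :&: [set y in orb rot x] by rewrite inE xS inE mem_head.
    have : y \in S :&: [set y in orb rot x] by rewrite inE yS inE.
    by rewrite e !inE => /eqP -> /eqP.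
  - have /eqP/cards1P[z ez] := g3 x (g1 x xS).
    have : x \in S :&: [set y | reg y == reg x] by rewrite !inE xS eqxx.
    have : y \in S :&: [set y | reg y == reg x] by rewrite !inE yS e eqxx.
    by rewrite ez !inE => /eqP -> /eqP.
  - have [d dr] := ksreg rk; rewrite -dr in rk *.
    have /eqP/cards1P[z ez] := g3 d rk; have := set11 z; rewrite -ez !inE.
    by case/andP=> zS /eqP zr; exists z.
split; apply/forallP => d.
- by apply/implyP; apply: h1.
- have [x xS xd] := h2 d; apply/eqP/eqP/cards1P; exists x; apply/setP => y.
  rewrite in_setI in_set in_set1; apply/andP/eqP => [[yS yd]|->]; last by rewrite xS.
  by apply/esym/h3 => //; rewrite (orb_in _ xd).
- apply/implyP => dk; have [x xS xd] := h5 _ dk; apply/cards1P; exists x; apply/setP => y.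
  rewrite !inE; apply/andP/eqP => [[yS /eqP yd]|->]; last by rewrite xS xd.
  by apply: h4; rewrite ?yd.
Qed.

Lemma choices_sub cs s : s \in choices rot cs -> {subset s <= flatten [seq orb rot c | c <- cs]}.
Proof.
elim: cs s => [|c cs IH] s; first by rewrite inE => /eqP ->.
rewrite choices_cons flatten_orb => /allpairsPdep[a [s' [ac /IH ss ->]]] x.
by rewrite inE mem_cat => /predU1P[->|/ss ->]; rewrite ?ac ?orbT.
Qed.

Lemma choices_filter cs s c : uniq (flatten [seq orb rot c | c <- cs]) ->
  s \in choices rot cs -> c \in cs ->
  exists2 a, a \in s & [seq x <- orb rot c | x \in s] = [:: a].
Proof.
elim: cs s => [|c0 cs IH] s //; rewrite choices_cons flatten_orb cat_uniq.
case/and3P=> u0 dj ucs /allpairsPdep[a [s' [ac s's ->]]]; have sub := choices_sub s's.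
have dj' x : x \in orb rot c0 -> x \notin flatten [seq orb rot c | c <- cs].
  by move=> x0; apply: contra dj => xf; apply/hasP; exists x.
rewrite inE => /predU1P[->|cc].
  exists a; rewrite ?mem_head // (@eq_in_filter _ _ (pred1 a)) ?filter_pred1_uniq //.
  move=> x xc; rewrite inE /=; case: eqP => //= _; apply: contraNF (dj' x xc); exact: sub.
have [b bs e] := IH _ ucs s's cc; exists b; first by rewrite inE bs orbT.
rewrite -e; apply: eq_in_filter => x xc; rewrite inE; case: eqP => // xa.
have := dj' a ac; rewrite -xa => /negP[]; apply/flattenP; exists (orb rot c) => //.
exact: map_f.
Qed.

Lemma choices_pick cs s : uniq (flatten [seq orb rot c | c <- cs]) ->
  s \in choices rot cs -> s = [seq head c [seq x <- orb rot c | x \in s] | c <- cs].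
Proof.
elim: cs s => [|c0 cs IH] s; first by rewrite inE => _ /eqP ->.
move=> u sc; have [a0 _ e0] := choices_filter u sc (mem_head _ _).
move: u sc; rewrite choices_cons flatten_orb cat_uniq.
case/and3P=> u0 dj ucs /allpairsPdep[a [s' [ac s's es]]]; rewrite es in e0 *.
rewrite map_cons; congr (_ :: _).
  have : a \in [seq x <- orb rot c0 | x \in a :: s'] by rewrite mem_filter ac mem_head.
  by rewrite e0 inE => /eqP.
rewrite {1}(IH _ ucs s's); apply/eq_in_map => c cc; congr (head _ _).
apply: eq_in_filter => x xc; rewrite inE; case: eqP => // xa; case/negP: dj.
apply/hasP; exists x; last by rewrite xa.
by apply/flattenP; exists (orb rot c) => //; apply: map_f.
Qed.

Lemma choices_uniq cs : uniq (flatten [seq orb rot c | c <- cs]) -> uniq (choices rot cs).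
Proof.
elim: cs => // c cs IH; rewrite choices_cons flatten_orb cat_uniq => /and3P[u0 _ /IH u].
by apply: (allpairs_uniq u0 u) => -[a s] [b s'] _ _ /= [-> ->].
Qed.

Lemma choices_mem_uniq cs s : uniq (flatten [seq orb rot c | c <- cs]) ->
  s \in choices rot cs -> uniq s.
Proof.
elim: cs s => [|c cs IH] s; first by rewrite inE => _ /eqP ->.
rewrite choices_cons flatten_orb cat_uniq.
case/and3P=> _ dj u /allpairsPdep[a [s' [ac s's ->]]]; rewrite /= (IH _ u s's) andbT.
by apply: contra dj => /(choices_sub s's) as'; apply/hasP; exists a.
Qed.

Lemma choices_state cs s : crossings rot cs -> s \in choices rot cs ->
  stateb [set x in s] = perm_eq [seq reg x | x <- s] ks.
Proof.
move=> cc sc; have uf : uniq (flatten [seq orb rot c | c <- cs]).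
  by rewrite (perm_uniq cc) enum_uniq.
have us := choices_mem_uniq uf sc.
apply/stateP/idP => [[h1 h2 h3 h4 h5]|p].
  apply: uniq_perm => //.
    by rewrite map_inj_in_uniq // => x y xs ys; apply: h4; rewrite inE.
  move=> r; apply/mapP/idP => [[x xs ->]|/h5[x]]; first by apply: h1; rewrite inE.
  by rewrite inE => xs <-; exists x.
have fl d : exists a, [/\ a \in s, a \in orb rot d & forall x, x \in s -> x \in orb rot d -> x = a].
  have [c c1 dc] := crossings_mem d cc; have [a as' e] := choices_filter uf sc c1.
  have mE x : (x \in s) && (x \in orb rot d) = (x == a).
    by rewrite (orb_in _ dc) -mem_filter e inE.
  exists a; have := mE a; rewrite eqxx => /andP[-> ->]; split=> // x xs xd.
  by apply/eqP; rewrite -mE xs.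
have ur : uniq [seq reg x | x <- s] by rewrite (perm_uniq p).
split=> [x|d|x y|x y|r].
- by rewrite inE => xs; rewrite -(perm_mem p) map_f.
- by have [a [as' ad _]] := fl d; exists a; rewrite // in_set.
- rewrite !in_set => xs ys yx; have [a [_ _ h]] := fl x.
  by rewrite (h x) ?mem_head // (h y).
- rewrite !in_set => xs ys e; have le : (size s <= size [seq reg x | x <- s])%N by rewrite size_map.
  have [i il ei] := (nthP x xs); have [j jl ej] := (nthP x ys); rewrite -ei -ej in e *.
  congr nth; apply/eqP; rewrite -(nth_uniq (reg x) _ _ ur) ?size_map //.
  by rewrite !(nth_map x) // e.
- by rewrite -(perm_mem p) => /mapP[x xs ->]; exists x; rewrite ?inE.
Qed.

Lemma state_choices cs S : crossings rot cs -> is_state S ->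
  exists2 s, s \in choices rot cs & S = [set x in s].
Proof.
move=> cc [h1 h2 h3 h4 h5].
pose pk d := odflt d [pick x | (x \in S) && (x \in orb rot d)].
have pkP d : pk d \in S /\ pk d \in orb rot d.
  rewrite /pk; case: pickP => [x /andP[] //|no].
  by have [x xS xd] := h2 d; have := no x; rewrite xS xd.
exists [seq pk c | c <- cs].
  apply/choicesP; split=> [|x y i i_lt]; first by rewrite size_map.
  by rewrite (nth_map y) //; case: (pkP (nth y cs i)).
apply/setP => x; rewrite inE; apply/idP/mapP => [xS|[c _ ->]]; last by case: (pkP c).
have [c c1 xc] := crossings_mem x cc; exists c => //; have [pS pc] := pkP c.
by apply: h3 => //; rewrite (orb_in _ xc).
Qed.

Lemma ssum_state (K : fieldType) (om : D -> K) cs : crossings rot cs ->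
  ssum rot reg ks om cs [::] = \sum_(S : {set D} | stateb S) \prod_(d in S) om d.
Proof.
move=> cc; have uf : uniq (flatten [seq orb rot c | c <- cs]).
  by rewrite (perm_uniq cc) enum_uniq.
rewrite ssum_choices; under eq_bigl => s do rewrite cats0.
rewrite -big_filter; set L := filter _ _.
have LP s : s \in L = (s \in choices rot cs) && stateb [set x in s].
  by rewrite mem_filter andbC; case: (boolP (s \in choices rot cs)) => //= /(choices_state cc) ->.
have -> : \sum_(s <- L) \prod_(a <- s) om a =
    \sum_(S <- [seq [set x in s] | s : seq D <- L]) \prod_(d in S) om d.
  rewrite big_map; apply: eq_big_seq => s; rewrite LP => /andP[/(choices_mem_uniq uf) us _].
  rewrite big_uniq //=; by apply: eq_bigl => x; rewrite inE.
rewrite -[RHS]big_filter; apply: perm_big; apply: uniq_perm.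
- rewrite map_inj_in_uniq ?filter_uniq ?choices_uniq // => s s'; rewrite !LP.
  move=> /andP[sc _] /andP[sc' _] /setP e; rewrite (choices_pick uf sc) (choices_pick uf sc').
  by apply: eq_map => c; congr (head _ _); apply: eq_filter => x; have := e x; rewrite !inE.
- by rewrite filter_uniq ?index_enum_uniq.
- move=> S; rewrite mem_filter mem_index_enum andbT; apply/mapP/idP => [[s]|/stateP sS].
    by rewrite LP => /andP[_ st] ->.
  have [s sc e] := state_choices cc sS; exists s => //; rewrite LP sc -e.
  exact/stateP.
Qed.

End StateSets.

(** * Exchange along alternating paths *)

Section Exchange.
Variables (D J : finType) (rot opp : D -> D) (reg : D -> J) (lev : J -> nat) (i0 : D).
Hypothesis Dg : diagram rot opp reg lev i0.
Let rotK := rot4 Dg.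
Let ks := kept opp reg i0.
Local Notation orb := (orb rot).

Lemma kept_mem r : (r \in ks) = [&& r != reg (opp i0), r != reg i0 & r \in [set reg d | d : D]].
Proof. by rewrite mem_enum !inE. Qed.

Lemma kept_uniq : uniq ks. Proof. exact: enum_uniq. Qed.

Lemma kept_reg r : r \in ks -> exists d, reg d = r.
Proof. by rewrite kept_mem => /and3P[_ _ /imsetP[d _ ->]]; exists d. Qed.

Lemma reg_kept d : (reg d \in ks) = (reg d != reg (opp i0)) && (reg d != reg i0).
Proof. by rewrite kept_mem imset_f // andbT. Qed.

Variable c0 : D.

(* A state with one crossing and one region left unmatched. *)
Record near (N : {set D}) (r : J) : Prop := Near {
  near1 : forall x, x \in N -> [/\ x \notin orb c0, reg x \in ks & reg x != r];
  near2 : forall d, d \notin orb c0 -> exists2 x, x \in N & x \in orb d;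
  near3 : forall x y, x \in N -> y \in N -> y \in orb x -> x = y;
  near4 : forall x y, x \in N -> y \in N -> reg x = reg y -> x = y;
  near5 : forall r', r' \in ks -> r' != r -> exists2 x, x \in N & reg x = r' }.

Let orbE := orb_in rotK.
Let orbS := orb_sym rotK.

(** A step of an alternating path: the unmatched region is served at [y], and the corner [n] of the
    same crossing is given up, so that its region becomes the unmatched one. *)
Lemma near_move N r y n : near N r -> r \in ks -> y \notin orb c0 -> reg y = r ->
  n \in N -> n \in orb y -> near (y |: N :\ n) (reg n).
Proof.
case=> h1 h2 h3 h4 h5 rk yc yr nN ny; have [nc nk nr] := h1 n nN.
split=> [x|d dc|x z|x z|r' r'k r'n].
- rewrite !(in_setU1, in_setD1) => /predU1P[->|/andP[xn xN]]; first by split; rewrite ?yr // eq_sym.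
  have [xc xk xr] := h1 x xN; split=> //; apply: contraNneq xn => e; apply/eqP.
  exact: h4.
- have [x xN xd] := h2 d dc; have [e|xn] := eqVneq x n.
    exists y; rewrite ?setU11 //; rewrite -(orbE _ xd) e -(orbS) //.
  by exists x; rewrite // in_setU1 in_setD1 xn xN orbT.
- rewrite !(in_setU1, in_setD1) => /predU1P[->|/andP[xn xN]] /predU1P[->|/andP[zn zN]] //.
  + by move=> zy; case/eqP: zn; apply: h3 => //; rewrite orbS (orbE _ ny).
  + move=> yx; case/eqP: xn; apply: h3 => //.
    by rewrite -(orbE _ yx).
  + exact: h3.
- rewrite !(in_setU1, in_setD1) => /predU1P[->|/andP[xn xN]] /predU1P[->|/andP[zn zN]] //.
  + by move=> e; have [_ _] := h1 z zN; rewrite -e yr eqxx.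
  + by move=> e; have [_ _] := h1 x xN; rewrite e yr eqxx.
  + exact: h4.
- have [->|r'r] := eqVneq r' r; first by exists y; rewrite ?setU11.
  have [x xN xr] := h5 r' r'k r'r; exists x => //; rewrite in_setU1 in_setD1 xN andbT.
  by apply/orP; right; apply: contraNneq r'n => <-; rewrite xr.
Qed.

Definition hole_step (N : {set D}) (r r' : J) := [exists y, [exists n,
  [&& y \notin orb c0, reg y == r, n \in N, n \in orb y & reg n == r']]].

Lemma near_path N r p : near N r -> r \in ks -> path (hole_step N) r p -> uniq (r :: p) ->
  exists N', near N' (last r p).
Proof.
elim: p N r => [|r1 p IH] N r Nr rk /=; first by exists N.
case/andP=> /existsP[y /existsP[n /and5P[yc /eqP yr nN ny /eqP nr]]] pp.
case/andP=> rp /andP[r1p up].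
have N1 := near_move Nr rk yc yr nN ny; rewrite nr in N1.
apply: (IH _ _ N1); [by rewrite -nr; case: (near1 Nr nN) | | by rewrite /= r1p up].
(* The path is simple, so the later steps do not enter [r1] and never use the corner [n] that has
   been removed. *)
have aux q s : r1 \notin q -> path (hole_step N) s q -> path (hole_step (y |: N :\ n)) s q.
  elim: q s => //= s' q IHq s; rewrite inE negb_or => /andP[rs' rq] /andP[st pq].
  rewrite IHq // andbT; case/existsP: st => y' /existsP[n' /and5P[h1 h2 h3 h4 h5]].
  apply/existsP; exists y'; apply/existsP; exists n'; rewrite h1 h2 h4 h5 in_setU1 in_setD1 h3 !andbT.
  by rewrite orbC; apply/orP; left; apply: contraNneq rs' => e; rewrite -nr -(eqP h5) e.
exact: aux.
Qed.

(** Freeing the crossing of [c0] leaves the region of [s] unmatched, a hole which travels along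
    alternating paths. If it could not reach the region of [c0], the reachable regions [R] would
    have all their corners at the crossings that [S0] matches into [R]. There are no more such
    crossings than regions in [R], contrary to [region_bound]. *)
Lemma state_through S0 : is_state rot reg ks S0 -> reg c0 \in ks ->
  exists2 S, is_state rot reg ks S & c0 \in S.
Proof.
case=> h1 h2 h3 h4 h5 c0k; have [s sS sc] := h2 c0.
pose N0 := S0 :\ s; have nN0 : near N0 (reg s).
  split=> [x|d dc|x y|x y|r' r'k r's].
  - rewrite !in_setD1 => /andP[xs xS]; split; last by apply: contraNneq xs => /h4 ->.
      by apply: contra xs => xc; apply/eqP/h3 => //; rewrite (orbE _ xc).
    exact: h1.
  - have [x xS xd] := h2 d; exists x => //; rewrite in_setD1 xS andbT.
    by apply: contraNneq dc => e; rewrite -(orbE _ sc) -e orbS.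
  - by rewrite !in_setD1 => /andP[_ xS] /andP[_ yS]; apply: h3.
  - by rewrite !in_setD1 => /andP[_ xS] /andP[_ yS]; apply: h4.
  - have [x xS xr] := h5 r' r'k; exists x => //; rewrite in_setD1 xS andbT.
    by apply: contraNneq r's => <-; rewrite xr.
have sk := h1 s sS.
case: (boolP (connect (hole_step N0) (reg s) (reg c0))) => [/connectP[p pp e]|nc].
  case/shortenP: pp e => p' pp' up' _ e; have [N' [g1 g2 g3 g4 g5]] := near_path nN0 sk pp' up'.
  rewrite -e in g1 g5; exists (c0 |: N'); last by rewrite setU11.
  split=> [x|d|x y|x y|r rk].
  - by rewrite !(in_setU1, in_setD1) => /predU1P[-> //|/g1[]].
  - case: (boolP (d \in orb c0)) => [dc|/g2[x xN xd]]; last by exists x; rewrite // in_setU1 xN orbT.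
    by exists c0; rewrite ?setU11 // orbS.
  - rewrite !(in_setU1, in_setD1) => /predU1P[->|xN] /predU1P[->|yN] //; last exact: g3.
      by move=> yc; have [] := g1 y yN; rewrite yc.
    by rewrite orbS => xc; have [] := g1 x xN; rewrite xc.
  - rewrite !(in_setU1, in_setD1) => /predU1P[->|xN] /predU1P[->|yN] //; last exact: g4.
      by move=> e'; have [_ _] := g1 y yN; rewrite e' eqxx.
    by move=> e'; have [_ _] := g1 x xN; rewrite e' eqxx.
  - have [->|rc] := eqVneq r (reg c0); first by exists c0; rewrite ?setU11.
    by have [x xN xr] := g5 r rk rc; exists x; rewrite // in_setU1 xN orbT.
pose R := [set r | connect (hole_step N0) (reg s) r].
(* [C] gathers the crossings whose corner in [N0] lies in a region out of reach. The crossing of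
   [c0], which has no corner in [N0], stays outside. *)
pose C := [set x | [exists n, [&& n \in N0, n \in orb x & reg n \notin R]]].
have Rks r : r \in R -> r \in ks.
  rewrite inE => /connectP[p pp ->]; elim: p (reg s) sk pp => //= r' p IH r0 _.
  case/andP=> /existsP[y /existsP[n /and5P[_ _ nN _ /eqP <-]]]; apply: IH.
  by case: (near1 nN0 nN).
have Rstep r r' : r \in R -> hole_step N0 r r' -> r' \in R.
  by rewrite !inE => c st; apply: connect_trans c (connect1 st).
have sR : reg s \in R by rewrite inE connect0.
have Cr : rot_closed rot (~: C).
  move=> x; rewrite !inE; congr (~~ _); apply: eq_existsb => n.
  by rewrite (orbE n (y := rot x) (x := x)) // !inE eqxx orbT.
have b : (4 * #|R| < #|~: C|)%N.
  apply: (region_bound Dg Cr).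
  - apply/set0Pn; exists c0; rewrite !inE; apply/existsPn => n; rewrite !negb_and.
    by case: (boolP (n \in N0)) => //= /(near1 nN0)[-> _ _].
  - apply/eqP => /setP; have [|n nN nr] := near5 nN0 c0k.
      by apply: contraNneq nc => ->; apply: connect0.
    move=> /(_ n); rewrite !inE => /negP[]; apply/existsP; exists n.
    by rewrite nN mem_head nr inE nc.
  - move=> x xR; rewrite !inE; apply/existsPn => n; apply/negP => /and3P[nN nx].
    case/negP; apply: Rstep xR _; apply/existsP; exists x; apply/existsP; exists n.
    rewrite eqxx nN nx eqxx !andbT; have [nc' _ _] := near1 nN0 nN.
    by apply: contra nc' => xc; rewrite -(orbE _ xc).
  - by move=> r /Rks/kept_reg.
  - by apply/negP => /Rks; rewrite kept_mem eqxx andbF.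
pose T := [set n in S0 | reg n \in R].
have T1 : (#|T| <= #|R|)%N.
  rewrite -(card_in_imset (f := reg) (D := T)).
    by apply/subset_leq_card/subsetP => r /imsetP[n]; rewrite inE => /andP[_ nR] ->.
  by move=> x y; rewrite !inE => /andP[xS _] /andP[yS _]; apply: h4.
suff T2 : (#|~: C| <= 4 * #|T|)%N by lia.
pose pk d := odflt d [pick x | (x \in S0) && (x \in orb d)].
have pkP d : pk d \in S0 /\ pk d \in orb d.
  rewrite /pk; case: pickP => [x /andP[] //|no].
  by have [x xS xd] := h2 d; have := no x; rewrite xS xd.
rewrite -sum1_card (partition_big pk (mem T)) /= => [|x].
  rewrite mulnC -sum_nat_const; apply: leq_sum => n _; rewrite sum1_card.
  apply: (@leq_trans #|orb n|); last exact: card_size.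
  apply/subset_leq_card/subsetP => x; rewrite unfold_in => /andP[_ /eqP <-].
  by rewrite orbS; case: (pkP x).
rewrite in_setC in_set => /existsPn/(_ (pk x)); have [pS px] := pkP x; rewrite px.
rewrite [_ \in T]in_set pS; have [->|ps] := eqVneq (pk x) s; first by rewrite sR.
by rewrite in_setD1 ps pS /= negbK.
Qed.

End Exchange.

(** * The bigon move as two mutations *)

(* [s] and [s'] are the sides of a bigon, and [g1], [g2], [h1], [h2] the other
   segments at its two crossings. *)
Record bigon_quiver (I : finType) (lb : pred I) (B : I -> I -> int)
    (s s' g1 g2 h1 h2 : I) : Prop := BigonQuiver {
  bq_asym : antisym B;
  bq_lb : [/\ lb s, lb s', lb g1 & lb h2];
  bq_ss : s != s';
  bq_s : [/\ s != g1, s != g2, s != h1 & s != h2];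
  bq_s' : [/\ s' != g1, s' != g2, s' != h1 & s' != h2];
  bq_g : g1 != h1 /\ g2 != h2;
  bq_rows : forall j, lb j -> B s j = (j == g1)%:Z - (j == h1)%:Z;
  bq_rows' : forall j, lb j -> B s' j = (j == h2)%:Z - (j == g2)%:Z
}.

Section TwoMutations.
Variables (I : finType) (lb : pred I) (B : I -> I -> int) (s s' g1 g2 h1 h2 : I).
Hypothesis Q : bigon_quiver lb B s s' g1 g2 h1 h2.
Local Notation e x j := ((j == x)%:Z).
Let asym := bq_asym Q.

Lemma inout_one B' k i o : (forall j, lb j -> B' k j = e o j - e i j) -> o != i ->
  inout lb B' k (fun j => e i j) (fun j => e o j).
Proof.
move=> h oi j lj; rewrite h //; split=> //.
have [->|_] := eqVneq j i; last by left.
by right; rewrite eq_sym (negbTE oi).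
Qed.

Let ls : lb s. Proof. by case: (bq_lb Q). Qed.
Let ls' : lb s'. Proof. by case: (bq_lb Q). Qed.
Let lg : lb g1. Proof. by case: (bq_lb Q). Qed.
Let lh : lb h2. Proof. by case: (bq_lb Q). Qed.
Let ss' : (s == s') = false. Proof. exact: negbTE (bq_ss Q). Qed.
Let s's : (s' == s) = false. Proof. by rewrite eq_sym ss'. Qed.
Let sN : ((s == g1) = false) * ((s == g2) = false) * ((s == h1) = false) * ((s == h2) = false).
Proof. by case: (bq_s Q) => a b c d; do !split; apply: negbTE. Qed.
Let s'N : ((s' == g1) = false) * ((s' == g2) = false) * ((s' == h1) = false) * ((s' == h2) = false).
Proof. by case: (bq_s' Q) => a b c d; do !split; apply: negbTE. Qed.

Definition bB1 := mutate_mat s B.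
Definition bB2 := mutate_mat s' bB1.
Let as1 : antisym bB1. Proof. exact: mutate_antisym. Qed.

Let io1 : inout lb B s (fun j => e h1 j) (fun j => e g1 j).
Proof. by apply: inout_one; [exact: (bq_rows Q) | case: (bq_g Q)]. Qed.

Let row1 j : lb j -> bB1 s' j = e h2 j - e g2 j.
Proof.
move=> lj; have [->|js] := eqVneq j s.
  by rewrite /bB1 mutate_mat_col (bq_rows' Q) // !sN.
by rewrite /bB1 (inout_mat asym io1) ?s's // (bq_rows' Q) // !s'N /=; ring.
Qed.

Let io2 : inout lb bB1 s' (fun j => e g2 j) (fun j => e h2 j).
Proof. by apply: inout_one; [exact: row1 | case: (bq_g Q) => _; rewrite eq_sym]. Qed.

Lemma bB2_outer u v : lb u -> lb v -> u != s -> u != s' -> v != s -> v != s' ->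
  bB2 u v = B u v + (e h1 u * e g1 v - e g1 u * e h1 v)
    + (e g2 u * e h2 v - e h2 u * e g2 v).
Proof.
move=> *; rewrite /bB2 (inout_mat as1 io2) // /bB1 (inout_mat asym io1) //; ring.
Qed.

Definition bf1 := frozen_out lb B s.
Definition bf2 := frozen_out lb bB1 s'.

Section Values.
Variables (K : fieldType) (pos : K -> Prop) (X : I -> K).
Hypothesis cone : positive_cone pos.
Hypothesis Xp : all_pos pos X.
Definition bs1 := mutate s (Seed X B).
Definition bs2 := mutate s' bs1.
Let p1 : all_pos pos (cvar bs1). Proof. exact: (mutate_pos cone). Qed.
Let X0 : nonzero X. Proof. exact: all_pos_nonzero cone _ Xp. Qed.
Let z1 : nonzero (cvar bs1). Proof. exact: all_pos_nonzero cone _ p1. Qed.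
Local Notation y := (yh X B s).
Local Notation y' := (yh X B s').

Lemma by_neq0 k : 1 + yh X B k != 0.
Proof.
apply: (pos_neq0 cone); apply: (posD cone); first exact: (pos1 cone).
exact: (@pos_mon _ _ _ cone X (B^~ k) Xp).
Qed.

Let yh1 j : lb j -> j != s -> yh (cvar bs1) bB1 j = yh X B j * y ^ e g1 j * (1 + y) ^ (e h1 j - e g1 j).
Proof. by move=> lj js; apply: (@inout_yh _ _ _ (Seed X B) _ _ _ _ X0 asym (by_neq0 s) io1 lj js). Qed.

Let yh1' : yh (cvar bs1) bB1 s' = y'.
Proof. by rewrite yh1 ?s's // !s'N /= !expr0z !mulr1. Qed.

Lemma yh_bs2 j : lb j -> j != s -> j != s' -> yh (cvar bs2) bB2 j =
  yh X B j * (y / (1 + y)) ^ e g1 j * (1 + y) ^ e h1 j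
   * (y' / (1 + y')) ^ e h2 j * (1 + y') ^ e g2 j.
Proof.
move=> lj js js'; have nz := by_neq0 s; have nz' := by_neq0 s'.
have u1 : 1 + yh (cvar bs1) bB1 s' != 0 by rewrite yh1'.
have S1 (z u : K) (m n : bool) : u != 0 ->
    z ^ m%:Z * u ^ (n%:Z - m%:Z) = (z / u) ^ m%:Z * u ^ n%:Z.
  by case: m; case: n => /=; rewrite ?expr0z ?expr1z // => u0; rewrite ?exprN1; field.
rewrite (@inout_yh _ _ _ bs1 _ _ _ _ z1 as1 u1 io2 lj js') yh1' yh1 // -[LHS]mulrA S1 //.
by rewrite -[X in X * _ = _]mulrA S1 // !mulrA.
Qed.

Lemma bs2_outer j : j != s -> j != s' -> cvar bs2 j = X j.
Proof. by move=> js js'; rewrite !mutate_cvarE. Qed.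

Lemma bs2_s : cvar bs2 s = mon X bf1 * X g1 * (1 + y) / X s.
Proof.
rewrite (@mutate_cvarE _ _ bs1 s' s) ?ss' // (@mutate_cvar _ _ (Seed X B)) //.
by rewrite (inout_outp X0 io1) prod_one.
Qed.

Lemma bs2_s' : cvar bs2 s' = mon X bf2 * X h2 * (1 + y') / X s'.
Proof.
rewrite (@mutate_cvar _ _ bs1) // yh1' (inout_outp z1 io2) prod_one //.
rewrite (@mutate_cvarE _ _ (Seed X B) s s') ?s's // (@mutate_cvarE _ _ (Seed X B) s h2); last first.
  by rewrite eq_sym sN.
rewrite (mon_frozen (lb := lb) (X := X)) // => j; first by rewrite /frozen_out => ->.
by move=> nl; rewrite mutate_cvarE //; apply: contraNneq nl => ->.
Qed.

End Values.
End TwoMutations.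

Lemma ssum_used (D J : finType) (K : fieldType) (rot : D -> D) (reg : D -> J) ks ks' t
    (om : D -> K) cs u : perm_eq ks (t :: ks') ->
  ssum rot reg ks om cs (t :: u) = ssum rot reg ks' om cs u.
Proof.
move=> p; elim: cs u => [|c cs IH] u; first by rewrite /= (permPr p) perm_cons.
have lE L w : ssum rot reg L om (c :: cs) w =
  \sum_(a <- orb rot c) om a * ssum rot reg L om cs (reg a :: w) by [].
rewrite !lE; apply: eq_bigr => a _; congr (_ * _); rewrite -IH.
by apply: ssum_perm_used; rewrite -[_ :: _ :: u]/([:: _] ++ [:: _] ++ u) perm_catCA.
Qed.

Lemma val0_sum (T : finType) (P : pred T) (n : T -> int) z :
  (forall i, 0 <= n i) -> val0 z -> val0 (z + \sum_(i | P i) tvar ^ n i).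
Proof.
move=> n0 z0; elim/big_rec: _ => [|i x _ IH]; first by rewrite addr0.
by rewrite addrCA addrC -[tvar ^ _]mulr1; apply: val0D => //; apply: (pos1 val0_cone).
Qed.

Section BigonStep.
Variables (D J : finType) (rot opp : D -> D) (reg : D -> J) (lev : J -> nat) (i0 : D).
Hypothesis Dg : diagram rot opp reg lev i0.
Hypothesis D8 : (8 < #|D|)%N.
Variables d0 d1 : D.
Hypothesis bg : bigon_at rot opp d0.
Hypothesis t_i0 : reg d0 <> reg i0.
Hypothesis t_i1 : reg d0 <> reg (opp i0).
Local Notation r2 d := (rot (rot d)).
Local Notation r3 d := (rot (rot (rot d))).
Local Notation nx := (fnext rot opp).
Local Notation t := (reg d0).
Hypothesis nx0 : nx d0 = d1.
Let D4 : (4 < #|D|)%N. Proof. by apply: ltn_trans D8. Qed.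
Let rotK := rot4 Dg.
Let oppK := dopK Dg.
Local Notation out := (outer opp reg d0).
Local Notation brot := (merge_rot rot opp reg d0).
Local Notation D' := (bdart opp reg d0).
Local Notation bR := (@bdrot D J rot opp reg d0).

Let rt1 : reg d1 = t. Proof. by rewrite -nx0 (reg_fnext Dg). Qed.
Let nx1 : nx d1 = d0. Proof. by rewrite -nx0; apply: (eqP bg). Qed.
Let od0 : opp d0 = rot d1. Proof. by rewrite -nx0 (rot_nx Dg). Qed.
Let od1 : opp d1 = rot d0. Proof. by rewrite -nx1 (rot_nx Dg). Qed.
Let t_cases x : reg x = t -> x = d0 \/ x = d1.
Proof. by move=> rx; have := bigon_fiber Dg bg rx; rewrite nx0. Qed.
Let d01 : d0 != d1. Proof. by rewrite -nx0 eq_sym (no_monogon Dg). Qed.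
Let out2 x : reg x = t -> out (r2 x). Proof. exact: (outer_r2 Dg D4). Qed.
Let out3 x : reg x = t -> out (r3 x). Proof. exact: (outer_r3 Dg D4). Qed.

Let b20 : brot (r2 d0) = r3 d0. Proof. exact: (brot_r2 Dg). Qed.
Let b21 : brot (r2 d1) = r3 d1. Proof. exact: (brot_r2 Dg). Qed.
Let b30 : brot (r3 d0) = r2 d1. Proof. by rewrite (brot_r3 Dg) // nx0. Qed.
Let b31 : brot (r3 d1) = r2 d0. Proof. by rewrite (brot_r3 Dg) // nx1. Qed.

Definition bfar x := [&& reg x != t, reg (rot x) != t, reg (r2 x) != t & reg (r3 x) != t].
Let bfar_rot x : bfar (rot x) = bfar x.
Proof. by rewrite /bfar rotK; do 4?case: (_ != t). Qed.
Let brot_far x : bfar x -> brot x = rot x.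
Proof. by case/and4P=> _ h _ _; rewrite /merge_rot (negbTE h). Qed.
Let far_out x : bfar x -> out x.
Proof. by move=> /and4P[h1 _ _ h4]; rewrite /outer h1 -(reg_r3 Dg). Qed.

Let outer_ind (P : D -> Prop) : P (r2 d0) -> P (r3 d0) -> P (r2 d1) -> P (r3 d1) ->
  (forall z, bfar z -> P z) -> forall z, out z -> P z.
Proof.
move=> p1 p2 p3 p4 pf z /andP[h1]; rewrite -(reg_r3 Dg) => h4.
have [/eqP/t_cases h2|h2] := boolP (reg (rot z) == t).
  by rewrite -[z]rotK; case: h2 => ->.
have [/eqP/t_cases h3|h3] := boolP (reg (r2 z) == t).
  by rewrite -[z]rotK; case: h3 => ->.
by apply: pf; rewrite /bfar h1 h2 h3 h4.
Qed.

(** With both pairs of outer ends joined, the two crossings of the bigon would be the whole diagram,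
    which has more than eight darts. *)
Let big_closed : opp (r2 d0) = r3 d1 -> opp (r3 d0) = r2 d1 -> False.
Proof.
move=> e1 e2; pose P := [pred x | (x \in orb rot d0) || (x \in orb rot d1)].
have oi := inj_eq (inv_inj oppK).
have Pr x : P (rot x) = P x.
  by rewrite /P /= ![rot x \in _](orb_sym rotK) !(perm_mem (orb_rot rotK x)) ![_ \in orb rot x](orb_sym rotK).
have Po x : P (opp x) = P x.
  have f a b : (opp a == b) = (a == opp b) by rewrite -{1}[b]oppK oi.
  have e1' : opp (r3 d1) = r2 d0 by rewrite -e1 oppK.
  have e2' : opp (r2 d1) = r3 d0 by rewrite -e2 oppK.
  have o0 : opp (rot d0) = d1 by rewrite -od1 oppK.
  have o1 : opp (rot d1) = d0 by rewrite -od0 oppK.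
  rewrite /P /= !inE !f od0 od1 e1 e2 e1' e2' o0 o1.
  by case: (x == d0); case: (x == d1); case: (x == rot d0); case: (x == rot d1);
     case: (x == r2 d0); case: (x == r2 d1); case: (x == r3 d0); case: (x == r3 d1).
have PT x : P x by rewrite (diagram_conn Dg Pr Po x d0) /P /= mem_head.
have : (#|D| <= size (orb rot d0 ++ orb rot d1))%N.
  by apply: leq_trans (card_size _); apply/subset_leq_card/subsetP => x _; rewrite mem_cat; apply: PT.
by rewrite leqNgt D8.
Qed.

(** If one pair of outer ends were joined, the two ends of the other pair would separate the same
    regions and be joined as well, by [reg_prime]. *)
Let no_g1 : opp (r2 d0) != r3 d1.
Proof.
apply/eqP => e1; apply: big_closed => //.
have p : reg (r2 d1) = reg (r2 d0) by have := reg_r3 Dg (r3 d1); rewrite rotK -e1 oppK.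
suff -> : r3 d0 = opp (r2 d1) by rewrite oppK.
apply: (reg_prime Dg); first by rewrite (reg_back Dg) (reg_r3 Dg) od0.
by rewrite oppK p -(reg_r3 Dg) rotK.
Qed.

Let no_g2 : opp (r3 d0) != r2 d1.
Proof.
apply/eqP => e2; apply: big_closed => //.
suff -> : r2 d0 = opp (r3 d1) by rewrite oppK.
apply: (reg_prime Dg); first by rewrite -[in RHS](reg_r3 Dg) rotK -e2 -(reg_r3 Dg) rotK.
by rewrite oppK (reg_back Dg) (reg_r3 Dg) od1.
Qed.

Section Labelled.
Variables (I : finType) (lab : D -> I) (B : I -> I -> int) (nu : D -> I -> int).
Hypothesis Fr : framed rot opp i0 lab B nu.
Let lE := lab_eq Fr.
Local Notation s := (lab d1).
Local Notation s' := (lab d0).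
Local Notation g1 := (lab (r2 d0)).
Local Notation g2 := (lab (r3 d0)).
Local Notation h1 := (lab (r3 d1)).
Local Notation h2 := (lab (r2 d1)).
Local Notation lb := (fun u => u \in codom lab).

Let lab_opp x : lab (opp x) = lab x.
Proof. by apply/eqP; rewrite lE oppK eqxx orbT. Qed.
Let lr0 : lab (rot d0) = s. Proof. by rewrite -od1 lab_opp. Qed.
Let lr1 : lab (rot d1) = s'. Proof. by rewrite -od0 lab_opp. Qed.
Let lbT d : lb (lab d). Proof. exact: codom_f. Qed.

Let inner_outer x z : reg x = t -> out z -> lab x != lab z.
Proof.
move=> rx /andP[h1 h2]; rewrite lE; apply/norP; split.
  by apply: contraNneq h1 => ->; apply/eqP.
by apply: contraNneq h2 => ->; rewrite oppK; apply/eqP.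
Qed.

Let r23 x y : reg x = t -> reg y = t -> (r2 x == r3 y) = false.
Proof.
move=> rx ry; apply/eqP => /(drot_inj Dg)/(drot_inj Dg) e.
by have := in_t_pre Dg ry; rewrite -e rx eqxx.
Qed.

Let row d j : lb j -> B (lab d) j =
  (j == lab (rot d))%:Z + (j == lab (rot (opp d)))%:Z
  - ((j == lab (r3 d))%:Z + (j == lab (r3 (opp d)))%:Z).
Proof. by move=> /codomP[f ->]; rewrite (framed_asym Fr) (framed_seg Fr); ring. Qed.

Let Q : bigon_quiver lb B s s' g1 g2 h1 h2.
Proof.
have o := inner_outer; split.
- exact: (framed_asym Fr).
- by split; apply: lbT.
- rewrite lE; apply/norP; split; first by rewrite d01.
  by apply/eqP => e; have := in_t_inn Dg rt1; rewrite -e eqxx.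
- by split; apply: o => //; first [by apply: out3 | by apply: out2].
- by split; apply: o => //; first [by apply: out3 | by apply: out2].
- split; rewrite lE ![_ == opp _]eq_sym (negbTE no_g1, negbTE no_g2) orbF.
    by rewrite eq_sym r23.
  by rewrite r23.
- by move=> j lj; rewrite row // lr1 od1 rotK; ring.
- by move=> j lj; rewrite row // lr0 od0 rotK; ring.
Qed.

(** The sides [s] and [s'] of the bigon label no dart of the smaller diagram: there they count as
    frozen vertices. *)
Definition blab (z : D') := lab (val z).
Local Notation B2 := (bB2 B s s').

Let outN z : out z -> (lab z != s) /\ (lab z != s').
Proof. by move=> oz; split; rewrite eq_sym inner_outer. Qed.

Let blab_eq (d e : D') : (blab d == blab e) = (e == d) || (e == bdopp d).
Proof. by rewrite /blab lE -!val_eqE /= (val_bdopp Dg). Qed.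

Local Notation io d z := ((z == d)%:Z).
Let io2 z d : (lab z == lab d)%:Z = io d z + io d (opp z) :> int.
Proof.
have ox : opp z != z by apply: contraNneq (reg_opp_neq Dg z) => ->.
have oE x y : (opp x == y) = (x == opp y) by apply/eqP/eqP => [<-|->]; rewrite oppK.
rewrite eq_sym lE oE; have [<-|_] := eqVneq z d; last by case: (z == opp d).
by rewrite eq_sym (negbTE ox).
Qed.

Let ioT : ((r2 d0 == r3 d0) = false) * ((r2 d0 == r2 d1) = false) * ((r2 d0 == r3 d1) = false) *
  ((r3 d0 == r2 d0) = false) * ((r3 d0 == r2 d1) = false) * ((r3 d0 == r3 d1) = false) *
  ((r2 d1 == r2 d0) = false) * ((r2 d1 == r3 d0) = false) * ((r2 d1 == r3 d1) = false) *
  ((r3 d1 == r2 d0) = false) * ((r3 d1 == r3 d0) = false) * ((r3 d1 == r2 d1) = false).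
Proof.
have ri := inj_eq (drot_inj Dg).
have h3 x y : reg x = t -> reg y = t -> (r3 y == r2 x) = false by move=> *; rewrite eq_sym r23.
have n01 : (d0 == d1) = false by apply: negbTE.
have n10 : (d1 == d0) = false by rewrite eq_sym.
by do !split; first [by apply: r23 | by apply: h3 | by rewrite !ri].
Qed.

Let far_io z : bfar z -> ((z == r2 d0) = false) * ((z == r3 d0) = false) *
  ((z == r2 d1) = false) * ((z == r3 d1) = false).
Proof.
move=> /and4P[f1 f2 f3 f4]; do !split; apply/eqP => ez; move: f2 f3.
all: by rewrite ez !rotK ?rt1 eqxx.
Qed.

Local Notation br3 z := (brot (brot (brot z))).
Local Notation kap u z := ((u == lab (br3 z))%:Z - (u == lab (brot z))%:Z : int).

Let kapE u z : u != s -> u != s' -> out z -> kap u z =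
  (u == lab (r3 z))%:Z - (u == lab (rot z))%:Z
  + io (r2 d0) z * (u == h1)%:Z - io (r3 d0) z * (u == h2)%:Z
  + io (r2 d1) z * (u == g2)%:Z - io (r3 d1) z * (u == g1)%:Z.
Proof.
move=> /negbTE us /negbTE us'; move: z; apply: outer_ind => [||||z fz].
5: by rewrite !(brot_far, bfar_rot) // !(far_io fz) /=; ring.
all: rewrite ?b20 ?b21 ?b30 ?b31 ?b20 ?b21 ?b30 ?b31 ?b20 ?b21 ?b30 ?b31 !ioT !eqxx !rotK.
all: by rewrite ?lr0 ?lr1 ?us ?us' /=; ring.
Qed.

Let bseg (d f : D') : B2 (blab f) (blab d) =
  (blab f == blab (bR (bR (bR d))))%:Z
  + (blab f == blab (bR (bR (bR (bdopp d)))))%:Z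
  - (blab f == blab (bR d))%:Z - (blab f == blab (bR (bdopp d)))%:Z.
Proof.
rewrite /blab !(val_bdrot Dg D4) (val_bdopp Dg).
have [us us'] := outN (valP f); have [vs vs'] := outN (valP d).
have od : out (opp (val d)) by apply: (outer_opp Dg); apply: valP.
have := kapE us us' (valP d); have := kapE us us' od.
rewrite (bB2_outer Q) // (framed_seg Fr) !(io2 (val d)) => e1 e2.
apply: (@etrans _ _ ((kap (lab (val f)) (val d)) + (kap (lab (val f)) (opp (val d))))).
  by rewrite e1 e2; ring.
ring.
Qed.

Definition bnu x u : int :=
  if x == r2 d0 then nu (r2 d0) u + nu d1 u
  else if x == r3 d0 then nu (r3 d0) u + nu d1 u - bf2 lb B s s' u + (u == s')%:Z
  else if x == r2 d1 then nu d0 u + nu (r2 d1) u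
  else if x == r3 d1 then nu d0 u + nu (r3 d1) u - bf1 lb B s u + (u == s)%:Z
  else nu x u.

Let nu_lb x u : lb u -> nu x u = 0.
Proof. by case/codomP=> y ->; apply: (framed_nu Fr). Qed.
Let bf_lb B' k u : lb u -> frozen_out lb B' k u = 0.
Proof. by rewrite /frozen_out => ->. Qed.

Let bnu_lb x u : lb u -> bnu x u =
  (if x == r3 d0 then (u == s')%:Z else if x == r3 d1 then (u == s)%:Z else 0).
Proof.
move=> lu; rewrite /bnu /bf1 /bf2 !bf_lb // !nu_lb // ?subr0 ?addr0 ?add0r.
case: (eqVneq x (r2 d0)) => [->|_]; first by rewrite !ioT.
case: (eqVneq x (r3 d0)) => // _; case: (eqVneq x (r2 d1)) => [->|//].
by rewrite !ioT.
Qed.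

Section Values.
Variables (K : fieldType) (pos : K -> Prop) (X : I -> K).
Hypothesis cone : positive_cone pos.
Hypothesis Xp : all_pos pos X.
Let X0 : nonzero X. Proof. exact: all_pos_nonzero cone _ Xp. Qed.
Local Notation X2 := (cvar (bs2 B s s' X)).
Let X2p : all_pos pos X2. Proof. by do 2!apply: (mutate_pos cone). Qed.
Let X20 : nonzero X2. Proof. exact: all_pos_nonzero cone _ X2p. Qed.
Local Notation om := (omega rot lab X nu).
Local Notation om' := (omega bR blab X2 (fun z : D' => bnu (val z))).
Definition ob x := mon X2 (bnu x) / (X2 (lab x) * X2 (lab (brot x))).
Local Notation y := (yh X B s).
Local Notation y' := (yh X B s').
Local Notation W x := (mon X (nu x)).

Let om'E (z : D') : om' z = ob (val z).
Proof. by rewrite /omega /ob /blab (val_bdrot Dg D4). Qed.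

Let mon2 v : (forall u, lb u -> v u = 0) -> mon X2 v = mon X v.
Proof.
move=> v0; apply: (mon_frozen (lb := lb) v0) => j nl.
by rewrite bs2_outer //; apply: contraNneq nl => ->; apply: lbT.
Qed.
Let monW x : mon X2 (nu x) = W x. Proof. by apply: mon2 => u; apply: nu_lb. Qed.
Let monF B' k : mon X2 (frozen_out lb B' k) = mon X (frozen_out lb B' k).
Proof. by apply: mon2 => u; apply: bf_lb. Qed.
Let X2o z : out z -> X2 (lab z) = X (lab z).
Proof. by move=> /outN[h h']; rewrite bs2_outer. Qed.

Let yy0 := by_neq0 B cone Xp.
Let m0 v := mon_neq0 v X0.
Let oo := (X2o (out2 (erefl t)), X2o (out2 rt1), X2o (out3 (erefl t)), X2o (out3 rt1)).
Let XX := X s * X s'.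

Let ob20 : ob (r2 d0) = XX * (om (r2 d0) * om d1).
Proof.
rewrite /ob b20 !oo (eq_mon _ (v := fun u => nu (r2 d0) u + nu d1 u)); last first.
  by move=> u; rewrite /bnu eqxx.
by rewrite monD // !monW /omega lr1 /XX; field; rewrite !X0.
Qed.

Let ob21 : ob (r2 d1) = XX * (om d0 * om (r2 d1)).
Proof.
rewrite /ob b21 !oo (eq_mon _ (v := fun u => nu d0 u + nu (r2 d1) u)); last first.
  by move=> u; rewrite /bnu !ioT eqxx.
by rewrite monD // !monW /omega lr0 /XX; field; rewrite !X0.
Qed.

Let ob30 : ob (r3 d0) = XX * (om (r3 d0) * om d1 * (1 + y')).
Proof.
rewrite /ob b30 !oo (eq_mon _ (v := fun u => nu (r3 d0) u + nu d1 u + - bf2 lb B s s' u + (u == s')%:Z)).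
  rewrite monD // mon_delta monD // monD // monN /bf2 monF !monW (bs2_s' Q cone Xp).
  rewrite /omega rotK lr1 /XX -/(bf2 lb B s s'); field; by rewrite !X0 m0.
by move=> u; rewrite /bnu !ioT eqxx.
Qed.

Let ob31 : ob (r3 d1) = XX * (om d0 * om (r3 d1) * (1 + y)).
Proof.
rewrite /ob b31 !oo (eq_mon _ (v := fun u => nu d0 u + nu (r3 d1) u + - bf1 lb B s u + (u == s)%:Z)).
  rewrite monD // mon_delta monD // monD // monN /bf1 monF !monW (bs2_s Q cone Xp).
  rewrite /omega rotK lr0 /XX -/(bf1 lb B s); field; by rewrite !X0 m0.
by move=> u; rewrite /bnu !ioT eqxx.
Qed.

Let ob_far z : bfar z -> ob z = om z.
Proof.
move=> fz; have fr : bfar (rot z) by rewrite bfar_rot.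
rewrite /ob brot_far // !X2o ?far_out // (eq_mon _ (v := nu z)) ?monW //.
by move=> u; rewrite /bnu !(far_io fz).
Qed.

Let notroot x : reg x = t -> (x != i0) /\ (x != opp i0).
Proof. by move=> rx; split; apply/eqP => e; [apply: t_i0|apply: t_i1]; rewrite -rx e. Qed.
Let yE x : reg x = t -> yh X B (lab x) = mfac rot om x * mfac rot om (opp x).
Proof. by move=> /notroot[? ?]; apply: (framed_y Fr cone Xp). Qed.
Let om0 x : om x != 0.
Proof. by rewrite mulf_neq0 ?invr_eq0 ?m0 // mulf_neq0 ?X0. Qed.
Let ysE : y = om d1 * om (rot d0) / (om (r3 d1) * om d0).
Proof. by rewrite yE // od1 /mfac rotK; field; rewrite !om0. Qed.
Let ys'E : y' = om d0 * om (rot d1) / (om (r3 d0) * om d1).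
Proof. by rewrite yE // od0 /mfac rotK; field; rewrite !om0. Qed.
Let XX0 : XX != 0. Proof. by rewrite mulf_neq0. Qed.

Definition bfac z := (y / (1 + y)) ^ io (r2 d0) z * (1 + y) ^ io (r3 d1) z
   * (y' / (1 + y')) ^ io (r2 d1) z * (1 + y') ^ io (r3 d0) z.

Let mfac_outer z : out z -> ob z / ob (br3 z) = mfac rot om z * bfac z.
Proof.
move: (yy0 s) (yy0 s') ob20 ob21 ob30 ob31; rewrite /bfac.
set v := 1 + y; set v' := 1 + y' => v0 v'0 e1 e2 e3 e4.
move: z; apply: outer_ind => [||||z fz].
5: by rewrite !(far_io fz) !expr0z !mulr1 ob_far // !brot_far ?bfar_rot // ob_far ?bfar_rot.
all: rewrite ?b20 ?b21 ?b30 ?b31 ?b20 ?b21 ?b30 ?b31 ?b20 ?b21 ?b30 ?b31.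
all: rewrite ?ioT ?eqxx ?expr0z ?expr1z ?mul1r ?mulr1 ?e1 ?e2 ?e3 ?e4 /mfac ?rotK.
all: rewrite ?ysE ?ys'E; field; by rewrite ?om0 ?v0 ?v'0 ?XX0.
Qed.

Lemma by2 (d : D') : val d != i0 -> val d != opp i0 ->
  yh X2 B2 (blab d) = mfac bR om' d * mfac bR om' (bdopp d).
Proof.
move=> n1 n2; have od := valP d; have ood := outer_opp Dg od.
rewrite /mfac !om'E !(val_bdrot Dg D4) (val_bdopp Dg) !mfac_outer // /blab.
have [vs vs'] := outN od; rewrite (yh_bs2 Q cone Xp) //.
rewrite (framed_y Fr cone Xp) // /bfac !(io2 (val d)).
have y0 k : yh X B k != 0 by apply: m0.
have e1 : y / (1 + y) != 0 by rewrite mulf_neq0 ?invr_eq0 ?y0 ?yy0.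
have e2 : y' / (1 + y') != 0 by rewrite mulf_neq0 ?invr_eq0 ?y0 ?yy0.
by rewrite !expfzDr ?yy0 //; do ![move: (_ ^ _) => ?]; ring.
Qed.

Local Notation j0 := (bdroot t_i0 t_i1).

Let segprod2 : segprod j0 blab X2 * XX = segprod i0 lab X.
Proof.
have -> : segprod j0 blab X2 =
    \prod_(u | [&& lb u && (u != lab i0), u != s & u != s']) X u.
  apply: eq_big => [u|u /andP[/codomP[z ->] _]]; last by rewrite (X2o (valP z)).
  apply/andP/and3P => [[/codomP[z ->] ->]|[/andP[/codomP[x ->] ->] xs xs']].
    by have [h h'] := outN (valP z); rewrite /blab lbT h h'.
  split=> //; have ox : out x.
    apply/andP; split; apply/negP => /eqP/t_cases[] e.
    - by move: xs'; rewrite e eqxx.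
    - by move: xs; rewrite e eqxx.
    - by move: xs'; rewrite -[x]oppK e lab_opp eqxx.
    - by move: xs; rewrite -[x]oppK e lab_opp eqxx.
  by apply/codomP; exists (Sub x ox).
rewrite /segprod [RHS](bigD1 s) ?lbT ?inner_outer //=; last exact: outer_i0.
rewrite [in RHS](bigD1 s') /=; last first.
  by rewrite lbT [s' == s]eq_sym (bq_ss Q) andbT inner_outer //; apply: outer_i0.
rewrite mulrA [RHS]mulrC; congr (_ * _); apply: eq_bigl => u; by rewrite -!andbA.
Qed.

Let ks := kept opp reg i0.
Let ks' := kept (@bdopp _ _ opp reg d0) (@bdreg _ _ opp reg d0) j0.

Let ks_perm : perm_eq ks (t :: ks').
Proof.
have tk : t \in ks by rewrite reg_kept; apply/andP; split; exact/eqP.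
have kE r : (r \in ks') = (r \in ks) && (r != t).
  rewrite !kept_mem /bdreg (val_bdopp Dg) (bdreg_image Dg D4) !inE /=.
  by case: (r == t); rewrite ?andbF ?andbT.
apply: uniq_perm; rewrite ?kept_uniq //=; first by rewrite kept_uniq kE eqxx andbF.
by move=> r; rewrite inE kE; case: eqP => [->|]; rewrite ?tk ?andbT.
Qed.

Let gdart : D' := Sub (r2 d0) (out2 (erefl t)).

Let val_orb (z : D') : map val (orb bR z) =
  [:: val z; brot (val z); brot (brot (val z)); br3 (val z)].
Proof. by rewrite /orb !map_cons !(val_bdrot Dg D4). Qed.

Let val_gorb : map val (orb bR gdart) = [:: r2 d0; r3 d0; r2 d1; r3 d1].
Proof. by rewrite val_orb /= b20 b30 b21. Qed.

Let b4 (z : D') : bR (bR (bR (bR z))) = z.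
Proof. exact: (rot4 (bigon_move Dg D4 bg t_i0 t_i1)). Qed.

Let frontcs : exists2 cs' : seq D', crossings bR (gdart :: cs') &
  (forall z x, z \in cs' -> x \in orb rot (val z) -> bfar x) /\
  crossings rot [:: d0, d1 & map val cs'].
Proof.
have Dg' := bigon_move Dg D4 bg t_i0 t_i1.
have [cs pcs] := exists_crossings (rot4 Dg') (rot2_neq Dg').
have [|cs' p _] := crossings_front K (@bdreg _ _ opp reg d0) ks' b4 (d := gdart) pcs.
  by rewrite mem_enum.
exists cs' => //; move: (p); rewrite flatten_orb => pf.
have := enum_uniq D'; rewrite -(perm_uniq pf) cat_uniq => /and3P[_ dj uf].
have gN z x : z \in cs' -> x \in orb bR z -> val x \notin [:: r2 d0; r3 d0; r2 d1; r3 d1].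
  move=> zc xz; apply: contra dj; rewrite -val_gorb (mem_map val_inj) => xg; apply/hasP.
  by exists x => //; apply/flattenP; exists (orb bR z) => //; apply: map_f.
have gfar z x : z \in cs' -> x \in orb bR z -> bfar (val x).
  move=> zc xz; have := gN z x zc xz; move: (val x) (valP x); apply: outer_ind => [||||x' f _ //].
  1,2,3,4: by move=> /negP; case; rewrite !inE eqxx ?orbT.
have orbE z : z \in cs' -> orb rot (val z) = map val (orb bR z).
  move=> zc; have f0 : bfar (val z) by apply: (gfar z) => //; rewrite mem_head.
  by rewrite val_orb !brot_far ?bfar_rot.
have far z x : z \in cs' -> x \in orb rot (val z) -> bfar x.
  by move=> zc; rewrite orbE // => /mapP[x' x'z ->]; apply: gfar x'z.
split=> //; rewrite /crossings !flatten_orb.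
have fE : flatten [seq orb rot c | c <- map val cs'] =
    map val (flatten [seq orb bR c | c <- cs']).
  rewrite map_flatten -!map_comp; congr flatten; apply/eq_in_map => z zc /=; exact: orbE.
have nf x : bfar x -> (x \in orb rot d0) = false /\ (x \in orb rot d1) = false.
  case/and4P=> f1 f2 f3 f4; split; apply/negP; rewrite !inE => /or4P[] /eqP e; move: f1 f2 f3 f4;
    by rewrite e ?rotK ?rt1 eqxx ?andbF.
have fin x : x \in flatten [seq orb rot c | c <- map val cs'] -> bfar x.
  by case/flattenP=> o /mapP[_ /mapP[z zc ->] ->]; apply: far.
apply: uniq_perm; rewrite ?enum_uniq //.
  rewrite cat_uniq (orb_uniq rotK (rot2_neq Dg)) andTb cat_uniq (orb_uniq rotK (rot2_neq Dg)) andTb.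
  rewrite fE (map_inj_uniq val_inj) uf andbT.
  apply/andP; split; apply/hasPn => x; last by rewrite -fE => /fin/nf[_ ->].
  rewrite mem_cat -fE => /orP[x1|/fin/nf[-> //]]; apply/negP => x0.
  have : d1 \in orb rot d0 by rewrite -(orb_in rotK _ x0) (orb_sym rotK).
  rewrite !inE => /or4P[] /eqP e.
  - by move: d01; rewrite e eqxx.
  - by have := in_t_pre Dg (erefl t); rewrite -e rt1 eqxx.
  - by have := in_t_r2 Dg D4 (erefl t); rewrite -e rt1 eqxx.
  - by have := in_t_inn Dg (erefl t); rewrite -(reg_r3 Dg) -e rt1 eqxx.
move=> x; rewrite mem_enum !mem_cat; case: (boolP (out x)) => ox.
  have := mem_enum D' (Sub x ox : D'); rewrite -(perm_mem pf) mem_cat => /orP[|].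
    rewrite -(mem_map val_inj) val_gorb SubK => xg.
    by move: xg; rewrite inE => /predU1P[->|]; rewrite !inE ?eqxx ?orbT // => /or3P[] /eqP ->; rewrite eqxx ?orbT.
  by rewrite -(mem_map val_inj) SubK -fE => ->; rewrite !orbT.
have tin z : reg z = t -> [|| z \in orb rot d0, z \in orb rot d1 | z \in flatten [seq orb rot c | c <- map val cs']].
  by case/t_cases=> ->; rewrite mem_head ?orbT.
move: ox; rewrite negb_and !negbK => /orP[/eqP/tin //|/eqP/t_cases e].
have -> : x = opp (opp x) by rewrite oppK.
by case: e => ->; rewrite ?od0 ?od1 !inE eqxx ?orbT.
Qed.

(** Exactly one of the two crossings uses [t], and the other one a corner in one of four regions.
    The two regions across the sides of the bigon touch both crossings and arise in two ways each,
    which accounts for the factors [1 + y] and [1 + y'] at the merged crossing. *)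
Lemma ssum2 cs cs' : crossings rot cs -> crossings bR cs' ->
  ssum bR (@bdreg _ _ opp reg d0) ks' om' cs' [::] = XX * ssum rot reg ks om cs [::].
Proof.
move=> cc cc'; have [rest pr [fr pr']] := frontcs.
have e1 : perm_eq (flatten [seq orb rot c | c <- cs]) (flatten [seq orb rot c | c <- [:: d0, d1 & map val rest]]).
  by apply: perm_trans cc _; rewrite perm_sym.
have e2 : perm_eq (flatten [seq orb bR c | c <- cs']) (flatten [seq orb bR c | c <- gdart :: rest]).
  by apply: perm_trans cc' _; rewrite perm_sym.
rewrite (ssum_indep _ _ rotK _ _ e1) (ssum_indep _ _ b4 _ _ e2).
pose V r := ssum rot reg ks' om (map val rest) [:: r].
have restE u : ssum bR (@bdreg _ _ opp reg d0) ks' om' rest u = ssum rot reg ks' om (map val rest) u.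
  apply: ssum_map => z zc; have f0 x : x \in orb rot (val z) -> bfar x by apply: fr.
  have f1 : bfar (val z) by apply: f0; rewrite mem_head.
  have oE : map val (orb bR z) = orb rot (val z) by rewrite val_orb !brot_far ?bfar_rot.
  split=> // x xz; rewrite om'E ob_far //; apply: f0; rewrite -oE; exact: map_f.
have vt1 r : ssum rot reg ks om (map val rest) [:: t; r] = V r by rewrite (ssum_used _ _ _ _ _ ks_perm).
have vt2 r : ssum rot reg ks om (map val rest) [:: r; t] = V r.
  by rewrite -vt1; apply: ssum_perm_used; rewrite -![[:: _; _]]/([:: _] ++ [:: _]) perm_catC.
have v0 r q : r != t -> q != t -> ssum rot reg ks om (map val rest) [:: q; r] = 0.
  move=> rt qt; apply: (@ssum_miss _ _ _ _ _ _ _ _ _ t).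
  - by rewrite (perm_mem ks_perm) mem_head.
  - by rewrite !inE ![t == _]eq_sym negb_or rt qt.
  - by move=> c a /mapP[z zc ->] az; case/and4P: (fr z a zc az).
have vtt : V t = 0.
  by rewrite -vt1; apply: ssum_dup; rewrite ?kept_uniq //= inE eqxx.
have rN x : reg x = t -> [/\ reg (rot x) != t, reg (r2 x) != t & reg (r3 x) != t].
  by move=> rx; rewrite (in_t_pre Dg rx) (in_t_r2 Dg D4 rx) (reg_r3 Dg) (in_t_inn Dg rx).
have [n1 n2 n3] := rN d0 erefl; have [n4 n5 n6] := rN d1 rt1.
rewrite !ssum_cons !restE !om'E !(val_bdrot Dg D4) /bdreg !(val_bdrot Dg D4) SubK b20 b30 b21.
rewrite ob20 ob30 ob21 ob31 -!/(V _) rt1 !vt1 ?vt2 !v0 // vtt.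
have -> : reg (rot d1) = reg (r3 d0) by rewrite (reg_r3 Dg) od0.
have -> : reg (rot d0) = reg (r3 d1) by rewrite (reg_r3 Dg) od1.
rewrite ysE ys'E; field; by rewrite !om0.
Qed.

Lemma bigon_step_value cs cs' gam' : crossings rot cs -> crossings bR cs' ->
  (forall u, lb u -> gam' u = 0) ->
  mon X2 gam' * segprod j0 blab X2 * ssum bR (@bdreg _ _ opp reg d0) ks' om' cs' [::] =
  mon X gam' * segprod i0 lab X * ssum rot reg ks om cs [::].
Proof.
move=> cc cc' g0; rewrite (ssum2 cc cc') mon2 // -segprod2; ring.
Qed.

End Values.

Local Notation j0 := (bdroot t_i0 t_i1).
Local Notation bnu' := (fun z : D' => bnu (val z)).

Lemma framed_bigon : framed bR (@bdopp _ _ opp reg d0) j0 blab B2 bnu'.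
Proof.
split; [exact: blab_eq | by do 2!apply: mutate_antisym; apply: (framed_asym Fr)
  | exact: bseg | |].
  move=> d e; have [h h'] := outN (valP e).
  by rewrite bnu_lb ?lbT // (negbTE h) (negbTE h') !if_same.
move=> K pos X' cone X'p d dn dn'.
have [X Xp e] := unmutate (K := K) (pos := pos) [:: s; s'] cone (framed_asym Fr) X'p.
have -> : X' = cvar (bs2 B s s' X).
  by transitivity (cvar (mutations (Seed X B) [:: s; s'])); first by rewrite e.
apply: (by2 cone Xp).
  by apply: contraNneq dn => h; apply/eqP/val_inj; rewrite h.
by apply: contraNneq dn' => h; apply/eqP/val_inj; rewrite h (val_bdopp Dg).
Qed.

Let Dg' := bigon_move Dg D4 bg t_i0 t_i1.

Section Pin.
Variables (gam' : I -> int) (mus' : seq D') (k' : D') (cs' : seq D').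
Hypothesis g0 : forall z, gam' (blab z) = 0.
Hypothesis cc' : crossings bR cs'.
Hypothesis value : forall (K : fieldType) (pos : K -> Prop) (X : I -> K),
  positive_cone pos -> all_pos pos X ->
  cvar (mutations (Seed X B2) (map blab mus')) (blab k') =
    mon X gam' * segprod j0 blab X * ssum bR (@bdreg _ _ opp reg d0)
      (kept (@bdopp _ _ opp reg d0) (@bdreg _ _ opp reg d0) j0) (omega bR blab X bnu') cs' [::].

(* A state avoiding the corner [q] shows that the new frozen variable [p], which
   only enters the weight of [q], does not divide the state sum; it does not
   divide cluster variables either. *)
Lemma pin p (q : D') : p = s \/ p = s' -> (forall z, bnu (val z) p = (z == q)%:Z) ->
  gam' p = 0.
Proof.
move=> ps nuq; pose X a : tfield := if a == p then tvar else 1.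
have bN z : blab z != p by have [h h'] := outN (valP z); case: ps => ->.
have Xb z : X (blab z) = 1 by rewrite /X (negbTE (bN z)).
have Xp : all_pos tpos X.
  by move=> a; rewrite /X; case: eqP => _; [apply: tpos_tvar | apply: (pos1 tpos_cone)].
have monX v : mon X v = tvar ^ v p.
  rewrite /mon (bigD1 p) //= {1}/X eqxx big1 ?mulr1 // => a /negbTE ap.
  by rewrite /X ap exp1rz.
have Xu : unit_off p X.
  split; first by rewrite /X eqxx.
  by move=> a /negbTE ap; rewrite /X ap; apply: (pos1 val0_cone).
have asym2 : antisym B2 by do 2!apply: mutate_antisym; apply: (framed_asym Fr).
have [_ lhs] := mutations_unit_off (s := Seed X B2) (p := p) (ks := map blab mus')
   (negbT (introF mapP (fun '(ex_intro2 z _ e) => negP (bN z) (introT eqP (esym e))))) asym2 Xu.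
have := lhs _ (bN k'); rewrite (value tpos_cone Xp) monX.
have -> : segprod j0 blab X = 1.
  by apply: big1 => u /andP[/codomP[z ->] _]; apply: Xb.
rewrite mulr1 (ssum_state (rot4 Dg') (kept_uniq _ _ _) (@kept_reg _ _ _ _ _)) //.
have -> : \sum_(S | stateb bR (@bdreg _ _ opp reg d0) (kept (@bdopp _ _ opp reg d0) (@bdreg _ _ opp reg d0) j0) S)
    \prod_(d in S) omega bR blab X bnu' d =
  \sum_(S : {set D'} | stateb bR (@bdreg _ _ opp reg d0) (kept (@bdopp _ _ opp reg d0) (@bdreg _ _ opp reg d0) j0) S)
    tvar ^ (q \in S)%:Z.
  apply: eq_bigr => S _; rewrite (eq_bigr (fun z => tvar ^ (z == q)%:Z)); last first.
    by move=> z _; rewrite /omega !Xb mulr1 divr1 monX nuq.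
  case: (boolP (q \in S)) => qS.
    rewrite (bigD1 q) //= eqxx big1 ?mulr1 // => z /andP[_ /negbTE ->]; exact: expr0z.
  by rewrite expr0z big1 // => z zS; case: eqP qS zS => [->|]; rewrite ?expr0z // => /negbTE ->.
set st := stateb _ _ _ => val; have stP := stateP (rot4 Dg')
  (@kept_reg _ _ (@bdopp _ _ opp reg d0) (@bdreg _ _ opp reg d0) j0).
(* The left side of [value] is nonzero, so the sum over the states is not empty. *)
have [S0 S0P] : exists S0, st S0.
  apply/existsP; apply: contraT; rewrite negb_exists => /forallP no.
  have := pos_neq0 val0_cone val; rewrite big1 ?mulr0 ?eqxx // => S.
  by rewrite (negbTE (no S)).
have [S SP qS] : exists2 S, st S & q \notin S.
  have [qk|qk] := boolP (bdreg q \in kept (@bdopp _ _ opp reg d0) (@bdreg _ _ opp reg d0) j0); last first.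
    by exists S0 => //; apply: contra qk => qS; move/stP: S0P => [h _ _ _ _]; apply: h.
  (* There is no monogon, so [q'] is another corner of the region of [q], and a state through [q']
     cannot contain [q]. *)
  pose q' := fnext bR (@bdopp _ _ opp reg d0) q.
  have q'r : bdreg q' = bdreg q by apply: (reg_fnext Dg').
  have D'4 : (4 < #|D'|)%N by have := card_bdart Dg D4 bg; move: D8; lia.
  have [|S SP q'S] := state_through Dg' (c0 := q') (elimT (stP S0) S0P); first by rewrite q'r.
  exists S; first exact/stP.
  apply/negP => qS; have := no_monogon Dg' q D'4.
  by rewrite -/q' (state_reg_inj SP q'S qS q'r) eqxx.
apply: tvar_val0; set z := \sum_(_ | _) _ in val.
have z0 : val0 z.
  rewrite /z (bigD1 S) //= (negbTE qS) expr0z; apply: val0_sum => //.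
  exact: (pos1 val0_cone).
have -> : tvar ^ gam' p = tvar ^ gam' p * z * z^-1 by rewrite mulfK // (pos_neq0 val0_cone).
by apply: (posM val0_cone) => //; apply: (posV val0_cone).
Qed.

Lemma pinned u : lb u -> gam' u = 0.
Proof.
case/codomP=> x ->; case: (boolP (out x)) => ox; first exact: (g0 (Sub x ox)).
have ps : gam' s = 0.
  apply: (@pin s (Sub (r3 d1) (out3 rt1))); first by left.
  move=> z; rewrite bnu_lb ?lbT // -val_eqE /= (negbTE (bq_ss Q)) eqxx.
  by case: eqP => [->|_]; rewrite ?ioT //; case: eqP.
have ps' : gam' s' = 0.
  apply: (@pin s' (Sub (r3 d0) (out3 (erefl t)))); first by right.
  move=> z; rewrite bnu_lb ?lbT // -val_eqE /= eqxx [s' == s]eq_sym (negbTE (bq_ss Q)).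
  by rewrite if_same; case: eqP.
move: ox; rewrite negb_and !negbK => /orP[/eqP/t_cases[] -> //|/eqP/t_cases e].
by have -> : lab x = lab (opp x) by []; case: e => ->.
Qed.

End Pin.

Lemma bigon_value (gam' : I -> int) (mus' : seq D') (k' : D') :
  (forall z, gam' (blab z) = 0) ->
  (forall cs', crossings bR cs' -> forall (K : fieldType) (pos : K -> Prop) (X : I -> K),
    positive_cone pos -> all_pos pos X ->
    cvar (mutations (Seed X B2) (map blab mus')) (blab k') =
    mon X gam' * segprod j0 blab X * ssum bR (@bdreg _ _ opp reg d0)
      (kept (@bdopp _ _ opp reg d0) (@bdreg _ _ opp reg d0) j0) (omega bR blab X bnu') cs' [::]) ->
  exists2 gam : I -> int, forall d, gam (lab d) = 0 &
  forall cs, crossings rot cs -> forall (K : fieldType) (pos : K -> Prop) (X : I -> K),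
    positive_cone pos -> all_pos pos X ->
    cvar (mutations (Seed X B) (map lab ([:: d1; d0] ++ map val mus'))) (lab (val k')) =
      mon X gam * segprod i0 lab X * ssum rot reg (kept opp reg i0) (omega rot lab X nu) cs [::].
Proof.
move=> g0 value; have [cs' cc'] := exists_crossings (rot4 Dg') (rot2_neq Dg').
have gl := pinned g0 cc' (value cs' cc').
exists gam' => [d|cs cc K pos X cone Xp]; first by apply: gl; apply: lbT.
rewrite -(bigon_step_value cone Xp cc cc' gl).
have X2p : all_pos pos (cvar (bs2 B s s' X)) by do 2!apply: (mutate_pos cone).
rewrite -(value cs' cc' K pos _ cone X2p).
by rewrite /mutations map_cat foldl_cat -map_comp.
Qed.

End Labelled.
End BigonStep.

Lemma bigon_computed (D J : finType) (rot opp : D -> D) (reg : D -> J)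
    (lev : J -> nat) (i0 : D) (Dg : diagram rot opp reg lev i0) (D8 : (8 < #|D|)%N) d0
    (bg : bigon_at rot opp d0) (t0 : reg d0 <> reg i0) (t1 : reg d0 <> reg (opp i0)) :
  computed (@bdrot D J rot opp reg d0) (@bdopp _ _ opp reg d0) (@bdreg _ _ opp reg d0)
    (bdroot t0 t1) ->
  computed rot opp reg i0.
Proof.
move=> [mus' [k' H]]; set d1 := fnext rot opp d0.
exists ([:: d1; d0] ++ map val mus'), (val k') => I lab B nu Fr.
have [gam' g0 val] := H _ _ _ _ (framed_bigon Dg D8 bg t0 t1 (erefl d1) Fr).
exact: (bigon_value Dg D8 bg (erefl d1) Fr g0 val).
Qed.

(** * State sums are cluster variables *)

Section BaseCase.
Variables (D J : finType) (rot opp : D -> D) (reg : D -> J) (lev : J -> nat) (i0 : D).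
Hypothesis Dg : diagram rot opp reg lev i0.
Hypothesis D8 : #|D| = 8%N.
Local Notation r2 d := (rot (rot d)).
Local Notation r3 d := (rot (rot (rot d))).
Local Notation nx := (fnext rot opp).
Let D4 : (4 < #|D|)%N. Proof. by rewrite D8. Qed.
Let rotK := rot4 Dg.
Let oppK := dopK Dg.

(* The four regions share eight corners and none is a monogon. *)
Lemma all_bigons x : nx (nx x) = x.
Proof.
apply/eqP; apply: contraT => nb; have nm := no_monogon Dg.
pose fib r := [set y | reg y == r].
have fib2 r : r \in [set reg d | d : D] -> (2 <= #|fib r|)%N.
  case/imsetP=> y _ ->; have /card_uniqP /= <- : uniq [:: y; nx y].
    by rewrite /= inE eq_sym nm.
  by apply/subset_leq_card/subsetP => z; rewrite !inE => /orP[] /eqP ->; rewrite ?(reg_fnext Dg).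
have fib3 : (3 <= #|fib (reg x)|)%N.
  have /card_uniqP /= <- : uniq [:: x; nx x; nx (nx x)].
    by rewrite /= !inE negb_or !(eq_sym x) nb nm // [nx x == _]eq_sym nm.
  by apply/subset_leq_card/subsetP => z; rewrite !inE => /or3P[] /eqP ->; rewrite ?(reg_fnext Dg).
have : #|D| = (\sum_(r in [set reg d | d : D]) #|fib r|)%N.
  rewrite -sum1_card (partition_big reg (mem [set reg d | d : D])) /=; last first.
    by move=> y _; apply: imset_f.
  by apply: eq_bigr => r _; rewrite -sum1_card; apply: eq_bigl => y; rewrite inE.
rewrite (bigD1 (reg x)) ?imset_f //= => e.
have : (2 * (#|[set reg d | d : D]|).-1 <= \sum_(i in [set reg d | d : D] | i != reg x) #|fib i|)%N.
  have -> : (#|[set reg d | d : D]|).-1 = #|[set reg d | d : D] :\ reg x|.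
    by rewrite (cardsD1 (reg x) [set reg d | d : D]) imset_f.
  rewrite mulnC -sum_nat_const (eq_bigl (fun i => (i \in [set reg d | d : D]) && (i != reg x))).
    by apply: leq_sum => r /andP[/fib2].
  by move=> r; rewrite !inE andbC.
have rc := reg_card Dg; move: (\sum_(i in _ | _) _)%N e fib3 rc => Sm; rewrite D8.
move: #|fib (reg x)| #|[set reg d | d : D]| => a b; lia.
Qed.

Local Notation o := (opp (r2 i0)).

Let ro : rot o = opp (rot i0).
Proof.
have := all_bigons (rot i0); have : nx o = rot i0 by rewrite /fnext oppK rotK.
move=> e; have := all_bigons o; rewrite e /fnext => h.
by rewrite -h rotK.
Qed.

Let ro3 : opp (r3 o) = r3 i0.
Proof.
have := all_bigons (r2 i0); rewrite {2}/fnext -/(nx (r3 o)) /fnext => h.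
by apply: (drot_inj Dg); apply: (drot_inj Dg); apply: (drot_inj Dg); rewrite h !rotK.
Qed.

Let regs : [/\ reg o = reg (rot i0), reg (rot o) = reg i0, reg (r2 o) = reg (opp i0)
  & reg (r3 o) = reg (r2 i0)].
Proof.
split; first by rewrite (reg_back Dg).
- by rewrite ro (reg_back Dg).
- by rewrite -(rotK (r2 o)) (reg_r3 Dg) ro3 (reg_r3 Dg).
- by rewrite (reg_r3 Dg) oppK.
Qed.

Let rN d : [/\ reg d != reg (rot d), reg d != reg (r2 d) & reg d != reg (r3 d)].
Proof.
by split; rewrite eq_sym ?(reg_rot_neq Dg) ?(reg_r2_neq Dg D4) // (reg_r3 Dg) (reg_opp_neq Dg).
Qed.

Let o_orb : o \notin orb rot i0.
Proof.
have [e _ _ _] := regs; apply/negP; rewrite !inE => /or4P[] /eqP h; move: e; rewrite h => /eqP.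
- by case: (rN i0) => /negbTE ->.
- by move: h => /eqP; have := no_monogon Dg o D4; rewrite /fnext oppK rotK eq_sym => /negbTE ->.
- by rewrite eq_sym; case: (rN (rot i0)) => /negbTE ->.
- by rewrite eq_sym; case: (rN (rot i0)) => _ /negbTE ->.
Qed.

Let cross2 : crossings rot [:: i0; o].
Proof.
have u2 : uniq (orb rot i0 ++ orb rot o).
  rewrite cat_uniq !(orb_uniq rotK (rot2_neq Dg)) andbT andTb; apply/hasPn => x xo; apply/negP => xi.
  by case/negP: o_orb; rewrite -(orb_in rotK _ xi) (orb_sym rotK).
rewrite /crossings (_ : flatten _ = orb rot i0 ++ orb rot o) //.
have [|| _ h] := uniq_min_size u2 (s2 := enum D); first by move=> x; rewrite mem_enum.
  by rewrite -cardE D8.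
by apply: uniq_perm; rewrite ?enum_uniq.
Qed.

Let ks := kept opp reg i0.
Let ksE : perm_eq ks [:: reg (rot i0); reg (r2 i0)].
Proof.
have pq : reg (rot i0) != reg (r2 i0) by case: (rN (rot i0)).
have n1 : reg (rot i0) != reg i0 by rewrite eq_sym; case: (rN i0).
have n2 : reg (r2 i0) != reg i0 by rewrite eq_sym; case: (rN i0).
have n3 : reg (rot i0) != reg (opp i0) by rewrite -(reg_r3 Dg); case: (rN (rot i0)).
have n4 : reg (r2 i0) != reg (opp i0) by rewrite -(reg_r3 Dg); case: (rN (r2 i0)).
apply: uniq_perm; rewrite ?kept_uniq //= ?inE ?pq // => r; rewrite kept_mem !inE.
apply/and3P/idP => [[h1 h2 /imsetP[d _ rd]]|/orP[] /eqP ->]; last 2 first.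
- by split=> //; apply: imset_f.
- by split=> //; apply: imset_f.
have [e1 e2 e3 e4] := regs; have := mem_enum D d; rewrite -(perm_mem cross2) !flatten_orb !mem_cat.
rewrite /= orbF => /orP[]; rewrite !inE => /or4P[] /eqP h; move: h1 h2; rewrite rd h.
all: rewrite ?e1 ?e2 ?e3 ?e4 ?(reg_r3 Dg) ?eqxx ?orbT //.
Qed.

(** Two crossings are joined by four segments bounding four bigons, so all arrows at the segment of
    [rot (rot i0)], the one opposite to [i0], cancel except for frozen ones. A single mutation there
    gives [1 + y] times a monomial, and the diagram has exactly two states, whose weights have ratio
    [y]. *)
Lemma base_computed : computed rot opp reg i0.
Proof.
exists [:: r2 i0], (r2 i0) => I lab B nu Fr.
pose lb u := u \in codom lab; have lbT d : lb (lab d) by apply: codom_f.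
have lE := lab_eq Fr; have lab_opp x : lab (opp x) = lab x.
  by apply/eqP; rewrite lE oppK eqxx orbT.
have la : lab (rot o) = lab (rot i0) by rewrite ro lab_opp.
have le : lab (r3 o) = lab (r3 i0) by rewrite -ro3 lab_opp.
have row j : lb j -> B (lab (r2 i0)) j = 0.
  move=> /codomP[f ->]; rewrite (framed_asym Fr) (framed_seg Fr) la le !rotK; ring.
have io : inout lb B (lab (r2 i0)) (fun=> 0) (fun=> 0).
  by move=> j lj; rewrite row //; split=> //; left.
have nu0 x u : lb u -> nu x u = 0 by case/codomP=> y ->; apply: (framed_nu Fr).
exists (fun u => frozen_out lb B (lab (r2 i0)) u - nu (rot i0) u - nu (r3 o) u).
  by move=> d; rewrite !nu0 // /frozen_out lbT.
move=> cs cc K pos X cone Xp; have X0 := all_pos_nonzero cone Xp.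
have asym := framed_asym Fr.
rewrite [mutations _ _]/= (@mutate_cvar _ _ (Seed X B)) //= (inout_outp X0 io).
rewrite big1 ?mulr1 => [|j _]; last exact: expr0z.
set om := omega rot lab X nu; have m0 v := mon_neq0 v X0.
have om0 x : om x != 0 by rewrite mulf_neq0 ?invr_eq0 ?m0 // mulf_neq0 ?X0.
have nr : r2 i0 != i0 /\ r2 i0 != opp i0.
  split; first exact: (rot2_neq Dg).
  by apply/eqP => h; case: (rN (r2 i0)) => h1 _ _; move: h1; rewrite h -(reg_r3 Dg) -h eqxx.
have yE : yh X B (lab (r2 i0)) = om (r2 i0) / om (rot i0) * (om o / om (r3 o)).
  by case: nr => h1 h2; rewrite (framed_y Fr cone Xp) // /mfac !rotK.
have [e1 e2 e3 e4] := regs.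
have pE u : perm_eq u ks = perm_eq u [:: reg (rot i0); reg (r2 i0)] by rewrite (permPr ksE).
have pq : reg (rot i0) != reg (r2 i0) by case: (rN (rot i0)).
have n1 : reg i0 != reg (rot i0) by case: (rN i0).
have n2 : reg i0 != reg (r2 i0) by case: (rN i0).
have n3 : reg (opp i0) != reg (rot i0) by rewrite -(reg_r3 Dg) eq_sym; case: (rN (rot i0)).
have n4 : reg (opp i0) != reg (r2 i0) by rewrite -(reg_r3 Dg) eq_sym; case: (rN (r2 i0)).
have p2 x y : perm_eq [:: x; y] [:: reg (rot i0); reg (r2 i0)] =
   ((x == reg (rot i0)) && (y == reg (r2 i0))) || ((x == reg (r2 i0)) && (y == reg (rot i0))).
  have p1 (a b : J) : perm_eq [:: a] [:: b] = (a == b).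
    by apply/idP/eqP => [/perm_mem/(_ a)|->//]; rewrite !inE eqxx => /esym/eqP.
  have [->|xp] := eqVneq x (reg (rot i0)); first by rewrite perm_cons p1 (negbTE pq) orbF.
  have [->|xq] := eqVneq x (reg (r2 i0)).
    have h : perm_eq [:: reg (rot i0); reg (r2 i0)] [:: reg (r2 i0); reg (rot i0)].
      by rewrite -[[:: reg (rot i0); _]]/([:: reg (rot i0)] ++ [:: reg (r2 i0)]) perm_catC.
    by rewrite (permPr h) perm_cons p1.
  apply/negP => /perm_mem/(_ x); by rewrite !inE eqxx (negbTE xp) (negbTE xq).
have -> : ssum rot reg ks om cs [::] = om (rot i0) * om (r3 o) + om (r2 i0) * om o.
  have ep : perm_eq (flatten [seq orb rot c | c <- cs]) (flatten [seq orb rot c | c <- [:: i0; o]]).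
    by apply: perm_trans cc _; rewrite perm_sym; apply: cross2.
  rewrite (ssum_indep _ _ rotK _ _ ep) !ssum_cons /= !pE !p2 e1 e2 e3 e4 (reg_r3 Dg).
  rewrite ?eqxx ?(negbTE n1) ?(negbTE n2) ?(negbTE n3) ?(negbTE n4) ?(negbTE pq).
  rewrite ?[reg (r2 i0) == reg (rot i0)]eq_sym ?(negbTE pq) /=; ring.
have oi0 : opp i0 = r2 o.
  have : nx i0 = rot o by rewrite -(all_bigons (rot o)) {3}/fnext ro oppK rotK.
  by rewrite /fnext => h; rewrite -(rotK (opp i0)) h.
have oin x : x \in orb rot i0 -> opp x \in orb rot o.
  rewrite !inE => /or4P[] /eqP ->; rewrite ?oi0 -?ro -?ro3 ?oppK ?eqxx ?orbT //.
have dj x : x \in orb rot o -> x \notin orb rot i0.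
  move=> xo; apply: contra o_orb => xi; by rewrite -(orb_in rotK _ xi) (orb_sym rotK).
have ui := orb_uniq rotK (rot2_neq Dg) i0.
have lN x y : x \in orb rot i0 -> y \in orb rot i0 -> x != y -> lab x != lab y.
  move=> xi yi xy; rewrite lE negb_or eq_sym xy /=; apply: contraTneq yi => ->.
  exact: dj (oin _ xi).
have mi : [/\ i0 \in orb rot i0, rot i0 \in orb rot i0, r2 i0 \in orb rot i0 & r3 i0 \in orb rot i0].
  by rewrite !inE !eqxx ?orbT.
have [m0' m1 m2 m3] := mi; move: ui; rewrite /= !inE !negb_or => /and4P[/and3P[u1 u2 u3] /andP[u4 u5] u6 _].
have segE : segprod i0 lab X = X (lab (rot i0)) * X (lab (r2 i0)) * X (lab (r3 i0)).
  rewrite /segprod (bigD1 (lab (rot i0))) /=; last by rewrite codom_f eq_sym lN.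
  rewrite (bigD1 (lab (r2 i0))) /=; last by rewrite codom_f [_ == lab i0]eq_sym lN //= eq_sym lN.
  rewrite (bigD1 (lab (r3 i0))) /=; last first.
    by rewrite codom_f [_ == lab i0]eq_sym lN //= [_ == lab (rot i0)]eq_sym lN //= eq_sym lN.
  rewrite big_pred0 ?mulr1 ?mulrA // => u; apply/negP.
  case/andP=> /andP[/andP[/andP[/codomP[x ->] n0'] n1'] n2'] n3'.
  have := mem_enum D x; rewrite -(perm_mem cross2) !flatten_orb !mem_cat /= orbF => /orP[].
    by rewrite !inE => /or4P[] /eqP h; move: n0' n1' n2' n3'; rewrite h eqxx.
  rewrite !inE => /or4P[] /eqP h; move: n0' n1' n2' n3'; rewrite h ?la ?le ?lab_opp ?eqxx //.
  by rewrite -oi0 lab_opp eqxx.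
rewrite segE !monD // !monN yE.
have -> : om (rot i0) = mon X (nu (rot i0)) / (X (lab (rot i0)) * X (lab (r2 i0))) by [].
have -> : om (r3 o) = mon X (nu (r3 o)) / (X (lab (r3 i0)) * X (lab (r2 i0))).
  by rewrite /om /omega rotK le lab_opp.
by field; rewrite !X0 !m0.
Qed.

End BaseCase.

Theorem state_sum_computed (D J : finType) (rot opp : D -> D) (reg : D -> J)
    (lev : J -> nat) (i0 : D) :
  diagram rot opp reg lev i0 -> (4 < #|D|)%N -> computed rot opp reg i0.
Proof.
suff H n m (D' J' : finType) (rot' opp' : D' -> D') (reg' : D' -> J') (lev' : J' -> nat) (i0' : D') :
    diagram rot' opp' reg' lev' i0' -> (4 < #|D'|)%N -> (#|D'| <= n)%N ->
    (level_sum reg' lev' <= m)%N -> computed rot' opp' reg' i0'.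
  by move=> Dg D4; apply: (H _ _ _ _ _ _ _ _ _ Dg D4 (leqnn _) (leqnn _)).
elim: n m D' J' rot' opp' reg' lev' i0' => [|n IHn] m D' J' rot' opp' reg' lev' i0' Dg D4.
  by move=> le; move: D4; rewrite (leqn0 _) in le *; rewrite (eqP le).
elim: m J' reg' lev' opp' i0' Dg => [|m IHm] J' reg' lev' opp' i0' Dg Dn lm.
all: have [D8|D8] := leqP #|D'| 8.
(* Darts come in fours, so more than four and at most eight means eight. *)
1,3: apply: (base_computed Dg); have := card_reps Dg (C := setT) (fun x => etrans (in_setT _) (esym (in_setT _))).
1,2: by rewrite cardsT; move: D4 D8; lia.
all: have [[d [bg t0 t1]]|[d [tri tip t0 t1 nb]]] := exists_reducible Dg D4.
1,3: apply: (bigon_computed Dg D8 bg (t0 := t0) (t1 := t1)).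
1,2: have Dg' := bigon_move Dg D4 bg t0 t1; have cd := card_bdart Dg D4 bg.
1,2: by apply: (IHn _ _ _ _ _ _ _ _ Dg' _ _ (leqnn _)); move: cd D8 Dn; lia.
all: have lt := triangle_level_sum Dg D4 tri tip.
  by move: lt lm; lia.
apply: (triangle_computed Dg D4 tri t0 t1 nb).
by apply: (IHm _ _ _ _ _ (triangle_move Dg D4 tri tip t0 t1 nb)) => //; move: lt lm; lia.
Qed.

(** * Potentials on the sphere *)

Section ExactPair.
Variables (F : fieldType) (P Q N : finType) (M1 : P -> N -> F) (M2 : Q -> N -> F).
Variables (p0 : P) (q0 : Q).
Hypothesis orth : forall p q, \sum_n M1 p n * M2 q n = 0.
Hypothesis ker1 : forall v, (forall n, \sum_p v p * M1 p n = 0) -> v p0 = 0 ->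
  forall p, v p = 0.
Hypothesis ker2 : forall v, (forall n, \sum_q v q * M2 q n = 0) -> v q0 = 0 ->
  forall q, v q = 0.
Hypothesis dims : (#|N| + 2 <= #|P| + #|Q|)%N.

Definition mat_of (T : finType) (M : T -> N -> F) : 'M[F]_(#|T|, #|N|) :=
  \matrix_(i, j) M (enum_val i) (enum_val j).

Lemma mat_of_row (T : finType) (M : T -> N -> F) (v : 'rV[F]_(#|T|)) (n : N) :
  (v *m mat_of M) 0 (enum_rank n) = \sum_t v 0 (enum_rank t) * M t n.
Proof.
rewrite mxE (reindex _ (onW_bij _ (@enum_rank_bij T))) /=; apply: eq_bigr => t _.
by rewrite mxE !enum_rankK.
Qed.

(** Evaluation at [t0] is injective on the kernel, which therefore has dimension at most one. *)
Lemma rank_mat_of (T : finType) (M : T -> N -> F) (t0 : T) :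
  (forall v, (forall n, \sum_t v t * M t n = 0) -> v t0 = 0 -> forall t, v t = 0) ->
  (#|T| <= \rank (mat_of M) + 1)%N.
Proof.
move=> ker; pose f : 'cV[F]_(#|T|) := delta_mx (enum_rank t0) 0.
have /mxrank_injP e : (kermx (mat_of M) :&: kermx f)%MS == 0.
  rewrite -submx0; apply/rV_subP => v; rewrite sub_capmx => /andP[/sub_kermxP vM /sub_kermxP vf].
  rewrite submx0; apply/eqP/rowP => j; rewrite mxE.
  have := ker (fun t => v 0 (enum_rank t)) _ _ (enum_val j); rewrite enum_valK; apply.
    by move=> n; rewrite -mat_of_row vM mxE.
  have /matrixP/(_ 0 0) := vf; rewrite !mxE (bigD1 (enum_rank t0)) //= mxE !eqxx mulr1.
  by rewrite big1 ?addr0 // => k /negbTE kt; rewrite mxE kt mulr0.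
have := rank_leq_col (kermx (mat_of M) *m f); rewrite e mxrank_ker.
have := rank_leq_row (mat_of M); lia.
Qed.

(** The rows of [M1] lie in the space orthogonal to those of [M2]. The two ranks are at least
    [#|P| - 1] and [#|Q| - 1], so [dims] forces equality: the complex is exact in the middle. *)
Lemma exact_pair (h : N -> F) : (forall q, \sum_n h n * M2 q n = 0) ->
  exists f : P -> F, forall n, h n = \sum_p f p * M1 p n.
Proof.
move=> hM; pose A1 := mat_of M1; pose A2 := mat_of M2.
have tE (v : 'rV[F]_(#|N|)) q : (v *m A2^T) 0 (enum_rank q) = \sum_n v 0 (enum_rank n) * M2 q n.
  rewrite mxE (reindex _ (onW_bij _ (@enum_rank_bij N))) /=; apply: eq_bigr => n _.
  by rewrite !mxE !enum_rankK.
have A12 : (A1 <= kermx A2^T)%MS.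
  apply/row_subP => i; apply/sub_kermxP/rowP => j; rewrite [RHS]mxE -[j]enum_valK tE.
  rewrite -[RHS](orth (enum_val i) (enum_val j)); apply: eq_bigr => n _.
  by rewrite !mxE enum_rankK.
have [_ /esym] := mxrank_leqif_sup A12; rewrite mxrank_ker mxrank_tr.
have r1 := rank_mat_of ker1; have r2 := rank_mat_of ker2.
have r3 := mxrankS A12; rewrite mxrank_ker mxrank_tr in r3.
have -> : \rank A1 == (#|N| - \rank A2)%N by apply/eqP; move: r1 r2 r3 dims; rewrite -/A1 -/A2; lia.
move=> sub; pose hv : 'rV[F]_(#|N|) := \row_j h (enum_val j).
have : (hv <= A1)%MS.
  apply: submx_trans sub; apply/sub_kermxP/rowP => j; rewrite [RHS]mxE -[j]enum_valK tE.
  by rewrite -[RHS](hM (enum_val j)); apply: eq_bigr => n _; rewrite mxE enum_rankK.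
case/submxP=> w hw; exists (fun p => w 0 (enum_rank p)) => n; rewrite -mat_of_row -/A1 -hw.
by rewrite mxE enum_rankK.
Qed.

End ExactPair.

(* On a combinatorial sphere with vertices the cycles of [s] and of [t] and
   faces the cycles of [w], the first cohomology vanishes. *)
Section Potential.
Variables (F : fieldType) (N : finType) (s t w : {perm N}) (e0 : N).
Hypothesis face_w : forall e, porbit w (s (t e)) = porbit w e.
Hypothesis conn : forall g : N -> F, (forall e, g (s e) = g e) -> (forall e, g (t e) = g e) ->
  forall e, g e = g e0.
Hypothesis euler : (#|N| + 2 <= #|porbits w| + (#|porbits s| + #|porbits t|))%N.

Let T (u : {perm N}) : finType := {c : {set N} | c \in porbits u}.
Let cyc_in (u : {perm N}) e : porbit u e \in porbits u. Proof. exact: imset_f. Qed.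
Let cyc (u : {perm N}) e : T u := exist _ (porbit u e) (cyc_in u e).

Let cyc_ex u (c : T u) : exists e, c = cyc u e.
Proof.
have /imsetP[e _ ce] := valP c; exists e; exact: val_inj.
Qed.

Let M1 (f : T w) n : F := (n \in val f)%:R - (s n \in val f)%:R.
Let M2 (q : (T s + T t)%type) n : F :=
  match q with inl c => (n \in val c)%:R | inr c => (n \in val c)%:R end.

Let cycE u (c : T u) n : (n \in val c) = (c == cyc u n).
Proof.
have [e ->] := cyc_ex c; by rewrite -val_eqE /= eq_porbit_mem porbit_sym.
Qed.

Let sum_cyc u (g : T u -> F) n : \sum_c g c * (n \in val c)%:R = g (cyc u n).
Proof.
rewrite (bigD1 (cyc u n)) //= big1 ?addr0.
  by rewrite porbit_id mulr1.
by move=> c; rewrite cycE => /negbTE ->; rewrite mulr0.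
Qed.

Let cycS u n : cyc u (u n) = cyc u n.
Proof. by apply: val_inj; have := porbit_perm u 1 n; rewrite expg1. Qed.

Let mem_S u (c : T u) n : (u n \in val c) = (n \in val c).
Proof. by rewrite !cycE cycS. Qed.

Let sum_orb (u : {perm N}) (c : T u) (g : N -> F) :
  \sum_n g (u n) * (n \in val c)%:R = \sum_n g n * (n \in val c)%:R.
Proof.
rewrite [RHS](reindex_inj (@perm_inj _ u)) /=; apply: eq_bigr => n _.
by rewrite mem_S.
Qed.

Let memw f n : (n \in val (f : T w)) = (s (t n) \in val f).
Proof. by rewrite !cycE; congr (_ == _); apply: val_inj; rewrite /= face_w. Qed.

Let orth f q : \sum_n M1 f n * M2 q n = 0.
Proof.
rewrite /M1 /M2; under eq_bigr => n _ do rewrite mulrBl; rewrite sumrB; apply/eqP.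
rewrite subr_eq0; apply/eqP; case: q => c.
  by rewrite (sum_orb c (fun n => (n \in val f)%:R)).
by under eq_bigr => n _ do rewrite memw; rewrite (sum_orb c (fun n => (s n \in val f)%:R)).
Qed.

Let ker1 v : (forall n, \sum_p v p * M1 p n = 0) -> v (cyc w e0) = 0 -> forall p, v p = 0.
Proof.
move=> h v0 p; have [e ->] := cyc_ex p; rewrite -v0.
have hs n : v (cyc w (s n)) = v (cyc w n).
  have := h n; under eq_bigr => f _ do rewrite mulrBr.
  by rewrite sumrB !sum_cyc => /eqP; rewrite subr_eq0 => /eqP.
apply: (conn (g := fun e => v (cyc w e))) => // n; rewrite -hs; congr v.
by apply: val_inj; rewrite /= face_w.
Qed.

Let sum2 v n : \sum_q v q * M2 q n = v (inl (cyc s n)) + v (inr (cyc t n)).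
Proof. by rewrite big_sumType /= !sum_cyc. Qed.

Let ker2 v : (forall n, \sum_q v q * M2 q n = 0) -> v (inl (cyc s e0)) = 0 -> forall q, v q = 0.
Proof.
move=> h v0; have hn n : v (inl (cyc s n)) = - v (inr (cyc t n)).
  by have := h n; rewrite sum2 => /eqP; rewrite addr_eq0 => /eqP.
have g n : v (inl (cyc s n)) = 0.
  rewrite -v0; apply: (conn (g := fun e => v (inl (cyc s e)))) => e; first by rewrite cycS.
  by rewrite !hn cycS.
case=> c; have [e ->] := cyc_ex c => //.
by apply: oppr_inj; rewrite -hn g oppr0.
Qed.

Let cardT u : #|{: T u}| = #|porbits u|.
Proof. by rewrite card_sig; apply: eq_card. Qed.

Let ext u (f : T u -> F) : exists g : {set N} -> F, forall n, g (porbit u n) = f (cyc u n).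
Proof.
exists (fun c => if insub c is Some c' then f c' else 0) => n.
by rewrite insubT ?imset_f // => p; congr f; apply: val_inj.
Qed.

(** The rows of [M1] are the gradients of the indicators of faces, and the rows of [M2] express the
    two conditions on [h]. Euler's formula is the dimension count of [exact_pair]. *)
Lemma potential (h : N -> F) :
  (forall e, \sum_(n in porbit s e) h n = 0) -> (forall e, \sum_(n in porbit t e) h n = 0) ->
  exists f : {set N} -> F, forall n, h n = f (porbit w n) - f (porbit w (s n)).
Proof.
move=> hs ht; have dims : (#|N| + 2 <= #|{: T w}| + #|{: (T s + T t)%type}|)%N.
  by rewrite card_sum !cardT.
have [|f fE] := exact_pair orth ker1 ker2 dims (h := h).
  case=> c; have [e ->] := cyc_ex c; [rewrite -[RHS](hs e)|rewrite -[RHS](ht e)];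
  rewrite [RHS]big_mkcond; apply: eq_bigr => n _; rewrite /M2 /=;
  by case: (n \in _); rewrite ?mulr1 ?mulr0.
have [g gE] := ext f; exists g => n; rewrite fE !gE; under eq_bigr => p _ do rewrite mulrBr.
by rewrite sumrB !sum_cyc.
Qed.

(** The same exactness with the two families exchanged: what is orthogonal to all gradients is
    spanned by the cycles of [s] and of [t]. *)
Lemma dual_potential (v : N -> F) :
  (forall f : {set N} -> F, \sum_n v n * (f (porbit w n) - f (porbit w (s n))) = 0) ->
  exists a b : {set N} -> F, forall n, v n = a (porbit s n) + b (porbit t n).
Proof.
move=> hv; have dims : (#|N| + 2 <= #|{: (T s + T t)%type}| + #|{: T w}|)%N.
  by rewrite card_sum !cardT; move: euler; lia.
have [||c cE] := exact_pair (M1 := M2) (M2 := M1) _ ker2 ker1 dims (h := v).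
- by move=> q f; rewrite -[RHS](orth f q); apply: eq_bigr => n _; rewrite mulrC.
- move=> f; rewrite -[RHS](hv (fun c => (c == val f)%:R)); apply: eq_bigr => n _.
  have h m : (m \in val f) = (porbit w m == val f) by rewrite cycE -val_eqE /= eq_sym.
  by rewrite /M1 !h.
have [a aE] := ext (fun x => c (inl x)); have [b bE] := ext (fun x => c (inr x)).
by exists a, b => n; rewrite cE sum2 aE bE.
Qed.

End Potential.

(** * From link diagrams to levelled diagrams *)

Lemma card_porbits_const (N : finType) (s : {perm N}) k :
  (forall x, #|porbit s x| = k) -> #|N| = (#|porbits s| * k)%N.
Proof.
move=> sk; rewrite -[LHS]sum1_card.
rewrite (partition_big (fun x => porbit s x) (fun c => c \in porbits s)) /=; last first.
  by move=> x _; apply: imset_f.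
rewrite -sum_nat_const; apply: eq_bigr => _ /imsetP[x _ ->]; rewrite -(sk x) -sum1_card.
by apply: eq_bigl => y; rewrite eq_porbit_mem porbit_sym.
Qed.

(** * Distances in a two-coloured graph *)

Section Levels.
Variables (J : finType) (adj : rel J) (r0 : J) (col : J -> bool).
Hypothesis col_adj : forall r r', adj r r' -> col r' = ~~ col r.

Let reach n r := [exists p : n.-tuple J, path adj r0 p && (last r0 p == r)].
(** Length of a shortest path from [r0]. The search ends at [#|J|] because a path without
    repetitions has fewer steps. *)
Definition level r := find (reach^~ r) (iota 0 #|J|).

Let reachP n r : reflect (exists2 p, path adj r0 p & size p = n /\ last r0 p = r) (reach n r).
Proof.
apply: (iffP existsP) => [[p /andP[pp /eqP lp]]|[p pp [sp lp]]].
  by exists p => //; rewrite size_tuple.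
by exists (tcast sp (in_tuple p)); rewrite val_tcast pp lp /=.
Qed.

Let level_reach r : connect adj r0 r -> reach (level r) r.
Proof.
case/connectP=> p0 pp0 lp0; case/shortenP: pp0 lp0 => p pp up _ lp.
have sz : (size p < #|J|)%N by have /card_uniqP/= <- := up; apply: max_card.
have hs : has (reach^~ r) (iota 0 #|J|).
  by apply/hasP; exists (size p); rewrite ?mem_iota //=; apply/reachP; exists p.
by have := nth_find 0%N hs; rewrite nth_iota // -[X in (_ < X)%N](size_iota 0) -has_find.
Qed.

Let level_le n r : reach n r -> (level r <= n)%N.
Proof.
move=> rn; rewrite leqNgt; apply/negP => lt.
have := before_find 0%N lt; rewrite nth_iota ?rn //.
apply: leq_trans lt _; rewrite -[X in (_ <= X)%N](size_iota 0); exact: find_size.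
Qed.

Let path_col p : path adj r0 p -> col (last r0 p) = col r0 (+) odd (size p).
Proof.
elim: p (r0) => [|r p IH] r1 /=; first by rewrite addbF.
by case/andP=> /col_adj e /IH ->; rewrite e; case: (col r1); case: (odd _).
Qed.

Lemma level_root : level r0 = 0%N.
Proof. by apply/eqP; rewrite -leqn0; apply: level_le; apply/reachP; exists [::]. Qed.

(** Distances of neighbours differ by at most one, and the colouring makes their parities differ. *)
Lemma level_adj r r' : connect adj r0 r -> adj r r' -> adj r' r ->
  level r' = (level r).+1 \/ level r = (level r').+1.
Proof.
move=> c a a'; have c' : connect adj r0 r' by apply: connect_trans c (connect1 a).
have odd_level s : connect adj r0 s -> odd (level s) = col r0 (+) col s.
  by move=> /level_reach/reachP[p pp [<- <-]]; rewrite path_col //; case: (col r0); case: odd.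
have step s s' : connect adj r0 s -> adj s s' -> (level s' <= (level s).+1)%N.
  move=> /level_reach/reachP[p pp [sp lp]] ss; apply: level_le; apply/reachP.
  by exists (rcons p s'); rewrite ?rcons_path ?pp ?lp // size_rcons sp last_rcons.
have h1 := step _ _ c a; have h2 := step _ _ c' a'.
have := odd_level _ c; have := odd_level _ c'; rewrite (col_adj a).
have [e|ne] := eqVneq (level r) (level r').
  by rewrite e => ->; case: (col r0); case: (col r).
by move=> _ _; move: h1 h2 ne; lia.
Qed.

Lemma level_down r : connect adj r0 r -> r <> r0 ->
  exists2 r', adj r' r & (level r' < level r)%N.
Proof.
move=> /level_reach/reachP[p pp [sp lp]] nr; case/lastP: p pp sp lp => [|p r'] /=.
  by move=> _ _ /esym.
rewrite rcons_path size_rcons last_rcons => /andP[pp a] sp e; subst r'.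
exists (last r0 p) => //; rewrite -sp ltnS; apply: level_le; apply/reachP; by exists p.
Qed.

End Levels.

Lemma F2_cases (x : 'F_2) : x = 0 \/ x = 1.
Proof. by case: x => -[|[|m]] //= h; [left | right]; apply: val_inj. Qed.

Lemma F2_addb (x y : 'F_2) : (x + y == 1) = (x == 1) (+) (y == 1).
Proof. by case: (F2_cases x) => ->; case: (F2_cases y) => ->. Qed.

Section LinkToDiagram.
Variables (L : link_diagram) (Lconn : connected L) (Lprime : prime_like L)
  (Lred : forall c : crossing L, ~ nugatory c).
Local Notation D := (dart L).
Local Notation rt := (rot L).
Local Notation op := (opp L).
Local Notation rg := (@region_of L).
Variable i0 : D.

Lemma link_rot4 d : rt (rt (rt (rt d))) = d.
Proof. by have := iter_porbit rt d; rewrite (rot_four d). Qed.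

Lemma link_rot2 d : rt (rt d) != d.
Proof.
apply/eqP => e.
have : (#|porbit rt d| <= #|[:: d; rt d]|)%N.
  apply/subset_leq_card/subsetP => x /porbitP[i ->]; rewrite permX.
  have : iter i rt d \in [:: d; rt d].
    elim: i => [|i IH]; first by rewrite mem_head.
    by move: IH; rewrite !inE iterS => /orP[] /eqP ->; rewrite ?e eqxx ?orbT.
  by [].
by rewrite (rot_four d) => h; have := leq_trans h (card_size _).
Qed.

Lemma link_orb x e : (x \in orb rt e) = (x \in porbit rt e).
Proof.
have u := orb_uniq link_rot4 link_rot2 e.
have sub : {subset orb rt e <= porbit rt e}.
  move=> y; rewrite !inE => /or4P[] /eqP ->; first exact: porbit_id.
  - by apply/porbitP; exists 1%N; rewrite permX.
  - by apply/porbitP; exists 2%N; rewrite permX.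
  - by apply/porbitP; exists 3%N; rewrite permX.
have := subset_cardP (A := mem (orb rt e)) (B := mem (porbit rt e)).
rewrite (card_uniqP u) rot_four => /(_ erefl) H.
by have /H : mem (orb rt e) \subset mem (porbit rt e) by apply/subsetP.
Qed.

Lemma region_permE d : region_perm L (op (rt d)) = d.
Proof. by rewrite permM oppK permK. Qed.

Lemma link_reg_back d : rg (op (rt d)) = rg d.
Proof.
by apply/eqP; rewrite eq_porbit_mem porbit_sym; apply/porbitP; exists 1%N; rewrite expg1 region_permE.
Qed.

Lemma link_reg_r3 d : rg (rt (rt (rt d))) = rg (op d).
Proof. by rewrite -(link_reg_back (rt (rt (rt d)))) link_rot4. Qed.

Lemma link_reg_conn d e : rg d = rg e -> fconnect (op \o rt) d e.
Proof.
move=> /eqP; rewrite eq_porbit_mem => /porbitP[i ->]; rewrite permX.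
elim: i => [|i IH]; first exact: connect0.
apply: connect_trans (fconnect1 _ _) _; rewrite iterS /=.
suff -> : op (rt (region_perm L (iter i (region_perm L) e))) = iter i (region_perm L) e by [].
by rewrite permM permKV oppK.
Qed.

Let ocard d : #|porbit op d| = 2%N.
Proof.
have -> : porbit op d = [set d; op d].
  apply/setP => x; rewrite !inE; apply/idP/orP => [/porbitP[i ->]|].
    rewrite permX; elim: i => [|i IH]; first by left; apply/eqP.
    by rewrite iterS; case: IH => /eqP ->; rewrite ?oppK eqxx; [right | left].
  by case=> /eqP ->; [apply: porbit_id | apply/porbitP; exists 1%N; rewrite expg1].
by rewrite cards2 eq_sym opp_neq.
Qed.

Lemma mem_seg x d : (x \in porbit op d) = (x == d) || (x == op d).
Proof.
rewrite (_ : porbit op d = [set d; op d]) ?inE //; apply/esym/eqP.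
rewrite eqEcard ocard cards2 eq_sym opp_neq andbT; apply/subsetP => y; rewrite !inE.
by case/orP=> /eqP ->; [apply: porbit_id | apply/porbitP; exists 1%N; rewrite expg1].
Qed.

Lemma link_cards : #|D| = (4 * #|porbits rt|)%N /\ #|D| = (2 * #|porbits op|)%N.
Proof.
by split; rewrite mulnC; apply: card_porbits_const; [exact: rot_four | exact: ocard].
Qed.

Lemma link_euler : (#|porbits rt| + #|porbits op| + #|porbits (region_perm L)| = #|D| + 2)%N.
Proof.
rewrite /region_perm planar; congr (_ + _)%N.
have cs : connect_sym (dart_adj rt op) by move=> x y; rewrite !Lconn.
rewrite (_ : n_comp _ _ = 1%N) // -(n_comp_connect cs i0); apply: eq_n_comp_r => x.
by rewrite !inE Lconn.
Qed.

Lemma link_invariant (T : Type) (g : D -> T) :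
  (forall d, g (rt d) = g d) -> (forall d, g (op d) = g d) -> forall d e, g d = g e.
Proof.
move=> gr go d e; have /connectP[p pp ->] := Lconn d e.
elim: p d pp => //= x p IH d /andP[dx xp]; rewrite -(IH _ xp).
by case/orP: dx => /eqP ->; rewrite ?gr ?go.
Qed.

Lemma corners_distinct d e : e \in porbit rt d -> rg d = rg e -> d = e.
Proof.
move=> ed re; apply/eqP; apply: contraT => /eqP ne.
have cin : porbit rt d \in porbits rt by apply: imset_f.
by case: (@Lred (exist _ (porbit rt d) cin)); exists d, e; split=> //; apply: porbit_id.
Qed.

Lemma link_reg_opp d : rg (op d) <> rg d.
Proof.
rewrite -link_reg_r3 => /esym e; have := link_rot2 d.
have h : rt (rt (rt d)) \in porbit rt d by apply/porbitP; exists 3%N; rewrite permX.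
have e3 := corners_distinct h e.
have r1 : rt d = d by rewrite {1}e3 link_rot4.
by rewrite !r1 eqxx.
Qed.

Let conn F (g : D -> F) : (forall e, g (op e) = g e) -> (forall e, g (rt e) = g e) ->
  forall e, g e = g i0.
Proof. by move=> go gr e; apply: link_invariant. Qed.

Lemma link_potential (F : fieldType) (h : D -> F) : (forall d, h (op d) = - h d) ->
  (forall d, h d + h (rt d) + h (rt (rt d)) + h (rt (rt (rt d))) = 0) ->
  exists f : {set D} -> F, forall d, h d = f (rg d) - f (rg (op d)).
Proof.
move=> ho hr; apply: (potential (s := op) (t := rt) (w := region_perm L) (e0 := i0)) => //.
- exact: link_reg_back.
- exact: conn.
- by have := link_euler; lia.
- move=> e; rewrite (eq_bigl (fun x => x \in [set e; op e])); last first.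
    by move=> x; rewrite mem_seg !inE.
  by rewrite big_setU1 /= ?big_set1 ?ho ?subrr // inE eq_sym opp_neq.
- move=> e; rewrite -[RHS](hr e) (eq_bigl (mem (orb rt e))).
    by rewrite -big_uniq ?(orb_uniq link_rot4 link_rot2) //= !big_cons big_nil addr0 !addrA.
  by move=> x; rewrite /= -link_orb.
Qed.

(** Over the field with two elements the constant function 1 sums to zero over the two ends of a
    segment and over the four darts of a crossing, so it has a potential, which is the chessboard
    colouring. *)
Lemma link_colour : exists col : {set D} -> bool, forall d, col (rg (op d)) = ~~ col (rg d).
Proof.
have [||f fE] := link_potential (F := 'F_2) (h := fun=> 1).
- by move=> d; apply: val_inj.
- by move=> d; apply: val_inj.
exists (fun r => f r == 1) => d; have /eqP := fE d.
rewrite eq_sym -[X in X == _]/(f (rg d) + - f (rg (op d))).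
by case: (F2_cases (f (rg d))) => ->; case: (F2_cases (f (rg (op d)))) => ->.
Qed.

(** If [d] and [e] lie between the same regions, the sum of their indicators modulo 2 is orthogonal
    to all gradients of functions on regions. By [dual_potential] it splits into a function of
    segments and a function [b] of crossings; [b] tells the two sides of a closed curve that crosses
    only the segments of [d] and [e]. *)
Lemma link_reg_prime d e : rg d = rg e -> rg (op d) = rg (op e) -> d = e.
Proof.
move=> r1 r2; apply/eqP; apply: contraT => ne; case: Lprime.
have aa (z : 'F_2) : z + z = 0 by case: (F2_cases z) => ->; apply: val_inj.
have noe : op d != e by apply/eqP => h; apply: (@link_reg_opp d); rewrite h.
pose v (n : D) : 'F_2 := (n == d)%:R + (n == e)%:R.
have [||||a [b ab]] := @dual_potential _ _ op rt (region_perm L) i0 _ _ _ v.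
- exact: link_reg_back.
- exact: conn.
- by have := link_euler; lia.
- move=> f; under eq_bigr => n _ do rewrite mulrDl.
  have dl x (g : D -> 'F_2) : \sum_n (n == x)%:R * g n = g x.
    rewrite (bigD1 x) //= eqxx mul1r big1 ?addr0 // => n /negbTE ->; exact: mul0r.
  rewrite big_split /= (dl d (fun n => f (rg n) - f (rg (op n)))).
  rewrite (dl e (fun n => f (rg n) - f (rg (op n)))) -/(rg _) r1 r2.
  by rewrite aa.
exists d, (op e); split; rewrite ?oppK //.
pose side x := b (porbit rt x) == 1.
have so x : side (op x) = side x (+) (x \in porbit op d) (+) (x \in porbit op (op e)).
  have : v x + v (op x) = b (porbit rt x) + b (porbit rt (op x)).
    rewrite !ab; have -> : porbit op (op x) = porbit op x.
      by apply/eqP; rewrite eq_porbit_mem mem_seg eqxx orbT.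
    by rewrite addrACA aa add0r.
  have bE (c : bool) : (c%:R == 1 :> 'F_2) = c by case: c.
  have oE y z : (op y == z) = (y == op z) by apply/eqP/eqP => [<-|->]; rewrite oppK.
  move=> /(congr1 (fun z => z == 1)) /=; rewrite !F2_addb !bE !oE !mem_seg oppK /side.
  have xd : (x == d) && (x == op d) = false.
    by apply/negP => /andP[/eqP -> /eqP h]; have := opp_neq d; rewrite -h eqxx.
  have xe : (x == op e) && (x == e) = false.
    by apply/negP => /andP[/eqP -> /eqP h]; have := opp_neq e; rewrite h eqxx.
  move: xd xe; case: (x == d); case: (x == e); case: (x == op d); case: (x == op e) => //= _ _;
  by case: (b (porbit rt x) == 1); case: (b (porbit rt (op x)) == 1).
have sd : side (op d) = ~~ side d.
  rewrite so !mem_seg eqxx oppK (negbTE ne) orbF.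
  have -> : (d == op e) = false by apply: contraNF noe => /eqP ->; rewrite oppK.
  by case: (side d).
exists side; split.
- split=> // x; rewrite /side; congr (b _ == _).
  by apply/eqP; rewrite eq_porbit_mem; apply/porbitP; exists 1%N; rewrite expg1.
- by case h : (side d); [exists d | exists (op d); rewrite sd h].
by case h : (side d); [exists (op d); rewrite sd h | exists d].
Qed.

Lemma link_to_diagram : exists lev, diagram rt op rg lev i0.
Proof.
have [col colE] := link_colour.
pose adj (r r' : {set D}) := [exists d, (rg d == r) && (rg (op d) == r')].
have adjE d : adj (rg d) (rg (op d)) by apply/existsP; exists d; rewrite !eqxx.
have adjC d : adj (rg (op d)) (rg d) by have := adjE (op d); rewrite oppK.
have col_adj r r' : adj r r' -> col r' = ~~ col r.
  by case/existsP=> d /andP[/eqP <- /eqP <-].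
have cn d : connect adj (rg i0) (rg d).
  have inv : forall x y, connect adj (rg i0) (rg x) = connect adj (rg i0) (rg y).
    apply: (link_invariant (g := fun x => connect adj (rg i0) (rg x))) => x.
      rewrite -(link_reg_back x).
      by apply/idP/idP => h; apply: connect_trans h (connect1 _).
    by apply/idP/idP => h; apply: connect_trans h (connect1 _).
  by rewrite (inv d i0) connect0.
exists (level adj (rg i0)); split.
- exact: link_rot4.
- exact: link_rot2.
- exact: oppK.
- exact: link_reg_back.
- exact: link_reg_conn.
- exact: link_reg_prime.
- by move=> d; apply: (level_adj col_adj).
- exact: level_root.
- move=> d nd; have [r /existsP[e /andP[/eqP er /eqP ed]] lt] := level_down (cn d) nd.
  by exists (op e); rewrite ?oppK // ed er.
- have [c1 c2] := link_cards; have := link_euler; rewrite c1 in c2 *.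
  by rewrite (_ : #|[set rg d | d : D]| = #|porbits (region_perm L)|) //; lia.
Qed.

(** The corners of a reduced crossing lie in four distinct regions, and Euler's formula with at
    least four regions requires at least eight darts. *)
Lemma link_darts : (4 < #|D|)%N.
Proof.
have [c1 c2] := link_cards; have e := link_euler.
have : (4 <= #|porbits (region_perm L)|)%N.
  have u := orb_uniq link_rot4 link_rot2 i0.
  have ui : uniq [seq rg x | x <- orb rt i0].
    rewrite map_inj_in_uniq // => x y xi yi; apply: corners_distinct.
    have /eqP <- : porbit rt i0 == porbit rt x by rewrite eq_porbit_mem porbit_sym -link_orb.
    by rewrite -link_orb.
  have /card_uniqP /= <- := ui; apply/subset_leq_card/subsetP => r rin.
  have /mapP[x _ ->] : r \in [seq rg x | x <- orb rt i0] by [].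
  exact: imset_f.
by rewrite c1 in c2 e *; lia.
Qed.

End LinkToDiagram.

(** * Corners, faces and matchings *)

Section Corners.
Variables (L : link_diagram) (Lred : forall c : crossing L, ~ nugatory c).
Local Notation D := (dart L).
Local Notation rt := (rot L).
Local Notation op := (opp L).
Local Notation rg := (@region_of L).
Local Notation r3 d := (rt (rt (rt d))).
Local Notation G := (incidence_graph L).

Definition seg_face (d : D) : face G := @face_of G d.
Local Notation lab := seg_face.

Lemma seg_face_val d : val (lab d) = porbit op d.
Proof. by rewrite /= /face_perm /= /region_perm mulgKV. Qed.

Lemma seg_face_eq d e : (lab d == lab e) = (e == d) || (e == op d).
Proof. by rewrite -val_eqE !seg_face_val eq_sym eq_porbit_mem mem_seg. Qed.

Lemma seg_face_eqC d e : (lab d == lab e) = (d == e) || (d == op e).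
Proof. by rewrite eq_sym seg_face_eq. Qed.

Lemma seg_face_opp d : lab (op d) = lab d.
Proof. by apply/eqP; rewrite seg_face_eqC eqxx orbT. Qed.

Lemma seg_face_surj (f : face G) : exists d, f = lab d.
Proof. by have /imsetP[d _ e] := valP f; exists d; apply: val_inj. Qed.

Lemma mem_face (x : D) (f : face G) : (x \in val f) = (lab x == f).
Proof. by have [d ->] := seg_face_surj f; rewrite seg_face_val mem_seg seg_face_eqC. Qed.

Lemma region_perm_corner d : region_perm L d = r3 (op d).
Proof. by rewrite permM; apply: (@perm_inj _ rt); rewrite permKV link_rot4. Qed.

Lemma mem_wb (x : D) (f : face G) : (x \in wb_edges f) = (lab (rt x) == f).
Proof.
apply/imsetP/eqP => [[y yf ->]|e].
  by rewrite [wrot G y]region_perm_corner link_rot4 seg_face_opp; apply/eqP; rewrite -mem_face.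
exists (op (rt x)); first by rewrite mem_face seg_face_opp e.
by rewrite [wrot G _]region_perm_corner oppK link_rot4.
Qed.

Lemma mem_face_edges (x : D) (f : face G) : (x \in face_edges f) = (lab x == f) || (lab (rt x) == f).
Proof. by rewrite in_setU mem_face mem_wb. Qed.

Lemma link_rot_neq d : rt d != d.
Proof. by apply/eqP => e; have := link_rot2 d; rewrite !e eqxx. Qed.

(** A segment joining two consecutive darts of a crossing would give this crossing two corners in
    the same region. *)
Lemma seg_face_rot d : lab (rt d) != lab d.
Proof.
rewrite seg_face_eqC (negbTE (link_rot_neq d)) /=; apply/eqP => e.
have e3 : r3 d = rt d.
  apply: (corners_distinct Lred); last by rewrite link_reg_r3 e.
  by apply/porbitP; exists 2%N; rewrite permX /= link_rot4.
by have := link_rot2 (rt d); rewrite e3 eqxx.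
Qed.

Lemma sum_delta (S : {set D}) d : \sum_(x in S) (x == d)%:Z = (d \in S)%:Z.
Proof.
case: (boolP (d \in S)) => dS.
  by rewrite (bigD1 d) //= eqxx big1 ?addr0 // => x /andP[_ /negbTE ->].
by apply: big1 => x xS; case: eqP xS dS => // -> ->.
Qed.

Lemma seg_face_ind x d : (lab x == lab d)%:Z = (x == d)%:Z + (x == op d)%:Z.
Proof.
rewrite seg_face_eqC; case: (eqVneq x d) => [->|_] /=; last by rewrite add0r.
by rewrite eq_sym (negbTE (opp_neq d)) addr0.
Qed.

Lemma rot_eq x d : (rt x == d) = (x == r3 d).
Proof. by apply/eqP/eqP => [<-|->]; rewrite link_rot4. Qed.

Lemma sum_seg (S : {set D}) d :
  \sum_(x in S) (lab x == lab d)%:Z = (d \in S)%:Z + (op d \in S)%:Z.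
Proof. by under eq_bigr => x _ do rewrite seg_face_ind; rewrite big_split !sum_delta. Qed.

Lemma sum_seg_rot (S : {set D}) d :
  \sum_(x in S) (lab (rt x) == lab d)%:Z = (r3 d \in S)%:Z + (r3 (op d) \in S)%:Z.
Proof.
by under eq_bigr => x _ do rewrite seg_face_ind !rot_eq; rewrite big_split !sum_delta.
Qed.

Definition face_count (S : {set D}) (f : face G) : int :=
  \sum_(x in S) ((lab x == f)%:Z + (lab (rt x) == f)%:Z).

Lemma face_countE S d : face_count S (lab d) =
  (d \in S)%:Z + (op d \in S)%:Z + ((r3 d \in S)%:Z + (r3 (op d) \in S)%:Z).
Proof. by rewrite /face_count big_split /= sum_seg sum_seg_rot. Qed.

Lemma card_face (S : {set D}) (f : face G) : #|S :&: face_edges f|%:Z = face_count S f.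
Proof.
rewrite -sum1_card (big_morph Posz PoszD (erefl _)) /face_count.
rewrite (eq_bigl (fun x => (x \in S) && (x \in face_edges f))); last by move=> x; rewrite inE.
rewrite big_mkcondr; apply: eq_bigr => x _; rewrite mem_face_edges.
case: (eqVneq (lab x) f) => [<-|_]; last by case: eqP.
by rewrite (negbTE (seg_face_rot x)).
Qed.

Lemma hvec_count (S : {set D}) (f : face G) : @hvec G S f = 1 - face_count S f.
Proof.
rewrite /hvec card_face; have [d e] := seg_face_surj f.
have -> : #|face_edges f| = 4%N.
  by apply/eqP; rewrite -eqz_nat -[face_edges f]setTI card_face e face_countE !in_setT.
by rewrite addrAC.
Qed.

Lemma mem_white r d : (r \in white_vertices (lab d)) = (r == rg d) || (r == rg (op d)).
Proof.
apply/imsetP/orP => [[x]|].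
  rewrite mem_face_edges !seg_face_eqC !rot_eq -[white_end x]/(rg x).
  case/orP=> /orP[] /eqP -> ->; rewrite ?link_reg_r3 ?oppK; by [left|right].
case=> /eqP ->; [exists d|exists (op d)] => //; rewrite mem_face_edges ?seg_face_opp eqxx //.
Qed.

Variable i0 : D.
Local Notation ks := (kept op rg i0).

Lemma kept_edge_kept e : kept_edge (lab i0) e = (rg e \in ks).
Proof. by rewrite /kept_edge mem_white reg_kept negb_or andbC. Qed.

Lemma share_white_kept d :
  share_white (lab d) (lab i0) = (rg d \notin ks) || (rg (op d) \notin ks).
Proof.
rewrite -!kept_edge_kept /kept_edge !negbK; apply/set0Pn/orP => [[r]|].
  rewrite in_setI => /andP[]; rewrite (mem_white r d) => /orP[] /eqP -> h; by [left|right].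
case=> h; [exists (rg d)|exists (rg (op d))]; rewrite in_setI h (mem_white _ d) eqxx ?orbT //.
Qed.

Lemma perfect_matching_state (M : {set D}) :
  @perfect_matching G (lab i0) M = stateb rt rg ks M.
Proof.
rewrite /perfect_matching /stateb; congr [&& _, _ & _]; apply: eq_forallb => d.
- by rewrite kept_edge_kept.
- congr (#|_ :&: _| == _); apply/setP => x; rewrite in_set link_orb //.
- rewrite kept_edge_kept; congr (_ ==> (#|_ :&: _| == _)); apply/setP => x.
  by rewrite in_set eq_porbit_mem.
Qed.

End Corners.

(** * Heights and the lattice of matchings *)

Section Heights.
Variables (L : link_diagram) (Lconn : connected L) (Lred : forall c : crossing L, ~ nugatory c).
Local Notation D := (dart L).
Local Notation rt := (rot L).
Local Notation op := (opp L).
Local Notation rg := (@region_of L).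
Local Notation r3 d := (rt (rt (rt d))).
Local Notation G := (incidence_graph L).
Local Notation lab := (@seg_face L).
Variable i0 : D.
Local Notation fi := (lab i0).
Local Notation ks := (kept op rg i0).
Local Notation state := (is_state rt rg ks).

(** The amount by which a down-flip at the segment of [d] lowers the sum of [v] over a state; see
    [down_sum]. *)
Definition curv (R : zmodType) (v : D -> R) d := v d - v (r3 d) + (v (op d) - v (r3 (op d))).

Lemma curv_delta d x :
  curv (fun y => (y == d)%:Z) x = (lab x == lab d)%:Z - (lab x == lab (rt d))%:Z.
Proof.
have e3 y : (r3 y == d) = (y == rt d) by apply/eqP/eqP => [<-|->]; rewrite link_rot4.
have eo y z : (op y == z) = (y == op z) by apply/eqP/eqP => [<-|->]; rewrite oppK.
rewrite /curv !e3 !eo !seg_face_ind; ring.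
Qed.

Definition height_weights (nu : face G -> D -> int) := nu fi =1 (fun=> 0) /\
  forall f x, lab x != fi -> curv (nu f) x = (lab x == f)%:Z.

(** For the face of [i0] the zero function will do, since nothing is required there. Subtracting an
    indicator at [d] moves the unit of curvature from the face of [d] to that of [rt d], by
    [curv_delta], and connectedness reaches all faces. *)
Lemma height_weights_exist : exists nu, height_weights nu.
Proof.
pose P d := exists v : D -> int, forall x, lab x != fi -> curv v x = (lab x == lab d)%:Z.
have Pop d : P d -> P (op d) by case=> v h; exists v; rewrite seg_face_opp.
have Prt d : P d -> P (rt d).
  case=> v h; exists (fun y => v y - (y == d)%:Z) => x xi; have := h x xi; have := curv_delta d x.
  by rewrite /curv /= => e1 e2; lia.
have P0 : P i0.
  by exists (fun=> 0) => x /negbTE ->.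
have Pall d : P d.
  have /connectP[p pp ->] := Lconn i0 d; elim: p (i0) P0 pp => //= x p IH y Py /andP[yx].
  by apply: IH; case/orP: yx => /eqP ->; [apply: Prt | apply: Pop].
have /fin_all_exists[nu nuP] : forall f : face G, exists v : D -> int,
    forall x, lab x != fi -> curv v x = (lab x == f)%:Z.
  by move=> f; have [d ->] := seg_face_surj f; apply: Pall.
exists (fun f x => nu f x - nu fi x); split=> [x|f x xi]; first exact: subrr.
have := nuP f x xi; have := nuP fi x xi; rewrite (negbTE xi) /curv /= => e1 e2.
lia.
Qed.

(** Summation by parts; the factor 2 arises because each segment is counted at both of its darts. *)
Lemma curv_sum (R : numDomainType) (v : D -> R) (g : {set D} -> R) :
  \sum_n v n * (g (porbit op n) - g (porbit op (rt n))) *+ 2 =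
  \sum_n curv v n * g (porbit op n).
Proof.
have po n : porbit op (op n) = porbit op n.
  by apply/eqP; rewrite eq_porbit_mem mem_seg eqxx orbT.
have s1 : \sum_n v n * (g (porbit op n) - g (porbit op (rt n))) =
    \sum_n (v n - v (r3 n)) * g (porbit op n).
  under eq_bigr => n _ do rewrite mulrBr; under [RHS]eq_bigr => n _ do rewrite mulrBl.
  rewrite !sumrB; congr (_ - _).
  rewrite [RHS](reindex_inj (@perm_inj _ rt)) /=; apply: eq_bigr => n _.
  by rewrite link_rot4.
rewrite sumrMnl s1 mulr2n {2}(reindex_inj (@perm_inj _ op)) /= -big_split /=.
by apply: eq_bigr => n _; rewrite po -mulrDl.
Qed.

(** Here the sphere is read through the incidence graph: its vertices are the crossings and the
    regions, and the segments are its faces. By [curv_sum], zero curvature is orthogonality to the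
    gradients on these faces. *)
Lemma flat_split (v : D -> int) : (forall x, curv v x = 0) ->
  exists a b : {set D} -> rat, forall n, (v n)%:~R = a (porbit rt n) + b (rg n).
Proof.
move=> v0; apply: (dual_potential (w := op) (e0 := i0)).
- move=> e; apply/eqP; rewrite region_perm_corner link_rot4 eq_porbit_mem mem_seg eqxx orbT //.
- move=> g gr gt e; apply: (link_invariant Lconn gr) => d.
  by have := gt (op d); rewrite region_perm_corner oppK -gr link_rot4.
- by have := link_euler Lconn i0; lia.
- move=> g; have := curv_sum (fun n => (v n)%:~R : rat) g.
  rewrite sumrMnl [X in _ = X]big1 => [/eqP|n _].
    by rewrite -mulr_natr mulf_eq0 pnatr_eq0 orbF => /eqP.
  by rewrite /curv -!rmorphB -rmorphD /= -/(curv v n) v0 mul0r.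
Qed.

Lemma state_sum_crossings (R : zmodType) (a : {set D} -> R) S : state S ->
  \sum_(x in S) a (porbit rt x) = \sum_(c in porbits rt) a c.
Proof.
case=> _ ex inj _ _; rewrite -(big_imset a) /=; last first.
  by move=> x y xS yS e; apply: inj; rewrite // link_orb e porbit_id.
apply: eq_bigl => c; apply/imsetP/imsetP => [[x xS ->]|[x _ ->]]; first by exists x.
have [y yS yx] := ex x; exists y => //; apply/eqP; rewrite eq_porbit_mem porbit_sym -link_orb //.
Qed.

Lemma state_sum_regions (R : zmodType) (b : {set D} -> R) S : state S ->
  \sum_(x in S) b (rg x) = \sum_(r <- ks) b r.
Proof.
case=> kp _ _ inj ex; rewrite -(big_imset b) /=; last by move=> x y xS yS; apply: inj.
rewrite [RHS]big_uniq ?kept_uniq //=; apply: eq_bigl => r; apply/imsetP/idP => [[x xS ->]|/ex[x]].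
  exact: kp.
by exists x.
Qed.

Variables (nu : face G -> D -> int).
Hypothesis nuP : height_weights nu.

Definition height (S : {set D}) (f : face G) : int := \sum_(x in S) nu f x.

Lemma height_root S : height S fi = 0.
Proof. by apply: big1 => x _; rewrite (proj1 nuP). Qed.

Lemma height_diff S S' d : state S -> state S' ->
  height S (lab d) - height S (lab (rt d)) - (d \in S)%:Z =
  height S' (lab d) - height S' (lab (rt d)) - (d \in S')%:Z.
Proof.
move=> sS sS'; pose k x := nu (lab d) x - nu (lab (rt d)) x - (x == d)%:Z.
have kE T : height T (lab d) - height T (lab (rt d)) - (d \in T)%:Z = \sum_(x in T) k x.
  by rewrite -sum_delta !sumrB.
have k0 x : lab x != fi -> curv k x = 0.
  move=> xi; have := proj2 nuP (lab d) x xi; have := proj2 nuP (lab (rt d)) x xi.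
  have := curv_delta d x; rewrite /curv /k /= => e1 e2 e3; lia.
have kall x : curv k x = 0.
  case: (eqVneq (lab x) fi) => [xi|]; last exact: k0.
  have cop y : curv k (op y) = curv k y by rewrite /curv oppK addrC.
  have -> : curv k x = curv k i0.
    by have /eqP := xi; rewrite seg_face_eqC => /orP[] /eqP ->; rewrite ?cop.
  (* The total curvature is zero. As it vanishes at all other darts and agrees at [i0] and [op i0],
     it vanishes there too. *)
  have := curv_sum k (fun=> 1); rewrite big1 => [/esym|n _]; last by rewrite subrr mulr0 mul0rn.
  under eq_bigr => n _ do rewrite mulr1.
  rewrite (bigD1 i0) //= (bigD1 (op i0)) ?opp_neq //= cop big1 ?addr0.
    by move=> /eqP; rewrite -mulr2n mulrn_eq0 /= => /eqP.
  by move=> n /andP[n1 n2]; apply: k0; rewrite seg_face_eqC negb_or n1.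
rewrite !kE; have [a [b ab]] := flat_split kall.
have sE T : state T -> (\sum_(x in T) k x)%:~R = \sum_(c in porbits rt) a c + \sum_(r <- ks) b r.
  move=> sT; rewrite rmorph_sum /=; under eq_bigr => x _ do rewrite ab.
  by rewrite big_split /= (state_sum_crossings a sT) (state_sum_regions b sT).
by apply: (@intr_inj rat); rewrite !sE.
Qed.

Lemma height_inj S S' : state S -> state S' -> height S =1 height S' -> S = S'.
Proof.
move=> sS sS' e; apply/setP => d; have := height_diff d sS sS'; rewrite !e.
by move/addrI/oppr_inj/eqP; case: (d \in S); case: (d \in S').
Qed.

(** A deleted region contains no corner of a state, so by [height_diff] the difference of two
    heights is constant around it, and it is zero at [fi]. *)
Lemma height_outer S S' d : state S -> state S' -> rg d \notin ks ->
  height S (lab d) = height S' (lab d).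
Proof.
move=> sS sS'; pose h f := height S f - height S' f.
have step e : rg e \notin ks -> h (lab e) = h (lab (op (rt e))).
  move=> ek; have no T : state T -> (e \in T) = false.
    by move=> sT; apply: contraNF ek; apply: (state_kept sT).
  have := height_diff e sS sS'; rewrite !no // seg_face_opp /h; lia.
have run e x : rg e \notin ks -> rg e = rg x -> h (lab e) = h (lab x).
  move=> ek /link_reg_conn/connectP[p pp ->]; elim: p e ek pp => //= y p IH e ek /andP[/eqP <- pp].
  by rewrite step // IH //= link_reg_back.
rewrite reg_kept negb_and !negbK => dk; apply/eqP; rewrite -subr_eq0 -/(h _).
have hi : h fi = 0 by rewrite /h !height_root.
have nk : rg i0 \notin ks /\ rg (op i0) \notin ks by rewrite !reg_kept !eqxx andbF.
case/orP: dk => /eqP e; last by rewrite -(run i0) ?hi ?e //; case: nk.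
by rewrite -(run (op i0)) ?seg_face_opp ?hi ?e //; case: nk.
Qed.

Definition down (d : D) (N : {set D}) : {set D} := N :\: [set d; op d] :|: [set r3 d; r3 (op d)].

Lemma down_state N d : state N -> d \in N -> op d \in N -> state (down d N).
Proof.
move=> sN dN oN; have [h1 h2 h3 h4 h5] := sN.
(* The flipped set is the image of [N] under two maps: [ph] moves a corner within its crossing, and
   [ps] within its region. Each of them yields one half of the state conditions. *)
pose ph x := if x == d then r3 d else if x == op d then r3 (op d) else x.
pose ps x := if x == d then r3 (op d) else if x == op d then r3 d else x.
have nod : (op d == d) = false := negbTE (opp_neq d).
have ph_orb x : ph x \in porbit rt x.
  rewrite /ph; case: eqP => [->|_]; first by apply/porbitP; exists 3%N; rewrite permX.
  by case: eqP => [->|_]; [apply/porbitP; exists 3%N; rewrite permX | apply: porbit_id].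
have ph_rot x : porbit rt (ph x) = porbit rt x by apply/eqP; rewrite eq_porbit_mem.
have ps_rg x : rg (ps x) = rg x.
  rewrite /ps; case: eqP => [->|_]; first by rewrite link_reg_r3 oppK.
  by case: eqP => [->|//]; rewrite link_reg_r3.
have eph : down d N = [set ph x | x in N].
  apply/setP => y; rewrite !inE; apply/orP/imsetP => [[/andP[]|/orP[]/eqP ->]|[x xN ->]].
  - rewrite negb_or => /andP[yd yo] yN; exists y; rewrite // /ph (negbTE yd) (negbTE yo) //.
  - by exists d; rewrite // /ph eqxx.
  - by exists (op d); rewrite // /ph eqxx nod.
  - rewrite /ph; case: (eqVneq x d) => [_|xd]; first by right; rewrite eqxx.
    case: (eqVneq x (op d)) => [_|xo]; first by right; rewrite eqxx orbT.
    by left; rewrite xN (negbTE xd) (negbTE xo).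
have eps : down d N = [set ps x | x in N].
  apply/setP => y; rewrite !inE; apply/orP/imsetP => [[/andP[]|/orP[]/eqP ->]|[x xN ->]].
  - rewrite negb_or => /andP[yd yo] yN; exists y; rewrite // /ps (negbTE yd) (negbTE yo) //.
  - by exists (op d); rewrite // /ps eqxx nod.
  - by exists d; rewrite // /ps eqxx.
  - rewrite /ps; case: (eqVneq x d) => [_|xd]; first by right; rewrite eqxx orbT.
    case: (eqVneq x (op d)) => [_|xo]; first by right; rewrite eqxx.
    by left; rewrite xN (negbTE xd) (negbTE xo).
split.
- by move=> x; rewrite eps => /imsetP[y yN ->]; rewrite ps_rg h1.
- move=> c; have [x xN xc] := h2 c; exists (ph x); first by rewrite eph imset_f.
  by move: xc; rewrite !link_orb -!eq_porbit_mem ph_rot.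
- move=> x y; rewrite eph => /imsetP[u uN ->] /imsetP[v vN ->].
  by rewrite link_orb -eq_porbit_mem !ph_rot eq_porbit_mem -link_orb => /(h3 _ _ uN vN) ->.
- move=> x y; rewrite eps => /imsetP[u uN ->] /imsetP[v vN ->].
  by rewrite !ps_rg => /(h4 _ _ uN vN) ->.
- by move=> r /h5[x xN <-]; exists (ps x); rewrite ?ps_rg // eps imset_f.
Qed.

Lemma state_rot3 N d : state N -> d \in N -> r3 d \notin N.
Proof.
move=> sN dN; apply/negP => rN.
have e : d = r3 d.
  by apply: (state_inj sN) => //; rewrite link_orb; apply/porbitP; exists 3%N; rewrite permX.
by have := link_rot_neq d; rewrite {1}e link_rot4 eqxx.
Qed.

Lemma down_sum (v : D -> int) N d : state N -> d \in N -> op d \in N ->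
  \sum_(x in N) v x = \sum_(x in down d N) v x + curv v d.
Proof.
move=> sN dN oN; have n3 := state_rot3 sN dN; have n3' := state_rot3 sN oN.
have nod := opp_neq d; have nrr : r3 (op d) != r3 d by rewrite !(inj_eq perm_inj).
have s2 (x y : D) : y != x -> \sum_(z in [set x; y]) v z = v x + v y.
  by move=> yx; rewrite big_setU1 ?big_set1 // inE eq_sym.
rewrite (big_setID [set d; op d]) /= (_ : N :&: _ = [set d; op d]); last first.
  apply/setP => x; rewrite !inE andbC; case: eqP => [->|_] //=; case: eqP => [->|_] //.
have -> : \sum_(x in down d N) v x =
    \sum_(x in N :\: [set d; op d]) v x + \sum_(x in [set r3 d; r3 (op d)]) v x.
  rewrite -bigU /=; first by apply: eq_bigl => x; rewrite in_setU.
  rewrite -setI_eq0; apply/eqP/setP => x; rewrite !inE; apply/negP => /andP[/andP[_ xN]].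
  by case/orP=> /eqP e; rewrite e ?(negbTE n3) ?(negbTE n3') in xN.
rewrite !s2 // /curv; ring.
Qed.

Lemma down_height N d f : state N -> d \in N -> op d \in N -> lab d != fi ->
  height N f = height (down d N) f + (lab d == f)%:Z.
Proof. by move=> sN dN oN di; rewrite /height (down_sum _ sN dN oN) (proj2 nuP). Qed.

Variable lev : {set D} -> nat.
Hypothesis Dg : diagram rt op rg lev i0.

Lemma state_through_corner S0 c : state S0 -> rg c \in ks -> exists2 S, state S & c \in S.
Proof. exact: (state_through Dg). Qed.

Lemma stateRP (S : {set D}) : reflect (state S) (stateb rt rg ks S).
Proof. by apply: (stateP (@link_rot4 L)) => r; apply: kept_reg. Qed.

(* Maximize the height difference with [M], then the height difference with the
   average of all states. *)
Lemma exists_down N M f0 : state N -> state M -> height M f0 < height N f0 ->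
  exists d, [/\ d \in N, op d \in N, rg d \in ks, rg (op d) \in ks
             & height M (lab d) < height N (lab d)].
Proof.
move=> sN sM lt0; pose dl f := height N f - height M f.
pose th f := \sum_(S | stateb rt rg ks S) (height N f - height S f).
have [g1 _ g1P] := @arg_maxP _ _ _ f0 predT dl isT.
have [g /eqP gA gP] := @arg_maxP _ _ _ g1 (fun g => dl g == dl g1) th (eqxx _).
have dg : 0 < dl g by rewrite gA; apply: lt_le_trans (g1P f0 isT); rewrite subr_gt0.
have kd d : lab d = g -> rg d \in ks.
  by move=> e; apply: contraLR dg => dk; rewrite -e /dl (height_outer sN sM dk) subrr.
have dN d : lab d = g -> d \in N.
  move=> e; apply: contraT => dn; have dk := kd d e.
  have e1 := height_diff d sN sM; rewrite (negbTE dn) e in e1.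
  have le1 : dl (lab (rt d)) <= dl g by rewrite gA; apply: g1P.
  have dM : (d \in M) = false.
    by apply/negP => dM; move: e1 le1; rewrite dM /dl; lia.
  rewrite dM in e1; have e2 : dl (lab (rt d)) = dl g by rewrite /dl; move: e1; lia.
  have : th (lab (rt d)) <= th g by apply: gP; rewrite e2 gA.
  (* Passing from [g] to the face of [rt d] keeps the maximal difference [dl], but the state [S]
     through [d] makes [th] strictly larger there. *)
  have [S sS dS] := state_through_corner sN dk.
  rewrite /th -subr_ge0 -sumrB (bigD1 S) /=; last exact/stateRP.
  have e3 := height_diff d sN sS; rewrite (negbTE dn) dS e in e3.
  have -> : height N g - height S g - (height N (lab (rt d)) - height S (lab (rt d))) = -1.
    by move: e3; lia.
  rewrite addrC subr_ge0 => /(lt_le_trans ltr01); rewrite ltNge sumr_le0 // => T /andP[/stateRP sT _].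
  by have := height_diff d sN sT; rewrite (negbTE dn) e; case: (d \in T); lia.
have [d e] := seg_face_surj g; exists d.
rewrite !dN ?kd ?seg_face_opp //; split=> //; by rewrite -subr_gt0 -/(dl _) -e.
Qed.

Lemma down_flip_down d N : state N -> d \in N -> op d \in N -> rg d \in ks -> rg (op d) \in ks ->
  @down_flip G fi (lab d) N (down d N).
Proof.
move=> sN dN oN dk ok; rewrite /down_flip /bounded_face share_white_kept dk ok /=.
rewrite perfect_matching_state (introT (stateRP N) sN) /=.
have bw : bw_edges (lab d) = [set d; op d].
  by apply/setP => x; rewrite mem_face !inE seg_face_eqC.
have wb : wb_edges (lab d) = [set r3 d; r3 (op d)].
  by apply/setP => x; rewrite mem_wb !inE seg_face_eqC !rot_eq.
rewrite bw wb eqxx andbT; apply/subsetP => x; rewrite !inE => /orP[] /eqP -> //.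
Qed.

Lemma down_flipP (g : face G) (N M : {set D}) : @down_flip G fi g N M ->
  exists d, [/\ g = lab d, state N, d \in N, op d \in N & M = down d N] /\
            (rg d \in ks /\ rg (op d) \in ks).
Proof.
case/and4P; have [d ->] := seg_face_surj g; rewrite /bounded_face share_white_kept negb_or !negbK.
case/andP=> dk ok; rewrite perfect_matching_state => /stateRP sN.
have bw : bw_edges (lab d) = [set d; op d].
  by apply/setP => x; rewrite mem_face !inE seg_face_eqC.
have wb : wb_edges (lab d) = [set r3 d; r3 (op d)].
  by apply/setP => x; rewrite mem_wb !inE seg_face_eqC !rot_eq.
rewrite bw wb => /subsetP sub /eqP ->; exists d; split=> //; split=> //; apply: sub;
  by rewrite !inE eqxx ?orbT.
Qed.

Lemma kept_root d : rg d \in ks -> lab d != fi.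
Proof.
move=> dk; rewrite seg_face_eqC; apply/negP => /orP[] /eqP e; move: dk;
  by rewrite e reg_kept eqxx ?andbF.
Qed.

Lemma down_flip_height (g : face G) (N M : {set D}) f : @down_flip G fi g N M ->
  height N f = height M f + (g == f)%:Z.
Proof.
move=> /down_flipP[d [[-> sN dN oN ->] [dk _]]].
exact: (down_height f sN dN oN (kept_root dk)).
Qed.

Lemma flip_chain_height (M : {set D}) gs N f : @flip_chain G fi M gs N ->
  height N f = height M f + (count_mem f gs)%:Z.
Proof.
elim: gs M => [|g gs IH] M /=; first by move=> ->; rewrite addr0.
by case=> M' /(down_flip_height f) e /IH ->; rewrite e PoszD addrA.
Qed.

Lemma flip_chain_rcons (M : {set D}) gs N g N' : @flip_chain G fi M gs N ->
  @down_flip G fi g N' N -> @flip_chain G fi M (rcons gs g) N'.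
Proof.
elim: gs M => [|h gs IH] M /=; first by move=> ->; exists N'.
by case=> M' hM c /(IH _ c); exists M'.
Qed.

(** A state of least total height is the bottom. Any state higher than it somewhere admits a
    down-flip, which lowers the total by one; a state nowhere higher has the same heights by
    minimality, and is equal by [height_inj]. *)
Lemma min_state S0 : state S0 -> exists2 M0, state M0 &
  forall N, state N -> exists gs, @flip_chain G fi M0 gs N.
Proof.
move=> s0; pose tot S := \sum_f height S f.
have [M0 /stateRP sM0 M0P] := @arg_minP _ _ _ S0 (stateb rt rg ks) tot (introT (stateRP S0) s0).
exists M0 => // N sN.
have [n] := ubnP `|tot N - tot M0|; elim: n N sN => // n IH N sN lt.
have le0 : tot M0 <= tot N by apply: M0P; apply/stateRP.
case: (pickP (fun f => height M0 f < height N f)) => [f ltf|no].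
  have [d [dN oN dk ok _]] := exists_down sN sM0 ltf.
  have sN' := down_state sN dN oN; have le1 : tot M0 <= tot (down d N) by apply: M0P; apply/stateRP.
  have e : tot N = tot (down d N) + 1.
    rewrite /tot (eq_bigr (fun f => height (down d N) f + (lab d == f)%:Z)); last first.
      by move=> f' _; apply: (down_height f' sN dN oN (kept_root dk)).
    rewrite big_split /=; congr (_ + _); rewrite (bigD1 (lab d)) //= eqxx big1 ?addr0 // => f'.
    by rewrite eq_sym => /negbTE ->.
  have [|gs gsP] := IH _ sN'; first by move: lt le0 le1; rewrite e; lia.
  exists (rcons gs (lab d)); apply: flip_chain_rcons gsP _; exact: down_flip_down.
exists [::]; apply: height_inj => // f; apply/eqP; have := no f.
have le f' : height N f' <= height M0 f' by rewrite leNgt no.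
move=> _; rewrite -subr_eq0; apply: contraT => ne.
have : 0 < \sum_f (height M0 f - height N f).
  rewrite (bigD1 f) //= ltr_wpDr ?sumr_ge0 // => [f' _|]; first by rewrite subr_ge0.
  by rewrite lt_def ne subr_ge0 le.
by rewrite sumrB subr_gt0 ltNge le0.
Qed.

Section MinimalMatching.
Variable S0 : {set D}.
Hypothesis s0 : state S0.
Local Notation m0 := (@min_matching G fi).

Lemma min_matchingP : state m0 /\ forall N, state N -> exists gs, @flip_chain G fi m0 gs N.
Proof.
have [M0 sM0 M0P] := min_state s0.
have [pm le] : @perfect_matching G fi m0 /\
    forall N, @perfect_matching G fi N -> flip_le fi m0 N.
  refine (@epsilon_spec _ (inhabits set0) (fun M => @perfect_matching G fi M /\
    forall N, @perfect_matching G fi N -> flip_le fi M N) _).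
  exists M0; rewrite perfect_matching_state; split; first exact/stateRP.
  by move=> N; rewrite perfect_matching_state => /stateRP/M0P.
rewrite perfect_matching_state in pm; split=> [|N sN]; first exact/stateRP.
by apply: le; rewrite perfect_matching_state; apply/stateRP.
Qed.

(** Exponent of the variable of [f] in [mrk], read off from heights and hence the same for all
    chains. *)
Definition flip_count S f : nat := `|height S f - height m0 f|.

Lemma flip_countE S f : state S -> (flip_count S f)%:Z = height S f - height m0 f.
Proof.
move=> sS; have [gs c] := proj2 min_matchingP S sS; have := flip_chain_height f c.
by rewrite /flip_count => ->; lia.
Qed.

Lemma flip_chain_count gs S f : @flip_chain G fi m0 gs S -> count_mem f gs = flip_count S f.
Proof. by move=> /(flip_chain_height f) e; rewrite /flip_count e; lia. Qed.

Lemma prod_count (T : finType) (R : comNzRingType) (h : T -> R) gs :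
  \prod_(g <- gs) h g = \prod_f h f ^+ count_mem f gs.
Proof.
elim: gs => [|g gs IH]; first by rewrite big_nil big1.
rewrite big_cons IH [in RHS](eq_bigr (fun f => h f ^+ (g == f) * h f ^+ count_mem f gs)).
  rewrite big_split /=; congr (_ * _); rewrite (bigD1 g) //= eqxx big1 ?mulr1 // => f.
  by rewrite eq_sym => /negbTE ->.
by move=> f _; rewrite /= exprD.
Qed.

Lemma mrk_flip_count S : state S ->
  @mrk G fi S = \prod_f 'X_(enum_rank f) ^+ flip_count S f.
Proof.
move=> sS; have [gs c e] : exists2 gs, @flip_chain G fi m0 gs S &
    @mrk G fi S = \prod_(g <- gs) 'X_(enum_rank g).
  refine (@epsilon_spec _ (inhabits 0) (fun m => exists2 gs, @flip_chain G fi m0 gs S &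
    m = \prod_(g <- gs) 'X_(enum_rank g)) _); have [gs c] := proj2 min_matchingP S sS.
  by exists (\prod_(g <- gs) 'X_(enum_rank g)); exists gs.
by rewrite e prod_count; apply: eq_bigr => f _; rewrite (flip_chain_count f c).
Qed.

Lemma flip_chain_top (M : {set D}) gs N g : @flip_chain G fi M gs N -> g \in gs ->
  exists d N', [/\ g = lab d, state N', d \in N' & op d \in N'].
Proof.
elim: gs M => //= h gs IH M [M' hM c]; rewrite inE => /orP[/eqP ->|/(IH _ c)//].
by have [d [[e sN dN oN _] _]] := down_flipP hM; exists d, M'.
Qed.

(** If some state lies above the minimum at this face, a chain leading to it flips the face, and the
    state above that flip contains both corners. Otherwise the height there is constant, and
    comparing the minimum with a state through either corner shows by [height_diff] that it contains
    that corner. *)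
Lemma state_both d : rg d \in ks -> rg (op d) \in ks ->
  exists S, [/\ state S, d \in S & op d \in S].
Proof.
move=> dk ok.
case: (pickP (fun S : {set D} => stateb rt rg ks S && (0 < flip_count S (lab d))%N)) => [S|no].
  case/andP=> /stateRP sS; have [gs c] := proj2 min_matchingP S sS.
  rewrite -(flip_chain_count _ c) -has_count => /hasP[g gin /eqP e]; rewrite e in gin.
  have [d' [N [e' sN dN oN]]] := flip_chain_top c gin; exists N; split=> //;
  by have /eqP := e'; rewrite seg_face_eqC => /orP[] /eqP ->; rewrite ?oppK.
have [sm mP] := min_matchingP; exists m0.
have z e : lab e = lab d -> rg e \in ks -> e \in m0.
  move=> le ek; have [S sS eS] := state_through_corner s0 ek.
  have := height_diff e sS sm; have := flip_countE (lab (rt e)) sS; have := flip_countE (lab e) sS.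
  have := no S; rewrite (introT (stateRP S) sS) /= eS le; case: (flip_count S (lab d)) => // _.
  by case: (e \in m0) => //; lia.
by split=> //; apply: z; rewrite ?seg_face_opp.
Qed.

End MinimalMatching.
End Heights.

(** * The cluster variable of a segment *)

Section MonomialSums.
Variables (I : finType) (K : fieldType) (X : I -> K).
Hypothesis X0 : nonzero X.

Lemma mon_sum (T : finType) (S : {set T}) (v : T -> I -> int) :
  \prod_(x in S) mon X (v x) = mon X (fun a => \sum_(x in S) v x a).
Proof.
rewrite /mon exchange_big /=; apply: eq_bigr => a _.
by rewrite (big_morph (fun n => X a ^ n) (fun m n => expfzDr m n (X0 a)) (expr0z _)).
Qed.

Lemma mon_ind (P : pred I) : \prod_(a | P a) X a = mon X (fun a => (P a)%:Z).
Proof. by rewrite /mon big_mkcond; apply: eq_bigr => a _; case: (P a). Qed.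

End MonomialSums.

Lemma expz_succ (K : fieldType) (x : K) (n m : int) : x != 0 -> 0 <= n + m ->
  x ^ n = x ^+ `|n + m| / x ^ m.
Proof.
by move=> x0 h; rewrite exprnP gez0_abs // expfzDr // mulfK // expfz_neq0.
Qed.

Section RationalFunctions.
Variable I : finType.

Definition onepos : ratfun I -> Prop := evpos (meval (fun _ : 'I_#|I| => 1 : int)).

Lemma onepos_cone : positive_cone onepos. Proof. exact: evpos_cone. Qed.

Lemma onepos_ivar : all_pos onepos (@ivar I).
Proof. by move=> a; apply: evpos_tofrac; rewrite /= mevalXU. Qed.

Lemma ivar_neq0 (a : I) : ivar a != 0.
Proof. exact: (all_pos_nonzero onepos_cone onepos_ivar). Qed.

End RationalFunctions.

(** * F-polynomials of sums of monomials *)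

Section FramedMonomials.
Variable V : finType.
Implicit Types (h : V -> int) (m e : V -> nat).

Definition framed_monomial m e : {mpoly int[#|{: V + V}|]} :=
  (\prod_f 'X_(enum_rank (inl f)) ^+ m f) * \prod_f 'X_(enum_rank (inr f)) ^+ e f.

Lemma framed_monomialE h e : (forall f, 0 <= h f + 1) ->
  mon (@ivar (V + V)%type)
    (fun a => match a with inl f => h f | inr f => (e f)%:Z end) =
  tofrac (framed_monomial (fun f => absz (h f + 1)) e) /
    \prod_f ivar (inl f : (V + V)%type) ^+ 1.
Proof.
move=> h1; rewrite /mon big_sumType /= /framed_monomial rmorphM /=.
have -> : tofrac (\prod_f 'X_(enum_rank (inr f : V + V)) ^+ e f) =
    \prod_f (ivar (inr f : (V + V)%type)) ^+ e f.
  by rewrite rmorph_prod; apply: eq_bigr => f _; rewrite rmorphXn.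
have -> : tofrac (\prod_f 'X_(enum_rank (inl f : V + V)) ^+ absz (h f + 1)) =
    \prod_f (ivar (inl f : (V + V)%type)) ^+ absz (h f + 1).
  by rewrite rmorph_prod; apply: eq_bigr => f _; rewrite rmorphXn.
rewrite [RHS]mulrAC -prodf_div; congr (_ * _); apply: eq_bigr => f _.
by rewrite expr1 (expz_succ (ivar_neq0 _) (h1 f)) expr1z.
Qed.

Lemma specialize_framed_monomial m e :
  specialize_x1 (framed_monomial m e) = \prod_f 'X_(enum_rank f) ^+ e f.
Proof.
rewrite /specialize_x1 /framed_monomial rmorphM !rmorph_prod /= big1 ?mul1r.
  by apply: eq_bigr => f _; rewrite rmorphXn /= mmapX mmap1U enum_rankK.
by move=> f _; rewrite rmorphXn /= mmapX mmap1U enum_rankK expr1n.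
Qed.

(** By the bound on [h], the product of all mutable variables is a common denominator. *)
Lemma framed_sum_F (T : finType) (P : pred T) (h : T -> V -> int) (e : T -> V -> nat)
    B mus k F : (forall S f, P S -> 0 <= h S f + 1) ->
  framed_cluster_variable B mus k = \sum_(S | P S)
    mon (@ivar (V + V)%type)
      (fun a => match a with inl f => h S f | inr f => (e S f)%:Z end) ->
  F = \sum_(S | P S) \prod_f 'X_(enum_rank f) ^+ e S f ->
  is_F_polynomial B mus k F.
Proof.
move=> h1 ez ->; exists (\sum_(S | P S) framed_monomial (fun f => absz (h S f + 1)) (e S)).
exists (fun=> 1%N); split.
  rewrite ez (raddf_sum (@tofrac {mpoly int[#|{: V + V}|]})) mulr_suml; apply: eq_bigr => S PS.
  by apply: framed_monomialE => f; apply: h1.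
rewrite /specialize_x1 rmorph_sum; apply: eq_bigr => S _.
exact/esym/specialize_framed_monomial.
Qed.

End FramedMonomials.

Section LinkClusters.
Variables (L : link_diagram) (Lconn : connected L) (Lprime : prime_like L)
  (Lred : forall c : crossing L, ~ nugatory c).
Local Notation D := (dart L).
Local Notation rt := (rot L).
Local Notation op := (opp L).
Local Notation rg := (@region_of L).
Local Notation r3 d := (rt (rt (rt d))).
Local Notation G := (incidence_graph L).
Local Notation lab := (@seg_face L).
Variable i0 : D.
Local Notation fi := (lab i0).
Local Notation ks := (kept op rg i0).
Local Notation state := (is_state rt rg ks).
Local Notation qv := (@quiver G).

Lemma card_and (P Q : pred D) :
  #|[set x | P x && Q x]|%:Z = \sum_(x in [set x | P x]) (Q x)%:Z.
Proof.
rewrite -sum1_card (big_morph Posz PoszD (erefl _)).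
rewrite (eq_bigl (fun x => (x \in [set x | P x]) && Q x)); last by move=> x; rewrite !inE.
by rewrite big_mkcondr; apply: eq_bigr => x _; case: (Q x).
Qed.

Lemma quiver_seg f d : qv f (lab d) =
  (f == lab (r3 d))%:Z + (f == lab (r3 (op d)))%:Z - (f == lab (rt d))%:Z - (f == lab (rt (op d)))%:Z.
Proof.
rewrite /quiver.
have -> : (@arrows G f (lab d))%:Z = (f == lab (r3 d))%:Z + (f == lab (r3 (op d)))%:Z.
  rewrite /arrows (card_and (fun x => lab x == f) (fun x => lab (rt x) == lab d)) sum_seg_rot.
  by rewrite !inE ![_ == f]eq_sym.
have -> : (@arrows G (lab d) f)%:Z = (f == lab (rt d))%:Z + (f == lab (rt (op d)))%:Z.
  rewrite /arrows; under eq_finset => x do rewrite andbC.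
  rewrite (card_and (fun x => lab (rt x) == f) (fun x => lab x == lab d)) sum_seg.
  by rewrite !inE ![_ == f]eq_sym.
by rewrite opprD addrA.
Qed.

Lemma quiver_antisym : antisym qv.
Proof. by move=> f g; rewrite /quiver opprB. Qed.

Lemma framed_intro (I : finType) (lb : D -> I) B nu :
    (forall d e, (lb d == lb e) = (e == d) || (e == op d)) -> antisym B ->
    (forall d e, B (lb e) (lb d) =
      (lb e == lb (r3 d))%:Z + (lb e == lb (r3 (op d)))%:Z
      - (lb e == lb (rt d))%:Z - (lb e == lb (rt (op d)))%:Z) ->
    (forall d e, nu d (lb e) = 0) ->
    (forall a d, a \notin codom lb -> d != i0 -> d != op i0 ->
      B a (lb d) = curv (fun x => nu x a) d) ->
  framed rt op i0 lb B nu.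
Proof.
move=> lbE asym seg nu0 fz; split=> // K pos X cone Xp d di dio.
have X0 := all_pos_nonzero cone Xp.
pose om x a := nu x a + - ((a == lb x)%:Z + (a == lb (rt x))%:Z).
have omE x : omega rt lb X nu x = mon X (om x).
  by rewrite /omega monD // monN monD // !mon_delta.
have lbo : lb (op d) = lb d by apply/eqP; rewrite lbE oppK eqxx orbT.
rewrite /mfac !omE -!monN -!monD //; apply: eq_mon => a.
case: (boolP (a \in codom lb)) => [/codomP[e ->]|ac].
  by rewrite seg /om !nu0 !link_rot4 lbo; ring.
have no x : (a == lb x) = false by apply: contraNF ac => /eqP ->; apply: codom_f.
by rewrite fz // /om /curv !no; ring.
Qed.

Variable lev : {set D} -> nat.
Hypothesis Dg : diagram rt op rg lev i0.

Section Value.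
Variables (I : finType) (lb : D -> I) (nu : D -> I -> int) (gam : I -> int).

Definition state_exp (S : {set D}) (a : I) : int :=
  gam a + ((a \in codom lb) && (a != lb i0))%:Z +
  \sum_(x in S) (nu x a - ((a == lb x)%:Z + (a == lb (rt x))%:Z)).

Lemma state_value (K : fieldType) (X : I -> K) cs : nonzero X -> crossings rt cs ->
  mon X gam * segprod i0 lb X * ssum rt rg ks (omega rt lb X nu) cs [::] =
  \sum_(S : {set D} | stateb rt rg ks S) mon X (state_exp S).
Proof.
move=> X0 cc; rewrite (ssum_state (@link_rot4 L) (kept_uniq _ _ _) (@kept_reg _ _ _ _ _)) //.
rewrite big_distrr /=; apply: eq_bigr => S _; rewrite /segprod mon_ind -monD //.
have -> : \prod_(d in S) omega rt lb X nu d =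
    \prod_(d in S) mon X (fun a => nu d a - ((a == lb d)%:Z + (a == lb (rt d))%:Z)).
  by apply: eq_bigr => x _; rewrite /omega monD // monN monD // !mon_delta.
by rewrite mon_sum // -monD.
Qed.

End Value.

Definition shifted (S : {set D}) (f : face G) : int := @hvec G S f - (f == fi)%:Z.

Lemma codom_lab f : f \in codom lab.
Proof. by have [d ->] := seg_face_surj f; apply: codom_f. Qed.

Lemma framed_plain : framed rt op i0 lab qv (fun _ _ => 0).
Proof.
apply: framed_intro => //; first exact: seg_face_eq; first exact: quiver_antisym.
  by move=> d e; apply: quiver_seg.
by move=> a d; rewrite codom_lab.
Qed.

Lemma count_exp (S : {set D}) f :
  \sum_(x in S) (0 - ((f == lab x)%:Z + (f == lab (rt x))%:Z)) = - face_count S f.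
Proof.
rewrite /face_count -sumrN; apply: eq_bigr => x _.
by rewrite sub0r ![f == _]eq_sym.
Qed.

Lemma plain_exp gam (S : {set D}) f : gam f = 0 -> state_exp lab (fun _ _ => 0) gam S f = shifted S f.
Proof.
move=> g0; rewrite /state_exp g0 codom_lab count_exp /shifted hvec_count //=; case: (f == fi);
  by rewrite /=; ring.
Qed.

Variables (nu : face G -> D -> int).
Hypothesis nuP : height_weights i0 nu.

Definition flab (d : D) : (face G + face G)%type := inl (lab d).
Definition fnu (d : D) (a : (face G + face G)%type) : int :=
  if a is inr f then nu f d else 0.

Lemma codom_flab a : (a \in codom flab) = if a is inl _ then true else false.
Proof.
case: a => f; last by apply/codomP => -[].
by have [d ->] := seg_face_surj f; apply: (codom_f flab).
Qed.

Lemma framed_framing : framed rt op i0 flab (framed_mat qv) fnu.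
Proof.
apply: framed_intro => //.
- by move=> d e; rewrite -seg_face_eq.
- move=> [f|f] [g|g] /=; rewrite ?oppr0 ?opprK //; first exact: quiver_antisym.
  + by rewrite eq_sym.
  + by rewrite eq_sym.
- by move=> d e; apply: quiver_seg.
move=> [f|f] d; rewrite codom_flab // => _ di dio /=.
have dn : lab d != fi by rewrite seg_face_eqC negb_or di.
by rewrite (proj2 nuP) // eq_sym.
Qed.

Lemma framing_exp gam (S : {set D}) a : (forall d, gam (flab d) = 0) ->
  state_exp flab fnu gam S a =
  match a with inl f => shifted S f | inr f => gam (inr f) + height nu S f end.
Proof.
move=> g0; rewrite /state_exp codom_flab; case: a => f /=.
  have -> : gam (inl f) = 0 by have [d ->] := seg_face_surj f; apply: g0.
  rewrite (count_exp S f) /shifted hvec_count //; rewrite (_ : (inl f != flab i0) = (f != fi)) //.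
  by case: (f == fi); rewrite /=; ring.
by rewrite addr0; congr (_ + _); apply: eq_bigr => x _; apply: subr0.
Qed.

Variable S0 : {set D}.
Hypothesis s0 : state S0.
Local Notation m0 := (@min_matching G fi).
Local Notation exc := (flip_count i0 nu).
Let mP := min_matchingP Lconn nuP Dg s0.
Let excE := flip_countE Lconn nuP Dg s0.
Let stR := @stateRP L i0.

Section Pinning.
Variables (gam : (face G + face G)%type -> int) (mus : seq D) (k : D).
Hypothesis g0 : forall d, gam (flab d) = 0.
Hypothesis value : forall (K : fieldType) (pos : K -> Prop) (X : (face G + face G)%type -> K),
  positive_cone pos -> all_pos pos X ->
  cvar (mutations (Seed X (framed_mat qv)) (map flab mus)) (flab k) =
    \sum_(S : {set D} | stateb rt rg ks S) mon X (state_exp flab fnu gam S).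

(* A cluster variable is not divisible by a frozen variable. *)
Lemma pin_framing f : gam (inr f) = - height nu m0 f.
Proof.
pose p : (face G + face G)%type := inr f; pose X a : tfield := if a == p then tvar else 1.
have Xp : all_pos tpos X.
  by move=> a; rewrite /X; case: eqP => _; [apply: tpos_tvar | apply: (pos1 tpos_cone)].
have monX v : mon X v = tvar ^ v p.
  rewrite /mon (bigD1 p) //= {1}/X eqxx big1 ?mulr1 // => a /negbTE ap.
  by rewrite /X ap exp1rz.
have Xu : unit_off p X.
  split; first by rewrite /X eqxx.
  by move=> a /negbTE ap; rewrite /X ap; apply: (pos1 val0_cone).
have pn : p \notin map flab mus by apply/mapP => -[].
have [_ lhs] := mutations_unit_off (s := Seed X (framed_mat qv)) pn (framed_asym framed_framing) Xu.
have := lhs (flab k) isT; rewrite (value tpos_cone Xp).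
have t0 : tvar != 0 := pos_neq0 tpos_cone tpos_tvar.
have -> : \sum_(S : {set D} | stateb rt rg ks S) mon X (state_exp flab fnu gam S) =
    tvar ^ (gam p + height nu m0 f) * \sum_(S : {set D} | stateb rt rg ks S) tvar ^ (exc S f)%:Z.
  rewrite big_distrr /=; apply: eq_bigr => S /stR sS; rewrite monX framing_exp //.
  by rewrite excE // -expfzDr //; congr (_ ^ _); rewrite /p; ring.
set z := \sum_(_ | _) _ => val.
have z0 : val0 z.
  rewrite /z (bigD1 m0) /=; last by apply/stR; case: mP.
  rewrite /flip_count subrr expr0z; apply: val0_sum => //; exact: (pos1 val0_cone).
have : val0 (tvar ^ (gam p + height nu m0 f)).
  rewrite -[_ ^ _](mulfK (pos_neq0 val0_cone z0)).
  by apply: (posM val0_cone) => //; apply: (posV val0_cone).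
by move=> /tvar_val0/eqP; rewrite addr_eq0 => /eqP.
Qed.

End Pinning.

Lemma no_corner S x : state S -> rg x \notin ks -> (x \in S) = false.
Proof. by move=> sS; apply: contraNF; apply: (state_kept sS). Qed.

Lemma kept_root_face d : lab d = fi -> rg d \notin ks /\ rg (op d) \notin ks.
Proof.
by move=> /eqP; rewrite seg_face_eqC => /orP[] /eqP ->; rewrite ?oppK !reg_kept !eqxx andbF.
Qed.

(** The four corners around a segment form a cycle in which neighbours share a crossing or a region,
    so a state contains no two neighbours. Each deleted region takes away two of the four. *)
Lemma face_count_bounds S d : state S ->
  [/\ face_count S (lab d) <= 2, share_white (lab d) fi -> face_count S (lab d) <= 1
    & lab d = fi -> face_count S (lab d) = 0].
Proof.
move=> sS; have r1 := @state_rot3 _ _ S d sS; have r2 := @state_rot3 _ _ S (op d) sS.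
have nr e : rt (op e) <> e.
  by move=> h; have := seg_face_rot Lred (op e); rewrite h seg_face_opp eqxx.
split.
- rewrite face_countE; move: r1 r2; case: (d \in S); case: (op d \in S);
    case: (r3 d \in S); case: (r3 (op d) \in S) => // h1 h2;
    by [have := h1 isT | have := h2 isT].
- rewrite share_white_kept face_countE => /orP[] nk.
    rewrite (no_corner sS nk) (no_corner (x := r3 (op d)) sS) ?link_reg_r3 ?oppK //.
    case: (boolP (op d \in S)) => oS; case: (boolP (r3 d \in S)) => rS //.
    have e := state_reg_inj sS oS rS (esym (link_reg_r3 d)).
    by case: (nr d); rewrite e link_rot4.
  rewrite (no_corner sS nk) (no_corner (x := r3 d) sS) ?link_reg_r3 //.
  case: (boolP (d \in S)) => oS; case: (boolP (r3 (op d) \in S)) => rS //.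
  have e := state_reg_inj sS oS rS; rewrite link_reg_r3 oppK in e.
  by case: (nr (op d)); rewrite oppK {1}(e erefl) link_rot4.
- move=> /kept_root_face[k1 k2]; rewrite face_countE !(no_corner sS) ?link_reg_r3 ?oppK //.
Qed.

Definition dvec (f : face G) : int := if share_white f fi then 0 else 1.

Lemma share_root : share_white fi fi.
Proof. by rewrite share_white_kept reg_kept eqxx andbF. Qed.

Lemma shiftedE S f : shifted S f = 1 - face_count S f - (f == fi)%:Z.
Proof. by rewrite /shifted hvec_count. Qed.

Lemma shifted_dvec S f : state S -> 0 <= shifted S f + dvec f.
Proof.
move=> sS; have [d e] := seg_face_surj f; have [b1 b2 b3] := face_count_bounds d sS.
rewrite shiftedE /dvec; rewrite -e in b1 b2 b3; case: (eqVneq f fi) => [ff|_] /=.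
  by rewrite (b3 ff) ff share_root.
by case: ifP => sh; [have := b2 sh | ]; lia.
Qed.

Lemma shifted_ge S f : state S -> 0 <= shifted S f + 1.
Proof. by move=> sS; have := shifted_dvec f sS; rewrite /dvec; case: ifP; lia. Qed.

(** A face between two kept regions has a state with both corners, by [state_both]; a face with one
    kept region has a state through one of its corners. A face without kept regions is [fi], since a
    segment is determined by its two regions. *)
Lemma shifted_attained f : exists2 S, state S & shifted S f + dvec f = 0.
Proof.
have [d e] := seg_face_surj f; rewrite /dvec; case: (eqVneq f fi) => [ff|nf].
  exists S0 => //; have [_ _ b3] := face_count_bounds d s0.
  by rewrite shiftedE ff share_root -ff e b3 -?e // ff eqxx.
case: ifP => sh; last first.
  move: sh; rewrite e share_white_kept => /negbT; rewrite negb_or !negbK => /andP[dk ok].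
  have [S [sS dS oS]] := state_both Lconn nuP Dg s0 dk ok.
  exists S => //; rewrite shiftedE -e (negbTE nf); have [b1 _ _] := face_count_bounds d sS.
  by move: b1; rewrite e face_countE dS oS; case: (r3 d \in S); case: (r3 (op d) \in S).
have go c : f = lab c -> rg c \in ks -> exists2 S, state S & shifted S f + 0 = 0.
  move=> ec ck; have [S sS cS] := state_through_corner Dg s0 ck; exists S => //.
  have [_ b2 _] := face_count_bounds c sS; rewrite -ec in b2; have := b2 sh.
  rewrite shiftedE (negbTE nf) ec face_countE cS.
  by case: (op c \in S); case: (r3 c \in S); case: (r3 (op c) \in S).
case: (boolP (rg d \in ks)) => dk; first exact: (go d).
case: (boolP (rg (op d) \in ks)) => ok; first by apply: (go (op d)); rewrite ?seg_face_opp.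
case/negP: nf; rewrite e seg_face_eqC; move: dk ok; rewrite !reg_kept !negb_and !negbK.
have pr := @link_reg_prime L Lconn Lprime Lred i0; have no := @link_reg_opp L Lred d.
case/orP=> /eqP e1 /orP[] /eqP e2.
- by case: no; rewrite e1 e2.
- by rewrite (pr d (op i0)) ?oppK ?eqxx ?orbT.
- by rewrite (pr d i0) ?eqxx.
- by case: no; rewrite e1 e2.
Qed.

Lemma plain_denominator : is_denominator_vector
  (\sum_(S : {set D} | stateb rt rg ks S) xmon (shifted S)) dvec.
Proof.
exists (\sum_(S : {set D} | stateb rt rg ks S) \prod_f 'X_(enum_rank f) ^+ `|shifted S f + dvec f|); split.
  rewrite rmorph_sum big_distrl /=; apply: eq_bigr => S /stR sS.
  rewrite rmorph_prod /xmon -prodf_div; apply: eq_bigr => f _; rewrite rmorphXn.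
  by apply: expz_succ; [apply: ivar_neq0 | apply: shifted_dvec].
(* Setting the variable of [f] to 0 and the others to 1 turns the numerator into the number of
   states of least exponent at [f], which is positive. *)
move=> f [Q /(congr1 (meval (fun j => (j != enum_rank f)%:R)))].
rewrite mevalM mevalXU eqxx mul0r rmorph_sum /= => /eqP; apply/negP.
have tE S : (\prod_g 'X_(enum_rank g) ^+ `|shifted S g + dvec g|).@[fun j => (j != enum_rank f)%:R]
    = (absz (shifted S f + dvec f) == 0%N)%:R :> int.
  rewrite rmorph_prod /= (bigD1 f) //= rmorphXn /= mevalXU eqxx expr0n big1 ?mulr1 // => g gf.
  by rewrite rmorphXn /= mevalXU (inj_eq enum_rank_inj) gf expr1n.
have [S sS e] := shifted_attained f; rewrite (bigD1 S) /=; last exact/stR.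
rewrite tE e gt_eqF // ltr_wpDr // sumr_ge0 // => T _; rewrite tE //.
Qed.

(** Replacing the two corners of a flip alters the exponents by the column of the quiver at that
    face, so each up-flip multiplies the monomial by one hat y. *)
Lemma flip_chain_monomial (M : {set D}) gs (N : {set D}) : @flip_chain G fi M gs N ->
  xmon (shifted N) = xmon (shifted M) * \prod_(g <- gs) yhat qv g.
Proof.
elim: gs M => [|g gs IH] M /=; first by move=> ->; rewrite big_nil mulr1.
case=> M' fl /IH ->; rewrite big_cons mulrA; congr (_ * _).
have [d [[-> sN dN oN ->] _]] := down_flipP fl.
rewrite -monD; last exact: ivar_neq0.
apply: eq_mon => f; rewrite !shiftedE quiver_seg.
rewrite {1}/face_count (down_sum _ sN dN oN) -/(face_count _ f) /curv /= !link_rot4.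
rewrite seg_face_opp ![_ == f]eq_sym; move: (face_count _ f) (f == fi) (f == lab d) => c b0 b1.
by move: (f == lab (rt d)) (f == lab (rt (op d))) (f == lab (r3 d)) (f == lab (r3 (op d))); lia.
Qed.

Lemma subst_dimer :
  \sum_(S : {set D} | stateb rt rg ks S) xmon (shifted S) =
  xmon (shifted m0) * subst_yhat qv (@dimer_face_poly G fi).
Proof.
rewrite /subst_yhat /dimer_face_poly rmorph_sum big_distrr /=.
apply: eq_big => [S|S /stR sS]; first by rewrite perfect_matching_state.
rewrite (mrk_flip_count Lconn nuP Dg s0 sS) rmorph_prod /=.
have [gs c] := proj2 mP S sS; rewrite (flip_chain_monomial c) prod_count; congr (_ * _).
apply: eq_bigr => f _; rewrite rmorphXn /= mmapX mmap1U enum_rankK.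
by rewrite (flip_chain_count nuP f c).
Qed.

Lemma framed_F mus k :
  framed_cluster_variable qv mus k = \sum_(S : {set D} | stateb rt rg ks S)
    mon (@ivar _) (fun a => match a with inl f => shifted S f | inr f => (exc S f)%:Z end) ->
  is_F_polynomial qv mus k (@dimer_face_poly G fi).
Proof.
move=> e; apply: (framed_sum_F _ e) => [S f /stR sS|]; first exact: shifted_ge.
rewrite /dimer_face_poly; apply: eq_big => [S|S]; first by rewrite perfect_matching_state.
by rewrite perfect_matching_state => /stR sS; apply: (mrk_flip_count Lconn nuP Dg s0 sS).
Qed.

End LinkClusters.

Theorem theorem7p2 (L : link_diagram) (Lconn : connected L)
    (Lprime : prime_like L) (Lred : forall c : crossing L, ~ nugatory c)
    (i : segment L) :
  let G := incidence_graph L in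
  let fi := segment_face i in
  let B := @quiver G in
  let M0 := min_matching fi in
  let shifted_h := fun (M : {set edge G}) (f : face G) =>
    hvec M f - (f == fi)%:Z in
  exists (ks : seq (face G)) (k : face G),
    let z := cluster_variable B ks k in
    [/\ is_F_polynomial B ks k (dimer_face_poly fi),
        is_g_vector B ks k (shifted_h M0) /\
        (forall f : face G, shifted_h M0 f =
           if f == fi then 0 else 1 - #|face_edges f :&: M0|%:Z),
        z = \sum_(M : {set edge G} | perfect_matching fi M) xmon (shifted_h M)
      & is_denominator_vector z
          (fun f : face G => if share_white f fi then 0 else 1)].
Proof.
have /imsetP[i0 _ ei] := valP i.
have -> : segment_face i = seg_face i0 by apply: val_inj; rewrite seg_face_val.
move=> G fi B M0 sh.
have [lev Dg] := link_to_diagram Lconn Lprime Lred i0.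
have [mus [k H]] := state_sum_computed Dg (link_darts Lconn Lred i0).
have [cs cc] := exists_crossings (@link_rot4 L) (@link_rot2 L).
have [nu nuP] := height_weights_exist Lconn i0.
exists (map (@seg_face L) mus), (seg_face k).
have zE : cluster_variable B (map (@seg_face L) mus) (seg_face k) =
    \sum_(S : {set dart L} | stateb (rot L) (@region_of L) (kept (opp L) (@region_of L) i0) S)
      xmon (shifted i0 S).
  have [gam g0 val] := H _ _ _ _ (framed_plain i0).
  rewrite [LHS](val cs cc _ _ _ (@onepos_cone _) (@onepos_ivar _)).
  rewrite (@state_value L i0 _ _ _ _ _ _ cs (@ivar_neq0 _) cc); apply: eq_bigr => S _.
  by apply: eq_mon => f; apply: plain_exp => //; have [d ->] := seg_face_surj f.
(* A perfect matching exists because the cluster variable lies in a positive cone, so the sum that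
   expresses it cannot be empty. *)
have [S0 s0] : exists S0, is_state (rot L) (@region_of L) (kept (opp L) (@region_of L) i0) S0.
  have zp : onepos (cluster_variable B (map (@seg_face L) mus) (seg_face k)).
    by rewrite /cluster_variable; apply: (@mutations_pos _ _ _ (@onepos_cone _) (initial_seed B) _ (@onepos_ivar _)).
  have := pos_neq0 (@onepos_cone _) zp; rewrite zE.
  case: (pickP (stateb (rot L) (@region_of L) (kept (opp L) (@region_of L) i0))) => [S /stateRP sS _|no].
    by exists S.
  by rewrite big1 ?eqxx // => S; rewrite no.
have isF : is_F_polynomial B (map (@seg_face L) mus) (seg_face k) (dimer_face_poly fi).
  have [gam g0 val] := H _ _ _ _ (framed_framing nuP).
  have val' (K : fieldType) (pos : K -> Prop) (X : (face G + face G)%type -> K) :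
      positive_cone pos -> all_pos pos X ->
      cvar (mutations (Seed X (framed_mat B)) (map (@flab L) mus)) (flab k) =
      \sum_(S : {set dart L} | stateb (rot L) (@region_of L) (kept (opp L) (@region_of L) i0) S)
        mon X (state_exp i0 (@flab L) (fnu nu) gam S).
    move=> cone Xp; rewrite (val cs cc _ _ _ cone Xp).
    exact: (@state_value L i0 _ _ _ _ _ _ cs (all_pos_nonzero cone Xp) cc).
  apply: (framed_F Lconn Lred Dg nuP s0); rewrite /framed_cluster_variable -map_comp.
  rewrite [LHS](val' _ _ _ (@onepos_cone _) (@onepos_ivar _)); apply: eq_bigr => S /stateRP sS.
  apply: eq_mon => a; rewrite (framing_exp Lred) //; case: a => f //.
  by rewrite (pin_framing Lconn Lred Dg nuP s0 g0 val') (flip_countE Lconn nuP Dg s0) // addrC.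
have [sM _] := min_matchingP Lconn nuP Dg s0.
have shE S : sh S = shifted i0 S by [].
split=> //.
- split.
    by exists (dimer_face_poly fi) => //; rewrite zE; apply: (subst_dimer Lconn Lred Dg nuP s0).
  move=> f; rewrite shE shiftedE // setIC card_face //; have [d e] := seg_face_surj f.
  case: eqP => [ff|_]; last by rewrite subr0.
  by have [_ _ b] := face_count_bounds Lred d sM; rewrite e b -?e.
- by rewrite zE; apply: eq_bigl => S; rewrite perfect_matching_state.
by rewrite zE; apply: (plain_denominator Lconn Lprime Lred Dg nuP s0).
Qed.
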